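(* Let $E=\{(s_q,t_q):q\in\mathbb{N}\}$ be a test and $T$ the tree generated by $E$. Let $\xi<\omega_1^{\mathrm{CK}}$ and $A_{1+\xi}:=\{(\alpha,\beta)\in[T]: S(\alpha\Delta\beta)\notin H_{1+\xi}\}$. Let $X$, $Y$ be recursively presented Polish spaces. (1) Let $A$, $B$ be disjoint ${\it\Sigma}^1_1$ (lightface) subsets of $X\times Y$. The following are equivalent: (a) $A$ cannot be separated from $B$ by a potentially ${\bf\Pi}^0_{1+\xi}$ set; (b) $A$ cannot be separated from $B$ by a ${\it\Delta}^1_1$ set which is potentially ${\bf\Pi}^0_{1+\xi}$; (c) $A$ cannot be separated from $B$ by a ${\bf\Pi}^0_{1+\xi}(\tau_1)$ set; (d) $\overline{A}^{\tau_{1+\xi}}\cap B\neq\emptyset$; (e) there are continuous maps $u:2^{\mathbb{N}}\to X$, $v:2^{\mathbb{N}}\to Y$ with $A_{1+\xi}\subseteq(u\times v)^{-1}(A)$ and $[T]\setminus A_{1+\xi}\subseteq(u\times v)^{-1}(B)$. (2) The sets $W^{X\times Y}_{1+\xi}$ and $W^{X\times Y}_{<1+\xi}$ are ${\it\Pi}^1_1$.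
   Context: Potential classes: a Borel set $C\subseteq X\times Y$ is potentially in $\Gamma$ if there are finer Polish topologies $\sigma$ on $X$, $\tau$ on $Y$ with $C\in\Gamma([X,\sigma]\times[Y,\tau])$. ''$A$ separated from $B$ by a set $C$'' means $A\subseteq C$ and $C\cap B=\emptyset$. Test and tree: let $\langle i,j\rangle:=(\sum_{k\le i+j}k)+j$, a bijection $\mathbb{N}^2\to\mathbb{N}$, with inverse $\varphi=(\varphi_0,\varphi_1)$. $E\subseteq\bigcup_q2^q\times2^q$ is a test if (a) for each $q$ there is exactly one $(s_q,t_q)\in E\cap(2^q\times2^q)$; (b) for all $m,q\in\mathbb{N}$, $u\in2^{<\mathbb{N}}$ there is $v\in2^{<\mathbb{N}}$ with $(s_q0uv,t_q1uv)\in E$ and $\varphi_0(|t_q1uv|-1)=m$; (c) for each $n>0$ there are $q<n$, $w\in2^{<\mathbb{N}}$ with $s_n=s_q0w$, $t_n=t_q1w$. The tree generated by $E$ is $T:=\{(s,t): s=t=\emptyset$ or $\exists q\,\exists w\ s=s_q0w,\ t=t_q1w\}$, and $[T]:=\{(\alpha,\beta)\in2^{\mathbb{N}}\times2^{\mathbb{N}}:\forall n\ (\alpha|n,\beta|n)\in T\}$. The set $H_{1+\xi}$: $\alpha\Delta\beta$ is the pointwise symmetric difference ($(\alpha\Delta\beta)(i)=1$ iff $\alpha(i)\ne\beta(i)$), $S$ is the shift $S(\alpha)(i)=\alpha(i+1)$. Define $\rho_0:2^{\mathbb{N}}\to2^{\mathbb{N}}$ by $\rho_0(\varepsilon)(i)=1$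 if $\varepsilon(\langle i,j\rangle)=0$ for all $j$, and $0$ otherwise. Define $\rho_0^\eta$ for $\eta<\aleph_1$ by induction: $\rho_0^0=\mathrm{Id}$, $\rho_0^{\eta+1}=\rho_0\circ\rho_0^\eta$; for limit $\lambda>0$ fix a sequence $(\xi^\lambda_k)_k\subseteq\lambda\setminus\{0\}$ with ordinal sum $\sum_k\xi^\lambda_k=\lambda$, let $(\varepsilon)^k(i):=\varepsilon(i+k)$, define $\rho_0^{(k,k+1)}(\varepsilon)(i)=\varepsilon(i)$ if $i<k$ and $=\rho_0^{\xi^\lambda_k}((\varepsilon)^k)(i-k)$ if $i\ge k$, $\rho_0^{(0,k+1)}:=\rho_0^{(k,k+1)}\circ\rho_0^{(k-1,k)}\circ\cdots\circ\rho_0^{(0,1)}$, and $\rho_0^\lambda(\varepsilon)(k):=\rho_0^{(0,k+1)}(\varepsilon)(k)$. Set $H_{1+\xi}:=(\rho_0^\xi)^{-1}(\{0^\infty\})$. Effective notions: ${\it\Sigma}^1_1,{\it\Pi}^1_1,{\it\Delta}^1_1$ are the lightface classes on recursively presented Polish spaces. ${\it\Delta}_X$ is the topology on $X$ generated by ${\it\Delta}^1_1(X)$; $\tau_1:={\it\Delta}_X\times{\it\Delta}_Y$ on $X\times Y$. For $2\le\eta<\omega_1^{\mathrm{CK}}$, $\tau_\eta$ is the topology on $X\times Y$ generated by ${\it\Sigma}^1_1(X\times Y)\cap{\bf\Pi}^0_{<\eta}(\tau_1)$, where ${\bf\Pi}^0_{<\eta}=\bigcup_{\zeta<\eta}{\bf\Pi}^0_\zeta$.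 Fix ${\it\Pi}^1_1$ sets $W^{X\times Y}\subseteq\mathbb{N}$ and $C^{X\times Y}\subseteq\mathbb{N}\times(X\times Y)$ with ${\it\Delta}^1_1(X\times Y)=\{C^{X\times Y}_n:n\in W^{X\times Y}\}$ and $\{(n,z):n\in W^{X\times Y},z\notin C^{X\times Y}_n\}\in{\it\Pi}^1_1$. Let ''potentially ${\bf\Pi}^0_0$'' mean belonging to ${\bf\Delta}^1_1(X)\times{\bf\Delta}^1_1(Y)$ (products of Borel sets), and for $\eta<\omega_1^{\mathrm{CK}}$ set $W^{X\times Y}_\eta:=\{n\in W^{X\times Y}: C^{X\times Y}_n$ is potentially ${\bf\Pi}^0_\eta\}$, $W^{X\times Y}_{<\eta}:=\bigcup_{\zeta<\eta}W^{X\times Y}_\zeta$. *)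

(* Defs.v *)
From mathcomp Require Import all_boot all_order all_algebra.
From mathcomp Require Import wochoice.
From mathcomp Require Import all_classical all_reals all_analysis.

Set Implicit Arguments.
Unset Strict Implicit.
Unset Printing Implicit Defensive.

Import Order.TTheory GRing.Theory Num.Theory.

Local Open Scope classical_set_scope.
Local Open Scope nat_scope.

(* The elements of a well-ordered uncountable set that have countably many
   predecessors form an initial segment of type aleph_1. *)
Definition wo_rel : rel (set nat) :=
  sval (well_ordering_principle (set nat)).

Definition Ord : Type := {x : set nat | countable [set y | wo_rel y x]}.

Definition ole (x y : Ord) : Prop := wo_rel (sval x) (sval y).
Definition olt (x y : Ord) : Prop := ole x y /\ x <> y.

Lemma wo_relP : well_order wo_rel.
Proof. exact: svalP (well_ordering_principle (set nat)). Qed.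

Lemma wo_relT : total wo_rel.
Proof.
have /withinW/wo_chainW tot := wo_relP.
by move=> x y; apply: (tot predT).
Qed.

Lemma wo_rel_refl : reflexive wo_rel.
Proof. by move=> x; have := wo_relT x x; rewrite orbb. Qed.

Lemma wo_rel_min (P : set (set nat)) : P !=set0 ->
  exists2 x, P x & forall y, P y -> wo_rel x y.
Proof.
move=> [x Px].
have [|z [[Pz lbz] _]] := wo_relP (A := fun z => `[< P z >]).
  by exists x; apply/asboolP.
exists z; first exact/asboolP.
by move=> y Py; apply: lbz; apply/asboolP.
Qed.

Lemma wo_rel_anti : antisymmetric wo_rel.
Proof.
have /withinW/wo_chain_antisymmetric anti := wo_relP.
by move=> x y; apply: (anti predT).
Qed.

Lemma wo_rel_trans : transitive wo_rel.
Proof.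
move=> y x z xy yz.
have [|m mP mmin] := @wo_rel_min [set w | w = x \/ w = y \/ w = z].
  by exists x; left.
have zx := mmin z (or_intror (or_intror erefl)).
have yx := mmin y (or_intror (or_introl erefl)).
have xx := mmin x (or_introl erefl).
case: mP => [|[|]] mE; subst m => //.
- by have -> : x = y by apply: wo_rel_anti; rewrite xy xx.
- have <- : y = z by apply: wo_rel_anti; rewrite yz yx.
  by [].
Qed.

Lemma sval_Ord_inj : injective (sval : Ord -> set nat).
Proof. by move=> [x px] [y py] /= xy; subst y; congr exist; exact: Prop_irrelevance. Qed.

Lemma ole_refl x : ole x x. Proof. exact: wo_rel_refl. Qed.

Lemma ole_trans y x z : ole x y -> ole y z -> ole x z.
Proof. exact: wo_rel_trans. Qed.

Lemma ole_anti x y : ole x y -> ole y x -> x = y.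
Proof. by move=> xy yx; apply/sval_Ord_inj/wo_rel_anti; apply/andP. Qed.

Lemma ole_total x y : ole x y \/ ole y x.
Proof. by have /orP[] := wo_relT (sval x) (sval y); [left|right]. Qed.

Lemma ole_lt_trans y x z : ole x y -> olt y z -> olt x z.
Proof.
move=> xy [yz nyz]; split; first exact: ole_trans yz.
by move=> xz; subst z; apply/nyz/ole_anti.
Qed.

Lemma olt_le_trans y x z : olt x y -> ole y z -> olt x z.
Proof.
move=> [xy nxy] yz; split; first exact: ole_trans yz.
by move=> xz; subst z; apply/nxy/ole_anti.
Qed.

Lemma oltNle x y : olt x y <-> ~ ole y x.
Proof.
split=> [[xy nxy] yx|nyx]; first exact/nxy/ole_anti.
case: (ole_total x y) => // xy; split=> // xE; apply: nyx.
by rewrite xE; exact: ole_refl.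
Qed.

Lemma ord_min (P : set Ord) : P !=set0 ->
  exists2 x, P x & forall y, P y -> ole x y.
Proof.
move=> [x Px].
have [|_ [m Pm <-] mmin] := @wo_rel_min (sval @` P).
  by exists (sval x), x.
by exists m => // y Py; apply: mmin; exists y.
Qed.

Lemma olt_wf : well_founded olt.
Proof.
move=> x; apply: contrapT => nx.
have [|m nm mmin] := @ord_min [set y | ~ Acc olt y]; first by exists x.
apply: nm; constructor => y /oltNle ym.
by apply: contrapT => ny; apply/ym/mmin.
Qed.

Lemma ord_inh : exists x : Ord, True.
Proof.
have [|m _ mmin] := @wo_rel_min setT; first by exists set0.
have c : countable [set y | wo_rel y m].
  apply: (@sub_countable _ _ _ [set m]); last exact: countable1.
  apply: subset_card_le => y /= ym.
  by apply: wo_rel_anti; rewrite ym mmin.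
by exists (exist _ m c).
Qed.

(* Arbitrary if P is empty; the sets of ordinals used below are nonempty because
   countable sets of ordinals are bounded (countable_obounded). *)
Definition omin (P : set Ord) : Ord :=
  xget (sval (cid ord_inh)) [set x | P x /\ forall y, P y -> ole x y].

Lemma ominP (P : set Ord) : P !=set0 ->
  P (omin P) /\ forall y, P y -> ole (omin P) y.
Proof.
move=> /ord_min[m Pm mmin].
by apply: (@xgetPex _ _ [set x | P x /\ forall y, P y -> ole x y]); exists m.
Qed.

Lemma countableU2 (T : Type) (A B : set T) :
  countable A -> countable B -> countable (A `|` B).
Proof.
by move=> cA cB; rewrite -bigcup2E; apply: bigcup_countable => // -[|[|n]] _ //=.
Qed.

Lemma countable_setnat : ~ countable [set: set nat].
Proof.
move=> /countable_injP[f finj].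
pose D : set nat := [set n | exists S, f S = n /\ ~ S n].
have DfD : ~ D (f D).
  move=> /[dup] DfD [S [fS nS]].
  by apply: nS; have -> : S = D by apply: finj; rewrite ?inE.
by apply: (DfD); exists D.
Qed.

Lemma countable_ord : ~ countable [set: Ord].
Proof.
move=> cO.
have cS : countable [set x | countable [set y | wo_rel y x]].
  apply: (@sub_countable _ _ _ (sval @` [set: Ord])).
    by apply: subset_card_le => x cx; exists (exist _ x cx).
  exact: (sub_countable (card_image_le _ _) cO).
have [[x nx]|all] := pselect (exists x, ~ countable [set y | wo_rel y x]).
  have [|m nm mmin] := @wo_rel_min [set x | ~ countable [set y | wo_rel y x]].
    by exists x.
  apply: nm.
  apply: (@sub_countable _ _ _
    ([set x | countable [set y | wo_rel y x]] `|` [set m])).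
    apply: subset_card_le => y /= ym.
    have [->|nym] := pselect (y = m); first by right.
    left; apply: contrapT => /mmin my; apply: nym.
    by apply: wo_rel_anti; rewrite ym my.
  by apply: countableU2 => //; exact: countable1.
apply: countable_setnat; apply: sub_countable cS.
apply: subset_card_le => x _ /=.
by apply: contrapT => nx; apply: all; exists x.
Qed.

Lemma countable_ole x : countable [set y | ole y x].
Proof.
have cx := svalP x.
have /countable_injP[f finj] := cx.
apply/countable_injP; exists (f \o sval) => y z; rewrite !inE => yx zx /= fyz.
by apply/sval_Ord_inj/finj; rewrite ?inE.
Qed.

Lemma countable_obounded (A : set Ord) : countable A ->
  exists x, forall y, A y -> olt y x.
Proof.
move=> cA; apply: contrapT => nb; apply: countable_ord.
apply: (@sub_countable _ _ _ (\bigcup_(x in A) [set y | ole y x])).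
  apply: subset_card_le => x _.
  apply: contrapT => nx; apply: nb; exists x => y Ay.
  by apply/oltNle => xy; apply: nx; exists y.
by apply: bigcup_countable => // x _; exact: countable_ole.
Qed.

Definition ozero : Ord := omin setT.
Definition osucc (x : Ord) : Ord := omin [set y | olt x y].
Definition oone : Ord := osucc ozero.
Definition olimit (x : Ord) : Prop := x <> ozero /\ forall y, x <> osucc y.
Definition osup (f : nat -> Ord) : Ord := omin [set y | forall n, ole (f n) y].

(* Recursion on the right summand: x + y is the least z >= x that is
   greater than every x + y' with y' < y. *)
Definition oadd (x : Ord) : Ord -> Ord :=
  Fix olt_wf (fun=> Ord) (fun y rec =>
    omin [set z | ole x z /\ forall y' (h : olt y' y), olt (rec y' h) z]).

Fixpoint opsum (f : nat -> Ord) (n : nat) : Ord :=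
  if n is m.+1 then oadd (opsum f m) (f m) else ozero.

Definition osum (f : nat -> Ord) : Ord := osup (opsum f).

Lemma ozero_le x : ole ozero x.
Proof. by have [|_ ] := @ominP setT; [exists x|apply]. Qed.

Lemma osucc_gt x : olt x (osucc x).
Proof.
have [|//] := @ominP [set y | olt x y].
have [y xy] := countable_obounded (countable1 x).
by exists y; exact: xy.
Qed.

Lemma osucc_le x y : olt x y -> ole (osucc x) y.
Proof. by move=> xy; have [|_] := @ominP [set y | olt x y]; [exists y|apply]. Qed.

Lemma osucc_inj : injective osucc.
Proof.
have H x y : osucc x = osucc y -> ole x y.
  move=> xy; apply: contrapT => /oltNle/osucc_le; rewrite -xy.
  by have /oltNle := osucc_gt x.
by move=> x y xy; apply: ole_anti; apply: H.
Qed.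

Lemma osup_ub f n : ole (f n) (osup f).
Proof.
have [|H _] := @ominP [set y | forall n, ole (f n) y]; last exact: H.
have [x xub] := countable_obounded (sub_countable (card_image_le f setT)
  (countableP setT)).
by exists x => k; have [] : olt (f k) x by apply: xub; exists k.
Qed.

Lemma osup_least f x : (forall n, ole (f n) x) -> ole (osup f) x.
Proof. by move=> fx; have [|_] := @ominP [set y | forall n, ole (f n) y]; [exists x|apply]. Qed.

Lemma oaddE x y : oadd x y =
  omin [set z | ole x z /\ forall y', olt y' y -> olt (oadd x y') z].
Proof.
rewrite /oadd Fix_eq// => {}y f g fg; congr omin; apply/seteqP.
by split=> z [xz H]; split=> // y' h; have := H y' h; rewrite fg.
Qed.

Lemma oaddP x y :
  [/\ ole x (oadd x y), forall y', olt y' y -> olt (oadd x y') (oadd x y)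
    & forall z, ole x z -> (forall y', olt y' y -> olt (oadd x y') z) ->
      ole (oadd x y) z].
Proof.
set P := [set z | ole x z /\ forall y', olt y' y -> olt (oadd x y') z].
have : P (omin P) /\ forall z, P z -> ole (omin P) z.
  apply: ominP.
  have c : countable (x |` (oadd x @` [set y' | ole y' y])).
    apply: countableU2; first exact: countable1.
    exact: (sub_countable (card_image_le _ _) (countable_ole y)).
  have [z zub] := countable_obounded c.
  exists z; split; first by have [] : olt x z by apply: zub; left.
  by move=> y' [y'y _]; apply: zub; right; exists y'.
rewrite oaddE -/P => -[[? ?] H]; split=> // z xz zH; exact: H.
Qed.

Lemma oadd0 x : oadd x ozero = x.
Proof.
have [xz _ least] := oaddP x ozero; apply: ole_anti => //.
apply: least => [|y /oltNle]; first exact: ole_refl.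
by have := ozero_le y.
Qed.

Lemma oaddS x y : oadd x (osucc y) = osucc (oadd x y).
Proof.
have [_ gt least] := oaddP x (osucc y).
have [xy mono _] := oaddP x y.
apply: ole_anti; last exact/osucc_le/gt/osucc_gt.
apply: least => [|y' y'y].
  by apply: ole_trans xy _; have [] := osucc_gt (oadd x y).
have [->|ny] := pselect (y' = y); first exact: osucc_gt.
have y'ley : ole y' y.
  apply: contrapT => /oltNle/osucc_le; move/oltNle: y'y; exact.
have [h _] : olt (oadd x y') (oadd x y) by apply: mono.
exact: ole_lt_trans h (osucc_gt _).
Qed.

Definition pairN (i j : nat) : nat := (\sum_(k < (i + j).+1) k) + j.

Fixpoint phi (n : nat) : nat * nat :=
  if n is m.+1 then
    if phi m is (i.+1, j) then (i, j.+1) else ((phi m).2.+1, 0)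
  else (0, 0).

Notation phi0 n := (phi n).1.
Notation phi1 n := (phi n).2.

Lemma pairNS0 j : pairN j.+1 0 = (pairN 0 j).+1.
Proof. by rewrite /pairN !addn0 add0n big_ord_recr /= addnS. Qed.

Lemma pairNSS i j : pairN i j.+1 = (pairN i.+1 j).+1.
Proof. by rewrite /pairN addSnnS addnS. Qed.

Lemma phiK n : pairN (phi0 n) (phi1 n) = n.
Proof.
elim: n => [|n IHn]; first by rewrite /pairN big_ord_recr big_ord0.
rewrite /=; move: IHn; case: (phi n) => [[|i] j] /= IHn.
  by rewrite pairNS0 IHn.
by rewrite pairNSS IHn.
Qed.

Lemma pairNK i j : phi (pairN i j) = (i, j).
Proof.
have [n nE] := ubnP (i + j); elim: n i j nE => // n IHn i j.
elim: j i => [|j IHj] i ij.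
  case: i ij => [|i] ij; first by rewrite /pairN big_ord_recr big_ord0.
  by rewrite pairNS0 /= IHn //; move: ij; rewrite addn0 add0n !ltnS.
by rewrite pairNSS /= IHj // addSnnS.
Qed.

Inductive recursive : forall k, (k.-tuple nat -> nat) -> Prop :=
| rec_const k c : @recursive k (fun=> c)
| rec_succ : @recursive 1 (fun v => (thead v).+1)
| rec_proj k (i : 'I_k) : @recursive k (fun v => tnth v i)
| rec_comp k m (g : m.-tuple nat -> nat) (h : 'I_m -> k.-tuple nat -> nat) :
    recursive g -> (forall i, recursive (h i)) ->
    @recursive k (fun v => g [tuple h i v | i < m])
| rec_prim k (g : k.-tuple nat -> nat) (h : k.+2.-tuple nat -> nat) :
    recursive g -> recursive h ->
    @recursive k.+1 (fun v =>
      iteri (thead v)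
        (fun n r => h [tuple of r :: n :: behead_tuple v])
        (g (behead_tuple v)))
| rec_min k (g : k.+1.-tuple nat -> nat) (f : k.-tuple nat -> nat) :
    recursive g ->
    (forall v, g [tuple of f v :: v] = 0 /\
      forall m, m < f v -> g [tuple of m :: v] <> 0) ->
    recursive f.

Definition recursive_rel k (P : set (k.-tuple nat)) : Prop :=
  recursive (fun v => `[< P v >] : nat).

(* xi < omega_1^CK: xi is the order type of a recursive well-ordering of a
   recursive set D of natural numbers; f enumerates xi along that ordering. *)
Definition below_omega1CK (xi : Ord) : Prop :=
  exists (D : set (1.-tuple nat)) (L : set (2.-tuple nat)) (f : nat -> Ord),
    [/\ recursive_rel D, recursive_rel L,
        (forall n, D [tuple n] -> olt (f n) xi),
        (forall eta, olt eta xi -> exists2 n, D [tuple n] & f n = eta)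
      & forall m n, D [tuple m] -> D [tuple n] ->
          (L [tuple m; n] <-> olt (f m) (f n)) /\ (f m = f n -> m = n)].

Section Topologies.
Context {T : Type}.

Definition is_topology (tau : set (set T)) : Prop :=
  [/\ tau setT, (forall U V, tau U -> tau V -> tau (U `&` V))
    & forall F : set (set T), F `<=` tau -> tau (\bigcup_(U in F) U)].

Definition gen_top (G : set (set T)) : set (set T) :=
  [set U | forall tau, is_topology tau -> G `<=` tau -> tau U].

Definition top_closure (tau : set (set T)) (A : set T) : set T :=
  [set x | forall U, tau U -> U x -> A `&` U !=set0].

(* Empty at index 0, so that only classes of index >= 1 are used in unions
   and in Pi0_lt. *)
Inductive Sigma0 (tau : set (set T)) : Ord -> set T -> Prop :=
| Sigma0_open U : tau U -> Sigma0 tau oone U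
| Sigma0_bigcup xi (zeta : nat -> Ord) (F : nat -> set T) :
    olt oone xi ->
    (forall n, olt (zeta n) xi /\ Sigma0 tau (zeta n) (~` F n)) ->
    Sigma0 tau xi (\bigcup_n F n).

Definition Pi0 (tau : set (set T)) (xi : Ord) : set (set T) :=
  [set A | Sigma0 tau xi (~` A)].

Definition Pi0_lt (tau : set (set T)) (xi : Ord) : set (set T) :=
  [set A | exists2 zeta, olt zeta xi & Pi0 tau zeta A].

End Topologies.

Definition prod_top {T U : Type} (sigma : set (set T)) (tau : set (set U)) :
    set (set (T * U)) :=
  [set W | forall z, W z -> exists P Q,
    [/\ sigma P, tau Q, P z.1, Q z.2 & P `*` Q `<=` W]].

Section Metrics.
Context {R : realType} {T : Type}.
Local Open Scope ring_scope.
Implicit Type d : T -> T -> R.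

Definition is_metric d : Prop :=
  [/\ (forall x y, d x y = 0 <-> x = y), (forall x y, d x y = d y x)
    & forall x y z, d x z <= d x y + d y z].

Definition metric_complete d : Prop :=
  forall x : nat -> T,
    (forall e, 0 < e -> exists N, forall m n, (N <= m)%N -> (N <= n)%N ->
      d (x m) (x n) < e) ->
    exists l, forall e, 0 < e -> exists N, forall n, (N <= n)%N ->
      d (x n) l < e.

Definition metric_top d : set (set T) :=
  [set U | forall x, U x -> exists2 e, 0 < e & forall y, d x y < e -> U y].

Definition metric_separable d : Prop :=
  exists2 D : set T, countable D &
    forall x e, 0 < e -> exists2 y, D y & d x y < e.

End Metrics.

Definition polish (R : realType) {T : Type} (tau : set (set T)) : Prop :=
  exists d : T -> T -> R,
    [/\ is_metric d, metric_complete d, metric_separable d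
      & tau = metric_top d].

Definition Borel (T : topologicalType) : set (set T) := <<s @open T >>.

(* A tuple v = (i, j, m, k) stands for the comparison of d(r_i, r_j) with
   m/(k+1). *)
Record rpPolish (R : realType) := RPPolish {
  rp_space :> metricType R;
  rp_seq : nat -> rp_space;
  rp_complete : metric_complete (@mdist R rp_space);
  rp_dense : dense (range rp_seq);
  rp_rec_le : recursive_rel [set v : 4.-tuple nat |
    (mdist (rp_seq (nth 0%N v 0)) (rp_seq (nth 0%N v 1)) <=
     (nth 0%N v 2)%:R / ((nth 0%N v 3).+1)%:R)%R];
  rp_rec_lt : recursive_rel [set v : 4.-tuple nat |
    (mdist (rp_seq (nth 0%N v 0)) (rp_seq (nth 0%N v 1)) <
     (nth 0%N v 2)%:R / ((nth 0%N v 3).+1)%:R)%R] }.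

(* N s is the basic open set with code s. *)
Definition nbhd_system (T : Type) := nat -> set T.

Definition rp_nb (R : realType) (X : rpPolish R) : nbhd_system X :=
  fun s => ball (rp_seq X (phi0 s))
    ((phi0 (phi1 s))%:R / ((phi1 (phi1 s)).+1)%:R)%R.

Arguments rp_nb {R} X _.

Definition nat_nb : nbhd_system nat := fun s => [set s].

(* s codes the sequence of length phi0 s whose entries are read off by
   repeatedly unpairing phi1 s. *)
Definition baire_nb : nbhd_system (nat -> nat) :=
  fun s => [set a | forall i, i < phi0 s ->
    a i = phi0 (iter i (fun c => phi1 c) (phi1 s))].

Definition prod_nb {T U : Type} (M : nbhd_system T) (N : nbhd_system U) :
    nbhd_system (T * U) :=
  fun s => M (phi0 s) `*` N (phi1 s).

Definition semirecursive {T : Type} (N : nbhd_system T) : set (set T) :=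
  [set P | exists2 Q : set (2.-tuple nat), recursive_rel Q &
    forall x, P x <-> exists s n, Q [tuple s; n] /\ N s x].

Definition Sigma11 {T : Type} (N : nbhd_system T) : set (set T) :=
  [set P | exists2 F : set (T * (nat -> nat)),
    semirecursive (prod_nb N baire_nb) (~` F) &
    forall x, P x <-> exists a, F (x, a)].

Definition Pi11 {T : Type} (N : nbhd_system T) : set (set T) :=
  [set P | Sigma11 N (~` P)].

Definition Delta11 {T : Type} (N : nbhd_system T) : set (set T) :=
  Sigma11 N `&` Pi11 N.

Section Products.
Context {R : realType} (X Y : rpPolish R).

Definition xy_nb : nbhd_system (X * Y) := prod_nb (rp_nb X) (rp_nb Y).

Definition potentially (Gamma : set (set (X * Y)) -> set (set (X * Y))) :
    set (set (X * Y)) :=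
  [set C | Borel C /\
    exists (sigma : set (set X)) (tau : set (set Y)),
      [/\ @open X `<=` sigma, polish R sigma,
          @open Y `<=` tau, polish R tau
        & Gamma (prod_top sigma tau) C]].

Definition pot_Pi0 (eta : Ord) : set (set (X * Y)) :=
  [set C | if `[< eta = ozero >] then
             exists (P : set X) (Q : set Y),
               [/\ @Borel X P, @Borel Y Q & C = P `*` Q]
           else potentially (fun t => Pi0 t eta) C].

Definition tau_one : set (set (X * Y)) :=
  prod_top (gen_top (Delta11 (rp_nb X))) (gen_top (Delta11 (rp_nb Y))).

Definition tau_ (eta : Ord) : set (set (X * Y)) :=
  if `[< eta = oone >] then tau_one
  else gen_top (Sigma11 xy_nb `&` Pi0_lt tau_one eta).

Definition separates (C A B : set (X * Y)) : Prop :=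
  A `<=` C /\ C `&` B = set0.

Definition Delta11_coding (W : set nat) (C : set (nat * (X * Y))) : Prop :=
  [/\ Pi11 nat_nb W,
      Pi11 (prod_nb nat_nb xy_nb) C,
      Delta11 xy_nb = [set [set z | C (n, z)] | n in W]
    & Pi11 (prod_nb nat_nb xy_nb) [set p | W p.1 /\ ~ C p]].

Definition W_ (W : set nat) (C : set (nat * (X * Y))) (eta : Ord) : set nat :=
  [set n | W n /\ pot_Pi0 eta [set z | C (n, z)]].

Definition W_lt (W : set nat) (C : set (nat * (X * Y))) (eta : Ord) :
    set nat :=
  \bigcup_(zeta in [set zeta | olt zeta eta]) W_ W C zeta.

End Products.

Arguments xy_nb {R} X Y _.
Arguments pot_Pi0 {R} X Y eta _.
Arguments tau_one {R} X Y _.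
Arguments tau_ {R} X Y eta _.

Record is_test (E : set (seq bool * seq bool)) : Prop := IsTest {
  test_dom : forall s t, E (s, t) -> size s = size t;
  test_uniq : forall q, exists! p, E p /\ size p.1 = q;
  test_ext : forall m s t u, E (s, t) ->
    exists v, E (s ++ false :: u ++ v, t ++ true :: u ++ v) /\
      phi0 (size (t ++ true :: u ++ v)).-1 = m;
  test_prev : forall s t, E (s, t) -> 0 < size s ->
    exists s' t' w, [/\ E (s', t'), size s' < size s,
      s = s' ++ false :: w & t = t' ++ true :: w] }.

Definition tree (E : set (seq bool * seq bool)) : set (seq bool * seq bool) :=
  [set p | p = ([::], [::]) \/
    exists s t w, E (s, t) /\ p = (s ++ false :: w, t ++ true :: w)].

Definition branches (T : set (seq bool * seq bool)) :
    set ((nat -> bool) * (nat -> bool)) :=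
  [set p | forall n, T (mkseq p.1 n, mkseq p.2 n)].

Notation cantor := (nat -> bool) (only parsing).

Definition symdiff (a b : cantor) : cantor := fun i => a i (+) b i.
Definition cshift (a : cantor) : cantor := fun i => a i.+1.

Definition rho0 (e : cantor) : cantor :=
  fun i => `[< forall j, e (pairN i j) = false >].

(* rho_step k r is rho^(k,k+1), where r stands for rho^{xi_k};
   rho_upto r k is rho^(0,k). *)
Definition rho_step (k : nat) (r : cantor -> cantor) (e : cantor) : cantor :=
  fun i => if i < k then e i else r (fun j => e (j + k)) (i - k).

Fixpoint rho_upto (r : nat -> cantor -> cantor) (k : nat) : cantor -> cantor :=
  if k is m.+1 then rho_step m (r m) \o rho_upto r m else id.

Definition rho_limit (r : nat -> cantor -> cantor) (e : cantor) : cantor :=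
  fun k => rho_upto r k.+1 e k.

Definition limit_choice (fs : Ord -> nat -> Ord) : Prop :=
  forall l, olimit l ->
    (forall k, olt ozero (fs l k) /\ olt (fs l k) l) /\ osum (fs l) = l.

Definition rho_body (fs : Ord -> nat -> Ord) (eta : Ord)
    (rec : forall z, olt z eta -> cantor -> cantor) : cantor -> cantor :=
  match pselect (eta = ozero), pselect (exists z, olt z eta /\ eta = osucc z)
  with
  | left _, _ => id
  | right _, left h => rho0 \o rec (sval (cid h)) (proj1 (svalP (cid h)))
  | right _, right _ =>
      rho_limit (fun k => if pselect (olt (fs eta k) eta) is left h
                          then rec (fs eta k) h else id)
  end.

Definition rho (fs : Ord -> nat -> Ord) : Ord -> cantor -> cantor :=
  Fix olt_wf (fun=> cantor -> cantor) (@rho_body fs).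

Lemma rhoE fs eta : rho fs eta = @rho_body fs eta (fun z _ => rho fs z).
Proof.
rewrite /rho Fix_eq// => {}eta f g fg; congr (rho_body _).
by apply: functional_extensionality_dep => z; apply: functional_extensionality_dep => h.
Qed.

Lemma rho_zero fs : rho fs ozero = id.
Proof. by rewrite rhoE /rho_body; case: pselect. Qed.

Lemma rho_succ fs eta : rho fs (osucc eta) = rho0 \o rho fs eta.
Proof.
rewrite rhoE /rho_body; case: pselect => [s0|_].
  by have /oltNle := osucc_gt eta; rewrite s0 => /(_ (ozero_le _)).
case: pselect => [h|[]]; last by exists eta; split=> //; exact: osucc_gt.
by have [_ /osucc_inj <-] := svalP (cid h).
Qed.

Lemma rho_lim fs l : limit_choice fs -> olimit l ->
  rho fs l = rho_limit (fun k => rho fs (fs l k)).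
Proof.
move=> fsP /[dup] /fsP[fsl _] [l0 lS]; rewrite rhoE /rho_body.
case: pselect => // _; case: pselect => [[z [_ /lS]]//|_].
by congr rho_limit; apply/funext => k; case: pselect => // -[]; case: (fsl k).
Qed.

(* H_{1+xi} and A_{1+xi} are indexed by xi. *)
Definition setH (fs : Ord -> nat -> Ord) (xi : Ord) : set cantor :=
  rho fs xi @^-1` [set fun=> false].

Definition setA (E : set (seq bool * seq bool)) (fs : Ord -> nat -> Ord)
    (xi : Ord) : set (cantor * cantor) :=
  [set p | branches (tree E) p /\ ~ setH fs xi (cshift (symdiff p.1 p.2))].

(* Main.v *)
(** A Pi^1_1 norm yields Delta^1_1 codes and the separation and covering
   theorems of effective descriptive set theory. Iterating "the complement is
   covered by coded sets of lower level disjoint from the set", starting with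
   rectangles, defines Pi^1_1 sets lev eta of codes and closures cl eta, which
   are Sigma^1_1; if cl (1+xi) A misses B, then a coded set of level 1+xi
   separates A from B.

   If cl (1+xi) A meets B, the maps u and v are built on finite levels of the
   tree. The map rho^xi is resolved into relations "s is an eta-true initial
   segment of t" (a form of the Debs-Saint Raymond resolutions), and every edge
   of the tree carries a Sigma^1_1 set which is contained in the zeta-closure of
   the set of its last (zeta+1)-true predecessor; along the xi-true initial
   segments these sets decrease and choose witnesses for membership in A or B.
   Since each level of the tree is a forest, its edges can be treated one by one.

   Conversely, such u and v refute every potentially Pi^0_(1+xi) separation: by
   Baire category they are continuous for finer Polish topologies on a comeager
   set, and 2^N maps continuously into branches in that set so that alpha Delta
   beta keeps the nonempty columns of the argument; a separating set would thus
   make H_(1+xi) a Sigma^0_(1+xi) set, against its Pi^0_(1+xi)-hardness. *)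

Require Import Defs.
From mathcomp Require Import all_boot all_order all_algebra.
From mathcomp Require Import all_classical all_reals all_analysis.
From mathcomp Require Import zify ring lra.

Set Implicit Arguments.
Unset Strict Implicit.
Unset Printing Implicit Defensive.

Import Order.TTheory GRing.Theory Num.Theory.

Local Open Scope classical_set_scope.
Local Open Scope nat_scope.


(** * Recursive functions *)

(** The closures are taken with respect to coded sets and not in the topologies [tau_ X Y eta]: the
    codes of lower level form a Pi^1_1 set, which keeps closures of Sigma^1_1 sets Sigma^1_1 and
    lets a covering be cut down to a Delta^1_1 one. The price shows in [cl_meet]: a set V inside the
    eta-closure of A leads to points of A in the zeta-closure of V only for zeta < eta. When a label
    is moved through a limit rank there is thus no single closure to ask for, unless the ranks that
    matter are bounded below the limit; the clause [res_unif] of a resolution supplies this bound.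
    The other obstacle is that an edge cannot be changed without moving points that belong to other
    edges. The points attainable at its two ends form Sigma^1_1 sets P and Q, and the whole
    extension is carried out inside the rectangle P x Q. Lusin separation is proved for an arbitrary
    sigma-algebra containing the open sets, since it is needed for Borel sets, for sets whose
    preimages have the Baire property, and for sets that become clopen in a finer Polish
    topology. *)

Class enc (T : Type) := Enc {
  ecode : T -> nat; edecode : nat -> T; ecodeK : cancel ecode edecode }.

#[export] Instance enc_nat : enc nat := @Enc nat id id (fun=> erefl).
Lemma bool_codeK : cancel nat_of_bool (fun n => 0 < n). Proof. by case. Qed.
#[export] Instance enc_bool : enc bool := @Enc bool nat_of_bool (fun n => 0 < n) bool_codeK.

Lemma prod_codeK (T U : Type) (eT : enc T) (eU : enc U) :
  cancel (fun p : T * U => pairN (ecode p.1) (ecode p.2))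
         (fun n => (edecode (phi0 n), edecode (phi1 n))).
Proof. by move=> [t u]; rewrite pairNK /= !ecodeK. Qed.
#[export] Instance enc_prod (T U : Type) (eT : enc T) (eU : enc U) :
  enc (T * U) := Enc (prod_codeK eT eU).

Definition rec1 (f : nat -> nat) := recursive (fun v : 1.-tuple nat => f (thead v)).
Definition comp (T U : Type) {eT : enc T} {eU : enc U} (f : T -> U) :=
  rec1 (fun n => ecode (f (edecode n))).

Section RawRecursion.
Variable k : nat.

Lemma recursive_comp1 (g : 1.-tuple nat -> nat) (f : k.-tuple nat -> nat) :
  recursive g -> recursive f -> recursive (fun v => g [tuple f v]).
Proof.
move=> rg rf.
have := rec_comp (h := fun i : 'I_1 => f) rg (fun=> rf).
by congr recursive; apply/funext => v; congr g; apply/eq_from_tnth => i;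
  rewrite tnth_mktuple (ord1 i).
Qed.

Lemma recursive_comp2 (g : 2.-tuple nat -> nat) (f1 f2 : k.-tuple nat -> nat) :
  recursive g -> recursive f1 -> recursive f2 ->
  recursive (fun v => g [tuple f1 v; f2 v]).
Proof.
move=> rg r1 r2.
have := rec_comp (h := fun i : 'I_2 => if val i == 0 then f1 else f2) rg _.
have H (i : 'I_2) : recursive (if val i == 0 then f1 else f2) by case: ifP.
move=> /(_ H); congr recursive; apply/funext => v; congr g.
by apply/eq_from_tnth => i; rewrite tnth_mktuple; case: i => [[|[|//]] ?].
Qed.

Lemma recursive_nth (i : nat) : recursive (fun v : k.-tuple nat => nth 0 v i).
Proof.
case: (ltnP i k) => ik.
  have := rec_proj (Ordinal ik); congr recursive; apply/funext => v.
  by rewrite (tnth_nth 0).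
have := rec_const k 0; congr recursive; apply/funext => v.
by rewrite nth_default // size_tuple.
Qed.

End RawRecursion.

Definition rec2 (f : nat -> nat -> nat) :=
  recursive (fun v : 2.-tuple nat => f (nth 0 v 0) (nth 0 v 1)).

Lemma thead_nth (k : nat) (v : k.+1.-tuple nat) : thead v = nth 0 v 0.
Proof. by rewrite /thead (tnth_nth 0). Qed.

Lemma rec1_comp k f (g : k.-tuple nat -> nat) :
  rec1 f -> recursive g -> recursive (fun v => f (g v)).
Proof.
move=> rf rg; have := recursive_comp1 rf rg.
by congr recursive; apply/funext => v; rewrite thead_nth.
Qed.

Lemma rec2_comp k f (g h : k.-tuple nat -> nat) :
  rec2 f -> recursive g -> recursive h -> recursive (fun v => f (g v) (h v)).
Proof. by move=> rf rg rh; exact: (recursive_comp2 rf rg rh). Qed.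

Lemma rec2_prim (g : nat -> nat) (h : nat -> nat -> nat -> nat) :
  rec1 g -> recursive (fun v : 3.-tuple nat =>
    h (nth 0 v 2) (nth 0 v 1) (nth 0 v 0)) ->
  rec2 (fun m x => iteri m (h x) (g x)).
Proof.
move=> rg rh; have := rec_prim rg rh.
rewrite /rec2; congr recursive; apply/funext => v.
by rewrite !thead_nth /= !nth_behead; congr iteri.
Qed.

Lemma rec1_id : rec1 id.
Proof. by have := recursive_nth 1 0; congr recursive; apply/funext => v; rewrite thead_nth. Qed.

Lemma rec1_const c : rec1 (fun=> c). Proof. exact: rec_const. Qed.
Lemma rec1_succ : rec1 succn. Proof. exact: rec_succ. Qed.

Lemma rec1_of2 f g h : rec2 f -> rec1 g -> rec1 h -> rec1 (fun n => f (g n) (h n)).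
Proof. by move=> rf rg rh; exact: (rec2_comp rf rg rh). Qed.

Lemma rec1_comp1 f g : rec1 f -> rec1 g -> rec1 (fun n => f (g n)).
Proof. exact: rec1_comp. Qed.

Lemma rec2_swap f : rec2 f -> rec2 (fun x y => f y x).
Proof. by move=> rf; apply: (rec2_comp rf); exact: recursive_nth. Qed.

Lemma rec2_add : rec2 addn.
Proof.
have := rec2_prim (g := id) (h := fun x n r => r.+1) rec1_id.
move/(_ (rec1_comp rec1_succ (recursive_nth 3 0))).
rewrite /rec2; congr recursive; apply/funext => v.
by elim: (nth 0 v 0) => //= n ->.
Qed.

Lemma rec1_pred : rec1 predn.
Proof.
have H := rec2_prim (g := id) (h := fun x n r => n) rec1_id (recursive_nth 3 1).
have := rec2_comp H (recursive_nth 1 0) (rec_const 1 0).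
by congr recursive; apply/funext => v; rewrite thead_nth; case: (nth 0 v 0).
Qed.

Lemma rec2_sub : rec2 subn.
Proof.
have := rec2_prim (g := id) (h := fun x n r => r.-1) rec1_id.
move/(_ (rec1_comp rec1_pred (recursive_nth 3 0)))/rec2_swap.
rewrite /rec2; congr recursive; apply/funext => v.
by elim: (nth 0 v 1) => [|n /= ->]; rewrite ?subn0 //= subnS.
Qed.

Lemma rec2_mul : rec2 muln.
Proof.
have := rec2_prim (g := fun=> 0) (h := fun x n r => x + r) (rec1_const 0).
move/(_ (rec2_comp rec2_add (recursive_nth 3 2) (recursive_nth 3 0))).
rewrite /rec2; congr recursive; apply/funext => v.
by elim: (nth 0 v 0) => //= n ->; rewrite mulSn.
Qed.

Lemma rec2_leq : rec2 (fun m n => m <= n).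
Proof.
have := rec2_comp rec2_sub (rec_const 2 1) rec2_sub.
rewrite /rec2; congr recursive; apply/funext => v.
by case: leqP => [|xy]; [rewrite -subn_eq0 => /eqP -> | rewrite /=; lia].
Qed.

Definition tri n := \sum_(k < n.+1) k.

Lemma triS n : tri n.+1 = tri n + n.+1. Proof. by rewrite /tri big_ord_recr. Qed.

Lemma rec1_tri : rec1 tri.
Proof.
have H := rec2_prim (g := fun=> 0) (h := fun x n r => r + n.+1) (rec1_const 0)
  (rec2_comp rec2_add (recursive_nth 3 0) (rec1_comp rec1_succ (recursive_nth 3 1))).
have := rec2_comp H (recursive_nth 1 0) (rec_const 1 0).
congr recursive; apply/funext => v; rewrite thead_nth.
elim: (nth 0 v 0) => [|n /= ->]; first by rewrite /tri big_ord_recr big_ord0.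
by rewrite triS.
Qed.

Lemma rec2_pairN : rec2 pairN.
Proof.
exact: (rec2_comp rec2_add (rec1_comp rec1_tri rec2_add) (recursive_nth 2 1)).
Qed.

Lemma leq_tri m n : m <= n -> tri m <= tri n.
Proof. by elim: n => [|n IH]; [case: m | rewrite leq_eqVlt => /orP[/eqP->//|/IH]; rewrite triS; lia]. Qed.

(** The recursion defining [phi] is not an instance of a scheme of [recursive]. On the code n of (i,
    j) the sum i + j is the least s with n < tri (s + 1), which [rec_min] finds; both components
    then follow by subtraction. *)
Lemma rec1_phi_sum : rec1 (fun n => phi0 n + phi1 n).
Proof.
apply: (@rec_min 1 (fun v => tri (nth 0 v 0).+1 <= nth 0 v 1)).
  apply: (rec2_comp rec2_leq) (recursive_nth 2 1).
  exact: rec1_comp rec1_tri (rec1_comp rec1_succ (recursive_nth 2 0)).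
move=> v; rewrite thead_nth; set n := nth 0 v 0; rewrite /= -/n.
have nE : n = tri (phi0 n + phi1 n) + phi1 n by rewrite -[LHS]phiK.
have : phi1 n <= phi0 n + phi1 n by rewrite leq_addl.
move: nE; set s := phi0 n + phi1 n => nE sn; split=> [|m ms].
  by rewrite triS; case: leqP => //; lia.
by have := leq_tri ms; case: leqP => //; lia.
Qed.

Lemma rec1_phi1 : rec1 (fun n => phi1 n).
Proof.
have := rec1_of2 rec2_sub rec1_id (rec1_comp1 rec1_tri rec1_phi_sum).
congr recursive; apply/funext => v; set n := thead v.
by rewrite -[X in X - _]phiK /pairN -/(tri _) addKn.
Qed.

Lemma rec1_phi0 : rec1 (fun n => phi0 n).
Proof.
have := rec1_of2 rec2_sub rec1_phi_sum rec1_phi1.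
by congr recursive; apply/funext => v; rewrite addnK.
Qed.

Section Comp.
Context {T U V : Type} {eT : enc T} {eU : enc U} {eV : enc V}.

Lemma comp_ext (f g : T -> U) : f =1 g -> comp f -> comp g.
Proof. by move=> /funext ->. Qed.

Lemma comp_comp (g : U -> V) (f : T -> U) : comp g -> comp f -> comp (fun x => g (f x)).
Proof.
move=> cg cf; have := rec1_comp cg cf.
by congr recursive; apply/funext => v; rewrite ecodeK.
Qed.

Lemma comp_const (c : U) : comp (fun _ : T => c). Proof. exact: rec1_const. Qed.

Lemma comp_pair (f : T -> U) (g : T -> V) : comp f -> comp g -> comp (fun x => (f x, g x)).
Proof. by move=> cf cg; exact: (rec1_of2 rec2_pairN cf cg). Qed.

End Comp.

Lemma comp2 {T U V W : Type} {eT : enc T} {eU : enc U} {eV : enc V} {eW : enc W}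
    (g : U * V -> W) (f : T -> U) (f' : T -> V) :
  comp g -> comp f -> comp f' -> comp (fun x => g (f x, f' x)).
Proof. by move=> cg cf cf'; exact: (comp_comp cg (comp_pair cf cf')). Qed.

(* The decoders are total on products of nat and bool but only injective on
   codes; [good_enc] is what identity and projections need. *)
Class good_enc (T : Type) {eT : enc T} :=
  good_encP : rec1 (fun n => ecode (edecode n : T)).
Arguments good_enc T {eT}.

#[export] Instance good_nat : good_enc nat. Proof. exact: rec1_id. Qed.
#[export] Instance good_bool : good_enc bool.
Proof.
exact: (rec2_comp rec2_leq (rec_const 1 1) rec1_id).
Qed.
#[export] Instance good_prod (T U : Type) (eT : enc T) (eU : enc U)
  (gT : good_enc T) (gU : good_enc U) : good_enc (T * U).
Proof.
exact: (rec1_of2 rec2_pairN (rec1_comp gT rec1_phi0) (rec1_comp gU rec1_phi1)).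
Qed.

Section CompGood.
Context {T U V : Type} {eT : enc T} {eU : enc U} {eV : enc V}.
Context {gT : good_enc T} {gU : good_enc U} {gV : good_enc V}.

Lemma comp_id : comp (fun x : T => x). Proof. exact: good_encP. Qed.

Lemma comp_fst (f : V -> T * U) : comp f -> comp (fun x => (f x).1).
Proof.
move=> cf; apply: (comp_comp (g := fst)) cf.
by apply: (rec1_comp (good_encP (T := T))) rec1_phi0.
Qed.

Lemma comp_snd (f : V -> T * U) : comp f -> comp (fun x => (f x).2).
Proof.
move=> cf; apply: (comp_comp (g := snd)) cf.
by apply: (rec1_comp (good_encP (T := U))) rec1_phi1.
Qed.

Lemma comp_iteri (n : T -> nat) (g : T -> U) (h : T -> nat -> U -> U) :
  comp n -> comp g -> comp (fun p : T * (nat * U) => h p.1 p.2.1 p.2.2) ->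
  comp (fun x => iteri (n x) (h x) (g x)).
Proof.
move=> cn cg ch.
pose H x i r : nat := @ecode _ eU (h (@edecode _ eT x) i (@edecode _ eU r)).
have rH : recursive (fun v : 3.-tuple nat => H (nth 0 v 2) (nth 0 v 1) (nth 0 v 0)).
  have := rec1_comp ch (rec2_comp rec2_pairN (recursive_nth 3 2)
    (rec2_comp rec2_pairN (recursive_nth 3 1) (recursive_nth 3 0))).
  by congr recursive; apply/funext => v; rewrite /= !pairNK.
have := rec1_of2 (rec2_prim cg rH) cn rec1_id.
congr recursive; apply/funext => v; set x := thead v => /=.
by elim: (n _) => //= m IH; rewrite /H IH ecodeK.
Qed.

End CompGood.

Lemma comp_op2 (T : Type) (eT : enc T) (o : nat -> nat -> nat) (f g : T -> nat) :
  rec2 o -> comp f -> comp g -> comp (fun x => o (f x) (g x)).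
Proof. by move=> ro cf cg; exact: (rec1_of2 ro cf cg). Qed.

Section CompArith.
Context {T : Type} {eT : enc T} {gT : good_enc T}.
Implicit Types (f g : T -> nat) (p q : T -> bool).

Lemma comp_add f g : comp f -> comp g -> comp (fun x => f x + g x).
Proof. exact: comp_op2 rec2_add. Qed.
Lemma comp_mul f g : comp f -> comp g -> comp (fun x => f x * g x).
Proof. exact: comp_op2 rec2_mul. Qed.
Lemma comp_sub f g : comp f -> comp g -> comp (fun x => f x - g x).
Proof. exact: comp_op2 rec2_sub. Qed.
Lemma comp_succ f : comp f -> comp (fun x => (f x).+1).
Proof. exact: rec1_comp rec1_succ. Qed.
Lemma comp_pred f : comp f -> comp (fun x => (f x).-1).
Proof. exact: rec1_comp rec1_pred. Qed.
Lemma comp_pairN f g : comp f -> comp g -> comp (fun x => pairN (f x) (g x)).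
Proof. exact: comp_op2 rec2_pairN. Qed.
Lemma comp_phi0 f : comp f -> comp (fun x => phi0 (f x)).
Proof. exact: rec1_comp rec1_phi0. Qed.
Lemma comp_phi1 f : comp f -> comp (fun x => phi1 (f x)).
Proof. exact: rec1_comp rec1_phi1. Qed.
Lemma comp_leq f g : comp f -> comp g -> comp (fun x => f x <= g x).
Proof. exact: comp_op2 rec2_leq. Qed.
Lemma comp_neg p : comp p -> comp (fun x => ~~ p x).
Proof.
move=> cp; have := rec1_of2 rec2_sub (rec1_const 1) cp.
by congr recursive; apply/funext => v /=; case: (p _).
Qed.
Lemma comp_and p q : comp p -> comp q -> comp (fun x => p x && q x).
Proof.
move=> cp cq; have := rec1_of2 rec2_mul cp cq.
by congr recursive; apply/funext => v /=; case: (p _); case: (q _).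
Qed.
Lemma comp_or p q : comp p -> comp q -> comp (fun x => p x || q x).
Proof.
move=> cp cq; apply: (comp_ext (f := fun x => ~~ (~~ p x && ~~ q x))).
  by move=> x; rewrite negb_and !negbK.
by apply/comp_neg/comp_and; apply: comp_neg.
Qed.
Lemma comp_imp p q : comp p -> comp q -> comp (fun x => p x ==> q x).
Proof.
move=> cp cq; apply: (comp_ext (f := fun x => ~~ p x || q x)).
  by move=> x; rewrite implybE.
by apply: comp_or => //; apply: comp_neg.
Qed.
Lemma comp_eqn f g : comp f -> comp g -> comp (fun x => f x == g x).
Proof.
move=> cf cg; apply: (comp_ext (f := fun x => (f x <= g x) && (g x <= f x))).
  by move=> x; rewrite -eqn_leq.
by apply: comp_and; apply: comp_leq.
Qed.
Lemma comp_if f g p : comp p -> comp f -> comp g -> comp (fun x => if p x then f x else g x).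
Proof.
move=> cp cf cg; have := rec1_of2 rec2_add (rec1_of2 rec2_mul cp cf)
  (rec1_of2 rec2_mul (comp_neg cp) cg).
by congr recursive; apply/funext => v /=; case: (p _); rewrite /= !(mul1n, mul0n) ?addn0.
Qed.

End CompArith.

Section CompSearch.
Context {T : Type} {eT : enc T} {gT : good_enc T}.

Lemma comp_ball (n : T -> nat) (p : T -> nat -> bool) :
  comp n -> comp (fun q : T * nat => p q.1 q.2) ->
  comp (fun x => all (p x) (iota 0 (n x))).
Proof.
move=> cn cp.
apply: (comp_ext (f := fun x => iteri (n x) (fun i r => r && p x i) true)).
  move=> x; elim: (n x) => // m IH.
  by rewrite iteriS IH -addn1 iotaD all_cat /= andbT add0n.
apply: comp_iteri => //; first exact: comp_const.
apply: comp_and; first by do 2!apply: comp_snd; exact: comp_id.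
apply: (comp2 cp); first by apply: comp_fst; exact: comp_id.
by apply: comp_fst; apply: comp_snd; exact: comp_id.
Qed.

Lemma comp_iter (n : T -> nat) (g : T -> nat) (h : nat -> nat) :
  comp n -> comp g -> comp h -> comp (fun x => iter (n x) h (g x)).
Proof.
move=> cn cg ch; apply: (comp_ext (f := fun x => iteri (n x) (fun i r => h r) (g x))).
  by move=> x; elim: (n x) => //= m ->.
apply: comp_iteri => //; apply: (comp_comp ch).
by do 2!apply: comp_snd; exact: comp_id.
Qed.

End CompSearch.


(** * Semirecursive relations *)

Lemma comp_bhas (T : Type) (eT : enc T) (gT : good_enc T) (n : T -> nat) (p : T -> nat -> bool) :
  comp n -> comp (fun q : T * nat => p q.1 q.2) ->
  comp (fun x => has (p x) (iota 0 (n x))).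
Proof.
move=> cn cp; apply: (comp_ext (f := fun x => ~~ all (fun i => ~~ p x i) (iota 0 (n x)))).
  by move=> x; rewrite -has_predC; apply: eq_has => i /=; rewrite negbK.
by apply/comp_neg/comp_ball => //; apply: comp_neg.
Qed.

Ltac rc1 := first [ assumption | apply: comp_const | apply: comp_id
  | apply: comp_phi0 | apply: comp_phi1 | apply: comp_succ | apply: comp_pred
  | apply: comp_pairN | apply: comp_add | apply: comp_mul | apply: comp_sub
  | apply: comp_leq | apply: comp_eqn | apply: comp_neg | apply: comp_and
  | apply: comp_or | apply: comp_imp
  | (apply: comp_ball; [|cbv beta]) | (apply: comp_bhas; [|cbv beta])
  | apply: comp_pair | apply: comp_if
  | apply: comp_fst | apply: comp_snd ].
Ltac rc := repeat rc1.

(** * Sequence codes, derivations of values, and a universal recursively enumerable set *)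

Definition get (c i : nat) := phi0 (iter i (fun c => phi1 c) c).

Lemma comp_get (T : Type) (eT : enc T) (gT : good_enc T) (c i : T -> nat) :
  comp c -> comp i -> comp (fun x => get (c x) (i x)).
Proof. by move=> cc ci; apply: comp_phi0; apply: comp_iter => //; rc. Qed.

Lemma get_foldr (l : seq nat) i : get (foldr pairN 0 l) i = nth 0 l i.
Proof.
rewrite /get; elim: i l => [|i IH] [|x l] //=; rewrite ?pairNK //.
  by rewrite (_ : iter i _ 0 = 0) //; elim: i {IH} => //= i ->.
by rewrite -[phi1 (iter _ _ _)]/(iter i.+1 (fun c => phi1 c) (pairN x (foldr pairN 0 l))) iterSr pairNK IH.
Qed.

(** The claim that the function coded by c takes the value y at x. Claims are numbers, so
    derivations are finite sequences of numbers. *)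
Definition trp (c x y : nat) := pairN c (pairN x y).
Notation tc s := (phi0 s).
Notation tx s := (phi0 (phi1 s)).
Notation ty s := (phi1 (phi1 s)).

(* Codes of unary partial functions: the first component of a code is its
   constructor (0 constant, 1 successor, 2 and 3 projections, 5 pairing,
   6 composition, 7 primitive recursion, 8 minimisation). *)
Definition ax (s : nat) : bool :=
  let k := phi0 (tc s) in
  [|| (k == 0) && (ty s == phi1 (tc s)), (k == 1) && (ty s == (tx s).+1),
      (k == 2) && (ty s == phi0 (tx s)) | (k == 3) && (ty s == phi1 (tx s))].

(** The intermediate values are read off the premises p and q, so no quantifier occurs and the
    relation is recursive; rules with a single premise leave q free. For code 8 the search runs
    upwards from the first half of the input. *)
Definition rule (s p q : nat) : bool :=
  let k := phi0 (tc s) in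
  let a := phi0 (phi1 (tc s)) in let b := phi1 (phi1 (tc s)) in
  [|| [&& k == 5, p == trp a (tx s) (ty p), q == trp b (tx s) (ty q)
        & ty s == pairN (ty p) (ty q)],
      [&& k == 6, p == trp b (tx s) (ty p) & q == trp a (ty p) (ty s)],
      [&& k == 7, phi0 (tx s) == 0 & p == trp a (phi1 (tx s)) (ty s)],
      [&& k == 7, 0 < phi0 (tx s),
          p == trp (tc s) (pairN (phi0 (tx s)).-1 (phi1 (tx s))) (ty p)
        & q == trp b (pairN (ty p) (pairN (phi0 (tx s)).-1 (phi1 (tx s)))) (ty s)],
      [&& k == 8, p == trp a (tx s) 0 & ty s == phi0 (tx s)]
    | [&& k == 8, p == trp a (tx s) (ty p), 0 < ty p
        & q == trp (tc s) (pairN (phi0 (tx s)).+1 (phi1 (tx s))) (ty s)]].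

Inductive der : nat -> Prop :=
| der_ax s : ax s -> der s
| der_rule s p q : der p -> der q -> rule s p q -> der s.

(** All searches are bounded by the length of the derivation; hence [der] is recursively enumerable
    although it is an inductive predicate. *)
Definition cert (d n : nat) : bool :=
  all (fun i => ax (get d i) ||
    has (fun j => has (fun k => rule (get d i) (get d j) (get d k)) (iota 0 i)) (iota 0 i))
    (iota 0 n).

Definition valid (l : seq nat) : Prop :=
  forall i, i < size l -> ax (nth 0 l i) \/
    exists j k, [/\ j < i, k < i & rule (nth 0 l i) (nth 0 l j) (nth 0 l k)].

Lemma valid_cat l1 l2 : valid l1 -> valid l2 -> valid (l1 ++ l2).
Proof.
move=> v1 v2 i; rewrite size_cat nth_cat => i2; case: (ltnP i (size l1)) => i1.
  case: (v1 _ i1) => [|[j [k [ji ki r]]]]; [by left|right].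
  by exists j, k; rewrite !nth_cat !(ltn_trans _ i1).
have : i - size l1 < size l2 by lia.
move=> /v2 [|[j [k [ji ki r]]]]; first by left.
right; exists (size l1 + j), (size l1 + k).
by rewrite !nth_cat !ltnNge !leq_addr /= !addKn; split=> //; lia.
Qed.

Lemma valid_rcons l s : valid l ->
  ax s \/ (exists p q, [/\ p \in l, q \in l & rule s p q]) -> valid (rcons l s).
Proof.
move=> v sP i; rewrite size_rcons ltnS leq_eqVlt => /orP[/eqP -> {i}|il].
  rewrite nth_rcons ltnn eqxx; case: sP => [|[p [q [pl ql r]]]]; [by left|right].
  exists (index p l), (index q l); rewrite !index_mem !nth_rcons !index_mem pl ql.
  by rewrite !nth_index.
rewrite nth_rcons il; case: (v _ il) => [|[j [k [ji ki r]]]]; [by left|right].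
by exists j, k; rewrite !nth_rcons !(ltn_trans _ il).
Qed.

Lemma certP l : cert (foldr pairN 0 l) (size l) <-> valid l.
Proof.
rewrite /cert; split=> [/allP H i il|v].
  have := H i; rewrite mem_iota /= il => /(_ isT); rewrite !get_foldr.
  case/orP=> [|/hasP[j]]; [by left|rewrite mem_iota => ji /hasP[k]].
  by rewrite mem_iota !get_foldr => ki r; right; exists j, k.
apply/allP => i; rewrite mem_iota => il; rewrite get_foldr; apply/orP.
case: (v _ il) => [|[j [k [ji ki r]]]]; [by left|right].
by apply/hasP; exists j; rewrite ?mem_iota //; apply/hasP; exists k; rewrite ?mem_iota // !get_foldr.
Qed.

Lemma valid_der l s : valid l -> s \in l -> der s.
Proof.
move=> v /(nthP 0)[i il <-]; elim/ltn_ind: i il => i IH il.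
case: (v _ il) => [|[j [k [ji ki r]]]]; first exact: der_ax.
by apply: der_rule r; apply: IH => //; exact: ltn_trans il.
Qed.

Lemma der_valid s : der s -> exists2 l, valid l & s \in l.
Proof.
elim=> {s} [s axs|s p q _ [l1 v1 p1] _ [l2 v2 q2] r].
  by exists [:: s]; rewrite ?mem_head //; apply: (@valid_rcons [::]) => //; left.
exists (rcons (l1 ++ l2) s); last by rewrite mem_rcons mem_head.
apply: valid_rcons; first exact: valid_cat.
by right; exists p, q; rewrite !mem_cat p1 q2 orbT.
Qed.

Lemma derE s : der s <-> exists w, cert (phi0 w) (phi0 (phi1 w)) &&
  has (fun i => get (phi0 w) i == s) (iota 0 (phi0 (phi1 w))).
Proof.
split=> [/der_valid[l v sl]|[w /andP[c h]]].
  exists (pairN (foldr pairN 0 l) (pairN (size l) 0)); rewrite !pairNK /=.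
  rewrite (certP l).2 //=; apply/hasP; exists (index s l).
    by rewrite mem_iota index_mem.
  by rewrite get_foldr nth_index.
move: c h; move: (phi0 w) (phi0 (phi1 w)) => d n c /hasP[i]; rewrite mem_iota /= => il /eqP <-.
pose l := mkseq (get d) n.
have v : valid l.
  move=> j; rewrite size_mkseq => jn; move/allP: c => /(_ j).
  rewrite mem_iota /= jn nth_mkseq // => /(_ isT) /orP[|/hasP[k]]; first by left.
  rewrite mem_iota => kj /hasP[m]; rewrite mem_iota => mj r; right; exists k, m.
  by rewrite !nth_mkseq //; apply: ltn_trans jn.
by apply: (valid_der v); rewrite -(nth_mkseq 0 (get d) il) mem_nth ?size_mkseq.
Qed.

Definition re (P : nat -> Prop) : Prop :=
  exists2 p : nat * nat -> bool, comp p & forall x, P x <-> exists n, p (x, n).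

Lemma comp_rule (T : Type) (eT : enc T) (gT : good_enc T) (s p q : T -> nat) :
  comp s -> comp p -> comp q -> comp (fun x => rule (s x) (p x) (q x)).
Proof. by move=> cs cp cq; rewrite /rule /trp /=; rc. Qed.

Lemma comp_ax (T : Type) (eT : enc T) (gT : good_enc T) (s : T -> nat) :
  comp s -> comp (fun x => ax (s x)).
Proof. by move=> cs; rewrite /ax; rc. Qed.

Lemma re_der : re der.
Proof.
exists (fun z => cert (phi0 z.2) (phi0 (phi1 z.2)) &&
  has (fun i => get (phi0 z.2) i == z.1) (iota 0 (phi0 (phi1 z.2)))); last exact: derE.
rewrite /cert; apply: comp_and; apply: comp_ball || apply: comp_bhas; try by rc.
  cbv beta; apply: comp_or; first by apply: comp_ax; apply: comp_get; rc.
  by do 2![apply: comp_bhas; [rc|cbv beta]]; apply: comp_rule; apply: comp_get; rc.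
by apply: comp_eqn; [apply: comp_get; rc|rc].
Qed.

Lemma der_inv s : der s <-> ax s \/ exists p q, [/\ der p, der q & rule s p q].
Proof.
split=> [[{}s|{}s p q dp dq r]|[|[p [q [dp dq r]]]]]; [by left|by right; exists p, q|exact: der_ax|].
exact: der_rule dp dq r.
Qed.

Lemma der_const k x y : der (trp (pairN 0 k) x y) <-> y = k.
Proof.
rewrite der_inv /ax /rule /trp !pairNK /= orbF; split=> [[/eqP//|[p [q []]]]|->].
  by rewrite ?orbF.
by left.
Qed.

Lemma der_basic k x y f : k \in [:: 1; 2; 3] ->
  f = nth (fun=> 0) [:: succn; (fun n => phi0 n); (fun n => phi1 n)] k.-1 ->
  der (trp (pairN k 0) x y) <-> y = f x.
Proof.
move=> kin ->; rewrite der_inv /ax /rule /trp !pairNK /=.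
rewrite !inE in kin; case/or3P: kin => /eqP -> /=; rewrite ?orbF;
by split=> [[/eqP//|[p [q []]]]|->]; [|left].
Qed.

Lemma der_pair a b x y : der (trp (pairN 5 (pairN a b)) x y) <->
  exists y1 y2, [/\ der (trp a x y1), der (trp b x y2) & y = pairN y1 y2].
Proof.
rewrite der_inv /ax /rule /trp !pairNK /=.
split=> [[//|[p [q [dp dq]]]]|[y1 [y2 [d1 d2 ->]]]].
  rewrite orbF => /and3P[/eqP pE /eqP qE /eqP ->].
  by exists (ty p), (ty q); split=> //; rewrite -?pE -?qE.
right; exists (trp a x y1), (trp b x y2); split=> //.
by rewrite /trp !pairNK /= !eqxx.
Qed.

Lemma der_comp a b x y : der (trp (pairN 6 (pairN a b)) x y) <->
  exists2 z, der (trp b x z) & der (trp a z y).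
Proof.
rewrite der_inv /ax /rule /trp !pairNK /=.
split=> [[//|[p [q [dp dq]]]]|[z d1 d2]].
  rewrite orbF => /andP[/eqP pE /eqP qE].
  by exists (ty p); [rewrite -pE|rewrite -qE].
right; exists (trp b x z), (trp a z y); split=> //.
by rewrite /trp !pairNK /= !eqxx.
Qed.

Lemma der_prec0 a b z y : der (trp (pairN 7 (pairN a b)) (pairN 0 z) y) <->
  der (trp a z y).
Proof.
rewrite der_inv /ax /rule /trp !pairNK /=.
split=> [[//|[p [q [dp dq]]]]|d].
  by rewrite orbF => /eqP pE; rewrite -pE.
by right; exists (trp a z y), (trp a z y); split=> //; rewrite orbF /trp.
Qed.

Lemma der_precS a b n z y : der (trp (pairN 7 (pairN a b)) (pairN n.+1 z) y) <->
  exists2 r, der (trp (pairN 7 (pairN a b)) (pairN n z) r) &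
    der (trp b (pairN r (pairN n z)) y).
Proof.
rewrite der_inv /ax /rule /trp !pairNK /=.
split=> [[//|[p [q [dp dq]]]]|[r d1 d2]].
  rewrite orbF => /andP[/eqP pE /eqP qE].
  by exists (ty p); [rewrite -pE|rewrite -qE].
right; exists (trp (pairN 7 (pairN a b)) (pairN n z) r), (trp b (pairN r (pairN n z)) y).
by split=> //; rewrite /trp !pairNK /= !eqxx.
Qed.

Lemma der_min a n z y : der (trp (pairN 8 a) (pairN n z) y) <->
  (der (trp (phi0 a) (pairN n z) 0) /\ y = n) \/
  (exists2 k, der (trp (phi0 a) (pairN n z) k.+1) &
    der (trp (pairN 8 a) (pairN n.+1 z) y)).
Proof.
rewrite der_inv /ax /rule /trp !pairNK /= ?orbF.
split=> [[//|[p [q [dp dq /orP[/andP[/eqP pE /eqP ->]|/and3P[/eqP pE p0 /eqP qE]]]]]]|].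
- by left; rewrite -pE.
- by right; exists (ty p).-1; rewrite ?prednK // -?pE -?qE.
case=> [[d ->]|[k d1 d2]]; right.
  by exists (trp (phi0 a) (pairN n z) 0), (trp (phi0 a) (pairN n z) 0); rewrite !eqxx.
exists (trp (phi0 a) (pairN n z) k.+1), (trp (pairN 8 a) (pairN n.+1 z) y).
by split=> //; rewrite /trp !pairNK /= !eqxx orbT.
Qed.

Definition tcode (k : nat) (v : k.-tuple nat) : nat := foldr pairN 0 v.

Definition computes (k : nat) (c : nat) (f : k.-tuple nat -> nat) : Prop :=
  forall v y, der (trp c (tcode v) y) <-> y = f v.

Lemma computes_proj k (i : 'I_k) : exists c, computes c (fun v : k.-tuple nat => tnth v i).
Proof.
have H j : exists c, forall l y, der (trp c (foldr pairN 0 l) y) <-> y = nth 0 l j.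
  elim: j => [|j [c IH]].
    exists (pairN 2 0) => l y; rewrite (@der_basic 2 _ _ (fun n => phi0 n) erefl erefl).
    by case: l => [|u l] //=; rewrite pairNK.
  exists (pairN 6 (pairN c (pairN 3 0))) => l y; rewrite der_comp.
  have d3 x z : der (trp (pairN 3 0) x z) <-> z = phi1 x by apply: (@der_basic _ _ _ _ _ erefl).
  have dE : phi1 (foldr pairN 0 l) = foldr pairN 0 (behead l) by case: l => [|u l] //=; rewrite pairNK.
  rewrite -nth_behead -IH -dE; split=> [[z /d3 -> //]|d]; exists (phi1 (foldr pairN 0 l)) => //.
  exact/d3.
have [c cP] := H i; exists c => v y; rewrite cP (tnth_nth 0) //.
Qed.

(** Every scheme of [recursive] has a matching constructor of codes. Tuples become iterated pairs
    ending in 0, so a tuple of functions is computed by iterated pairing. *)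
Lemma recursive_computes k (f : k.-tuple nat -> nat) : recursive f -> exists c, computes c f.
Proof.
elim=> {k f} [k c||k i|k m g h _ [cg cgP] _ chP|k g h _ [cg cgP] _ [ch chP]|k g f _ [cg cgP] fP].
- by exists (pairN 0 c) => v y; exact: der_const.
- exists (pairN 6 (pairN (pairN 1 0) (pairN 2 0))) => v y; rewrite der_comp thead_nth.
  have d2 x z : der (trp (pairN 2 0) x z) <-> z = phi0 x by apply: (@der_basic _ _ _ _ _ erefl).
  have d1 x z : der (trp (pairN 1 0) x z) <-> z = succn x by apply: (@der_basic _ _ _ _ _ erefl).
  have <- : phi0 (tcode v) = nth 0 v 0 by rewrite -(get_foldr v 0).
  split=> [[z /d2 -> /d1 //]|->]; exists (phi0 (tcode v)); first exact/d2.
  exact/d1.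
- exact: computes_proj.
- have [ch {}chP] := choice chP.
  have [c cP] : exists c, forall v y, der (trp c (tcode v) y) <-> y = tcode [tuple h i v | i < m].
    suff H l : exists c, forall v y, der (trp c (tcode v) y) <->
        y = foldr pairN 0 [seq h i v | i <- l].
      exact: H (enum 'I_m).
    elim: l => [|i l [c IH]]; first by exists (pairN 0 0) => v y; exact: der_const.
    exists (pairN 5 (pairN (ch i) c)) => v y; rewrite der_pair /=.
    split=> [[y1 [y2 [/chP -> /IH -> ->//]]]|->].
    by exists (h i v), (foldr pairN 0 [seq h i v | i <- l]); split=> //; [apply/chP|apply/IH].
  exists (pairN 6 (pairN cg c)) => v y; rewrite der_comp.
  split=> [[z /cP -> /cgP//]|->]; exists (tcode [tuple h i v | i < m]); first exact/cP.
  exact/cgP.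
- exists (pairN 7 (pairN cg ch)) => v y.
  have vE : tcode v = pairN (thead v) (tcode (behead_tuple v)).
    by rewrite {1}(tuple_eta v).
  rewrite vE; elim: (thead v) y => [|n IH] y /=.
    by rewrite der_prec0.
  rewrite der_precS; set r := iteri n _ _ in IH *.
  have rE : pairN r (pairN n (tcode (behead_tuple v))) = tcode [tuple of r :: n :: behead_tuple v] by [].
  split=> [[r' /IH ->]|->]; first by rewrite rE => /chP.
  by exists r; [apply/IH|rewrite rE; apply/chP].
(* There is no code for the identity; pairing the two projections reproduces the input, to which the
   search is applied with starting point 0. *)
exists (pairN 6 (pairN (pairN 8 (pairN cg 0)) (pairN 5 (pairN (pairN 0 0) (pairN 5 (pairN (pairN 2 0) (pairN 3 0))))))) => v y.
have [g0 gmin] := fP v.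
(* Induction on the distance d from the starting point n to the value f v: a search started at or
   below f v ends at f v. *)
have key d : forall n, f v = n + d -> forall y, der (trp (pairN 8 (pairN cg 0)) (pairN n (tcode v)) y) <-> y = f v.
  elim: d => [|d IH] n fE {}y; rewrite der_min pairNK /=.
    have nE : n = f v by lia.
    have gE : pairN n (tcode v) = tcode [tuple of f v :: v] by rewrite nE.
    split=> [[[_ ->]//|[j]]|->]; first by rewrite gE => /cgP; rewrite g0.
    by left; rewrite gE; split=> //; apply/cgP.
  have gE : pairN n (tcode v) = tcode [tuple of n :: v] by [].
  have gn : g [tuple of n :: v] <> 0 by apply: gmin; lia.
  rewrite gE; split=> [[[/cgP /esym //]|[j _]]|yE].
    by apply: (IH n.+1 _ y).1; lia.
  right; exists (g [tuple of n :: v]).-1; first by apply/cgP; rewrite prednK // lt0n; apply/eqP.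
  by apply: (IH n.+1 _ y).2 => //; lia.
have d2 x z : der (trp (pairN 2 0) x z) <-> z = phi0 x by apply: (@der_basic _ _ _ _ _ erefl).
have d3 x z : der (trp (pairN 3 0) x z) <-> z = phi1 x by apply: (@der_basic _ _ _ _ _ erefl).
rewrite der_comp; split=> [[z]|->].
  rewrite der_pair => -[y1 [y2 [/der_const -> + ->]]].
  by rewrite der_pair => -[z1 [z2 [/d2 -> /d3 -> ->]]]; rewrite phiK => /(key (f v)); apply.
exists (pairN 0 (tcode v)); last exact/(key (f v)).
rewrite der_pair; exists 0, (tcode v); split=> //; first exact/der_const.
by rewrite der_pair; exists (phi0 (tcode v)), (phi1 (tcode v)); split; [exact/d2|exact/d3|rewrite phiK].
Qed.

(** The trailing 0 closes the code of a one-entry tuple, and the output 1 is the code of [true]. *)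
Definition univ (e x : nat) : Prop := exists n, der (trp e (pairN (pairN x n) 0) 1).

Lemma univP (P : nat -> Prop) : re P -> exists e, forall x, P x <-> univ e x.
Proof.
move=> [p cp pP]; have [c cP] := recursive_computes cp.
exists c => x; rewrite pP; split=> -[n pn]; exists n.
  have /= /(_ 1) := cP [tuple pairN x n]; rewrite /tcode /= => ->.
  by rewrite thead_nth /= pairNK /= pn.
have /= := (cP [tuple pairN x n] 1).1 pn.
by rewrite thead_nth /= pairNK /=; case: (p _).
Qed.

Lemma re_subst (P : nat -> Prop) (f : nat -> nat) : re P -> comp f -> re (fun x => P (f x)).
Proof.
move=> [p cp pP] cf; exists (fun z => p (f z.1, z.2)) => [|x]; last exact: pP.
by apply: (comp2 cp); [apply: (comp_comp cf); rc|rc].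
Qed.

Lemma re_ex (P : nat -> Prop) : re P -> re (fun x => exists n, P (pairN x n)).
Proof.
move=> [p cp pP]; exists (fun z => p (pairN z.1 (phi0 z.2), phi1 z.2)) => [|x].
  by apply: (comp2 cp); rc.
split=> [[n /pP[m pm]]|[n pn]]; first by exists (pairN n m); rewrite pairNK.
by exists (phi0 n); apply/pP; exists (phi1 n).
Qed.

Lemma re_univ : re (fun z => univ (phi0 z) (phi1 z)).
Proof.
have := re_ex (re_subst (f := fun w => trp (phi0 (phi0 w)) (pairN (pairN (phi1 (phi0 w)) (phi1 w)) 0) 1) re_der _).
rewrite /trp /univ => /(_ ltac:(by rc)) [p cp pP]; exists p => // x; rewrite -pP /trp.
by split=> -[n dn]; exists n; move: dn; rewrite !pairNK.
Qed.


(** * Analytic relations on Baire space *)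

Section Analytic_relations.

Notation baire := (nat -> nat) (only parsing).
Implicit Types (a b c : nat -> nat) (P Q : (nat -> nat) -> nat -> Prop).

Definition row (k : nat) (a : baire) : baire := fun i => a (pairN k i).
Definition join (a b : baire) : baire :=
  fun i => if phi0 i == 0 then a (phi1 i) else b (phi1 i).

Lemma row0_join a b : row 0 (join a b) = a.
Proof. by apply/funext => i; rewrite /row /join pairNK. Qed.
Lemma row1_join a b : row 1 (join a b) = b.
Proof. by apply/funext => i; rewrite /row /join pairNK. Qed.

Lemma baire_nb_ex a n : exists2 s, phi0 s = n & baire_nb s a.
Proof.
exists (pairN n (foldr pairN 0 (mkseq a n))) => [|i]; rewrite pairNK //= => il.
by rewrite -[RHS]/(get _ i) get_foldr nth_mkseq.
Qed.

Lemma get_nb s a i : baire_nb s a -> i < phi0 s -> get (phi1 s) i = a i.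
Proof. by move=> sa /sa. Qed.

Definition sub_nb (s t : nat) : bool := (phi0 s <= phi0 t) &&
  all (fun i => get (phi1 s) i == get (phi1 t) i) (iota 0 (phi0 s)).

Lemma sub_nbP s t a : sub_nb s t -> baire_nb t a -> baire_nb s a.
Proof.
move=> /andP[st /allP sE] ta i il; rewrite ta; last exact: leq_trans st.
by have := sE i; rewrite mem_iota => /(_ il)/eqP.
Qed.

Lemma sub_nb_ex s t a : baire_nb s a -> baire_nb t a -> phi0 s <= phi0 t -> sub_nb s t.
Proof.
move=> sa ta st; rewrite /sub_nb st; apply/allP => i; rewrite mem_iota /= => il.
by rewrite (get_nb sa) // (get_nb ta) //; apply: leq_trans st.
Qed.

Lemma comp_sub_nb (T : Type) (eT : enc T) (gT : good_enc T) (s t : T -> nat) :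
  comp s -> comp t -> comp (fun x => sub_nb (s x) (t x)).
Proof.
move=> cs ct; apply: comp_and; first by rc.
apply: comp_ball; first by rc.
have c1 : comp (fun q : T * nat => s q.1) by apply: (comp_comp cs); rc.
have c2 : comp (fun q : T * nat => t q.1) by apply: (comp_comp ct); rc.
by apply: comp_eqn; apply: comp_get; rc.
Qed.

Definition sig01 (P : baire -> nat -> Prop) : Prop :=
  exists2 p : nat * (nat * nat) -> bool, comp p &
    forall a x, P a x <-> exists s n, baire_nb s a /\ p (x, (s, n)).

Lemma sig_ext P Q : (forall a x, P a x <-> Q a x) -> sig01 P -> sig01 Q.
Proof. by move=> PQ [p cp pP]; exists p => // a x; rewrite -PQ. Qed.

Lemma sig_re (R : nat -> Prop) : re R -> sig01 (fun _ x => R x).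
Proof.
move=> [p cp pP]; exists (fun z => p (z.1, z.2.2)) => [|a x].
  by apply: (comp2 cp); rc.
rewrite pP; split=> [[n pn]|[s [n [_ pn]]]]; last by exists n.
by have [s _ sa] := baire_nb_ex a 0; exists s, n.
Qed.

Lemma re_dec (p : nat -> bool) : comp p -> re (fun x => p x).
Proof.
move=> cp; exists (fun z => p z.1); first by apply: (comp_comp cp); rc.
by move=> x; split=> [px|[]//]; exists 0.
Qed.

Lemma sig_or P Q : sig01 P -> sig01 Q -> sig01 (fun a x => P a x \/ Q a x).
Proof.
move=> [p cp pP] [q cq qP]; exists (fun z => p z || q z); first exact: comp_or.
move=> a x; rewrite pP qP; split=> [[]|] [s [n [sa pn]]].
- by exists s, n; rewrite pn.
- by exists s, n; rewrite pn orbT.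
by case/orP: pn; [left|right]; exists s, n.
Qed.

Lemma sig_and P Q : sig01 P -> sig01 Q -> sig01 (fun a x => P a x /\ Q a x).
Proof.
move=> [p cp pP] [q cq qP].
exists (fun z => let n := z.2.2 in
  [&& sub_nb (phi0 (phi0 n)) z.2.1, sub_nb (phi0 (phi1 n)) z.2.1,
      p (z.1, (phi0 (phi0 n), phi1 (phi0 n))) & q (z.1, (phi0 (phi1 n), phi1 (phi1 n)))]).
  cbv zeta; apply: comp_and; first by apply: comp_sub_nb; rc.
  apply: comp_and; first by apply: comp_sub_nb; rc.
  by apply: comp_and; [apply: (comp_comp cp)|apply: (comp_comp cq)]; rc.
move=> a x; rewrite pP qP; split=> [[[s [n [sa pn]]] [t [m [ta qm]]]]|[s [n [sa /and4P[h1 h2 h3 h4]]]]].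
  have [u uE ua] := baire_nb_ex a (maxn (phi0 s) (phi0 t)).
  exists u, (pairN (pairN s n) (pairN t m)); split=> //; rewrite /= !pairNK /=.
  by rewrite pn qm (sub_nb_ex sa ua) ?(sub_nb_ex ta ua) // uE ?leq_maxl ?leq_maxr.
split; [exists (phi0 (phi0 n)), (phi1 (phi0 n))|exists (phi0 (phi1 n)), (phi1 (phi1 n))];
by split=> //; apply: sub_nbP sa.
Qed.

Lemma sig_ex P : sig01 P -> sig01 (fun a x => exists n, P a (pairN x n)).
Proof.
move=> [p cp pP]; exists (fun z => p (pairN z.1 (phi0 z.2.2), (z.2.1, phi1 z.2.2))).
  by apply: (comp_comp cp); rc.
move=> a x; split=> [[n /pP[s [m [sa pm]]]]|[s [n [sa pn]]]].
  by exists s, (pairN n m); rewrite !pairNK.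
by exists (phi0 n); apply/pP; exists s, (phi1 n).
Qed.

Lemma sig_subst P (f : nat -> nat) : sig01 P -> comp f -> sig01 (fun a x => P a (f x)).
Proof.
move=> [p cp pP] cf; exists (fun z => p (f z.1, z.2)) => [|a x]; last exact: pP.
by apply: (comp2 cp); [apply: (comp_comp cf); rc|rc].
Qed.

(** Each output value depends on one input value, at a recursively computed place. This small class
    of recursive operators contains projections, joins and re-indexing and composes without any
    continuity argument. *)
Definition oper (F : baire -> nat -> baire) : Prop :=
  exists (h : nat * nat -> nat) (G : nat * (nat * nat) -> nat),
    [/\ comp h, comp G & forall a x i, F a x i = G (x, (i, a (h (x, i))))].

Lemma ltn_bound (h : nat -> nat) n : exists N, forall i, i < n -> h i < N.
Proof.
elim: n => [|n [N NP]]; first by exists 0.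
exists (maxn N (h n).+1) => i; rewrite ltnS leq_eqVlt leq_max => /orP[/eqP ->|/NP ->//].
by rewrite leqnn orbT.
Qed.

Lemma sig_oper P F : sig01 P -> oper F -> sig01 (fun a x => P (F a x) x).
Proof.
move=> [p cp pP] [h [G [ch cG FE]]].
exists (fun z => let s := phi0 z.2.2 in
  p (z.1, (s, phi1 z.2.2)) && all (fun i => (h (z.1, i) < phi0 z.2.1) &&
   (G (z.1, (i, get (phi1 z.2.1) (h (z.1, i)))) == get (phi1 s) i)) (iota 0 (phi0 s))).
  cbv zeta; apply: comp_and; first by apply: (comp_comp cp); rc.
  apply: comp_ball; first by rc.
  cbv beta.
  have c1 : comp (fun q : nat * (nat * nat) * nat => h (q.1.1, q.2)) by apply: (comp_comp ch); rc.
  apply: comp_and; first by rc.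
  apply: comp_eqn; last by apply: comp_get; rc.
  by apply: (comp_comp cG); apply: comp_pair; first rc; apply: comp_pair; first rc;
    apply: comp_get; rc.
move=> a x; rewrite pP; split=> [[s [n [sa pn]]]|[s [n [sa /andP[pn /allP H]]]]].
  have [N NP] := ltn_bound (fun i => h (x, i)) (phi0 s).
  have [t tE ta] := baire_nb_ex a N.
  exists t, (pairN s n); split=> //; rewrite /= !pairNK /= pn; apply/allP => i.
  rewrite mem_iota /= => il; rewrite tE NP // (get_nb ta) ?tE ?NP //.
  by rewrite -FE (get_nb sa) // eqxx.
exists (phi0 n), (phi1 n); split=> // i il.
have := H i; rewrite mem_iota => /(_ il)/andP[hl /eqP GE].
by rewrite FE sa.
Qed.

Lemma sig_atom (h k : nat -> nat) : comp h -> comp k -> sig01 (fun a x => a (h x) = k x).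
Proof.
move=> ch ck; exists (fun z => (h z.1 < phi0 z.2.1) && (get (phi1 z.2.1) (h z.1) == k z.1)).
  have c1 : comp (fun z : nat * (nat * nat) => h z.1) by apply: (comp_comp ch); rc.
  have c2 : comp (fun z : nat * (nat * nat) => k z.1) by apply: (comp_comp ck); rc.
  by apply: comp_and; first rc; apply: comp_eqn; [apply: comp_get; rc|rc].
move=> a x; split=> [aE|[s [n [sa /andP[hl /eqP <-]]]]]; last exact: sa.
have [s sE sa] := baire_nb_ex a (h x).+1.
by exists s, 0; split=> //; rewrite /= sE ltnSn -aE sa ?sE //= -/(get _ _).
Qed.

Lemma sig_oracle P (h : nat -> nat) : sig01 P -> comp h ->
  sig01 (fun a x => P a (pairN x (a (h x)))).
Proof.
move=> sP ch.
have s1 : sig01 (fun a x => a (h (phi0 x)) = phi1 x).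
  by apply: sig_atom; [apply: (comp_comp ch)|]; rc.
apply: sig_ext (sig_ex (sig_and s1 sP)) => a x.
by split=> [[n []]|Px]; [rewrite pairNK /= => <-|exists (a (h x)); rewrite pairNK].
Qed.

Lemma oper_id : oper (fun a _ => a).
Proof. by exists (fun z => z.2), (fun z => z.2.2); split=> //; rc. Qed.

Lemma oper_reindex (h : nat * nat -> nat) : comp h -> oper (fun a x i => a (h (x, i))).
Proof. by move=> ch; exists h, (fun z => z.2.2); split=> //; rc. Qed.

Lemma oper_comp F F' : oper F -> oper F' -> oper (fun a x => F (F' a x) x).
Proof.
move=> [h [G [ch cG FE]]] [h' [G' [ch' cG' FE']]].
exists (fun z => h' (z.1, h z)), (fun z => G (z.1, (z.2.1, G' (z.1, (h (z.1, z.2.1), z.2.2))))).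
have c1 : comp (fun z : nat * (nat * nat) => h (z.1, z.2.1)) by apply: (comp_comp ch); rc.
split; first by apply: (comp_comp ch'); rc.
  apply: (comp_comp cG); apply: comp_pair; first rc; apply: comp_pair; first rc.
  by apply: (comp_comp cG'); rc.
by move=> a x i; rewrite FE FE'.
Qed.

Definition S11 (P : baire -> nat -> Prop) : Prop :=
  exists2 Q, sig01 Q & forall a x, P a x <-> exists b, ~ Q (join a b) x.

Lemma S11_ext P Q : (forall a x, P a x <-> Q a x) -> S11 P -> S11 Q.
Proof. by move=> PQ [p cp pP]; exists p => // a x; rewrite -PQ. Qed.

Lemma S11_oper P F : S11 P -> oper F -> S11 (fun a x => P (F a x) x).
Proof.
move=> [Q sQ QP] [h [G [ch cG FE]]].
pose F' c x i := if phi0 i == 0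
  then G (x, (phi1 i, c (pairN 0 (h (x, phi1 i))))) else c i.
have oF' : oper F'.
  exists (fun z => if phi0 z.2 == 0 then pairN 0 (h (z.1, phi1 z.2)) else z.2),
    (fun z => if phi0 z.2.1 == 0 then G (z.1, (phi1 z.2.1, z.2.2)) else z.2.2); split.
  - apply: comp_if; try rc; by apply: (comp_comp ch); rc.
  - apply: comp_if; try rc; by apply: (comp_comp cG); rc.
  - by move=> a x i; rewrite /F' /=; case: ifP.
exists (fun c x => Q (F' c x) x); first exact: sig_oper.
move=> a x; rewrite QP; split=> -[b Hb]; exists b; move: Hb; congr (~ Q _ x);
apply/funext => i; rewrite /F' {1}/join; case: ifP => i0 //;
  by rewrite ?FE /join ?pairNK ?i0.
Qed.

Lemma S11_subst P (f : nat -> nat) : S11 P -> comp f -> S11 (fun a x => P a (f x)).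
Proof. by move=> [Q sQ QP] cf; exists (fun a x => Q a (f x)) => //; exact: sig_subst. Qed.

Lemma S11_oracle P (h : nat -> nat) : S11 P -> comp h ->
  S11 (fun a x => P a (pairN x (a (h x)))).
Proof.
move=> [Q sQ QP] ch.
have c0 : comp (fun x => pairN 0 (h x)) by rc.
exists (fun c x => Q c (pairN x (c (pairN 0 (h x))))); first exact: (sig_oracle sQ c0).
by move=> a x; rewrite QP; split=> -[b Hb]; exists b; move: Hb; rewrite /join !pairNK.
Qed.

Lemma S11_pi P : sig01 P -> S11 (fun a x => ~ P a x).
Proof.
move=> sP; have c0 : comp (fun z : nat * nat => pairN 0 z.2) by rc.
exists (fun c x => P (fun i => c (pairN 0 i)) x); first exact: (sig_oper sP (oper_reindex c0)).
have E a b : (fun i => join a b (pairN 0 i)) = a by exact: row0_join.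
by move=> a x; split=> [nP|[b]]; rewrite ?E //; exists a; rewrite E.
Qed.

Lemma S11_dec (p : nat -> bool) : comp p -> S11 (fun _ x => p x).
Proof.
move=> cp; apply: (S11_ext _ (S11_pi (sig_re (re_dec (comp_neg cp))))).
by move=> a x; split=> [/negP|px]; rewrite ?negbK // px.
Qed.

Lemma S11_and P Q : S11 P -> S11 Q -> S11 (fun a x => P a x /\ Q a x).
Proof.
move=> [P' sP P'P] [Q' sQ Q'P].
pose h k (z : nat * nat) := if phi0 z.2 == 0 then z.2 else pairN 1 (pairN k (phi1 z.2)).
have ch k : comp (h k) by rewrite /h; rc.
have E k a c x : (fun i => join a c (h k (x, i))) = join a (row k c).
  by apply/funext => i; rewrite /join /h /row /=; case E0: (phi0 i == 0); rewrite ?E0 ?pairNK.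
exists (fun c x => P' (fun i => c (h 0 (x, i))) x \/ Q' (fun i => c (h 1 (x, i))) x).
  by apply: sig_or; [exact: (sig_oper sP (oper_reindex (ch 0)))|exact: (sig_oper sQ (oper_reindex (ch 1)))].
move=> a x; rewrite P'P Q'P; split=> [[[b Hb] [c Hc]]|[c]].
  by exists (join b c); rewrite !E row0_join row1_join => -[].
by rewrite !E => H; split; [exists (row 0 c)|exists (row 1 c)] => H'; apply: H; [left|right].
Qed.

(** By countable choice the witnesses for all n are the rows of one real; the matrix searches for an
    n whose row fails. *)
Lemma S11_alln (P : baire -> nat -> nat -> Prop) :
  S11 (fun a x => P a (phi0 x) (phi1 x)) -> S11 (fun a x => forall n, P a x n).
Proof.
move=> [Q sQ QP].
pose h (z : nat * nat) := if phi0 z.2 == 0 then z.2 else pairN 1 (pairN (phi1 z.1) (phi1 z.2)).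
have ch : comp h by rewrite /h; rc.
have E a c x : (fun i => join a c (h (x, i))) = join a (row (phi1 x) c).
  by apply/funext => i; rewrite /join /h /row /=; case E0: (phi0 i == 0); rewrite ?E0 ?pairNK.
exists (fun c x => exists n, Q (fun i => c (h (pairN x n, i))) (pairN x n)).
  exact: (sig_ex (sig_oper sQ (oper_reindex ch))).
move=> a x; split=> [H|[c H] n].
  have /choice[b bP] : forall n, exists b, ~ Q (join a b) (pairN x n).
    by move=> n; apply/QP; rewrite pairNK.
  exists (fun i => b (phi0 i) (phi1 i)) => -[n]; rewrite E pairNK /=.
  rewrite (_ : row n _ = b n) ?pairNK; last by apply/funext => i; rewrite /row pairNK.
  exact: bP.
have := QP a (pairN x n); rewrite pairNK => ->; exists (row n c) => Hn.
by apply: H; exists n; rewrite E pairNK.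
Qed.

(** The number n is kept as the first value of the new witness, and the old witness is shifted by
    one place. *)
Lemma S11_exn (P : baire -> nat -> nat -> Prop) :
  S11 (fun a x => P a (phi0 x) (phi1 x)) -> S11 (fun a x => exists n, P a x n).
Proof.
move=> [Q sQ QP].
pose h (z : nat * nat) := if phi0 z.2 == 0 then z.2 else pairN 1 (phi1 z.2).+1.
have ch : comp h by rewrite /h; rc.
have c0 : comp (fun _ : nat => pairN 1 0) by rc.
have cf : comp (fun x => pairN (phi0 x) (phi1 x)) by rc.
have E a c x : (fun i => join a c (h (x, i))) = join a (fun i => c i.+1).
  by apply/funext => i; rewrite /join /h /row /=; case E0: (phi0 i == 0); rewrite ?E0 ?pairNK.
exists (fun c x => Q (fun i => c (h (pairN x (c (pairN 1 0)), i))) (pairN x (c (pairN 1 0)))).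
  exact: (sig_oracle (sig_oper sQ (oper_reindex ch)) c0).
have J a c : join a c (pairN 1 0) = c 0 by rewrite /join pairNK.
move=> a x; split=> [[n Pn]|[c]]; last first.
  by rewrite E J => H; exists (c 0); have := QP a (pairN x (c 0)); rewrite pairNK => ->; eexists; exact: H.
have := QP a (pairN x n); rewrite pairNK /= => -[/(_ Pn)[b Hb] _].
by exists (fun i => if i is j.+1 then b j else n); rewrite E J.
Qed.

Lemma S11_exb (P : baire -> baire -> nat -> Prop) :
  S11 (fun a x => P (row 0 a) (row 1 a) x) -> S11 (fun a x => exists b, P a b x).
Proof.
move=> [Q sQ QP].
pose h (z : nat * nat) := let i := z.2 in if phi0 i == 0 then
    if phi0 (phi1 i) == 0 then pairN 0 (phi1 (phi1 i))
    else pairN 1 (pairN 0 (phi1 (phi1 i)))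
  else pairN 1 (pairN 1 (phi1 i)).
have ch : comp h by rewrite /h; cbv zeta; rc.
have E a c x : (fun i => join a c (h (x, i))) = join (join a (row 0 c)) (row 1 c).
  apply/funext => i; rewrite /join /h /row /=; case E0: (phi0 i == 0); rewrite ?pairNK //.
  by case E1: (phi0 (phi1 i) == 0); rewrite ?pairNK.
exists (fun c x => Q (fun i => c (h (x, i))) x); first exact: (sig_oper sQ (oper_reindex ch)).
move=> a x; split=> [[b]|[c]].
  have := QP (join a b) x; rewrite row0_join row1_join => -> [d Hd].
  by exists (join b d); rewrite E row0_join row1_join.
rewrite E => Hc; exists (row 0 c); have := QP (join a (row 0 c)) x.
by rewrite row0_join row1_join => ->; exists (row 1 c).
Qed.

(** A disjunction is an existential quantifier over a flag, where 0 selects the first alternative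
    and any other number the second. *)
Lemma S11_or P Q : S11 P -> S11 Q -> S11 (fun a x => P a x \/ Q a x).
Proof.
move=> [P' sP P'P] [Q' sQ Q'P].
have H : S11 (fun a x => ((phi1 x == 0) ==> `[<P a (phi0 x)>]) /\ ((phi1 x != 0) ==> `[<Q a (phi0 x)>])).
  exists (fun c x => ((phi1 x == 0) /\ P' c (phi0 x)) \/ ((phi1 x != 0) /\ Q' c (phi0 x))).
    apply: sig_or; apply: sig_and.
    - by apply/sig_re/re_dec; rc.
    - by apply: sig_subst sP _; rc.
    - by apply/sig_re/re_dec; rc.
    - by apply: sig_subst sQ _; rc.
  move=> a x; case: eqP => _ /=; split=> [[]|[b Hb]].
  - by move=> /asboolP/P'P[b Hb] _; exists b => -[[]|[]].
  - by split=> //; apply/asboolP/P'P; exists b => ?; apply: Hb; left.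
  - by move=> _ /asboolP/Q'P[b Hb]; exists b => -[[]|[]].
  - by split=> //; apply/asboolP/Q'P; exists b => ?; apply: Hb; right.
apply: S11_ext (S11_exn (P := fun a x n => ((n == 0) ==> `[<P a x>]) /\ ((n != 0) ==> `[<Q a x>])) H).
move=> a x; split=> [[n []]|[Px|Qx]].
- by case: eqP => /= _ => [/asboolP|_ /asboolP]; [left|right].
- by exists 0; split=> //=; apply/asboolP.
- by exists 1; split=> //=; apply/asboolP.
Qed.

Lemma sig_not_nb (s : nat -> nat) : comp s -> sig01 (fun a x => ~ baire_nb (s x) a).
Proof.
move=> cs.
have H : sig01 (fun a x => exists n, (fun x v => (phi1 x < phi0 (s (phi0 x))) && (v != get (phi1 (s (phi0 x))) (phi1 x))) (pairN x n) (a (phi1 (pairN x n)))).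
  pose p w := let x := phi0 w in (phi1 x < phi0 (s (phi0 x))) && (phi1 w != get (phi1 (s (phi0 x))) (phi1 x)).
  have c1 : comp (fun w => s (phi0 (phi0 w))) by apply: (comp_comp cs); rc.
  have cp : comp p.
    rewrite /p; cbv zeta; apply: comp_and; first by rc.
    by apply/comp_neg/comp_eqn; [rc|apply: comp_get; rc].
  have c2 : comp (fun x => phi1 x) by rc.
  have := sig_ex (sig_oracle (sig_re (re_dec cp)) c2).
  by apply: sig_ext => a x; rewrite /p; split=> -[n Hn]; exists n; move: Hn; rewrite !pairNK.
apply: sig_ext H => a x; split=> [[n]|nb].
  by rewrite pairNK /= => /andP[il /eqP nE] sa; apply: nE; exact: sa.
apply: contrapT => H; apply: nb => i il; apply: contrapT => nE; apply: H; exists i.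
by rewrite pairNK /= il; apply/eqP.
Qed.

Lemma S11_nb (s : nat -> nat) : comp s -> S11 (fun a x => baire_nb (s x) a).
Proof.
by move=> cs; apply: S11_ext (S11_pi (sig_not_nb cs)) => a x; split=> [/contrapT//|sa]; apply.
Qed.

Lemma S11_sig P : sig01 P -> S11 P.
Proof.
move=> [p cp pP].
have H : S11 (fun a x => baire_nb (phi0 (phi1 x)) a /\ p (phi0 x, (phi0 (phi1 x), phi1 (phi1 x)))).
  apply: S11_and; first by apply: S11_nb; rc.
  by apply: S11_dec; apply: (comp_comp cp); rc.
apply: (S11_ext _ (S11_exn (P := fun a x n => baire_nb (phi0 n) a /\ p (x, (phi0 n, phi1 n))) H)).
move=> a x; rewrite pP; split=> [[n [sa pn]]|[s [n H']]]; first by exists (phi0 n), (phi1 n).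
by exists (pairN s n); rewrite pairNK.
Qed.

Definition sigU (a : baire) (x : nat) : Prop :=
  exists s, baire_nb s a /\ univ (phi0 x) (pairN (phi1 x) s).

Lemma sig01U : sig01 sigU.
Proof.
have [p cp pP] := re_univ.
exists (fun z => p (pairN (phi0 z.1) (pairN (phi1 z.1) z.2.1), z.2.2)).
  by apply: (comp_comp cp); rc.
move=> a x; split=> [[s [sa u]]|[s [n [sa pn]]]].
  have := pP (pairN (phi0 x) (pairN (phi1 x) s)); rewrite pairNK /= => -[/(_ u)[n pn] _].
  by exists s, n.
exists s; split=> //; have := pP (pairN (phi0 x) (pairN (phi1 x) s)); rewrite pairNK /= => ->.
by exists n.
Qed.

Lemma sigUP P : sig01 P -> exists e, forall a x, P a x <-> sigU a (pairN e x).
Proof.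
move=> [p cp pP].
have [|e eP] := @univP (fun w => exists n, p (phi0 w, (phi1 w, n))).
  by exists (fun z => p (phi0 z.1, (phi1 z.1, z.2))) => //; apply: (comp_comp cp); rc.
exists e => a x; rewrite pP /sigU pairNK /=; split=> [[s [n [sa pn]]]|[s [sa]]].
  by exists s; split=> //; apply/eP; exists n; rewrite pairNK.
by move=> /eP[n]; rewrite pairNK => pn; exists s, n.
Qed.

Definition S11U (a : baire) (x : nat) : Prop := exists b, ~ sigU (join a b) x.

Lemma S11_U : S11 S11U. Proof. by exists sigU => //; exact: sig01U. Qed.

Lemma S11UP P : S11 P -> exists e, forall a x, P a x <-> S11U a (pairN e x).
Proof.
move=> [Q sQ QP]; have [e eP] := sigUP sQ; exists e => a x; rewrite QP /S11U.
by split=> -[b Hb]; exists b; rewrite ?eP // -eP.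
Qed.

End Analytic_relations.


(** * Names of points *)

Lemma comp_tuple2 (T : Type) (eT : enc T) (Q : set (2.-tuple nat)) (f g : T -> nat) :
  recursive_rel Q -> comp f -> comp g -> comp (fun x => `[<Q [tuple f x; g x]>]).
Proof. by move=> rQ cf cg; exact: (recursive_comp2 rQ cf cg). Qed.

Lemma comp_tuple4 (T : Type) (eT : enc T) (Q : set (4.-tuple nat)) (f g h k : T -> nat) :
  recursive_rel Q -> comp f -> comp g -> comp h -> comp k ->
  comp (fun x => `[<Q [tuple f x; g x; h x; k x]>]).
Proof.
move=> rQ cf cg ch ck.
pose F (i : 'I_4) := if val i == 0 then f else if val i == 1 then g else if val i == 2 then h else k.
have H (i : 'I_4) : comp (F i) by rewrite /F; do 3?case: ifP.
have := rec_comp (h := fun i v => F i (edecode (thead v))) rQ H.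
congr recursive; apply/funext => v; congr (nat_of_bool `[<Q _>]).
by apply/eq_from_tnth => i; rewrite tnth_mktuple; case: i => [[|[|[|[|//]]]] ?].
Qed.

(** The space T enters through neighbourhood codes u only; the Baire variable is an oracle and is
    left to [sig01]. *)
Definition semi (T : Type) (N : nbhd_system T) (Q : set (T * (nat -> nat))) : Prop :=
  exists2 Q', sig01 Q' & forall z b, Q (z, b) <-> exists u, N u z /\ Q' b u.

Lemma semiP (T : Type) (N : nbhd_system T) Q :
  semirecursive (prod_nb N baire_nb) Q <-> semi N Q.
Proof.
split=> [[R rR RQ]|[Q' [p cp pP] QQ']].
  exists (fun b u => exists s n, baire_nb s b /\ `[<R [tuple pairN u s; n]>]).
    exists (fun z => `[<R [tuple pairN z.1 z.2.1; z.2.2]>]) => //.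
    by apply: comp_tuple2 => //; rc.
  move=> z b; rewrite RQ /prod_nb; split=> [[w [n [Rw [/= Nz Nb]]]]|[u [Nu [s [n [sb /asboolP Rn]]]]]].
    exists (phi0 w); split=> //; exists (phi1 w), n; split=> //.
    by rewrite phiK; apply/asboolP.
  by exists (pairN u s), n; split=> //=; rewrite pairNK.
exists [set v | p (phi0 (nth 0 v 0), (phi1 (nth 0 v 0), nth 0 v 1))].
  pose q (z : nat * nat) := p (phi0 z.1, (phi1 z.1, z.2)).
  have cq : comp q by rewrite /q; apply: (comp_comp cp); rc.
  have := rec1_comp cq (rec2_comp rec2_pairN (recursive_nth 2 0) (recursive_nth 2 1)).
  congr recursive; apply/funext => v; rewrite /q /= pairNK /=.
  by congr nat_of_bool; apply/idP/idP => [?|/asboolP //]; apply/asboolP.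
move=> [z b]; rewrite QQ' /prod_nb /=; split=> [[u [Nu /pP[s [n [sb pn]]]]]|[w [n [/= pn [Nu sb]]]]].
  by exists (pairN u s), n; rewrite /= pairNK.
by exists (phi0 w); split=> //; apply/pP; exists (phi1 w), n.
Qed.

(* A representation of the points of T by elements of Baire space for which the
   basic neighbourhoods are uniformly semirecursive; a point may have many names. *)
Record naming (T : Type) (N : nbhd_system T) := Naming {
  nm : (nat -> nat) -> T -> Prop;
  nm_ex : forall z, exists a, nm a z;
  nm_inj : forall a z z', nm a z -> nm a z' -> z = z';
  nm_dom : S11 (fun a _ => exists z, nm a z);
  nm_closed : semi N [set p | ~ nm p.2 p.1];
  nm_cover : forall z, exists u, N u z;
  nm_nb : (nat -> nat) -> nat -> Prop;
  nm_nb_sig : sig01 nm_nb;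
  nm_nbP : forall a z s, nm a z -> N s z <-> nm_nb a s }.

Lemma oper_row k : oper (fun a _ => row k a).
Proof. by apply: (@oper_reindex (fun z => pairN k z.2)); rc. Qed.

Lemma sig_row k P : sig01 P -> sig01 (fun a x => P (row k a) x).
Proof. by move=> sP; exact: (sig_oper sP (oper_row k)). Qed.

Lemma S11_row k P : S11 P -> S11 (fun a x => P (row k a) x).
Proof. by move=> sP; exact: (S11_oper sP (oper_row k)). Qed.

Definition hat (T : Type) (N : nbhd_system T) (nu : naming N) (P : set T)
  (a : nat -> nat) (x : nat) : Prop := exists z, nm nu a z /\ P z.

(** From left to right, any name of z enumerates its neighbourhood codes. Conversely, the real
    required by [Sigma11] carries both a name of z and the witness; [nm_closed] makes being a name
    of z a closed condition. *)
Lemma transfer (T : Type) (N : nbhd_system T) (nu : naming N) (P : set T) :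
  Sigma11 N P <-> S11 (hat nu P).
Proof.
split=> [[F /semiP[Q sQ QP] FP]|[Q sQ QP]].
  have H1 : S11 (fun a x => ~ exists u, nm_nb nu (row 0 a) (phi1 (pairN x u)) /\ Q (row 1 a) (phi1 (pairN x u))).
    apply: S11_pi; apply: (sig_ex (P := fun a w => nm_nb nu (row 0 a) (phi1 w) /\ Q (row 1 a) (phi1 w))).
    have c1 : comp (fun w => phi1 w) by rc.
    apply: sig_and; first exact: (sig_subst (sig_row 0 (nm_nb_sig nu)) c1).
    exact: (sig_subst (sig_row 1 sQ) c1).
  have H2 := S11_exb (P := fun a b x => ~ exists u, nm_nb nu a (phi1 (pairN x u)) /\ Q b (phi1 (pairN x u))) H1.
  apply: S11_ext (S11_and (nm_dom nu) H2) => a x; split=> [[[z az] [b Hb]]|[z [az /FP[b Fb]]]].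
    exists z; split=> //; apply/FP; exists b; apply: contrapT => /(QP z b)[u [Nu Qu]].
    by apply: Hb; exists u; rewrite pairNK; split=> //; apply/(nm_nbP u az).
  split; first by exists z.
  exists b => -[u]; rewrite pairNK => -[/(nm_nbP u az) Nu Qu].
  by have /(_ Fb) : ~ F (z, b) by apply/(QP z b); exists u.
have [Q1 sQ1 Q1P] := nm_closed nu.
exists [set p | nm nu (row 0 p.2) p.1 /\ ~ Q (join (row 0 p.2) (row 1 p.2)) 0].
  apply/semiP.
  exists (fun c u => Q1 (row 0 c) u \/ Q (fun i => c (if phi0 i == 0 then i else pairN 1 (phi1 i))) 0).
    apply: sig_or; first exact: sig_row.
    have c0 : comp (fun _ : nat => 0) by rc.
    apply: (sig_subst (f := fun=> 0) (sig_oper sQ (oper_reindex (h := fun z => if phi0 z.2 == 0 then z.2 else pairN 1 (phi1 z.2)) _)) c0).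
    by rc.
  move=> z c /=.
  have -> : (fun i => c (if phi0 i == 0 then i else pairN 1 (phi1 i))) = join (row 0 c) (row 1 c).
    apply/funext => i; rewrite /join /row; case: eqP => // i0.
    by rewrite -{1}(phiK i) i0.
  have := Q1P z (row 0 c); rewrite /= => E.
  split=> [nF|[u [Nu [Q1u|Qc]]] [nmc nQ]//]; last by have /(_ nmc) : ~ nm nu (row 0 c) z by apply/E; exists u.
  have [nmc|/E[u [Nu Q1u]]] := pselect (nm nu (row 0 c) z); last by exists u; split=> //; left.
  have [u Nu] := nm_cover nu z; exists u; split=> //; right.
  by apply: contrapT => nQ; apply: nF.
move=> z; split=> [Pz|[c /= [nmc nQ]]].
  have [a az] := nm_ex nu z.
  have /(_ (ex_intro _ z (conj az Pz))) [b Qb] := (QP a 0).1.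
  by exists (join a b); rewrite /= row0_join row1_join.
by have [|z' [nmc' Pz']] := (QP (row 0 c) 0).2; [exists (row 1 c)|rewrite (nm_inj nmc nmc')].
Qed.

Lemma prod_dom (T U : Type) (M : nbhd_system T) (N : nbhd_system U)
  (mu : naming M) (nu : naming N) :
  S11 (fun a _ => exists z : T * U, nm mu (row 0 a) z.1 /\ nm nu (row 1 a) z.2).
Proof.
apply: S11_ext (S11_and (S11_row 0 (nm_dom mu)) (S11_row 1 (nm_dom nu))) => a _.
by split=> [[[t ?] [u ?]]|[[t u] [/= ? ?]]]; [exists (t, u)|split; [exists t|exists u]].
Qed.

Lemma prod_closed (T U : Type) (M : nbhd_system T) (N : nbhd_system U)
  (mu : naming M) (nu : naming N) :
  semi (prod_nb M N) [set p | ~ (nm mu (row 0 p.2) p.1.1 /\ nm nu (row 1 p.2) p.1.2)].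
Proof.
have [Q sQ QP] := nm_closed mu; have [R sR RP] := nm_closed nu.
have c0 : comp (fun x => phi0 x) by rc. have c1 : comp (fun x => phi1 x) by rc.
exists (fun b u => Q (row 0 b) (phi0 u) \/ R (row 1 b) (phi1 u)).
  by apply: sig_or; [exact: (sig_subst (sig_row 0 sQ) c0)|exact: (sig_subst (sig_row 1 sR) c1)].
move=> [t u] b /=; rewrite /prod_nb; split=> [/not_andP[/(QP t (row 0 b))[w [Mw Qw]]|/(RP u (row 1 b))[w [Nw Rw]]]|].
- have [w' Nw'] := nm_cover nu u; exists (pairN w w'); rewrite pairNK; split=> //.
  by left.
- have [w' Mw'] := nm_cover mu t; exists (pairN w' w); rewrite pairNK; split=> //.
  by right.
move=> [w [[/= Mw Nw] [Qw|Rw]]] [ht hu].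
  by have /(_ ht) : ~ nm mu (row 0 b) t by apply/(QP t (row 0 b)); exists (phi0 w).
by have /(_ hu) : ~ nm nu (row 1 b) u by apply/(RP u (row 1 b)); exists (phi1 w).
Qed.

Definition prod_naming (T U : Type) (M : nbhd_system T) (N : nbhd_system U)
  (mu : naming M) (nu : naming N) : naming (prod_nb M N).
Proof.
apply: (@Naming _ _ (fun a z => nm mu (row 0 a) z.1 /\ nm nu (row 1 a) z.2)
  _ _ (prod_dom mu nu) (prod_closed mu nu) _
  (fun a s => nm_nb mu (row 0 a) (phi0 s) /\ nm_nb nu (row 1 a) (phi1 s))).
- move=> [t u]; have [a ta] := nm_ex mu t; have [b ub] := nm_ex nu u.
  by exists (join a b); rewrite row0_join row1_join.
- by move=> a [t u] [t' u'] [/= h1 h2] [/= h3 h4]; rewrite (nm_inj h1 h3) (nm_inj h2 h4).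
- move=> [t u]; have [w Mw] := nm_cover mu t; have [w' Nw'] := nm_cover nu u.
  by exists (pairN w w'); rewrite /prod_nb pairNK.
- have c0 : comp (fun x => phi0 x) by rc. have c1 : comp (fun x => phi1 x) by rc.
  apply: sig_and; first exact: (sig_subst (sig_row 0 (nm_nb_sig mu)) c0).
  exact: (sig_subst (sig_row 1 (nm_nb_sig nu)) c1).
- move=> a [t u] s [/= h1 h2]; rewrite /prod_nb -(nm_nbP _ h1) -(nm_nbP _ h2).
  by split=> -[].
Defined.

Definition nat_naming : naming nat_nb.
Proof.
apply: (@Naming _ nat_nb (fun a n => a 0 = n) _ _ _ _ _ (fun a s => a 0 = s)).
- by move=> n; exists (fun=> n).
- by move=> a n m <-.
- have ct : comp (fun _ : nat => true) by rc.
  by apply: S11_ext (S11_dec ct) => a _; split=> // _; exists (a 0).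
- have cp : comp (fun w => phi0 w != phi1 w) by rc.
  have c0 : comp (fun _ : nat => 0) by rc.
  exists (fun b u => (fun w => phi0 w != phi1 w) (pairN u (b 0))).
    exact: (sig_oracle (sig_re (re_dec cp)) c0).
  move=> n b /=; split=> [nb|[u [/= ->]]]; last by rewrite pairNK /= => /eqP + /esym.
  by exists n; split=> //; rewrite pairNK /=; apply/eqP => nE; apply: nb.
- by move=> n; exists n.
- have c0 : comp (fun _ : nat => 0) by rc. have c1 : comp (fun n : nat => n) by rc.
  exact: (sig_atom c0 c1).
- by move=> a n s <-; split=> [->|->].
Defined.

(** * Names in a recursively presented Polish space *)

Lemma sig_exo (p : nat -> nat -> nat -> bool) :
  comp (fun w => p (phi0 (phi0 w)) (phi1 (phi0 w)) (phi1 w)) ->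
  sig01 (fun a x => exists n, p x n (a n)).
Proof.
move=> cp; have c1 : comp (fun x => phi1 x) by rc.
have := sig_ex (sig_oracle (sig_re (re_dec cp)) c1).
by apply: sig_ext => a x; split=> -[n Hn]; exists n; move: Hn; rewrite !pairNK.
Qed.

(** Fractions are stored as m / (k + 1), so the common denominator (n + 1)(l + 1) is recorded minus
    one. *)
Definition den (n l : nat) : nat := (n.+1 * l.+1).-1.
Arguments den : simpl never.

Definition iv (R : realType) (n : nat) : R := (n.+1%:R^-1)%R.
Definition fr (R : realType) (m k : nat) : R := (m%:R / k.+1%:R)%R.

Ltac glra := repeat match goal with
  | |- context [iv ?A ?n] => generalize (iv A n)
  | |- context [fr ?A ?m ?n] => generalize (fr A m n)
  | |- context [@mdist ?a ?b ?c ?d] => generalize (@mdist a b c d) end; intros; lra.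

Section RPNaming.
Context (R : realType) (X : rpPolish R).
Local Notation r := (rp_seq X).
Local Notation d := (@mdist R X).

Lemma rp_tri x y z : (d x z <= d x y + d y z)%R. Proof. exact: metric_triangle. Qed.
Lemma rp_sym x y : d x y = d y x. Proof. exact: metric_sym. Qed.
Lemma rp_ge0 x y : (0 <= d x y)%R. Proof. exact: mdist_ge0. Qed.

Definition rp_le (i j m k : nat) : bool := `[< (d (r i) (r j) <= fr R m k)%R >].
Definition rp_lt (i j m k : nat) : bool := `[< (d (r i) (r j) < fr R m k)%R >].

Lemma comp_rp_le (T : Type) (eT : enc T) (f g h k : T -> nat) :
  comp f -> comp g -> comp h -> comp k -> comp (fun x => rp_le (f x) (g x) (h x) (k x)).
Proof. by move=> cf cg ch ck; have := comp_tuple4 (rp_rec_le X) cf cg ch ck. Qed.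
Lemma comp_rp_lt (T : Type) (eT : enc T) (f g h k : T -> nat) :
  comp f -> comp g -> comp h -> comp k -> comp (fun x => rp_lt (f x) (g x) (h x) (k x)).
Proof. by move=> cf cg ch ck; have := comp_tuple4 (rp_rec_lt X) cf cg ch ck. Qed.

(** The rate of convergence 1 / (n + 1) is prescribed. By completeness, naming some point is then a
    condition on pairs of entries only, which is decidable for each pair ([rp_dom]). *)
Definition rp_nm (a : nat -> nat) (x : X) : Prop :=
  forall n, (d (r (a n)) x <= iv R n)%R.

Lemma small_inv (e : R) : (0 < e)%R -> exists n : nat, (iv R n < e)%R.
Proof. by move=> /ltr_add_invr[n]; rewrite add0r; exists n. Qed.

Lemma rp_close (x : X) (e : R) : (0 < e)%R -> exists i, (d (r i) x < e)%R.
Proof.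
move=> e0; have := rp_dense (r := X) (O := (ball x e)°%classic).
case; [by exists x; exact: nbhsx_ballx|exact: open_interior|].
move=> y [/interior_subset]; rewrite ballEmdist /= => xy [i _ iy]; exists i.
by rewrite rp_sym iy.
Qed.

Lemma inv_add (m l n : nat) :
  (fr R m l + iv R n = fr R (m * n.+1 + l.+1) (den n l))%R.
Proof.
rewrite /fr /iv /den prednK // natrD !natrM.
have : (l.+1%:R != 0 :> R)%R by rewrite pnatr_eq0.
have : (n.+1%:R != 0 :> R)%R by rewrite pnatr_eq0.
by move: (l.+1%:R)%R (n.+1%:R)%R => u v u0 v0; field; apply/andP.
Qed.

Lemma inv_add2 (n m : nat) :
  (iv R n + iv R m = fr R (n.+1 + m.+1) (den m n))%R.
Proof. by have := inv_add 1 n m; rewrite {1}/fr mul1r mul1n addnC -/(iv R n). Qed.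

Lemma rp_nm_ex x : exists a, rp_nm a x.
Proof.
have /choice[a aP] : forall n : nat, exists i, (d (r i) x <= iv R n)%R.
  by move=> n; have [|i /ltW] := @rp_close x (iv R n); [rewrite /iv invr_gt0|exists i].
by exists a.
Qed.

Lemma rp_nm_inj a x y : rp_nm a x -> rp_nm a y -> x = y.
Proof.
move=> ax ay; apply/eqP/contraT; rewrite -mdist_gt0 => xy.
have [n nP] : exists n : nat, (iv R n < d x y / 2)%R by apply: small_inv; rewrite divr_gt0.
have := rp_tri x (r (a n)) y; have := ax n; have := ay n.
by rewrite (rp_sym x (r _)); move: nP; glra.
Qed.

Lemma rp_dom : S11 (fun a _ => exists x, rp_nm a x).
Proof.
pose D y := rp_le (phi1 (phi0 y)) (phi1 y)
  ((phi0 (phi1 (phi0 (phi0 y)))).+1 + (phi1 (phi1 (phi0 (phi0 y)))).+1)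
  (den (phi1 (phi1 (phi0 (phi0 y)))) (phi0 (phi1 (phi0 (phi0 y))))).
have cD : comp D by apply: comp_rp_le; rewrite /den; rc.
have c1 : comp (fun y => phi1 (phi1 (phi0 y))) by rc.
have c2 : comp (fun y => phi0 (phi1 y)) by rc.
have H := S11_oracle (S11_oracle (S11_dec cD) c1) c2.
apply: S11_ext (S11_alln (P := fun a _ n => rp_le (a (phi0 n)) (a (phi1 n))
  ((phi0 n).+1 + (phi1 n).+1) (den (phi1 n) (phi0 n))) _); last first.
  by apply: S11_ext H => a x; rewrite /D !pairNK.
move=> a _; split=> [H'|[x ax] n]; last first.
  apply/asboolP; rewrite -inv_add2; have := rp_tri (r (a (phi0 n))) x (r (a (phi1 n))).
  have := ax (phi0 n); have := ax (phi1 n); rewrite (rp_sym x); glra.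
have {}H' n m : (d (r (a n)) (r (a m)) <= iv R n + iv R m)%R.
  by have /asboolP := H' (pairN n m); rewrite !pairNK /= inv_add2.
have inv_le n m : n <= m -> (iv R m <= iv R n)%R.
  by move=> nm; rewrite /iv lef_pV2 ?posrE // ler_nat.
have [|x xP] := rp_complete (r := X) (x := fun n => r (a n)).
  move=> e e0; have [N NP] : exists n : nat, (iv R n < e / 2)%R by apply: small_inv; rewrite divr_gt0.
  exists N => m n Nm Nn; apply: le_lt_trans (H' m n) _.
  have := inv_le _ _ Nm; have := inv_le _ _ Nn; move: NP; glra.
exists x => n; apply/ler_addgt0Pl => e e0.
have [N NP] := xP (e / 2)%R ltac:(by rewrite divr_gt0).
have [M MP] : exists n : nat, (iv R n < e / 2)%R by apply: small_inv; rewrite divr_gt0.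
have := NP (maxn N M) (leq_maxl _ _); have := H' n (maxn N M).
have := rp_tri (r (a n)) (r (a (maxn N M))) x.
have := inv_le _ _ (leq_maxr N M); move: MP; glra.
Qed.

(** If the n-th entry is too far from x, a small rational ball around x shows this for all its
    points at once: its centre is at distance more than the radius plus 1 / (n + 1) from that entry,
    a decidable inequality. *)
Lemma rp_closed : semi (rp_nb X) [set p | ~ rp_nm p.2 p.1].
Proof.
pose D u n v := ~~ rp_le (phi0 u) v
  (phi0 (phi1 u) * n.+1 + (phi1 (phi1 u)).+1) (den n (phi1 (phi1 u))).
exists (fun b u => exists n, D u n (b n)).
  by apply: sig_exo; apply: comp_neg; apply: comp_rp_le; rewrite /den; rc.
move=> x b; rewrite /rp_nb /=; split=> [nb|[u [+ [n]]]].
  have [n] : exists n, ~ (d (r (b n)) x <= iv R n)%R.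
    by apply: contrapT => H; apply: nb => n; apply: contrapT => H'; apply: H; exists n.
  move=> /negP; rewrite -ltNge => /ltr_add_invr[l]; rewrite -/(iv R l); set e : R := iv R l => lP.
  have e0 : (0 < e)%R by rewrite /iv invr_gt0.
  have ll : (fr R 1 l.*2.+1 = e / 2)%R.
    by rewrite /fr /e /iv -doubleS -muln2 natrM invfM mul1r.
  have [k kP] := @rp_close x (e / 2)%R ltac:(by rewrite divr_gt0).
  exists (pairN k (pairN 1 l.*2.+1)); rewrite !pairNK /= ballEmdist /= -/(fr R 1 l.*2.+1) ll; split=> //.
  exists n; rewrite /D !pairNK /=; apply/negP => /asboolP; rewrite -inv_add ll.
  by move: lP kP; rewrite -/e; have := rp_tri (r (b n)) (r k) x; rewrite (rp_sym (r (b n)) (r k)); glra.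
rewrite ballEmdist /= -/(fr R _ _) => xu /negP + bx; apply; apply/asboolP.
rewrite -inv_add; have := bx n; have := rp_tri (r (phi0 u)) x (r (b n)).
by rewrite (rp_sym x); move: xu; glra.
Qed.

(** A point lies in an open ball exactly if some entry of its name lies in it with margin 1 / (n +
    1). *)
Definition rp_nb_sig (a : nat -> nat) (s : nat) : Prop :=
  exists n, rp_lt (phi0 s) (a n) (phi0 (phi1 s) * n.+1 - (phi1 (phi1 s)).+1)
    (den n (phi1 (phi1 s))).

Lemma rp_nb_sigP a x s : rp_nm a x -> rp_nb X s x <-> rp_nb_sig a s.
Proof.
move=> ax; rewrite /rp_nb /rp_nb_sig ballEmdist /=.
set m := phi0 (phi1 s); set l := phi1 (phi1 s); set i := phi0 s.
rewrite -/(fr R m l).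
have E n : l.+1 <= m * n.+1 ->
    (fr R (m * n.+1 - l.+1) (den n l) = fr R m l - iv R n)%R.
  move=> lm;   apply: (addIr (iv R n))%R; rewrite subrK.
  rewrite /fr /iv /den prednK // natrB // !natrM; have : (l.+1%:R != 0 :> R)%R by rewrite pnatr_eq0.
  have : (n.+1%:R != 0 :> R)%R by rewrite pnatr_eq0.
  by move: (l.+1%:R)%R (n.+1%:R)%R => u v u0 v0; field; apply/andP.
split=> [xs|[n /asboolP]].
  have [n nP] : exists n : nat, (iv R n < (fr R m l - d (r i) x) / 2)%R.
    by apply: small_inv; rewrite divr_gt0 // subr_gt0.
  have H : (d (r i) (r (a n)) < fr R m l - iv R n)%R.
    have := ax n; have := rp_tri (r i) x (r (a n)); rewrite (rp_sym x).
    by move: nP; glra.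
  have lm : l.+1 <= m * n.+1.
    have := le_lt_trans (mdist_ge0 _ _) H; rewrite subr_gt0 /fr /iv ltr_pdivlMr // mulrC.
    by rewrite ltr_pdivrMr // -natrM ltr_nat => /ltnW.
  by exists n; apply/asboolP; rewrite E.
(* When the natural subtraction is truncated the bound is 0, and no distance is below it. *)
have [lm|/ltnW] := leqP l.+1 (m * n.+1); last first.
  by rewrite -subn_eq0 => /eqP ->; rewrite /fr mul0r ltNge mdist_ge0.
rewrite E //; have := ax n; have := rp_tri (r i) (r (a n)) x.
by glra.
Qed.

Definition rp_naming : naming (rp_nb X).
Proof.
apply: (@Naming _ _ rp_nm rp_nm_ex rp_nm_inj rp_dom rp_closed _ rp_nb_sig _ rp_nb_sigP).
- move=> x; have [i ix] := @rp_close x 1%R ltac:(by []).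
  by exists (pairN i (pairN 1 0)); rewrite /rp_nb !pairNK /= ballEmdist /= divr1.
- apply: (@sig_exo (fun s n v => rp_lt (phi0 s) v (phi0 (phi1 s) * n.+1 - (phi1 (phi1 s)).+1)
    (den n (phi1 (phi1 s))))).
  by apply: comp_rp_lt; rewrite /den; rc.
Defined.

End RPNaming.


(** * Sigma^1_1 sets and norms *)

Record espace := ESpace {
  es_car :> Type; es_nb : nbhd_system es_car; es_nu : naming es_nb }.

Canonical enat := ESpace nat_naming.
Canonical eprod (E F : espace) := ESpace (prod_naming (es_nu E) (es_nu F)).

Definition Sg (E : espace) (P : set E) : Prop := Sigma11 (@es_nb E) P.
Arguments Sg : clear implicits.
Definition Pg (E : espace) (P : set E) : Prop := Sg E (~` P).
Arguments Pg : clear implicits.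

Lemma SgP (E : espace) (P : set E) : Sg E P <-> S11 (hat (es_nu E) P).
Proof. exact: transfer. Qed.

Lemma oper_if (F G : (nat -> nat) -> nat -> nat -> nat) : oper F -> oper G ->
  oper (fun a x i => if phi0 i == 0 then F a x (phi1 i) else G a x (phi1 i)).
Proof.
move=> [h [G1 [ch cG FE]]] [h' [G' [ch' cG' GE]]].
exists (fun z => if phi0 z.2 == 0 then h (z.1, phi1 z.2) else h' (z.1, phi1 z.2)),
  (fun z => if phi0 z.2.1 == 0 then G1 (z.1, (phi1 z.2.1, z.2.2)) else G' (z.1, (phi1 z.2.1, z.2.2))).
split.
- by apply: comp_if; [rc|apply: (comp_comp ch); rc|apply: (comp_comp ch'); rc].
- by apply: comp_if; [rc|apply: (comp_comp cG); rc|apply: (comp_comp cG'); rc].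
- by move=> a x i /=; case: ifP => _; rewrite ?FE ?GE.
Qed.

Lemma oper_const (k : nat -> nat) : comp k -> oper (fun _ x _ => k x).
Proof.
move=> ck; exists (fun=> 0), (fun z => k z.1); split=> //; first by rc.
by apply: (comp_comp ck); rc.
Qed.

Section Toolkit.
Context {E F G : espace}.
Implicit Types P Q : set E.

Lemma Sg_ext P Q : (forall x, P x <-> Q x) -> Sg E P -> Sg E Q.
Proof. by move=> PQ; rewrite (_ : P = Q) //; apply/funext => x; apply/propext. Qed.

Lemma Sg_and P Q : Sg E P -> Sg E Q -> Sg E (fun x => P x /\ Q x).
Proof.
move=> /SgP hP /SgP hQ; apply/SgP; apply: S11_ext (S11_and hP hQ) => a x.
split=> [[[z [az Pz]] [z' [az' Qz]]]|[z [az [Pz Qz]]]]; last by split; exists z.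
by exists z; split=> //; split=> //; rewrite (nm_inj az az').
Qed.

Lemma Sg_or P Q : Sg E P -> Sg E Q -> Sg E (fun x => P x \/ Q x).
Proof.
move=> /SgP hP /SgP hQ; apply/SgP; apply: S11_ext (S11_or hP hQ) => a x.
split=> [[[z [az Pz]]|[z [az Pz]]]|[z [az [Pz|Qz]]]];
by [exists z; split=> //; left|exists z; split=> //; right|left; exists z|right; exists z].
Qed.

Lemma oper_rejoin : oper (fun c _ => join (row 0 c) (row 1 c)).
Proof.
have := oper_if (oper_row 0) (oper_row 1); congr oper.
Qed.

Lemma Sg_ex (P : set (eprod E F)) : Sg _ P -> Sg E (fun x => exists y, P (x, y)).
Proof.
move=> /SgP hP; apply/SgP.
have H := S11_exb (P := fun a b x => hat (es_nu (eprod E F)) P (join a b) x) (S11_oper hP oper_rejoin).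
apply: S11_ext H => a x; split=> [[b [[z w]]]|[z [az [w Pzw]]]].
  rewrite /= row0_join row1_join => -[[az bw] Pzw]; exists z; split=> //.
  by exists w.
have [b bw] := nm_ex (es_nu F) w; exists b, (z, w).
by rewrite /= row0_join row1_join.
Qed.

Lemma Sg_alln (P : set (eprod E enat)) : Sg _ P -> Sg E (fun x => forall n, P (x, n)).
Proof.
move=> /SgP hP; apply/SgP.
have c1 : comp (fun x => phi1 x) by rc. have c0 : comp (fun x => phi0 x) by rc.
have H := S11_alln (P := fun a _ n => hat (es_nu (eprod E enat)) P (join a (fun=> n)) 0)
  (S11_oper hP (oper_if oper_id (oper_const c1))).
apply: S11_ext (S11_and (nm_dom (es_nu E)) H) => a x.
split=> [[[z az] Hn]|[z [az Pz]]]; last first.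
  by split=> [|n]; [exists z|exists (z, n); rewrite /= row0_join row1_join].
exists z; split=> // n; have [[z' n'] [/=]] := Hn n.
by rewrite row0_join row1_join => -[az' <-]; rewrite (nm_inj az az').
Qed.

Definition eff (f : E -> F) : Prop :=
  exists2 Phi, oper Phi & forall a x, nm (es_nu E) a x -> nm (es_nu F) (Phi a 0) (f x).

Lemma Sg_pre (f : E -> F) (P : set F) : eff f -> Sg F P -> Sg E (fun x => P (f x)).
Proof.
move=> [Phi oP fP] /SgP hP; apply/SgP.
have c0 : comp (fun _ : nat => 0) by rc.
have H := S11_subst (f := fun=> 0) (S11_oper hP oP) c0.
apply: S11_ext (S11_and (nm_dom (es_nu E)) H) => a x.
split=> [[[z az] [w [/= aw Pw]]]|[z [az Pz]]].
  by exists z; split=> //; rewrite (nm_inj (fP _ _ az) aw).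
by split; [exists z|exists (f z); split=> //; exact: fP].
Qed.

End Toolkit.

Lemma eff_id (E : espace) : eff (fun x : E => x).
Proof. by exists (fun a _ => a) => //; exact: oper_id. Qed.

Lemma eff_comp (E F G : espace) (g : F -> G) (f : E -> F) : eff g -> eff f -> eff (fun x => g (f x)).
Proof.
move=> [Psi oPsi gP] [Phi oPhi fP]; exists (fun a x => Psi (Phi a x) x); first exact: oper_comp.
by move=> a x ax; apply: gP; exact: fP.
Qed.

Lemma eff_pair (E F G : espace) (f : E -> F) (g : E -> G) :
  eff f -> eff g -> @eff E (eprod F G) (fun x => (f x, g x)).
Proof.
move=> [Phi oPhi fP] [Psi oPsi gP]; exists (fun a x => join (Phi a x) (Psi a x)).
  exact: oper_if.
by move=> a x ax /=; rewrite row0_join row1_join; split; [exact: fP|exact: gP].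
Qed.

Lemma eff_fst (E F G : espace) (f : E -> eprod F G) : eff f -> eff (fun x => (f x).1).
Proof.
move=> [Phi oPhi fP]; exists (fun a x => row 0 (Phi a x)); first exact: (oper_comp (oper_row 0)).
by move=> a x /fP[].
Qed.

Lemma eff_snd (E F G : espace) (f : E -> eprod F G) : eff f -> eff (fun x => (f x).2).
Proof.
move=> [Phi oPhi fP]; exists (fun a x => row 1 (Phi a x)); first exact: (oper_comp (oper_row 1)).
by move=> a x /fP[].
Qed.

Lemma eff_const (E : espace) (k : nat) : @eff E enat (fun=> k).
Proof. by exists (fun _ _ _ => k) => //; apply: oper_const; rc. Qed.

Lemma eff_nat (E : espace) (f : E -> nat) (h : nat -> nat) : comp h ->
  @eff E enat f -> @eff E enat (fun x => h (f x)).
Proof.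
move=> ch; apply: (@eff_comp E enat enat h f); exists (fun a _ i => h (a 0)).
  by exists (fun=> 0), (fun z => h z.2.2); split=> //; [rc|apply: (comp_comp ch); rc].
by move=> a x /= ->.
Qed.

Ltac ef := lazymatch goal with
  | |- @eff _ _ (fun z => z) => exact: eff_id
  | |- @eff _ _ (fun z => (@?f z, @?g z)) => apply: eff_pair; ef
  | |- @eff _ _ (fun z => fst (@?f z)) => apply: eff_fst; ef
  | |- @eff _ _ (fun z => snd (@?f z)) => apply: eff_snd; ef
  | |- @eff _ _ (@fst _ _) => exact: (@eff_fst _ _ _ (fun x => x) (eff_id _))
  | |- @eff _ _ (@snd _ _) => exact: (@eff_snd _ _ _ (fun x => x) (eff_id _))
  | |- @eff _ _ id => exact: eff_id
  | |- @eff _ _ (fun z => ?k) => exact: eff_const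
  | |- _ => assumption end.


Lemma Sg_dec (E : espace) (p : nat -> bool) (f : E -> nat) : comp p -> @eff E enat f ->
  Sg E (fun x => p (f x)).
Proof.
move=> cp ef_f; apply: (@Sg_pre E enat f (fun n => p n)) => //; apply/SgP.
have c0 : comp (fun _ : nat => 0) by rc.
have c1 : comp (fun x => p (phi1 x)) by apply: (comp_comp cp); rc.
apply: S11_ext (S11_oracle (S11_dec c1) c0) => a x; rewrite pairNK /=.
by split=> [pa|[n [<-]]//]; exists (a 0).
Qed.

Lemma Sg_dec2 (E : espace) (p : nat -> nat -> bool) (f g : E -> nat) :
  comp (fun z : nat * nat => p z.1 z.2) -> @eff E enat f -> @eff E enat g ->
  Sg E (fun x => p (f x) (g x)).
Proof.
move=> cp ef_f ef_g.
apply: (@Sg_pre E (eprod enat enat) (fun x => (f x, g x)) (fun z => p z.1 z.2)).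
  exact: eff_pair.
apply/SgP.
have c0 : comp (fun _ : nat => pairN 0 0) by rc. have c1 : comp (fun _ : nat => pairN 1 0) by rc.
have c2 : comp (fun x => p (phi1 (phi0 x)) (phi1 x)) by apply: (comp_comp cp (f := fun x => (phi1 (phi0 x), phi1 x))); rc.
apply: S11_ext (S11_oracle (S11_oracle (S11_dec c2) c1) c0) => a x; rewrite !pairNK /=.
rewrite ?pairNK /=; split=> [pa|[[n m] [/= [<- <-]]]//].
by exists (a (pairN 0 0), a (pairN 1 0)).
Qed.

(** Pairing two values reads the name at two places, which [oper] does not allow; the pair is
    therefore guessed by an existential quantifier and its components are checked. *)
Lemma Sg_pairN (E : espace) (P : set (eprod E enat)) (f g : E -> nat) :
  Sg _ P -> @eff E enat f -> @eff E enat g -> Sg E (fun x => P (x, pairN (f x) (g x))).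
Proof.
move=> sP ef_f ef_g.
have H : Sg (eprod E enat) (fun z => ((phi0 z.2 == f z.1) /\ (phi1 z.2 == g z.1)) /\ P z).
  apply: Sg_and => //; apply: Sg_and.
    apply: (@Sg_dec2 (eprod E enat) (fun m n => phi0 m == n) (fun z => z.2)); [by rc|by ef|].
    by apply: (eff_comp (f := fun z : eprod E enat => z.1) ef_f); ef.
  apply: (@Sg_dec2 (eprod E enat) (fun m n => phi1 m == n) (fun z => z.2)); [by rc|by ef|].
  by apply: (eff_comp (f := fun z : eprod E enat => z.1) ef_g); ef.
apply: Sg_ext (Sg_ex H) => x /=; split=> [[k [[/eqP <- /eqP <-]]]|Px]; first by rewrite phiK.
by exists (pairN (f x) (g x)); rewrite pairNK /= !eqxx.
Qed.

(** * Comparison of ranks by simulations *)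

Section Simulation.
Implicit Types c d e : nat -> nat -> Prop.

(* For well-founded c and d: the rank of t is at most that of u. A simulation is
   a single real, which makes the comparison of ranks Sigma^1_1. *)
Definition sim c d (t u : nat) : Prop := exists Z : nat -> nat, Z (pairN t u) = 1 /\
  forall t u t', Z (pairN t u) = 1 -> c t' t -> exists u', d u' u /\ Z (pairN t' u') = 1.

Lemma simE c d t u : sim c d t u <-> forall t', c t' t -> exists2 u', d u' u & sim c d t' u'.
Proof.
split=> [[Z [Ztu ZP]] t' ct|H].
  by have [u' [du Z']] := ZP _ _ _ Ztu ct; exists u' => //; exists Z.
(* The set of all simulating pairs together with (t, u) is again a simulation. *)
exists (fun w => `[< w = pairN t u \/ sim c d (phi0 w) (phi1 w) >] : nat).
split; first by case: asboolP => // -[]; left.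
have one (Q : Prop) : (`[<Q>] : nat) = 1 <-> Q by case: asboolP.
move=> s v s' /one Hs cs.
have [v' dv sv] : exists2 v', d v' v & sim c d s' v'.
  case: Hs => [/(congr1 phi)|]; rewrite !pairNK /=; first by case=> sE ->; apply: H; rewrite -sE.
  move=> [Z [Zs ZP]].
  by have [v' [dv Z']] := ZP _ _ _ Zs cs; exists v' => //; exists Z.
by exists v'; split=> //; apply/one; right; rewrite pairNK.
Qed.

(** Induction along c: some child t' of t is simulated by no child of u, and by induction every
    child of u is then simulated by a child of t'. *)
Lemma sim_total c d t u : Acc c t -> ~ sim c d t u -> exists2 t', c t' t & sim d c u t'.
Proof.
move=> At; elim: At u => {}t _ IH u /simE ns.
have [t' ct H] : exists2 t', c t' t & ~ exists2 u', d u' u & sim c d t' u'.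
  apply: contrapT => H; apply: ns => t' ct; apply: contrapT => H'; apply: H.
  by exists t'.
exists t' => //; apply/simE => u' du.
have [|t'' ct' s''] := IH _ ct u'; last by exists t''.
by move=> s; apply: H; exists u'.
Qed.

Lemma sim_trans c d e t u v : sim c d t u -> sim d e u v -> sim c e t v.
Proof.
move=> [Z [Ztu ZP]] [Y [Yuv YP]].
exists (fun w => `[< exists u, Z (pairN (phi0 w) u) = 1 /\ Y (pairN u (phi1 w)) = 1 >] : nat).
have one (Q : Prop) : (`[<Q>] : nat) = 1 <-> Q by case: asboolP.
split; first by apply/one; exists u; rewrite pairNK.
move=> s w s' /one; rewrite pairNK /= => -[x [Zx Yx]] cs.
have [x' [dx Zx']] := ZP _ _ _ Zx cs; have [w' [ew Yw]] := YP _ _ _ Yx dx.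
by exists w'; split=> //; apply/one; exists x'; rewrite pairNK.
Qed.

Lemma sim_irr c t t' : Acc c t -> c t' t -> ~ sim c c t t'.
Proof.
move=> At; elim: At t' => {}t _ IH t' ct /simE/(_ _ ct)[t'' ct' s].
exact: IH ct _ ct' s.
Qed.

Lemma sim_acc c d t u : Acc d u -> sim c d t u -> Acc c t.
Proof.
move=> Au; elim: Au t => {}u _ IH t /simE s; constructor => t' /s[u' du s'].
exact: IH s'.
Qed.

End Simulation.

(** * The norm of a Pi^1_1 set *)

Section Norm.
Context (E : espace) (P : set E).
Variable Q : (nat -> nat) -> nat -> Prop.
Variable p : nat * (nat * nat) -> bool.
Hypothesis cp : comp p.
Hypothesis QP : forall a x, Q a x <-> exists s n, baire_nb s a /\ p (x, (s, n)).
Hypothesis PQ : forall z, P z <-> forall b, exists u, es_nb u z /\ Q b u.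

(* The node t, a finite sequence, already verifies the matrix at a point with
   set of neighbourhood codes O. *)
Definition ver (O : nat -> Prop) (t : nat) : Prop := exists w,
  [&& w < phi0 t, sub_nb (phi0 (phi1 w)) t & p (phi0 w, (phi0 (phi1 w), phi1 (phi1 w)))] /\ O (phi0 w).
(** An infinite path from the empty sequence, coded by 0, is a real whose nonempty initial segments
    never verify the matrix. Hence z belongs to P exactly if 0 is accessible, and the rank of 0 is
    the norm. *)
Definition child (O : nat -> Prop) (t' t : nat) : Prop :=
  ~ ver O t' /\ ((phi0 t' == (phi0 t).+1) && sub_nb t t').

Definition nbs (z : E) : nat -> Prop := fun u => es_nb u z.

Lemma child_chain O (f : nat -> nat) : f 0 = 0 -> (forall n, child O (f n.+1) (f n)) ->
  exists b, forall n, phi0 (f n) = n /\ baire_nb (f n) b.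
Proof.
move=> f0 fc; have len n : phi0 (f n) = n.
  by elim: n => [|n IH]; [rewrite f0|have [_ /andP[/eqP -> _]] := fc n; rewrite IH].
have step n i : i < n -> get (phi1 (f n)) i = get (phi1 (f n.+1)) i.
  move=> il; have [_ /andP[_ /andP[_ /allP H]]] := fc n.
  by have := H i; rewrite mem_iota len => /(_ il)/eqP.
exists (fun i => get (phi1 (f i.+1)) i) => n; split=> // i; rewrite len.
elim: n => // n IH; rewrite ltnS leq_eqVlt => /orP[/eqP ->//|il].
by rewrite -[RHS]/(get _ i) -(step n) //; exact: IH.
Qed.

Lemma norm_acc z : P z <-> Acc (child (nbs z)) 0.
Proof.
split=> [Pz|A0].
  apply: contrapT => nA.
  have /choice[g gP] : forall t : {t | ~ Acc (child (nbs z)) t},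
      exists t' : {t | ~ Acc (child (nbs z)) t}, child (nbs z) (sval t') (sval t).
    move=> [t nt] /=; apply: contrapT => H; apply: nt; constructor => t' ct.
    by apply: contrapT => nt'; apply: H; exists (exist _ t' nt').
  have [b bP] := @child_chain (nbs z) (fun n => sval (iter n g (exist _ 0 nA))) erefl (fun n => gP _).
  have /PQ/(_ b)[u [Nu /QP[s [n [sb pn]]]]] := Pz.
  set w := pairN u (pairN s n).
  have [len nb] := bP (maxn w (phi0 s)).+1.
  have [nv _] := gP (iter (maxn w (phi0 s)) g (exist _ 0 nA)); apply: nv.
  exists w; rewrite /w !pairNK /= pn andbT; split=> //; rewrite -iterS len.
  by rewrite ltnS leq_maxl (sub_nb_ex sb nb) // len ltnW // ltnS leq_maxr.
apply/PQ => b; apply: contrapT => nQ.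
have /choice[f fP] : forall n, exists s, phi0 s = n /\ baire_nb s b.
  by move=> n; have [s] := baire_nb_ex b n; exists s.
have nver t : baire_nb t b -> ~ ver (nbs z) t.
  move=> tb [w [/and3P[_ sw pw] Nw]]; apply: nQ; exists (phi0 w); split=> //.
  by apply/QP; do 2!eexists; split; [exact: sub_nbP sw tb|exact: pw].
have cf n t : phi0 t = n -> baire_nb t b -> child (nbs z) (f n.+1) t.
  move=> tn tb; have [fn fb] := fP n.+1; split; first exact: nver.
  by rewrite fn tn eqxx /= (sub_nb_ex tb fb) // fn tn.
have : forall t, Acc (child (nbs z)) t -> forall n, phi0 t = n -> baire_nb t b -> False.
  move=> t; elim=> {}t _ IH n tn tb; have [fn fb] := fP n.+1.
  exact: (IH _ (cf _ _ tn tb) n.+1).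
by move=> /(_ 0 A0 0 erefl); apply => i.
Qed.

Definition nle (x y : E) : Prop := sim (child (nbs x)) (child (nbs y)) 0 0.
(** Comparison with a child of the root makes the inequality of ranks strict when y lies in P. *)
Definition nlt (x y : E) : Prop := exists u, child (nbs y) u 0 /\ sim (child (nbs x)) (child (nbs y)) 0 u.

Lemma sig_ver O : sig01 O -> sig01 (fun a t => ver (O a) t).
Proof.
move=> sO; have c0 : comp (fun w => phi0 (phi1 w)) by rc.
have cd : comp (fun w => [&& phi1 w < phi0 (phi0 w), sub_nb (phi0 (phi1 (phi1 w))) (phi0 w)
   & p (phi0 (phi1 w), (phi0 (phi1 (phi1 w)), phi1 (phi1 (phi1 w))))]).
  apply: comp_and; first by rc.
  by apply: comp_and; [apply: comp_sub_nb; rc|apply: (comp_comp cp); rc].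
apply: sig_ext (sig_ex (sig_and (sig_re (re_dec cd)) (sig_subst sO c0))) => a x.
by split=> -[w]; rewrite ?pairNK => Hw; exists w; rewrite ?pairNK.
Qed.

Lemma S11_child O f g : sig01 O -> comp f -> comp g -> S11 (fun a x => child (O a) (f x) (g x)).
Proof.
move=> sO cf cg; apply: S11_and.
  exact: S11_pi (sig_subst (sig_ver sO) cf).
by apply: S11_dec; apply: comp_and; [rc|apply: comp_sub_nb].
Qed.

Lemma S11_nchild O f g : sig01 O -> comp f -> comp g -> S11 (fun a x => ~ child (O a) (f x) (g x)).
Proof.
move=> sO cf cg.
have cd : comp (fun x => ~~ ((phi0 (f x) == (phi0 (g x)).+1) && sub_nb (g x) (f x))).
  by apply: comp_neg; apply: comp_and; [rc|apply: comp_sub_nb].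
apply: S11_ext (S11_or (S11_sig (sig_subst (sig_ver sO) cf)) (S11_dec cd)) => a x.
rewrite /child; split=> [[v []|/negP nd []]//|nc].
have [v|nv] := pselect (ver (O a) (f x)); [by left|right].
by apply/negP => d; apply: nc.
Qed.

Lemma S11_sim O O' : sig01 O -> sig01 O' ->
  S11 (fun a x => sim (child (O a)) (child (O' a)) (phi0 x) (phi1 x)).
Proof.
move=> sO sO'; apply: (S11_exb (P := fun a Z x => Z (pairN (phi0 x) (phi1 x)) = 1 /\
  forall t u t', Z (pairN t u) = 1 -> child (O a) t' t -> exists u', child (O' a) u' u /\ Z (pairN t' u') = 1)).
have atom h : comp h -> S11 (fun a x => row 1 a (h x) = 1).
  move=> ch; have c1 : comp (fun x => pairN 1 (h x)) by rc. have c2 : comp (fun _ : nat => 1) by rc.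
  exact: S11_sig (sig_atom c1 c2).
have natom h : comp h -> S11 (fun a x => row 1 a (h x) <> 1).
  move=> ch; have c1 : comp (fun x => pairN 1 (h x)) by rc. have c2 : comp (fun _ : nat => 1) by rc.
  exact: S11_pi (sig_atom c1 c2).
apply: S11_and; first by apply: atom; rc.
have H : S11 (fun a x => forall n, row 1 a (pairN (phi0 n) (phi0 (phi1 n))) <> 1 \/
   ~ child (O (row 0 a)) (phi1 (phi1 n)) (phi0 n) \/
   exists u', child (O' (row 0 a)) u' (phi0 (phi1 n)) /\ row 1 a (pairN (phi1 (phi1 n)) u') = 1).
  apply: S11_alln; apply: S11_or; first by apply: (natom (fun x => pairN (phi0 (phi1 x)) (phi0 (phi1 (phi1 x))))); rc.
  apply: S11_or.
    by apply: (S11_nchild (f := fun x => phi1 (phi1 (phi1 x))) (g := fun x => phi0 (phi1 x)) (sig_row 0 sO)); rc.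
  apply: S11_exn; apply: S11_and.
    by apply: (S11_child (f := fun x => phi1 x) (g := fun x => phi0 (phi1 (phi1 (phi0 x)))) (sig_row 0 sO')); rc.
  by apply: (atom (fun x => pairN (phi1 (phi1 (phi1 (phi0 x)))) (phi1 x))); rc.
apply: S11_ext H => a x; split=> [H t u t' Z1 c1|H n].
  by have [] := H (pairN t (pairN u t')); rewrite !pairNK //= => -[].
have [Z1|] := pselect (row 1 a (pairN (phi0 n) (phi0 (phi1 n))) = 1); [right|by left].
have [c1|] := pselect (child (O (row 0 a)) (phi1 (phi1 n)) (phi0 n)); [right|by left].
exact: H c1.
Qed.

Lemma nbsE (nu := es_nu E) a z : nm nu a z -> nbs z = nm_nb nu a.
Proof. by move=> az; apply/funext => u; apply/propext; exact: nm_nbP. Qed.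

Let sO k : sig01 (fun a x => nm_nb (es_nu E) (row k a) x).
Proof. exact: sig_row (nm_nb_sig _). Qed.

Lemma Sg_nle : Sg (eprod E E) (fun q => nle q.1 q.2).
Proof.
apply/SgP; have c0 : comp (fun _ : nat => pairN 0 0) by rc.
apply: S11_ext (S11_and (nm_dom (es_nu (eprod E E))) (S11_subst (S11_sim (sO 0) (sO 1)) c0)) => a x.
rewrite pairNK /=; split=> [[[[z w] az] H]|[[z w] [az H]]].
  by exists (z, w); split=> //; rewrite /nle (nbsE az.1) (nbsE az.2).
by split; [exists (z, w)|move: H; rewrite /nle (nbsE az.1) (nbsE az.2)].
Qed.

Lemma Sg_nlt : Sg (eprod E E) (fun q => nlt q.1 q.2).
Proof.
apply/SgP.
have c0 : comp (fun x => pairN 0 (phi1 x)) by rc.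
have c1 : comp (fun x => phi1 x) by rc. have c2 : comp (fun _ : nat => 0) by rc.
have H := S11_exn (P := fun a _ n => child (nm_nb (es_nu E) (row 1 a)) n 0 /\
  sim (child (nm_nb (es_nu E) (row 0 a))) (child (nm_nb (es_nu E) (row 1 a))) 0 n).
have {}H := H (S11_and (S11_child (sO 1) c1 c2) _).
have H2 := S11_subst (S11_sim (sO 0) (sO 1)) c0.
have {H2}H2 : S11 (fun a x => sim (child (nm_nb (es_nu E) (row 0 a))) (child (nm_nb (es_nu E) (row 1 a))) 0 (phi1 x)).
  by apply: S11_ext H2 => a x; rewrite pairNK.
apply: S11_ext (S11_and (nm_dom (es_nu (eprod E E))) (H H2)) => a x.
split=> [[[[z w] az] Hu]|[[z w] [az Hu]]].
  by exists (z, w); split=> //; rewrite /nlt (nbsE az.1) (nbsE az.2).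
by split; [exists (z, w)|move: Hu; rewrite /nlt (nbsE az.1) (nbsE az.2)].
Qed.

End Norm.

(** Both relations are Sigma^1_1, and for x in P the statement [le x y] is the negation of [lt y x].
    This makes the initial segments determined by points of P Delta^1_1. *)
Lemma norm (E : espace) (P : set E) : Pg E P -> exists le lt : E -> E -> Prop,
  (Sg (eprod E E) (fun q => le q.1 q.2) /\ Sg (eprod E E) (fun q => lt q.1 q.2)) /\
  [/\ forall x y, P x -> ~ le x y -> lt y x, forall x y, P x -> le x y -> ~ lt y x,
      forall x y, P y -> le x y -> P x & forall x y, P y -> lt x y -> P x].
Proof.
move=> [F /semiP[Q [p cp pP] QP] FP].
have PQ z : P z <-> forall b, exists u, es_nb u z /\ Q b u.
  split=> [Pz b|H].
    apply/(QP z b) => Fz; have /FP : exists a, F (z, a) by exists b.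
    by apply.
  by apply: contrapT => /FP[b Fb]; have /(QP z b) := H b.
exists (nle (E := E) p), (nlt (E := E) p); split; first by split; [exact: Sg_nle|exact: Sg_nlt].
have A := norm_acc pP PQ.
split=> x y; rewrite ?A => Ax.
- move=> /(sim_total Ax)[t' ct s]; exists t'; split=> //.
- move=> s [u [cu s']]; exact: sim_irr Ax cu (sim_trans s s').
- exact: sim_acc.
- by move=> [u [cu]]; apply: sim_acc; apply: Acc_inv cu.
Qed.


(** * Reduction, separation and codes *)

Definition baire_naming : naming baire_nb.
Proof.
apply: (@Naming _ baire_nb (fun a b => a = b) _ _ _ _ _ (fun a s => baire_nb s a)).
- by move=> b; exists b.
- by move=> a b c -> ->.
- have ct : comp (fun _ : nat => true) by rc.
  by apply: S11_ext (S11_dec ct) => a _; split=> // _; exists a.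
- have c1 : comp (fun x : nat => x) by rc.
  exists (fun b u => ~ baire_nb u b); first exact: (sig_not_nb c1).
  move=> z b /=; split=> [nb|[u [uz ub] bz]]; last by apply: ub; rewrite bz.
  apply: contrapT => H; apply: nb; apply/funext => i.
  have [s sE sz] := baire_nb_ex z i.+1.
  have sb : baire_nb s b by apply: contrapT => sb; apply: H; exists s.
  by rewrite -(get_nb sb) ?sE // (get_nb sz) ?sE.
- by move=> z; have [s _ sz] := baire_nb_ex z 0; exists s.
- exists (fun z => sub_nb z.1 z.2.1) => [|a x]; first by apply: comp_sub_nb; rc.
  split=> [xa|[s [n [sa xs]]]]; last exact: sub_nbP xs sa.
  by exists x, 0; split=> //=; rewrite (sub_nb_ex xa xa).
- by move=> a z s ->.
Defined.

Canonical ebaire := ESpace baire_naming.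

Lemma Sg_true (E : espace) : Sg E setT.
Proof. have ct : comp (fun _ : nat => true) by rc. exact: Sg_ext (Sg_dec ct (eff_const E 0)). Qed.

Lemma Sg_exn (E : espace) (P : E -> nat -> Prop) :
  Sg (eprod E enat) (fun z => P z.1 z.2) -> Sg E (fun x => exists n, P x n).
Proof. by move/Sg_ex. Qed.
Lemma Sg_all (E : espace) (P : E -> nat -> Prop) :
  Sg (eprod E enat) (fun z => P z.1 z.2) -> Sg E (fun x => forall n, P x n).
Proof. by move/Sg_alln. Qed.
Lemma Sg_exp (E F : espace) (P : E -> F -> Prop) :
  Sg (eprod E F) (fun z => P z.1 z.2) -> Sg E (fun x => exists y, P x y).
Proof. by move/Sg_ex. Qed.

Definition Usg (E : espace) (p : eprod enat E) : Prop :=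
  exists a, nm (es_nu E) a p.2 /\ S11U a (pairN p.1 0).

Lemma Sg_nm (E : espace) : Sg (eprod E ebaire) (fun p => nm (es_nu E) p.2 p.1).
Proof.
apply/SgP; have [Q sQ QP] := nm_closed (es_nu E).
have H := S11_pi (sig_ex (sig_subst (f := fun x => phi1 x)
  (sig_and (sig_row 0 (nm_nb_sig (es_nu E))) (sig_row 1 sQ)) ltac:(by rc))).
apply: S11_ext (S11_and (nm_dom (es_nu (eprod E ebaire))) H) => a x.
split=> [[[[z b] [/= az bE]] nQ]|[[z b] [/= [az bE] bz]]].
  exists (z, b); split=> //=; apply: contrapT => /(QP z b)[u [Nu Qu]]; apply: nQ.
  by exists u; rewrite pairNK /= bE; split=> //; apply/(nm_nbP u az).
split; first by exists (z, b).
move=> -[u]; rewrite pairNK /= bE => -[Nu Qu].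
by have /(_ bz) : ~ nm (es_nu E) b z by apply/(QP z b); exists u; split=> //; apply/(nm_nbP u az).
Qed.

Lemma Sg_U (E : espace) : Sg (eprod enat E) (@Usg E).
Proof.
have H : Sg (eprod enat ebaire) (fun p => S11U p.2 (pairN p.1 0)).
  apply/SgP; have c0 : comp (fun _ : nat => pairN 0 0) by rc.
  have c1 : comp (fun x => pairN (phi1 x) 0) by rc.
  have H1 := S11_oper S11_U (oper_row 1).
  have := S11_oracle (S11_subst H1 c1) c0.
  apply: S11_ext => a x; rewrite pairNK /=.
  split=> [Ua|[[n b] [/= [nE bE]]]]; first by exists (a (pairN 0 0), row 1 a).
  by rewrite -nE bE.
apply: Sg_exp; apply: Sg_and.
  by refine (@Sg_pre _ (eprod E ebaire) (fun z : eprod (eprod enat E) ebaire => (z.1.2, z.2)) _ _ (Sg_nm E)); ef.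
by refine (@Sg_pre _ (eprod enat ebaire) (fun z : eprod (eprod enat E) ebaire => (z.1.1, z.2)) _ _ H); ef.
Qed.

Lemma UsgP (E : espace) (P : set E) : Sg E P -> exists e, forall z, P z <-> Usg (e, z).
Proof.
move=> /SgP/S11UP[e eP]; exists e => z; split=> [Pz|[a [/= az /eP[z' [az' Pz']]]]].
  by have [a az] := nm_ex (es_nu E) z; exists a; split=> //; apply/eP; exists z.
by rewrite (nm_inj az az').
Qed.

(** One norm on the disjoint union of P0 and P1 compares the stages at which x enters the two sets;
    ties go to P0. *)
Lemma Pg_reduction (E : espace) (P0 P1 : set E) : Pg E P0 -> Pg E P1 ->
  exists Q0 Q1 : set E, [/\ Pg E Q0, Pg E Q1 &
   [/\ Q0 `<=` P0, Q1 `<=` P1, P0 `|` P1 `<=` Q0 `|` Q1 & forall x, Q0 x -> ~ Q1 x]].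
Proof.
move=> pP0 pP1.
pose P : set (eprod enat E) := fun p => (p.1 = 0 /\ P0 p.2) \/ (p.1 <> 0 /\ P1 p.2).
have pP : Pg _ P.
  have H0 : Sg (eprod enat E) (fun p => ~ P0 p.2) by refine (@Sg_pre _ E _ _ _ pP0); ef.
  have H1 : Sg (eprod enat E) (fun p => ~ P1 p.2) by refine (@Sg_pre _ E _ _ _ pP1); ef.
  have c0 : comp (fun n : nat => n == 0) by rc. have c1 : comp (fun n : nat => n != 0) by rc.
  have ef1 : @eff (eprod enat E) enat (fun p => p.1) by ef.
  apply: Sg_ext (Sg_and (Sg_or (Sg_dec c1 ef1) H0) (Sg_or (Sg_dec c0 ef1) H1)) => -[n x] /=.
  rewrite /P /setC /=; split=> [[h0 h1] [[n0 p0]|[n0 p1]]|nP].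
  - by case: h0 => //; rewrite n0.
  - by case: h1 => // /eqP.
  - by case: eqP => n0 /=; split; [right|left|left|right] => // px; apply: nP; [left|right].
have [le [lt [[sle slt] [n1 n2 n3 n4]]]] := norm pP.
have e0 : @eff E (eprod enat E) (fun x => (0, x)) by ef.
have e1 : @eff E (eprod enat E) (fun x => (1, x)) by ef.
exists (fun x => P0 x /\ ~ lt (1, x) (0, x)), (fun x => P1 x /\ ~ le (0, x) (1, x)); split.
- have H : Sg E (fun x => lt (1, x) (0, x)) by exact: (Sg_pre (eff_pair e1 e0) slt).
  by apply: Sg_ext (Sg_or pP0 H) => x; rewrite /setC /=; split=> [[]|/not_andP[|/contrapT]]; tauto.
- have H : Sg E (fun x => le (0, x) (1, x)) by exact: (Sg_pre (eff_pair e0 e1) sle).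
  by apply: Sg_ext (Sg_or pP1 H) => x; rewrite /setC /=; split=> [[]|/not_andP[|/contrapT]]; tauto.
have P0E x : P (0, x) <-> P0 x by rewrite /P /=; tauto.
have P1E x : P (1, x) <-> P1 x by rewrite /P /=; intuition.
split=> [x []//|x []//|x|x [p0 nl] [p1 nle]]; last by apply: nl; apply: n1 => //; apply/P0E.
move=> px; have [p0|np0] := pselect (P0 x); last first.
  have p1 : P1 x by case: px.
  by right; split=> // /(n3 _ _ ((P1E x).2 p1))/P0E.
have [l|nl] := pselect (lt (1, x) (0, x)); last by left.
right; split; first by apply/P1E; apply: n4 l; apply/P0E.
by move=> /(n2 _ _ ((P0E x).2 p0)); apply.
Qed.

Lemma Sg_separation (E : espace) (A B : set E) : Sg E A -> Sg E B -> A `&` B = set0 ->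
  exists D, [/\ Sg E D, Pg E D, A `<=` D & D `&` B = set0].
Proof.
move=> sA sB AB0.
have AB x : A x -> ~ B x by move=> Ax Bx; have : (A `&` B) x by []; rewrite AB0.
have nn (Q : set E) : Sg E Q -> Pg E (~` Q) by rewrite /Pg setCK.
have [Q0 [Q1 [pQ0 pQ1 [Q0B Q1A cov dis]]]] := Pg_reduction (nn _ sB) (nn _ sA).
have QE x : ~ Q1 x <-> Q0 x.
  split=> [nQ1|/dis//]; have [|//|/nQ1//] := cov x.
  by have [/AB|] := pselect (A x); [left|right].
exists Q0; split=> //.
- exact: Sg_ext QE pQ1.
- by move=> x Ax; apply/QE => /Q1A.
- by apply/seteqP; split=> x // [/Q0B].
Qed.

(** Two separations: P is enlarged away from the projection of A over Q, and then Q away from the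
    projection of A over the enlarged P'. *)
Lemma Sg_rect_separation (E F : espace) (P : set E) (Q : set F) (A : set (eprod E F)) :
  Sg E P -> Sg F Q -> Sg _ A -> (forall x y, P x -> Q y -> ~ A (x, y)) ->
  exists P' Q', [/\ Sg E P' /\ Pg E P', Sg F Q' /\ Pg F Q', P `<=` P', Q `<=` Q'
    & forall x y, P' x -> Q' y -> ~ A (x, y)].
Proof.
move=> sP sQ sA H.
have s1 : Sg E (fun x => exists y, Q y /\ A (x, y)).
  apply: Sg_exp; apply: Sg_and.
    by refine (@Sg_pre _ F (fun z : eprod E F => z.2) _ _ sQ); ef.
  by refine (@Sg_pre _ (eprod E F) (fun z : eprod E F => (z.1, z.2)) _ _ sA); ef.
have [|P' [sP' pP' PP' P'A]] := Sg_separation sP s1.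
  by apply/seteqP; split=> x // [Px [y [Qy]]]; exact: H.
have s2 : Sg F (fun y => exists x, P' x /\ A (x, y)).
  apply: Sg_exp; apply: Sg_and.
    by refine (@Sg_pre _ E (fun z : eprod F E => z.2) _ _ sP'); ef.
  by refine (@Sg_pre _ (eprod E F) (fun z : eprod F E => (z.2, z.1)) _ _ sA); ef.
have [|Q' [sQ' pQ' QQ' Q'A]] := Sg_separation sQ s2.
  apply/seteqP; split=> y // [Qy [x [P'x Axy]]].
  have : (P' `&` (fun x => exists y, Q y /\ A (x, y))) x by split=> //; exists y.
  by rewrite P'A.
exists P', Q'; split=> // x y P'x Q'y Axy.
have : (Q' `&` (fun y => exists x, P' x /\ A (x, y))) y by split=> //; exists x.
by rewrite Q'A.
Qed.

Definition coding (E : espace) (W : set enat) (C : set (eprod enat E)) : Prop :=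
  [/\ Pg enat W, Pg _ C, Pg (eprod enat E) (fun p => W p.1 /\ ~ C p),
      (forall n, W n -> Sg E (fun z => C (n, z)) /\ Pg E (fun z => C (n, z)))
    & (forall D, Sg E D -> Pg E D -> exists n, W n /\ forall z, C (n, z) <-> D z)].

(** A number (i, j) proposes the complements of the i-th and the j-th Sigma^1_1 sets as a set and
    its complement. Reduction makes the proposals disjoint, so being complementary becomes the
    Pi^1_1 condition that they cover the space. *)
Lemma coding_ex (E : espace) : exists W C, @coding E W C.
Proof.
pose R i (p : eprod enat E) := ~ Usg ((if i == 0 then phi0 p.1 else phi1 p.1), p.2).
have sR i : Pg _ (R i).
  rewrite /Pg (_ : ~` R i = fun p => Usg ((if i == 0 then phi0 p.1 else phi1 p.1), p.2)).
    refine (@Sg_pre _ (eprod enat E) _ _ _ (Sg_U E)); apply: eff_pair; last by ef.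
    by apply: (@eff_nat _ (fun p : eprod enat E => p.1) (fun n => if i == 0 then phi0 n else phi1 n)); [rc|ef].
  by apply/funext => p; apply/propext; rewrite /R /setC /=; split=> [/contrapT//|u /(_ u)].
have [Q0 [Q1 [pQ0 pQ1 [Q00 Q11 cov dis]]]] := Pg_reduction (sR 0) (sR 1).
pose W : set enat := fun n => forall z, Q0 (n, z) \/ Q1 (n, z).
have WE n z : W n -> ~ Q0 (n, z) <-> Q1 (n, z).
  by move=> Wn; split=> [nQ|]; [have [|] := Wn z|move=> ? /dis].
have pW : Pg enat W.
  have H : Sg enat (fun n => exists z : E, ~ Q0 (n, z) /\ ~ Q1 (n, z)).
    apply: Sg_exp; apply: Sg_and; [refine (@Sg_pre _ (eprod enat E) (fun z : eprod enat E => (z.1, z.2)) _ _ pQ0)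
      |refine (@Sg_pre _ (eprod enat E) (fun z : eprod enat E => (z.1, z.2)) _ _ pQ1)]; by ef.
  apply: Sg_ext H => n; rewrite /W /setC /=; split=> [[z [n0 n1]] /(_ z)[]//|nW].
  by apply: contrapT => H; apply: nW => z; have [|n0] := pselect (Q0 (n, z)); [left|right];
    apply: contrapT => n1; apply: H; exists z.
exists W, Q0; split=> //.
- have H : Sg (eprod enat E) (fun p => ~ W p.1) by refine (@Sg_pre _ enat _ _ _ pW); ef.
  apply: Sg_ext (Sg_or H pQ1) => -[n z]; rewrite /setC /=; by have [Wn|nWn] := pselect (W n); have := WE n z; tauto.
- move=> n Wn; have e : @eff E (eprod enat E) (fun z => (n, z)) by ef.
  split; last exact: (Sg_pre e pQ0).
  apply: Sg_ext (Sg_pre e pQ1) => z; rewrite /setC /=; split=> [h|/dis//].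
  by apply: contrapT => n0; apply: h; apply/WE.
- move=> D sD pD; have [i iP] := UsgP pD; have [j jP] := UsgP sD.
  have R0 z : R 0 (pairN i j, z) <-> D z.
    by rewrite /R /= pairNK /= -iP /setC /=; split=> [/contrapT//|d /(_ d)].
  have R1 z : R 1 (pairN i j, z) <-> ~ D z by rewrite /R /= pairNK /= -jP.
  have QE z : Q0 (pairN i j, z) <-> D z.
    split=> [/Q00/R0//|Dz]; have [|//|/Q11/R1//] := cov (pairN i j, z).
    by left; apply/R0.
  exists (pairN i j); split=> // z; have [Dz|nDz] := pselect (D z); first by left; apply/QE.
  have [|/QE//|] := cov (pairN i j, z); last by right.
  by right; apply/R1.
Qed.

(* Either some initial segment of the norm of M works, or M itself is Sigma^1_1. *)
Lemma bounded_cover (E : espace) (W : set enat) (C : set (eprod enat E)) (M : set enat) (B : set E) :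
  coding W C -> Pg enat M -> M `<=` W -> Sg E B -> (forall z, B z -> exists2 m, M m & C (m, z)) ->
  exists D : set enat, [/\ Sg enat D, Pg enat D, D `<=` M & forall z, B z -> exists2 m, D m & C (m, z)].
Proof.
move=> [pW pC pWC _ _] pM MW sB cov.
have [le [lt [[sle slt] [n1 n2 n3 n4]]]] := norm pM.
pose Dk k m := M m /\ ~ lt k m.
have [[k [Mk kcov]]|H] := pselect (exists k, M k /\ forall z, B z -> exists2 m, Dk k m & C (m, z)).
  exists (Dk k); split=> //; last by move=> m [].
    have e : @eff enat (eprod enat enat) (fun m => (m, k)) by ef.
    apply: Sg_ext (Sg_pre e sle) => m /=; split=> [l|[Mm nl]].
      by have Mm := n3 _ _ Mk l; split=> //; exact: n2.
    by apply: contrapT => nl'; apply: nl; apply: n1.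
  have e : @eff enat (eprod enat enat) (fun m => (k, m)) by ef.
  apply: Sg_ext (Sg_or pM (Sg_pre e slt)) => m; rewrite /Dk /setC /=; split=> [[]|/not_andP[|/contrapT]]; tauto.
exists M; split=> //.
(* If no k bounds a cover, then k lies in M exactly if some point of B is missed by every code of
   norm at most that of k, which is a Sigma^1_1 condition. *)
have S : Sg enat (fun k => exists z, B z /\ forall m, (~ M m \/ lt k m) \/ ~ C (m, z)).
  apply: Sg_exp; apply: Sg_and.
    by refine (@Sg_pre _ E (fun p : eprod enat E => p.2) _ _ sB); ef.
  apply: Sg_all; apply: Sg_or; last first.
    by refine (@Sg_pre _ (eprod enat E) (fun p : eprod (eprod enat E) enat => (p.2, p.1.2)) _ _ pC); ef.
  apply: Sg_or.
    by refine (@Sg_pre _ enat (fun p : eprod (eprod enat E) enat => p.2) _ _ pM); ef.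
  by refine (@Sg_pre _ (eprod enat enat) (fun p : eprod (eprod enat E) enat => (p.1.1, p.2)) _ _ slt); ef.
apply: Sg_ext S => k; split=> [[z [Bz zP]]|Mk].
  apply: contrapT => nMk; have [m Mm Cm] := cov _ Bz.
  by case: (zP m) => // -[//|] /(n4 _ _ Mm).
apply: contrapT => nz; apply: H; exists k; split=> // z Bz.
apply: contrapT => nm; apply: nz; exists z; split=> // m.
have [Cm|] := pselect (C (m, z)); [left|by right].
have [Mm|] := pselect (M m); [right|by left].
by apply: contrapT => nl; apply: nm; exists m.
Qed.

Lemma coding_union (E : espace) (W : set enat) (C : set (eprod enat E)) (D : set enat) :
  coding W C -> Sg enat D -> Pg enat D -> D `<=` W ->
  Sg E (fun z => exists2 m, D m & C (m, z)) /\ Pg E (fun z => exists2 m, D m & C (m, z)).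
Proof.
move=> [pW pC pWC _ _] sD pD DW; split.
  have H : Sg E (fun z => exists m, D m /\ ~ (W m /\ ~ C (m, z))).
    apply: Sg_exn; apply: Sg_and.
      by refine (@Sg_pre _ enat (fun p : eprod E enat => p.2) _ _ sD); ef.
    by refine (@Sg_pre _ (eprod enat E) (fun p : eprod E enat => (p.2, p.1)) _ _ pWC); ef.
  apply: Sg_ext H => z; split=> [[m [Dm nC]]|[m Dm Cm]]; exists m => //.
    by apply: contrapT => nCm; apply: nC; split=> //; exact: DW.
  by split=> // -[].
have H : Sg E (fun z => forall m, ~ D m \/ ~ C (m, z)).
  apply: Sg_all; apply: Sg_or.
    by refine (@Sg_pre _ enat (fun p : eprod E enat => p.2) _ _ pD); ef.
  by refine (@Sg_pre _ (eprod enat E) (fun p : eprod E enat => (p.2, p.1)) _ _ pC); ef.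
apply: Sg_ext H => z; rewrite /setC /=; split=> [H [m Dm Cm]|nH m]; first by case: (H m).
have [Dm|] := pselect (D m); [right|by left] => Cm.
by apply: nH; exists m.
Qed.


(** * The hierarchy of codes *)

Lemma olt_trans y x z : olt x y -> olt y z -> olt x z.
Proof. by move=> xy [yz _]; exact: olt_le_trans xy yz. Qed.

Lemma olt_irr x : ~ olt x x. Proof. by case. Qed.

Lemma ole_eqVlt x y : ole x y -> x = y \/ olt x y.
Proof. by move=> xy; have [->|n] := pselect (x = y); [left|right]. Qed.

Lemma olt_ind (P : Ord -> Prop) : (forall x, (forall y, olt y x -> P y) -> P x) -> forall x, P x.
Proof. by move=> H x; elim: (olt_wf x) => {}x _; exact: H. Qed.

Lemma oadd_lt2 x y y' : olt y y' -> olt (oadd x y) (oadd x y').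
Proof. by have [_ H _] := oaddP x y'; exact: H. Qed.

Lemma oadd_le2 x y y' : ole y y' -> ole (oadd x y) (oadd x y').
Proof. by move=> /ole_eqVlt[->|/oadd_lt2 -/(_ x)[]//]; exact: ole_refl. Qed.

Lemma oadd_lt2E x y y' : olt (oadd x y) (oadd x y') -> olt y y'.
Proof. by move=> h; apply/oltNle => /(@oadd_le2 x); move/oltNle: h. Qed.

Lemma oadd_le2E x y y' : ole (oadd x y) (oadd x y') -> ole y y'.
Proof.
move=> h; apply: contrapT => /oltNle /(@oadd_lt2 x) /oltNle; exact.
Qed.

Lemma ole_addl x y : ole x (oadd x y). Proof. by have [] := oaddP x y. Qed.

Lemma ole_addr x y : ole y (oadd x y).
Proof.
elim/olt_ind: y => y IH; apply: contrapT => /oltNle h.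
by have := IH _ h; move/oltNle: (oadd_lt2 x h).
Qed.

Lemma ole_exists_add x z : ole x z -> exists y, z = oadd x y.
Proof.
move=> xz; have [|y zy ymin] := @ord_min [set y | ole z (oadd x y)].
  by exists z; exact: ole_addr.
exists y; apply: ole_anti => //; have [_ _ least] := oaddP x y; apply: least => // y' y'y.
by apply/oltNle => /ymin; move/oltNle: y'y.
Qed.

Lemma oaddA x y z : oadd x (oadd y z) = oadd (oadd x y) z.
Proof.
elim/olt_ind: z => z IH; apply: ole_anti.
  have [_ _ least] := oaddP x (oadd y z); apply: least.
    exact: ole_trans (ole_addl x y) (ole_addl _ _).
  move=> w wyz; have [yw|/oltNle wy] := pselect (ole y w).
    have [v wE] := ole_exists_add yw; subst w.
    by have vz := oadd_lt2E wyz; rewrite IH //; exact: oadd_lt2.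
  exact: olt_le_trans (oadd_lt2 x wy) (ole_addl _ _).
have [_ _ least] := oaddP (oadd x y) z; apply: least => [|w wz].
  exact: oadd_le2 (ole_addl _ _).
by rewrite -IH //; do 2!apply: oadd_lt2.
Qed.

Lemma ozero_lt x : x <> ozero -> olt ozero x.
Proof. by move=> x0; split; [exact: ozero_le|move=> /esym]. Qed.

Lemma olt0 x : ~ olt x ozero.
Proof. by move=> /oltNle; apply; exact: ozero_le. Qed.

Lemma oadd0l x : oadd ozero x = x.
Proof.
elim/olt_ind: x => x IH; apply: ole_anti; last exact: ole_addr.
have [_ _ least] := oaddP ozero x; apply: least; first exact: ozero_le.
by move=> y yx; rewrite IH.
Qed.

Lemma olt_succ x y : olt x (osucc y) <-> ole x y.
Proof.
split=> [/oltNle h|xy]; last exact: ole_lt_trans xy (osucc_gt y).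
by apply: contrapT => /oltNle/osucc_le.
Qed.

Lemma one_gt0 : olt ozero oone. Proof. exact: osucc_gt. Qed.
Lemma ole1 x : olt ozero x -> ole oone x. Proof. exact: osucc_le. Qed.
Lemma one_add_gt0 x : olt ozero (oadd oone x).
Proof. exact: olt_le_trans one_gt0 (ole_addl _ _). Qed.
Lemma one_addP z : olt ozero z -> exists y, z = oadd oone y.
Proof. by move/ole1/ole_exists_add. Qed.

Section Levels.
Context (X Y : espace).
Local Notation Z := (eprod X Y).
Context (W : set enat) (C : set (eprod enat Z)).
Hypothesis WC : coding W C.
Local Notation Ci n := (fun z : Z => C (n, z)).

(** Closure under exchanging coordinates characterizes rectangles, the empty one included, without
    naming their sides; for codes in W this is visibly Pi^1_1. *)
Definition rect_code : set enat := fun n => W n /\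
  forall x y x' y', C (n, (x, y')) -> C (n, (x', y)) -> C (n, (x, y)).

(** Disjointness in Pi^1_1 form: outside a coded set means membership in the Pi^1_1 set of pairs
    attached to the coding. *)
Definition Cdisj (m n : nat) : Prop :=
  forall z, (W m /\ ~ C (m, z)) \/ (W n /\ ~ C (n, z)).

Definition lev_step (below : nat -> Prop) (n : nat) : Prop :=
  W n /\ forall z, C (n, z) \/ exists m, below m /\ C (m, z) /\ Cdisj m n.

(* For 1 + zeta <= 1 + xi < omega_1^CK, the codes of potentially Pi^0_(1+zeta)
   sets are those in lev (1 + zeta): the complement is covered by coded sets of
   lower level that miss the set (pot_lev). *)
Definition lev : Ord -> set nat :=
  Fix olt_wf (fun=> set nat) (fun eta rec n =>
    if `[< eta = ozero >] then rect_code n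
    else lev_step (fun m => exists zeta (h : olt zeta eta), rec zeta h m) n).

Definition levlt (eta : Ord) : set nat := fun m => exists2 zeta, olt zeta eta & lev zeta m.

Lemma levE eta n : lev eta n =
  if `[< eta = ozero >] then rect_code n else lev_step (levlt eta) n.
Proof.
have -> : levlt eta = (fun m => exists zeta (h : olt zeta eta), lev zeta m).
  by apply/funext => m; apply/propext; split=> -[zeta [h l]]; exists zeta.
rewrite /lev Fix_eq // => {}eta f g fg; apply/funext => {}n.
case: asboolP => // _; congr lev_step; apply/funext => m; apply/propext.
by split=> -[zeta [h]] l; exists zeta, h; rewrite ?fg // -fg.
Qed.

Lemma lev0 n : lev ozero n = rect_code n.
Proof. by rewrite levE; case: asboolP. Qed.

Lemma levS eta n : olt ozero eta -> lev eta n = lev_step (levlt eta) n.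
Proof. by move=> e0; rewrite levE; case: asboolP => // eE; move: e0; rewrite eE => /olt_irr. Qed.

Lemma lev_W eta n : lev eta n -> W n.
Proof. by rewrite levE; case: asboolP => _ []. Qed.

Lemma levlt_W eta n : levlt eta n -> W n. Proof. by case=> zeta _ /lev_W. Qed.

Lemma levlt_le eta eta' : ole eta eta' -> levlt eta `<=` levlt eta'.
Proof. by move=> le m [zeta lt l]; exists zeta => //; exact: olt_le_trans lt le. Qed.

Let pW : Pg enat W. Proof. by case: WC. Qed.
Let pC : Pg _ C. Proof. by case: WC. Qed.
Let pWC : Pg (eprod enat Z) (fun p => W p.1 /\ ~ C p). Proof. by case: WC. Qed.

Lemma Pg_rect_code : Pg enat rect_code.
Proof.
pose G := eprod enat (eprod (eprod X Y) (eprod X Y)).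
have H : Sg enat (fun n => exists q : eprod Z Z,
  (~ (W n /\ ~ C (n, (q.1.1, q.2.2))) /\ ~ (W n /\ ~ C (n, (q.2.1, q.1.2)))) /\ ~ C (n, q.1)).
  apply: Sg_exp; apply: Sg_and; first apply: Sg_and.
  - by refine (@Sg_pre _ (eprod enat Z) (fun p : eprod enat (eprod Z Z) => (p.1, (p.2.1.1, p.2.2.2))) _ _ pWC); ef.
  - by refine (@Sg_pre _ (eprod enat Z) (fun p : eprod enat (eprod Z Z) => (p.1, (p.2.2.1, p.2.1.2))) _ _ pWC); ef.
  - by refine (@Sg_pre _ (eprod enat Z) (fun p : eprod enat (eprod Z Z) => (p.1, p.2.1)) _ _ pC); ef.
apply: Sg_ext (Sg_or pW H) => n; rewrite /rect_code /setC /=.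
have [Wn|nWn] := pselect (W n); last by tauto.
have cE z : ~ (W n /\ ~ C (n, z)) <-> C (n, z).
  by split=> [h|Cz []//]; apply: contrapT => nc; apply: h.
split=> [[//|[[[x y] [x' y']] /= [[/cE c1 /cE c2] nc]] [_ H']]|nr]; first exact: nc (H' _ _ _ _ c1 c2).
right; apply: contrapT => nq; apply: nr; split=> // x y x' y' c1 c2.
apply: contrapT => nc; apply: nq; exists ((x, y), (x', y')) => /=.
by split=> //; split; apply/cE.
Qed.

Lemma Pg_or (E : espace) (P Q : set E) : Pg E P -> Pg E Q -> Pg E (fun x => P x \/ Q x).
Proof. by move=> pP pQ; apply: Sg_ext (Sg_and pP pQ) => x; rewrite /setC /=; tauto. Qed.
Lemma Pg_and (E : espace) (P Q : set E) : Pg E P -> Pg E Q -> Pg E (fun x => P x /\ Q x).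
Proof.
move=> pP pQ; apply: Sg_ext (Sg_or pP pQ) => x; rewrite /setC /=.
by split=> [[]|/not_andP[]]; tauto.
Qed.
Lemma Pg_all (E F : espace) (P : E -> F -> Prop) :
  Pg (eprod E F) (fun z => P z.1 z.2) -> Pg E (fun x => forall y, P x y).
Proof.
move=> pP; apply: Sg_ext (Sg_exp (P := fun x y => ~ P x y) pP) => x; rewrite /setC /=.
split=> [[y ny] /(_ y)//|H]; apply: contrapT => H'; apply: H => y.
by apply: contrapT => ny; apply: H'; exists y.
Qed.
Lemma Pg_exn (E : espace) (P : E -> nat -> Prop) :
  Pg (eprod E enat) (fun z => P z.1 z.2) -> Pg E (fun x => exists n, P x n).
Proof.
move=> pP; apply: Sg_ext (Sg_all (P := fun x y => ~ P x y) pP) => x; rewrite /setC /=.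
by split=> [H [n]|H n Pn]; [exact: H|apply: H; exists n].
Qed.
Lemma Pg_pre (E F : espace) (f : E -> F) (P : set F) : eff f -> Pg F P -> Pg E (fun x => P (f x)).
Proof. by move=> ef_f pP; exact: (Sg_pre ef_f pP). Qed.
Lemma Pg_dec (E : espace) (p : nat -> bool) (f : E -> nat) : comp p -> @eff E enat f -> Pg E (fun x => p (f x)).
Proof.
move=> cp ef_f; apply: Sg_ext (Sg_dec (comp_neg cp) ef_f) => x; rewrite /setC /=.
by split=> /negP.
Qed.
Lemma Pg_dec2 (E : espace) (p : nat -> nat -> bool) (f g : E -> nat) :
  comp (fun z : nat * nat => p z.1 z.2) -> @eff E enat f -> @eff E enat g ->
  Pg E (fun x => p (f x) (g x)).
Proof.
move=> cp ef_f ef_g; apply: Sg_ext (Sg_dec2 (p := fun m n => ~~ p m n) (comp_neg cp) ef_f ef_g) => x.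
by rewrite /setC /=; split=> /negP.
Qed.

Lemma Pg_Cdisj : Pg (eprod enat enat) (fun p => Cdisj p.1 p.2).
Proof.
apply: Pg_all; apply: Pg_or.
  by refine (@Pg_pre _ (eprod enat Z) (fun p : eprod (eprod enat enat) Z => (p.1.1, p.2)) _ _ pWC); ef.
by refine (@Pg_pre _ (eprod enat Z) (fun p : eprod (eprod enat enat) Z => (p.1.2, p.2)) _ _ pWC); ef.
Qed.

Lemma Pg_step (E : espace) (below : E -> nat -> Prop) :
  Pg (eprod E enat) (fun p => below p.1 p.2) ->
  Pg (eprod E enat) (fun p => lev_step (below p.1) p.2).
Proof.
move=> pb; apply: Pg_and; first by refine (@Pg_pre _ enat (fun p : eprod E enat => p.2) _ _ pW); ef.
apply: Pg_all; apply: Pg_or.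
  by refine (@Pg_pre _ (eprod enat Z) (fun p : eprod (eprod E enat) Z => (p.1.2, p.2)) _ _ pC); ef.
apply: Pg_exn; apply: Pg_and; last apply: Pg_and.
- by refine (@Pg_pre _ (eprod E enat) (fun p : eprod (eprod (eprod E enat) Z) enat => (p.1.1.1, p.2)) _ _ pb); ef.
- by refine (@Pg_pre _ (eprod enat Z) (fun p : eprod (eprod (eprod E enat) Z) enat => (p.2, p.1.2)) _ _ pC); ef.
- by refine (@Pg_pre _ (eprod enat enat) (fun p : eprod (eprod (eprod E enat) Z) enat => (p.2, p.1.1.2)) _ _ Pg_Cdisj); ef.
Qed.

Section Recursive.
Variables (xi : Ord) (D : set (1.-tuple nat)) (L : set (2.-tuple nat)) (f : nat -> Ord).
Hypotheses (rD : recursive_rel D) (rL : recursive_rel L)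
  (fD : forall n, D [tuple n] -> olt (f n) xi)
  (fsurj : forall eta, olt eta xi -> exists2 n, D [tuple n] & f n = eta)
  (fL : forall m n, D [tuple m] -> D [tuple n] -> (L [tuple m; n] <-> olt (f m) (f n))).

Let bel (S : nat -> nat) (k m : nat) : Prop :=
  rect_code m \/ exists j, `[<D [tuple j]>] && `[<L [tuple j; k]>] /\ S (pairN j m) = 1.

(** The levels 1 + f j, put together as a relation between j and codes, are the least fixed point of
    a monotone step. As the intersection of all S closed under the step it is Pi^1_1, because
    [lev_step] is Pi^1_1 in S. Level 0 enters through [bel]. *)
Definition levfix : set (eprod enat enat) := fun p => forall S : nat -> nat,
  (exists w : nat, (`[<D [tuple phi0 w]>] /\ lev_step (bel S (phi0 w)) (phi1 w)) /\ S w <> 1)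
  \/ S (pairN p.1 p.2) = 1.

Lemma comp_D : comp (fun n : nat => `[<D [tuple n]>]).
Proof.
have := recursive_comp1 rD (recursive_nth 1 0).
by congr recursive; apply/funext => v; rewrite thead_nth.
Qed.

Lemma Sg_S1 : Sg (eprod ebaire enat) (fun p => p.1 p.2 = 1).
Proof.
have c0 : comp (fun _ : nat => pairN 1 0) by rc.
have c1 : comp (fun x => pairN 0 (phi1 x)) by rc. have c2 : comp (fun _ : nat => 1) by rc.
apply/SgP; apply: S11_ext (S11_oracle (S11_sig (sig_atom c1 c2)) c0) => a x; rewrite pairNK /=.
split=> [aE|[[b n] [/= [<- <-]]]//]; by exists (row 0 a, a (pairN 1 0)).
Qed.

Lemma Pg_S1 : Pg (eprod ebaire enat) (fun p => p.1 p.2 = 1).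
Proof.
have c0 : comp (fun _ : nat => pairN 1 0) by rc.
have c1 : comp (fun x => pairN 0 (phi1 x)) by rc. have c2 : comp (fun _ : nat => 1) by rc.
apply/SgP; apply: S11_ext (S11_oracle (S11_pi (sig_atom c1 c2)) c0) => a x; rewrite pairNK /=.
split=> [aE|[[b n] [/= [<- <-]]]//]; by exists (row 0 a, a (pairN 1 0)).
Qed.

Lemma Pg_S1p (E : espace) (S : E -> ebaire) (i j : E -> nat) : eff S -> @eff E enat i -> @eff E enat j ->
  Pg E (fun x => S x (pairN (i x) (j x)) = 1).
Proof.
move=> eS ei ej.
have H : Sg (eprod E enat) (fun p => S p.1 p.2 <> 1).
  have e1 : @eff (eprod E enat) E (fun p => p.1) by ef.
  by refine (@Sg_pre _ (eprod ebaire enat) (fun p : eprod E enat => (S p.1, p.2)) _ _ Pg_S1);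
    apply: eff_pair; [exact: (eff_comp eS e1)|ef].
exact: (Sg_pairN H ei ej).
Qed.

Lemma Pg_bel : Pg (eprod (eprod ebaire enat) enat) (fun p => bel p.1.1 p.1.2 p.2).
Proof.
apply: Pg_or; first by refine (@Pg_pre _ enat (fun p : eprod (eprod ebaire enat) enat => p.2) _ _ Pg_rect_code); ef.
apply: Pg_exn; apply: Pg_and.
  have c : comp (fun z : nat * nat => `[<D [tuple z.1]>] && `[<L [tuple z.1; z.2]>]).
    apply: comp_and; first by apply: (comp_comp comp_D); rc.
    by apply: comp_tuple2 => //; rc.
  refine (@Pg_dec2 _ (fun j k => `[<D [tuple j]>] && `[<L [tuple j; k]>])
    (fun p : eprod (eprod (eprod ebaire enat) enat) enat => p.2) (fun p => p.1.1.2) c _ _); ef.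
apply: (Pg_S1p (S := fun p : eprod (eprod (eprod ebaire enat) enat) enat => p.1.1.1)
  (i := fun p => p.2) (j := fun p => p.1.2)); ef.
Qed.

Lemma Pg_levfix : Pg _ levfix.
Proof.
apply: Pg_all; apply: Pg_or; last first.
  by apply: (Pg_S1p (S := fun p : eprod (eprod enat enat) ebaire => p.2) (i := fun p => p.1.1) (j := fun p => p.1.2)); ef.
apply: Pg_exn; pose G := eprod (eprod (eprod enat enat) ebaire) enat.
have e2 : @eff G enat (fun p => p.2) by ef.
have c0 : comp (fun n => phi0 n) by rc. have c1 : comp (fun n => phi1 n) by rc.
apply: Pg_and; first apply: Pg_and.
- have c : comp (fun n : nat => `[<D [tuple phi0 n]>]) by apply: (comp_comp comp_D); rc.
  exact: (Pg_dec c e2).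
- refine (@Pg_pre G (eprod (eprod ebaire enat) enat) (fun p => ((p.1.2, phi0 p.2), phi1 p.2)) _ _
    (Pg_step (below := fun q : eprod ebaire enat => bel q.1 q.2) Pg_bel)).
  apply: eff_pair; last exact: (eff_nat c1 e2).
  by apply: eff_pair; [ef|exact: (eff_nat c0 e2)].
- apply: Sg_ext (@Sg_pre G (eprod ebaire enat) (fun p => (p.1.2, p.2)) _ ltac:(ef) Sg_S1) => p.
  by rewrite /setC /=; split=> [s /(_ s)//|/contrapT].
Qed.

Lemma levlt_one_add k m : D [tuple k] -> levlt (oadd oone (f k)) m <->
  rect_code m \/ exists j, `[<D [tuple j]>] && `[<L [tuple j; k]>] /\ lev (oadd oone (f j)) m.
Proof.
move=> Dk; split=> [[zeta zk l]|[r|[j [/andP[/asboolP Dj /asboolP Ljk] l]]]].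
- have [z0|/ozero_lt/one_addP[y zE]] := pselect (zeta = ozero).
    by left; rewrite -lev0 -z0.
  right; subst zeta; have yk := oadd_lt2E zk.
  have [j Dj fj] := fsurj (olt_trans yk (fD Dk)).
  exists j; rewrite fj; split=> //; apply/andP; split; apply/asboolP => //.
  by apply/(fL Dj Dk); rewrite fj.
- by exists ozero; [exact: one_add_gt0|rewrite lev0].
- by exists (oadd oone (f j)) => //; apply: oadd_lt2; apply/(fL Dj Dk).
Qed.

Lemma levfixP k n : D [tuple k] -> levfix (k, n) <-> lev (oadd oone (f k)) n.
Proof.
have mono (b b' : nat -> Prop) m : b `<=` b' -> lev_step b m -> lev_step b' m.
  move=> bb' [Wm H]; split=> // z; case: (H z) => [|[j [bj Cj]]]; [by left|right].
  by exists j; split=> //; exact: bb'.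
have one (Q : Prop) : (`[<Q>] : nat) = 1 <-> Q by case: asboolP.
move=> Dk; split=> [H|l S].
  (* The true hierarchy is itself one of the closed S. *)
  have [[w [[/asboolP Dw st] nS]]|/one[_]] := H (fun w => `[< D [tuple phi0 w] /\ lev (oadd oone (f (phi0 w))) (phi1 w) >] : nat); last first.
    by rewrite pairNK.
  exfalso; apply: nS; apply/one; split=> //.
  rewrite levS; last exact: one_add_gt0.
  apply: mono st => m Hm; apply: (levlt_one_add m Dw).2.
  case: Hm => [r|[j [DL /one[_]]]]; first by left.
  by rewrite pairNK => lj; right; exists j.
have [|nH] := pselect (exists w, (`[<D [tuple phi0 w]>] /\ lev_step (bel S (phi0 w)) (phi1 w)) /\ S w <> 1).
  by left.
have clo j m : D [tuple j] -> lev_step (bel S j) m -> S (pairN j m) = 1.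
  move=> Dj st; apply: contrapT => nS; apply: nH; exists (pairN j m); rewrite pairNK /=.
  by split=> //; split=> //; apply/asboolP.
right=> /=; move: k n l Dk.
have : forall eta k n, f k = eta -> lev (oadd oone (f k)) n -> D [tuple k] -> S (pairN k n) = 1.
  elim/olt_ind => eta IH k n fk l Dk; apply: clo => //.
  move: l; rewrite levS; last exact: one_add_gt0.
  apply: mono => m /(levlt_one_add _ Dk)[r|[j [DL lj]]]; [by left|right].
  exists j; split=> //; case/andP: DL => /asboolP Dj /asboolP Ljk.
  by apply: (IH (f j)) => //; rewrite -fk; apply/(fL Dj Dk).
by move=> H k n l Dk; exact: (H _ k n erefl).
Qed.

Lemma Pg_levlt_top : Pg enat (levlt (oadd oone xi)).
Proof.
have H : Pg enat (fun m => rect_code m \/ exists j, `[<D [tuple j]>] /\ levfix (j, m)).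
  apply: Pg_or; first exact: Pg_rect_code.
  apply: Pg_exn; apply: Pg_and.
    by apply: (Pg_dec (f := fun p : eprod enat enat => p.2) comp_D); ef.
  by refine (@Pg_pre _ (eprod enat enat) (fun p : eprod enat enat => (p.2, p.1)) _ _ Pg_levfix); ef.
suff -> : levlt (oadd oone xi) = (fun m => rect_code m \/ exists j, `[<D [tuple j]>] /\ levfix (j, m)) by exact: H.
apply/funext => m; apply/propext; split=> [[zeta zk l]|[r|[j [/asboolP Dj /(levfixP _ Dj) l]]]].
- have [z0|/ozero_lt/one_addP[y zE]] := pselect (zeta = ozero).
    by left; rewrite -lev0 -z0.
  right; subst zeta; have [j Dj fj] := fsurj (oadd_lt2E zk).
  by exists j; split; [apply/asboolP|apply/(levfixP _ Dj); rewrite fj].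
- by exists ozero; [exact: one_add_gt0|rewrite lev0].
- by exists (oadd oone (f j)) => //; apply: oadd_lt2; exact: fD.
Qed.

Lemma Pg_levlt_k k : D [tuple k] -> Pg enat (levlt (oadd oone (f k))).
Proof.
move=> Dk; have H : Pg enat (fun m => rect_code m \/ exists j, (`[<D [tuple j]>] && `[<L [tuple j; k]>]) /\ levfix (j, m)).
  apply: Pg_or; first exact: Pg_rect_code.
  apply: Pg_exn; apply: Pg_and.
    have c : comp (fun j : nat => `[<D [tuple j]>] && `[<L [tuple j; k]>]).
      by apply: comp_and; [exact: comp_D|apply: comp_tuple2 => //; rc].
    by apply: (Pg_dec (f := fun p : eprod enat enat => p.2) c); ef.
  by refine (@Pg_pre _ (eprod enat enat) (fun p : eprod enat enat => (p.2, p.1)) _ _ Pg_levfix); ef.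
suff -> : levlt (oadd oone (f k)) = (fun m => rect_code m \/ exists j, (`[<D [tuple j]>] && `[<L [tuple j; k]>]) /\ levfix (j, m)) by exact: H.
apply/funext => m; apply/propext; rewrite (levlt_one_add _ Dk).
by split=> -[|[j [DL l]]]; [left|right|left|right] => //; exists j; split=> //;
  apply/levfixP => //; case/andP: DL => /asboolP.
Qed.

End Recursive.

Variable xi : Ord.
Hypothesis hxi : below_omega1CK xi.

Lemma Pg_levlt zeta : ole zeta xi -> Pg enat (levlt (oadd oone zeta)).
Proof.
have [D [L [f [rD rL fD fs fL]]]] := hxi.
have fL' m n Dm Dn := (fL m n Dm Dn).1.
move=> /ole_eqVlt[->|/fs[k Dk <-]]; first exact: (Pg_levlt_top rD rL fD fs fL').
exact: (Pg_levlt_k rD rL fD fs fL').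
Qed.

Lemma Pg_lev zeta : ole zeta xi -> Pg enat (lev (oadd oone zeta)).
Proof.
move=> zx; have e : @eff enat (eprod enat enat) (fun n => (0, n)) by ef.
have p1 : Pg (eprod enat enat) (fun p => levlt (oadd oone zeta) p.2).
  by refine (@Pg_pre _ enat (fun p : eprod enat enat => p.2) _ _ (Pg_levlt zx)); ef.
have := Pg_pre e (Pg_step (below := fun _ : enat => levlt (oadd oone zeta)) p1).
by congr Pg; apply/funext => n; rewrite levS //; exact: one_add_gt0.
Qed.

(** Coded sets of levels below eta serve as basic neighbourhoods. Unlike a topological closure, this
    one quantifies over a Pi^1_1 set of codes. *)
Definition cl (eta : Ord) (A : set Z) : set Z := fun z =>
  forall m, levlt eta m -> C (m, z) -> exists z', C (m, z') /\ A z'.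

Lemma cl_sub eta A : A `<=` cl eta A. Proof. by move=> z Az m _ Cz; exists z. Qed.

Lemma cl_mono eta A B : A `<=` B -> cl eta A `<=` cl eta B.
Proof. by move=> AB z h m lm Cz; have [z' [Cz' /AB]] := h m lm Cz; exists z'. Qed.

Lemma cl_idem eta A : cl eta (cl eta A) `<=` cl eta A.
Proof. by move=> z h m lm Cz; have [z' [Cz' /(_ m lm Cz')]] := h m lm Cz. Qed.

Lemma cl_le eta eta' A : ole eta' eta -> cl eta A `<=` cl eta' A.
Proof. by move=> le z h m lm; apply: h; exact: levlt_le lm. Qed.

Lemma Sg_cl zeta A : ole zeta xi -> Sg Z A -> Sg Z (cl (oadd oone zeta) A).
Proof.
move=> zx sA; have pl := Pg_levlt zx.
have H : Pg Z (fun z => exists m, levlt (oadd oone zeta) m /\ (C (m, z) /\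
    forall z', (W m /\ ~ C (m, z')) \/ ~ A z')).
  apply: Pg_exn; apply: Pg_and; first by refine (@Pg_pre _ enat (fun p : eprod Z enat => p.2) _ _ pl); ef.
  apply: Pg_and; first by refine (@Pg_pre _ (eprod enat Z) (fun p : eprod Z enat => (p.2, p.1)) _ _ pC); ef.
  apply: Pg_all; apply: Pg_or.
    by refine (@Pg_pre _ (eprod enat Z) (fun p : eprod (eprod Z enat) Z => (p.1.2, p.2)) _ _ pWC); ef.
  have pA : Pg Z (~` A) by rewrite /Pg setCK.
  by refine (@Pg_pre _ Z (fun p : eprod (eprod Z enat) Z => p.2) _ _ pA); ef.
apply: Sg_ext H => z; rewrite /setC /=; split=> [nH m lm Cz|h [m [lm [Cz H]]]].
  apply: contrapT => nz; apply: nH; exists m; split=> //; split=> // z'.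
  have [Az'|] := pselect (A z'); [left|by right]; split; first exact: levlt_W lm.
  by move=> Cz'; apply: nz; exists z'.
by have [z' [Cz' Az']] := h m lm Cz; case: (H z') => [[]|].
Qed.

(** The codes of lower level that miss A cover B. [bounded_cover] thins them to a Delta^1_1 set of
    codes, and the complement of the union of the sets so coded is Delta^1_1 and of the required
    level. *)
Lemma lev_separation zeta A B : ole zeta xi -> Sg Z A -> Sg Z B ->
  cl (oadd oone zeta) A `&` B = set0 ->
  exists n, [/\ lev (oadd oone zeta) n, A `<=` Ci n & Ci n `&` B = set0].
Proof.
move=> zx sA sB AB0; have pl := Pg_levlt zx.
pose M : set enat := fun m => levlt (oadd oone zeta) m /\ forall z, (W m /\ ~ C (m, z)) \/ ~ A z.
have pM : Pg enat M.
  apply: Pg_and => //; apply: Pg_all; apply: Pg_or.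
    by refine (@Pg_pre _ (eprod enat Z) (fun p : eprod enat Z => (p.1, p.2)) _ _ pWC); ef.
  have pA : Pg Z (~` A) by rewrite /Pg setCK.
  by refine (@Pg_pre _ Z (fun p : eprod enat Z => p.2) _ _ pA); ef.
have MW : M `<=` W by move=> m [/levlt_W].
have [|D [sD pD DM cov]] := bounded_cover WC pM MW sB.
  move=> z Bz; apply: contrapT => nm.
  have : (cl (oadd oone zeta) A `&` B) z; last by rewrite AB0.
  split=> // m lm Cz; apply: contrapT => nz; apply: nm; exists m => //; split=> // z'.
  have [Az'|] := pselect (A z'); [left|by right]; split; first exact: levlt_W lm.
  by move=> Cz'; apply: nz; exists z'.
have DW m : D m -> W m by move/DM/MW.
have [sG pG] := coding_union WC sD pD DW.
have [_ _ _ _ surj] := WC.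
have [|n [Wn nP]] := surj (fun z => ~ (exists2 m, D m & C (m, z))) pG.
  by rewrite /Pg; apply: Sg_ext sG => z; rewrite /setC /=; split=> [s /(_ s)|/contrapT].
exists n; split.
- rewrite levS; last exact: one_add_gt0.
  split=> // z; have [|nC] := pselect (C (n, z)); [by left|right].
  have [m Dm Cm] : exists2 m, D m & C (m, z) by apply: contrapT => /nP.
  exists m; split; first by case: (DM _ Dm).
  split=> // z'; have [Cm'|] := pselect (C (m, z')); [right|left]; split=> //; last exact: DW.
  by move=> /nP; apply; exists m.
- move=> z Az; apply/nP => -[m Dm Cm].
  by have [_ /(_ z)[[]|]] := DM _ Dm.
- by apply/seteqP; split=> z // [/nP nz Bz]; apply: nz; exact: cov.
Qed.

End Levels.


(** * Resolutions of rho *)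

Section Resolutions.

Implicit Types (s t u p q : seq bool) (e : nat -> bool).

Lemma ord_cases (x : Ord) : [\/ x = ozero, exists y, x = osucc y | olimit x].
Proof.
have [->|x0] := pselect (x = ozero); first by constructor 1.
have [[y ->]|nS] := pselect (exists y, x = osucc y); first by constructor 2; exists y.
by constructor 3; split=> // y xy; apply: nS; exists y.
Qed.

Lemma prefix_nth s t i : prefix s t -> i < size s -> nth false s i = nth false t i.
Proof. by move=> /prefixP[r ->] il; rewrite nth_cat il. Qed.

Lemma prefix_drop k s t : prefix s t -> prefix (drop k s) (drop k t).
Proof.
move=> /prefixP[r ->]; rewrite drop_cat; case: ltnP => [_|sk].
  exact: prefix_prefix.
by rewrite drop_oversize // prefix0s.
Qed.

Lemma prefix_mkseq e m n : m <= n -> prefix (mkseq e m) (mkseq e n).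
Proof. by move=> mn; rewrite prefixE size_mkseq /mkseq -map_take take_iota (minn_idPl mn). Qed.

Definition is_path (R : seq bool -> seq bool -> Prop) (P : seq bool -> seq bool) e e' (n : nat -> nat) :=
  forall m, P (mkseq e (n m)) = mkseq e' m /\ R (mkseq e (n m)) (mkseq e (n m.+1)).

(* A resolution of rho of rank xi: R eta says that s is an eta-true initial
   segment of t, and P approximates rho along xi-true initial segments. *)
Record resolution (xi : Ord) (rho : (nat -> bool) -> (nat -> bool))
    (R : Ord -> seq bool -> seq bool -> Prop) (P : seq bool -> seq bool) : Prop := Resolution {
  res0 : forall s t, R ozero s t <-> prefix s t;
  res_dec : forall zeta eta s t, ole zeta eta -> ole eta xi -> R eta s t -> R zeta s t;
  res_refl : forall eta s, R eta s s;
  res_trans : forall eta s t u, R eta s t -> R eta t u -> R eta s u;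
  res_club : forall eta s t u, olt eta xi -> prefix s t ->
    R (osucc eta) s u -> R eta t u -> R (osucc eta) s t;
  res_lim : forall l s t, olimit l -> ole l xi -> (forall eta, olt eta l -> R eta s t) -> R l s t;
  res_nil : forall eta t, R eta [::] t;
  res_unif : forall l t, olimit l -> ole l xi ->
    exists2 th, olt th l & forall u, R th t u -> R l t u;
  res_P : forall s t, R xi s t -> prefix (P s) (P t);
  res_size : forall s, size (P s) <= size s;
  res_path : forall e, exists n, is_path (R xi) P e (rho e) n }.

Section ResolutionTheory.
Variables (xi : Ord) (rho : (nat -> bool) -> (nat -> bool))
    (R : Ord -> seq bool -> seq bool -> Prop) (P : seq bool -> seq bool).
Hypothesis res : resolution xi rho R P.

Lemma res_prefix eta s t : ole eta xi -> R eta s t -> prefix s t.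
Proof. by move=> ex /(res_dec res (ozero_le eta) ex)/(res0 res). Qed.

Lemma res_Pnil : P [::] = [::].
Proof. by have := res_size res [::]; case: (P [::]). Qed.

Lemma res_club' eta s t u : ole eta xi -> prefix s t -> R eta s u -> R eta t u -> R eta s t.
Proof.
elim/olt_ind: eta => eta IH ex st su tu; have dec z : ole z eta -> R z s u /\ R z t u.
  by move=> ze; split; apply: (res_dec res ze ex).
case: (ord_cases eta) => [->|[z eE]|el]; first exact/(res0 res).
  subst eta; have zx := olt_le_trans (osucc_gt z) ex.
  apply: (res_club res) zx st su _.
  by have [] := dec z; first by case: (osucc_gt z).
apply: (res_lim res) => // z ze; have [zs zt] := dec _ ze.1; apply: IH => //.
exact: ole_trans ze.1 ex.
Qed.

Lemma path_mono eta e e' n m m' : is_path (R eta) P e e' n -> m <= m' ->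
  R eta (mkseq e (n m)) (mkseq e (n m')).
Proof.
move=> np /subnK <-; elim: (m' - m) => [|k IH]; first exact: (res_refl res).
by apply: (res_trans res) IH _; have [_] := np (k + m).
Qed.

End ResolutionTheory.

Lemma res_id : resolution ozero id (fun _ s t => prefix s t) id.
Proof.
split=> //.
- by move=> eta s; exact: prefix_refl.
- by move=> eta s t u; exact: prefix_trans.
- by move=> l s t [l0 _] /ole_eqVlt[//|/olt0].
- by move=> eta t; exact: prefix0s.
- by move=> l t [l0 _] /ole_eqVlt[//|/olt0].
- by move=> e; exists id => m; split=> //; exact: prefix_mkseq.
Qed.

(** * Composition of resolutions *)

Section Composition.
Variables (xi1 xi2 : Ord) (rho1 rho2 : (nat -> bool) -> (nat -> bool)).
Variables (R1 R2 : Ord -> seq bool -> seq bool -> Prop) (P1 P2 : seq bool -> seq bool).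
Hypotheses (res1 : resolution xi1 rho1 R1 P1) (res2 : resolution xi2 rho2 R2 P2).

(** Up to rank xi1 truth is that of the first resolution. Rank xi1 + zeta also asks for zeta-truth
    between the images under P1, which are comparable because xi1-truth makes P1 monotone. *)
Definition Rcomp eta s t : Prop :=
  (forall zeta, ole zeta xi1 -> ole zeta eta -> R1 zeta s t) /\
  (forall zeta, ole zeta xi2 -> ole (oadd xi1 zeta) eta -> R2 zeta (P1 s) (P1 t)).

Lemma comp_path e n1 n2 : is_path (R1 xi1) P1 e (rho1 e) n1 ->
  is_path (R2 xi2) P2 (rho1 e) (rho2 (rho1 e)) n2 ->
  is_path (Rcomp (oadd xi1 xi2)) (P2 \o P1) e (rho2 (rho1 e)) (n1 \o n2).
Proof.
move=> p1 p2 m /=; have [E1 _] := p1 (n2 m); have [E1' _] := p1 (n2 m.+1).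
have [E2 H2] := p2 m; split; first by rewrite E1 E2.
have nn : n2 m <= n2 m.+1.
  have /size_prefix := res_prefix res2 (ole_refl _) H2.
  by rewrite !size_mkseq.
have H1 := path_mono res1 p1 nn.
split=> zeta z1 _; first exact: (res_dec res1 z1 (ole_refl _) H1).
by rewrite E1 E1'; exact: (res_dec res2 z1 (ole_refl _) H2).
Qed.

Lemma res_comp : resolution (oadd xi1 xi2) (rho2 \o rho1) Rcomp (P2 \o P1).
Proof.
split.
- move=> s t; split=> [[H _]|st]; first by apply/(res0 res1)/H; exact: ozero_le.
  split=> zeta z1 z0.
    have -> : zeta = ozero by apply: ole_anti => //; exact: ozero_le.
    exact/(res0 res1).
  have x0 : xi1 = ozero by apply: ole_anti (ozero_le _); exact: ole_trans (ole_addl _ _) z0.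
  have -> : zeta = ozero by apply: ole_anti (ozero_le _); exact: ole_trans (ole_addr _ _) z0.
  by apply/(res0 res2)/(res_P res1); rewrite x0; apply/(res0 res1).
- move=> zeta eta s t ze _ [H1 H2]; split=> z z1 z2; [apply: H1|apply: H2] => //; exact: ole_trans z2 ze.
- by move=> eta s; split=> z _ _; [exact: (res_refl res1)|exact: (res_refl res2)].
- move=> eta s t u [H1 H2] [H3 H4]; split=> z z1 z2.
    exact: (res_trans res1) (H1 _ z1 z2) (H3 _ z1 z2).
  exact: (res_trans res2) (H2 _ z1 z2) (H4 _ z1 z2).
- move=> eta s t u ex st [H1 H2] [H3 H4].
  have F zeta : ole zeta xi1 -> ole zeta (osucc eta) -> R1 zeta s t.
    move=> z1 /[dup] z2 /ole_eqVlt[zE|/olt_succ z3].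
      subst zeta; have e1 := olt_le_trans (osucc_gt eta) z1.
      by apply: (res_club res1) e1 st (H1 _ z1 z2) (H3 _ e1.1 (ole_refl _)).
    by apply: (res_club' res1) z1 st (H1 _ z1 z2) (H3 _ z1 z3).
  split=> // zeta z1 z2.
  have Pst : prefix (P1 s) (P1 t).
    by apply: (res_P res1); apply: F; [exact: ole_refl|exact: ole_trans (ole_addl _ _) z2].
  have G z : ole z xi2 -> ole (oadd xi1 z) eta -> R2 z (P1 s) (P1 t).
    move=> zx ze; apply: (res_club' res2) zx Pst (H2 _ zx _) (H4 _ zx ze).
    by apply: ole_trans ze _; case: (osucc_gt eta).
  move: (z2) => /ole_eqVlt[zE|/olt_succ]; last exact: G.
  case: (ord_cases zeta) => [->|[z zS]|zl]; first exact/(res0 res2).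
    subst zeta; move: zE; rewrite oaddS => /osucc_inj zE.
    have zx := olt_le_trans (osucc_gt z) z1.
    apply: (res_club res2) zx Pst (H2 _ z1 z2) (H4 _ zx.1 _).
    by rewrite zE; exact: ole_refl.
  apply: (res_lim res2) => // z zz; apply: G; first exact: ole_trans zz.1 z1.
  by apply/olt_succ; rewrite -zE; exact: oadd_lt2.
- move=> l s t ll lx H.
  have F zeta : ole zeta xi1 -> ole zeta l -> R1 zeta s t.
    move=> z1 /ole_eqVlt[zE|zl]; last by have [H1 _] := H _ zl; apply: H1 (ole_refl _).
    subst zeta; apply: (res_lim res1) => // eta el; have [H1 _] := H _ el.
    by apply: H1 (ole_refl _); exact: ole_trans el.1 z1.
  split=> // zeta z1 /[dup] z2 /ole_eqVlt[zE|zl]; last by have [_ H2] := H _ zl; apply: H2 (ole_refl _).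
  case: (ord_cases zeta) => [z0|[z zS]|zl].
  - subst zeta; apply/(res0 res2)/(res_P res1)/F; first exact: ole_refl.
    exact: ole_trans (ole_addl _ _) z2.
  - by subst zeta; case: ll => _ /(_ (oadd xi1 z)); rewrite -zE oaddS.
  - apply: (res_lim res2) => // z zz; have [_ H2] := H (oadd xi1 z) ltac:(by rewrite -zE; exact: oadd_lt2).
    by apply: H2 (ole_refl _); exact: ole_trans zz.1 z1.
- move=> eta t; split=> z _ _; first exact: (res_nil res1).
  by rewrite (res_Pnil res1); exact: (res_nil res2).
- move=> l t ll lx; have [l1|/oltNle l1] := pselect (ole l xi1).
    have [th thl H] := res_unif res1 t ll l1; exists th => // u [H1 _].
    have Rl : R1 l t u by apply/H/(H1 th _ (ole_refl _)); exact: ole_trans thl.1 l1.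
    split=> zeta z1 z2; first exact: (res_dec res1 z2 l1 Rl).
    have xl : l = xi1 by apply: ole_anti l1 _; exact: ole_trans (ole_addl _ _) z2.
    have -> : zeta = ozero.
      apply: ole_anti (ozero_le _); apply: (@oadd_le2E xi1).
      by rewrite oadd0 -{2}xl.
    by apply/(res0 res2)/(res_P res1); rewrite -xl.
  (* A limit beyond xi1 has the form xi1 + mu with mu a limit, so the bound comes from the second
     resolution at the image of t. *)
  have [mu lE] := ole_exists_add l1.1; subst l.
  have mx : ole mu xi2 := oadd_le2E lx.
  have ml : olimit mu.
    split=> [m0|y mS]; first by move: l1; rewrite m0 oadd0 => /olt_irr.
    by case: ll => _ /(_ (oadd xi1 y)); rewrite mS oaddS.
  have [th thl H] := res_unif res2 (P1 t) ml mx; exists (oadd xi1 th); first exact: oadd_lt2.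
  move=> u [H1 H2]; split=> zeta z1 z2.
    by apply: H1 => //; exact: ole_trans z1 (ole_addl _ _).
  apply: (res_dec res2 (oadd_le2E z2) mx); apply/H/H2; last exact: ole_refl.
  exact: ole_trans thl.1 mx.
- by move=> s t [_ H]; apply: (res_P res2); apply: H; exact: ole_refl.
- by move=> s; apply: leq_trans (res_size res2 _) (res_size res1 _).
- move=> e; have [n1 p1] := res_path res1 e; have [n2 p2] := res_path res2 (rho1 e).
  by exists (n1 \o n2); exact: comp_path.
Qed.

End Composition.

(** * Resolutions acting behind the first k letters *)

Section Shift.
Variables (k : nat) (xi : Ord) (rho : (nat -> bool) -> (nat -> bool)).
Variables (R : Ord -> seq bool -> seq bool -> Prop) (P : seq bool -> seq bool).
Hypothesis res : resolution xi rho R P.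

(** The first k letters are copied. Since [drop] forgets them, the prefix relation has to be
    required separately. *)
Definition Rshift eta s t : Prop := prefix s t /\ R eta (drop k s) (drop k t).
Definition Pshift s := take k s ++ P (drop k s).

Lemma mkseq_split e n : mkseq e (k + n) = mkseq e k ++ mkseq (fun j => e (j + k)) n.
Proof.
rewrite /mkseq iotaD map_cat add0n; congr cat.
rewrite -[X in iota X n]addn0 iotaDl -map_comp; apply: eq_map => i /=.
by rewrite addnC.
Qed.

Lemma shift_path e : exists2 n, (forall m, m <= k -> n m = m) &
  is_path (Rshift xi) Pshift e (rho_step k rho e) n.
Proof.
have [n' np] := res_path res (fun j => e (j + k)).
exists (fun m => if m <= k then m else k + n' (m - k)) => [m -> //|m].
have dr n : drop k (mkseq e (k + n)) = mkseq (fun j => e (j + k)) n.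
  by rewrite mkseq_split drop_size_cat ?size_mkseq.
have tk n : take k (mkseq e (k + n)) = mkseq e k.
  by rewrite mkseq_split take_size_cat ?size_mkseq.
have small m' : m' <= k -> drop k (mkseq e m') = [::] by move=> mk; rewrite drop_oversize ?size_mkseq.
have stepE m' : m' <= k -> mkseq (rho_step k rho e) m' = mkseq e m'.
  move=> mk; apply/eq_in_map => i; rewrite mem_iota add0n /= => im.
  by rewrite /rho_step (leq_trans im mk).
have mono a b : a <= b -> n' a <= n' b.
  move=> ab; have := path_mono res np ab => /(res_prefix res (ole_refl _))/size_prefix.
  by rewrite !size_mkseq.
split.
  case: ifP => [mk|/negbT]; first by rewrite /Pshift small // (res_Pnil res) cats0 take_oversize ?size_mkseq // stepE.
  rewrite -ltnNge => km; rewrite /Pshift dr tk.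
  have [-> _] := np (m - k); rewrite -{2}(subnKC (ltnW km)).
  rewrite mkseq_split stepE //; congr cat; apply: eq_mkseq => i.
  by rewrite /rho_step ltnNge leq_addl /= addnK.
case: (leqP m.+1 k) => [mk|km].
  rewrite (ltnW mk); split; first exact: prefix_mkseq.
  by rewrite small ?(ltnW mk) //; exact: (res_nil res).
case: (leqP m k) => [mk|km'].
  split; first by apply: prefix_mkseq; rewrite (leq_trans mk) // leq_addr.
  by rewrite small //; exact: (res_nil res).
split; first by apply: prefix_mkseq; rewrite leq_add2l; apply: mono; rewrite leq_sub2r.
by rewrite !dr subSn //; have [_] := np (m - k).
Qed.

Lemma res_shift : resolution xi (rho_step k rho) Rshift Pshift.
Proof.
split.
- move=> s t; split=> [[]//|st]; split=> //; apply/(res0 res); exact: prefix_drop.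
- by move=> z eta s t ze ex [st H]; split=> //; exact: (res_dec res ze ex H).
- by move=> eta s; split; [exact: prefix_refl|exact: (res_refl res)].
- move=> eta s t u [st H] [tu H']; split; first exact: prefix_trans st tu.
  exact: (res_trans res) H H'.
- move=> eta s t u ex st [su H] [tu H']; split=> //.
  by apply: (res_club res) ex _ H H'; exact: prefix_drop.
- move=> l s t ll lx H; have [st _] := H ozero (ozero_lt ll.1); split=> //.
  by apply: (res_lim res) => // eta /H[].
- by move=> eta t; split; [exact: prefix0s|exact: (res_nil res)].
- move=> l t ll lx; have [th thl H] := res_unif res (drop k t) ll lx.
  by exists th => // u [tu /H].
- move=> s t [st H]; rewrite /Pshift; case: (leqP (size s) k) => sk.
    rewrite drop_oversize // (res_Pnil res) cats0 take_oversize //.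
    apply: (prefix_trans (y := take k t)); last exact: prefix_prefix.
    by move: st; rewrite !prefixE take_takel.
  have -> : take k s = take k t.
    by move: st => /prefixP[r ->]; rewrite take_cat sk.
  by have /prefixP[r ->] := res_P res H; rewrite catA; exact: prefix_prefix.
- move=> s; rewrite /Pshift size_cat.
  by rewrite -{3}(cat_take_drop k s) size_cat leq_add2l; exact: (res_size res).
- by move=> e; have [n _ np] := shift_path e; exists n.
Qed.

End Shift.

(** * Resolutions at limit ranks *)

Section Limit.
Variables (l : Ord) (xs : nat -> Ord) (rhos : nat -> (nat -> bool) -> (nat -> bool)).
Variables (Rs : nat -> Ord -> seq bool -> seq bool -> Prop) (Ps : nat -> seq bool -> seq bool).
Hypothesis xsl : osum xs = l.
Hypothesis xs0 : forall k, olt ozero (xs k).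
Hypothesis ress : forall k, resolution (xs k) (rhos k) (Rs k) (Ps k).

Fixpoint PP k : seq bool -> seq bool := if k is j.+1 then Pshift j (Ps j) \o PP j else id.
Fixpoint RR k : Ord -> seq bool -> seq bool -> Prop :=
  if k is j.+1 then Rcomp (opsum xs j) (xs j) (RR j) (Rshift j (Rs j)) (PP j)
  else fun _ s t => prefix s t.

Lemma res_upto k : resolution (opsum xs k) (rho_upto rhos k) (RR k) (PP k).
Proof. by elim: k => [|k IH]; [exact: res_id|exact: res_comp IH (res_shift k (ress k))]. Qed.

(** Stage k knows only the ranks up to the partial sum [opsum xs k]; all stages are imposed at
    once. *)
Definition Rlim eta s t : Prop := forall k zeta, ole zeta (opsum xs k) -> ole zeta eta -> RR k zeta s t.
(** The map added after stage k fixes words of length at most k, so applying [size s] of the maps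
    amounts to applying all of them. *)
Definition Plim s := PP (size s) s.

Lemma opsum_le k : ole (opsum xs k) l.
Proof. by rewrite -xsl; exact: osup_ub. Qed.

Lemma PP_stable k s : size s <= k -> PP k s = Plim s.
Proof.
move=> /subnK <-; elim: (k - size s) => // n IH; rewrite addSn /= IH.
have sP : size (Plim s) <= n + size s.
  by apply: leq_trans (res_size (res_upto _) _) (leq_addl _ _).
by rewrite /Pshift drop_oversize // (res_Pnil (ress _)) cats0 take_oversize.
Qed.

Lemma rho_upto_stable e k i : i < k -> rho_upto rhos k e i = rho_limit rhos e i.
Proof.
move=> /subnK <-; elim: (k - i.+1) => // n IH; rewrite addSn /= /rho_step.
by rewrite leq_addl IH.
Qed.

Lemma RR_down k j zeta s t : j <= k -> ole zeta (opsum xs j) -> RR k zeta s t -> RR j zeta s t.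
Proof.
move=> /subnK <-; elim: (k - j) => // n IH zj /= [H _]; apply: IH => //.
apply: H (ole_refl _); apply: ole_trans zj _.
elim: n => [|n IH]; first exact: ole_refl.
by apply: ole_trans IH (ole_addl _ _).
Qed.

Lemma opsum_mono j k : j <= k -> ole (opsum xs j) (opsum xs k).
Proof.
move=> /subnK <-; elim: (k - j) => [|n IH]; first exact: ole_refl.
exact: ole_trans IH (ole_addl _ _).
Qed.

Lemma RR_up j k zeta s t : j <= k -> ole zeta (opsum xs j) -> RR j zeta s t -> RR k zeta s t.
Proof.
move=> /subnK <-; elim: (k - j) => // n IH zj H; rewrite addSn /=; have {IH}H := IH zj H.
have zn : ole zeta (opsum xs (n + j)) by apply: ole_trans zj (opsum_mono (leq_addl _ _)).
split=> z z1 z2; first exact: (res_dec (res_upto _) z2 zn H).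
have zE : zeta = opsum xs (n + j) by apply: ole_anti zn _; exact: ole_trans (ole_addl _ _) z2.
have -> : z = ozero.
  by apply: ole_anti (ozero_le _); apply: (@oadd_le2E (opsum xs (n + j))); rewrite oadd0 -{2}zE.
by apply/(res0 (res_shift _ (ress _)))/(res_P (res_upto _)); rewrite -zE.
Qed.

(* From stage size s on, s contributes no further letter to be checked. *)
Lemma RR_size k s t : size s <= k -> RR (size s) (opsum xs (size s)) s t -> RR k (opsum xs k) s t.
Proof.
move=> /subnK <-; elim: (k - size s) => // n IH H; rewrite addSn /=; have {IH}H := IH H.
split=> z z1 z2; first exact: (res_dec (res_upto _) z1 (ole_refl _) H).
have Pst := res_P (res_upto _) H; split=> //.
rewrite (drop_oversize (leq_trans (res_size (res_upto _) s) (leq_addl _ _))).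
exact: (res_nil (ress _)).
Qed.

Lemma lim_path e : exists n, is_path (Rlim l) Plim e (rho_limit rhos e) n.
Proof.
have /choice[n nP] : forall k, exists n, (forall m, m <= k -> n m = m) /\
    is_path (Rshift k (Rs k) (xs k)) (Pshift k (Ps k)) (rho_upto rhos k e)
      (rho_upto rhos k.+1 e) n.
  by move=> k; have [n n1 n2] := shift_path k (ress k) (rho_upto rhos k e); exists n.
pose N := fix N k := if k is j.+1 then N j \o n j else id.
have NP k : is_path (RR k (opsum xs k)) (PP k) e (rho_upto rhos k e) (N k).
  elim: k => [|k IH]; first by move=> m; split=> //; exact: (prefix_mkseq e (leqnSn m)).
  exact: (comp_path (res_upto k) (res_shift k (ress k)) IH (nP k).2).
(* The index map of stage k fixes all m <= k, so the composed index maps stabilize and the diagonal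
   is a path for all stages. *)
have NS k m : m <= k -> N k m = N m m.
  move=> /subnK <-; elim: (k - m) => // j IH; rewrite addSn /= (nP _).1 ?leq_addl //.
exists (fun m => N m m) => m; split.
  pose k := maxn (N m m) m; rewrite -(@PP_stable k) ?size_mkseq ?leq_maxl //.
  rewrite -(NS k) ?leq_maxr //; have [-> _] := NP k m.
  apply/eq_in_map => i; rewrite mem_iota add0n /= => im; apply: rho_upto_stable.
  by rewrite (leq_trans im) // leq_maxr.
move=> k zeta zk zl.
have H j : m < j -> RR j (opsum xs j) (mkseq e (N m m)) (mkseq e (N m.+1 m.+1)).
  by move=> mj; rewrite -(NS j m.+1) // -(NS j m) ?(ltnW mj) //; have [_] := NP j m.
have [mk|km] := ltnP m k; first by apply: (res_dec (res_upto k) zk (ole_refl _)); exact: H.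
apply: (@RR_down m.+1) => //; first exact: leqW.
apply: (res_dec (res_upto m.+1) _ (ole_refl _)); last exact: H.
move: zk km => zk /subnK <-; elim: (m - k) => [|j IH].
  exact: ole_trans zk (ole_addl _ _).
by apply: ole_trans IH (ole_addl _ _).
Qed.

Lemma res_limit : resolution l (rho_limit rhos) Rlim Plim.
Proof.
split.
- move=> s t; split=> [H|st k zeta _ z0].
    by apply/(res0 (res_upto 0)); apply: (H 0 ozero); exact: ole_refl.
  have -> : zeta = ozero by apply: ole_anti => //; exact: ozero_le.
  exact/(res0 (res_upto k)).
- by move=> z eta s t ze _ H k zeta zk zz; apply: H => //; exact: ole_trans zz ze.
- by move=> eta s k zeta _ _; exact: (res_refl (res_upto k)).
- by move=> eta s t u H H' k zeta zk ze; exact: (res_trans (res_upto k)) (H _ _ zk ze) (H' _ _ zk ze).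
- move=> eta s t u el st H H' k zeta zk /[dup] ze /ole_eqVlt[zE|/olt_succ z3].
    subst zeta; have ek := olt_le_trans (osucc_gt eta) zk.
    exact: (res_club (res_upto k)) ek st (H _ _ zk ze) (H' _ _ ek.1 (ole_refl _)).
  exact: (res_club' (res_upto k)) zk st (H _ _ zk ze) (H' _ _ zk z3).
- move=> l' s t l'l l'x H k zeta zk /ole_eqVlt[zE|zl]; last exact: H _ zl _ _ zk (ole_refl _).
  subst zeta; apply: (res_lim (res_upto k)) => // eta el.
  by apply: (H eta el _ _ _ (ole_refl _)); exact: ole_trans el.1 zk.
- by move=> eta t k zeta _ _; exact: (res_nil (res_upto k)).
- move=> l' t l'l /ole_eqVlt[lE|ll]; last first.
    have [k lk] : exists k, ole l' (opsum xs k).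
      apply: contrapT => nk; move/oltNle: ll; apply; rewrite -xsl; apply: osup_least => k.
      by have [|/oltNle []] := pselect (ole (opsum xs k) l'); last by apply: contrapT => h; apply: nk; exists k; have [//|] := ole_total l' (opsum xs k).
    have [th thl H] := res_unif (res_upto k) t l'l lk; exists th => // u Hu.
    have Rk : RR k l' t u by apply/H/Hu; [exact: ole_trans thl.1 lk|exact: ole_refl].
    move=> j zeta zj zl; have {}Rk := res_dec (res_upto k) zl lk Rk.
    have zk := ole_trans zl lk.
    have [jk|/ltnW kj] := leqP j k; first exact: RR_down jk zj Rk.
    by apply: RR_up Rk.
  (* At rank l itself the rank reached at stage [size t] is enough: later stages find no letter of t
     left to test. *)
  subst l'; exists (opsum xs (size t)).
    apply: (olt_le_trans _ (opsum_le (size t).+1)) => /=.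
    by rewrite -{1}(oadd0 (opsum xs (size t))); exact: oadd_lt2.
  move=> u Hu j zeta zj zl; have {}Hu := Hu (size t) _ (ole_refl _) (ole_refl _).
  have [jt|/ltnW tj] := leqP j (size t).
    apply: (RR_down jt zj); apply: (res_dec (res_upto _) _ (ole_refl _) Hu).
    exact: ole_trans zj (opsum_mono jt).
  exact: (res_dec (res_upto _) zj (ole_refl _) (RR_size tj Hu)).
- move=> s t H; pose k := maxn (size s) (size t).
  rewrite -(@PP_stable k s) ?leq_maxl // -(@PP_stable k t) ?leq_maxr //.
  by apply: (res_P (res_upto k)); apply: H; [exact: ole_refl|exact: opsum_le].
- by move=> s; exact: (res_size (res_upto _)).
- exact: lim_path.
Qed.

End Limit.

(** * The resolution of rank one *)

Section Base.

Definition colhit e (k n : nat) : bool := has (fun j => (phi0 j == k) && e j) (iota 0 n).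
Arguments colhit : simpl never.

Lemma colhitP e k n : reflect (exists2 j, j < n & phi0 j = k /\ e j) (colhit e k n).
Proof.
apply: (iffP hasP) => [[j]|[j jn [jk ej]]].
  by rewrite mem_iota => jn /andP[/eqP jk ej]; exists j.
by exists j; rewrite ?mem_iota // jk eqxx.
Qed.

(** Successive guesses of [rho0 e]. Letter k is true while column k looks empty. A hit in a column
    guessed empty cuts the word there and corrects the letter; otherwise one letter is appended
    according to the hits seen so far. *)
Fixpoint P0n e (n : nat) : seq bool :=
  if n is m.+1 then
    let p := P0n e m in
    if [&& e m, phi0 m < size p & nth false p (phi0 m)]
    then rcons (take (phi0 m) p) false else rcons p (~~ colhit e (size p) m.+1)
  else [::].

(** Corrections only turn true into false at the first difference, so an abandoned guess never
    returns. The club condition of rank one rests on this. *)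
Definition lexlt p q : Prop := exists i,
  [/\ i < size p, i < size q, take i p = take i q, nth false p i & ~~ nth false q i].

Lemma lexlt_prefix p q : lexlt p q -> ~ prefix p q.
Proof. by move=> [i [ip iq _ pi qi]] /prefix_nth/(_ ip); rewrite pi => H; rewrite -H in qi. Qed.

Lemma P0n_step e p n :
  (lexlt p (P0n e n) -> lexlt p (P0n e n.+1)) /\
  (prefix p (P0n e n) -> prefix p (P0n e n.+1) \/ lexlt p (P0n e n.+1)).
Proof.
set q := P0n e n; rewrite /= -/q; set j := phi0 n.
case: ifP => [/and3P[_ jq qj]|_]; last first.
  split=> [[i [ip iq pq pi qi]]|pq].
    by exists i; split=> //; [rewrite size_rcons ltnW|rewrite -cats1 takel_cat // ltnW|rewrite nth_rcons iq].
  by left; apply: prefix_trans pq _; exact: prefix_rcons.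
have sj : size (take j q) = j by rewrite size_takel // ltnW.
split=> [[i [ip iq pq pi qi]]|pq].
  case: (ltngtP i j) => ij.
  - exists i; rewrite size_rcons sj nth_rcons sj ij nth_take // -cats1 takel_cat ?sj ?(ltnW ij) //.
    by split=> //; [rewrite ltnS ltnW|rewrite take_takel // ltnW].
  - exists j; rewrite size_rcons sj nth_rcons sj ltnn eqxx ltnSn (ltn_trans ij ip).
    have pj : take j p = take j q by rewrite -(take_takel p (ltnW ij)) pq take_takel // ltnW.
    rewrite -cats1 takel_cat ?sj // (take_takel _ (leqnn j)) // pj.
    by split=> //; rewrite -(nth_take _ ij) pq nth_take.
  - by rewrite ij qj in qi.
case: (ltnP j (size p)) => jp; [right|left].
  exists j; rewrite size_rcons sj nth_rcons sj ltnn eqxx ltnSn jp (prefix_nth pq jp).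
  rewrite -cats1 takel_cat ?sj // (take_takel _ (leqnn j)) //; split=> //.
  by move/prefixP: pq => [r ->]; rewrite takel_cat // ltnW.
apply: (prefix_trans (y := take j q)); last exact: prefix_rcons.
by move: pq; rewrite !prefixE take_takel.
Qed.

Lemma P0n_lex e p n m : lexlt p (P0n e n) -> lexlt p (P0n e (m + n)).
Proof. by elim: m => // m IH /IH; rewrite addSn; have [H _] := P0n_step e p (m + n). Qed.

Lemma P0n_dich e n m : prefix (P0n e n) (P0n e (m + n)) \/ lexlt (P0n e n) (P0n e (m + n)).
Proof.
elim: m => [|m [IH|IH]]; first by left; exact: prefix_refl.
  by rewrite addSn; have [_] := P0n_step e (P0n e n) (m + n); apply.
by right; rewrite addSn; have [H _] := P0n_step e (P0n e n) (m + n); exact: H.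
Qed.

Lemma P0n_club e n n' n'' : n <= n' -> n' <= n'' -> prefix (P0n e n) (P0n e n'') ->
  prefix (P0n e n) (P0n e n').
Proof.
move=> /subnK <- /subnK <-; case: (P0n_dich e n (n' - n)) => // /(@P0n_lex _ _ _ (n'' - (n' - n + n))).
by move=> /lexlt_prefix.
Qed.

Lemma P0n_ext e e' n : (forall i, i < n -> e i = e' i) -> P0n e n = P0n e' n.
Proof.
elim: n => // n IH ee /=; rewrite -IH ?ee // => [|i il]; last by apply: ee; rewrite ltnW.
suff -> : colhit e (size (P0n e n)) n.+1 = colhit e' (size (P0n e n)) n.+1 by [].
by apply/colhitP/colhitP => -[j jn [jk ej]]; exists j => //; split=> //; rewrite ?ee // -ee.
Qed.

Lemma P0n_size e n : size (P0n e n) <= n.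
Proof.
elim: n => // n IH /=; case: ifP => _; rewrite size_rcons ltnS //.
by rewrite size_take; case: ifP => // /ltnW H; apply: leq_trans H IH.
Qed.

Definition P0 s := P0n (nth false s) (size s).

Lemma P0_mkseq e n : P0 (mkseq e n) = P0n e n.
Proof. by rewrite /P0 size_mkseq; apply: P0n_ext => i il; rewrite nth_mkseq. Qed.

Lemma P0_prefix s t : prefix s t -> P0 s = P0n (nth false t) (size s).
Proof. by move=> st; apply: P0n_ext => i /(prefix_nth st). Qed.

Definition R0 eta s t : Prop := prefix s t /\ (eta = ozero \/ prefix (P0 s) (P0 t)).

(** A correct guess is never cut ([stay]), and after it a correct guess with one more letter appears
    ([next]); choice strings these stages together. *)
Lemma path0 e : exists n, is_path (R0 oone) P0 e (rho0 e) n.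
Proof.
pose good m n := P0n e n = mkseq (rho0 e) m /\ forall n', n <= n' -> prefix (mkseq (rho0 e) m) (P0n e n').
have zero k n : k < size (P0n e n) -> ~~ nth false (P0n e n) k -> exists2 j, j < n & phi0 j = k /\ e j.
  elim: n => // n IH /=; case: ifP => [/and3P[en jq qj]|nh]; rewrite size_rcons nth_rcons.
    rewrite size_takel; last exact: ltnW.
    rewrite ltnS leq_eqVlt => /orP[/eqP ->|kj]; first by exists n.
    rewrite kj nth_take // => nk; have [j jn jE] := IH (ltn_trans kj jq) nk.
    by exists j => //; exact: ltnW.
  rewrite ltnS leq_eqVlt => /orP[/eqP ->|kp].
    by rewrite ltnn eqxx negbK => /colhitP.
  by rewrite kp => /(IH kp)[j jn jE]; exists j => //; exact: ltnW.
have one k n : k < size (P0n e n) -> nth false (P0n e n) k -> forall j, j < n -> phi0 j = k -> ~~ e j.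
  elim: n => // n IH /=; case: ifP => [/and3P[en jq qj]|nh]; rewrite size_rcons nth_rcons.
    rewrite size_takel; last exact: ltnW.
    rewrite ltnS leq_eqVlt => /orP[/eqP ->|kj]; first by rewrite ltnn eqxx.
    rewrite kj nth_take // => nk j; rewrite ltnS leq_eqVlt => /orP[/eqP ->|jn] jE.
      by rewrite jE ltnn in kj.
    exact: (IH (ltn_trans kj jq) nk).
  rewrite ltnS leq_eqVlt => /orP[/eqP ->|kp].
    rewrite ltnn eqxx => /colhitP H j jn jE; apply/negP => ej; apply: H.
    by exists j.
  rewrite kp => nk j; rewrite ltnS leq_eqVlt => /orP[/eqP ->|jn] jE; last exact: (IH kp nk).
  by move: nh; rewrite jE kp nk /= andbT => /negbT.
have stay m n : P0n e n = mkseq (rho0 e) m -> good m n.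
  move=> E; split=> // n' nn'; elim: n' nn' => [|n' IH]; first by rewrite leqn0 => /eqP <-; rewrite -E prefix_refl.
  rewrite leq_eqVlt => /orP[/eqP <-|]; first by rewrite -E prefix_refl.
  rewrite ltnS => /IH pre /=; case: ifP => [/and3P[en jq qj]|nh]; last by apply: prefix_trans pre (prefix_rcons _ _).
  case: (leqP m (phi0 n')) => mj.
    apply: (prefix_trans (y := take (phi0 n') (P0n e n'))); last exact: prefix_rcons.
    by move: pre; rewrite !prefixE size_mkseq take_takel.
  have := prefix_nth pre; rewrite size_mkseq => /(_ _ mj); rewrite nth_mkseq // qj.
  by move=> /asboolP/(_ (phi1 n')); rewrite phiK en.
have next m n : good m n -> exists2 n', n < n' & good m.+1 n'.
  move=> [E st].
  have pre := st n.+1 (leqnSn n).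
  have E1 : exists b, P0n e n.+1 = rcons (mkseq (rho0 e) m) b.
    move: pre; rewrite /= E; case: ifP => [/and3P[_ jq qj]|_]; last by eexists.
    move=> /prefix_nth/(_ jq); rewrite qj nth_rcons size_takel; last exact: ltnW.
    by rewrite ltnn eqxx.
  have mkS : mkseq (rho0 e) m.+1 = rcons (mkseq (rho0 e) m) (rho0 e m) by rewrite mkseqS.
  case: E1 => b E1; have [bE|bN] := eqVneq b (rho0 e m).
    by exists n.+1 => //; apply: stay; rewrite E1 mkS bE.
  have sz : m < size (P0n e n.+1) by rewrite E1 size_rcons size_mkseq.
  have nb : nth false (P0n e n.+1) m = b by rewrite E1 nth_rcons size_mkseq ltnn eqxx.
  case: b bN E1 nb => bN E1 nb; last first.
    have [j jn [jE ej]] := zero _ _ sz (negbT nb).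
    move: bN; rewrite eq_sym => /negP bN; exfalso; apply: bN; apply/eqP; apply/negbTE/negP => /asboolP/(_ (phi1 j)).
    by rewrite -jE phiK ej.
  have rm : rho0 e m = false by case: (rho0 e m) bN.
  have [j0 ej0] : exists j, e (pairN m j).
    apply: contrapT => H; move: rm; suff -> : rho0 e m = true by [].
    by apply/asboolP => j; apply/negbTE/negP => ej; apply: H; exists j.
  (* Letter m was guessed true although column m has a hit. The first m + 1 letters survive until
     the least hit j, which cuts the word to m letters and appends false. *)
  pose A j := (phi0 j == m) && e j.
  have exA : exists j, A j by exists (pairN m j0); rewrite /A pairNK eqxx.
  have [j /andP[/eqP jm ej] jmin] := ex_minnP exA.
  have nj : n < j.
    by rewrite ltnNge; apply/negP => jn; have := one _ _ sz nb j jn jm; rewrite ej.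
  have ext k : n + k.+1 <= j -> prefix (rcons (mkseq (rho0 e) m) true) (P0n e (n + k.+1)).
    elim: k => [|k IH] kj; first by rewrite addn1 E1 prefix_refl.
    have {}IH := IH ltac:(by rewrite addnS in kj; exact: ltnW).
    rewrite addnS /=; case: ifP => [/and3P[en jq qj]|nh]; last by apply: prefix_trans IH (prefix_rcons _ _).
    case: (ltngtP (phi0 (n + k.+1)) m) => mj.
    - have := prefix_nth IH; rewrite size_rcons size_mkseq => /(_ _ (ltnW mj)).
      rewrite nth_rcons size_mkseq mj nth_mkseq // qj => /asboolP/(_ (phi1 (n + k.+1))).
      by rewrite phiK en.
    - apply: (prefix_trans (y := take (phi0 (n + k.+1)) (P0n e (n + k.+1)))); last exact: prefix_rcons.
      by move: IH; rewrite !prefixE size_rcons size_mkseq take_takel.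
    - have := jmin (n + k.+1); rewrite /A mj eqxx en => /(_ isT); lia.
  have := ext (j - n.+1); rewrite (_ : n + (j - n.+1).+1 = j); last by lia.
  move=> /(_ (leqnn _)) pj; exists j.+1; first exact: ltnW.
  apply: stay; rewrite /= ej jm; have /[dup] := prefix_nth pj; rewrite size_rcons size_mkseq => /(_ _ (ltnSn m)).
  rewrite nth_rcons size_mkseq ltnn eqxx => <- _.
  have := size_prefix pj; rewrite size_rcons size_mkseq => -> /=.
  rewrite mkS rm; congr rcons; move: pj => /prefixP[r ->].
  by rewrite -cats1 -catA take_size_cat ?size_mkseq.
have /choice[f fP] : forall w : nat * nat, exists n, good w.1 w.2 -> w.2 < n /\ good w.1.+1 n.
  by move=> [m n]; have [/next[n' ? ?]|] := pselect (good m n); [exists n'|exists 0].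
pose N := fix N m := if m is k.+1 then f (k, N k) else 0.
have NP m : good m (N m).
  by elim: m => [|m IH]; [apply: stay|have [] := fP (m, N m) IH].
exists N => m; rewrite !P0_mkseq; split; first by case: (NP m).
have lt : N m < N m.+1 by have [] := fP (m, N m) (NP m).
split; first by apply: prefix_mkseq; exact: ltnW.
right; rewrite !P0_mkseq; have [-> st] := NP m; exact: st (ltnW lt).
Qed.

Lemma res_rho0 : resolution oone rho0 R0 P0.
Proof.
have one0 : oone <> ozero by move=> E; have := one_gt0; rewrite E => /olt_irr.
split.
- by move=> s t; split=> [[]//|st]; split=> //; left.
- move=> z eta s t ze ex [st H]; split=> //; have [z0|z0] := pselect (z = ozero); [by left|right].
  case: H => // e0; case: z0; apply: ole_anti (ozero_le _); by rewrite -e0.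
- by move=> eta s; split; [exact: prefix_refl|right; exact: prefix_refl].
- move=> eta s t u [st H] [tu H']; split; first exact: prefix_trans st tu.
  case: H => [|H]; [by left|]; case: H' => [|H']; [by left|right].
  exact: prefix_trans H H'.
- move=> eta s t u _ st [su H] [tu _]; split=> //; right.
  case: H => [E|]; first by have := ozero_le eta; have /oltNle := osucc_gt eta; rewrite E.
  rewrite (P0_prefix su) (P0_prefix tu) /P0; exact: P0n_club (size_prefix st) (size_prefix tu).
- by move=> l s t [l0 lS] /ole_eqVlt[l1|/olt_succ l1]; [case: (lS ozero)|case: l0; apply: ole_anti l1 (ozero_le _)].
- by move=> eta t; split; [exact: prefix0s|right; exact: prefix0s].
- by move=> l t [l0 lS] /ole_eqVlt[l1|/olt_succ l1]; [case: (lS ozero)|case: l0; apply: ole_anti l1 (ozero_le _)].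
- by move=> s t [_ []].
- by move=> s; exact: P0n_size.
- exact: path0.
Qed.

End Base.

Theorem resolution_ex (fs : Ord -> nat -> Ord) : limit_choice fs ->
  forall xi, exists R P, resolution xi (rho fs xi) R P.
Proof.
move=> hfs; elim/olt_ind => xi IH.
case: (ord_cases xi) => [->|[eta E]|xl].
- by rewrite rho_zero; do 2!eexists; exact: res_id.
- have [|R [P H]] := IH eta; first by rewrite E; exact: osucc_gt.
  rewrite E rho_succ (_ : osucc eta = oadd eta oone); last by rewrite /oone oaddS oadd0.
  by do 2!eexists; exact: (res_comp H res_rho0).
rewrite rho_lim //; have [xk xs] := hfs _ xl.
have /choice[RP RPs] : forall k, exists RP, resolution (fs xi k) (rho fs (fs xi k)) RP.1 RP.2.
  by move=> k; have [R [P H]] := IH (fs xi k) (xk k).2; exists (R, P).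
do 2!eexists.
refine (@res_limit xi (fs xi) _ (fun k => (RP k).1) (fun k => (RP k).2) xs (fun k => (xk k).1) RPs).
Qed.

End Resolutions.


(** * Extending a branch of labels *)

Lemma Sg_semi (E : espace) (F : set (E * (nat -> nat))) : semi (@es_nb E) (~` F) -> Sg (eprod E ebaire) F.
Proof.
move=> [Q sQ QP]; apply/SgP.
have H := S11_pi (sig_ex (sig_subst (f := fun x => phi1 x)
  (sig_and (sig_row 0 (nm_nb_sig (es_nu E))) (sig_row 1 sQ)) ltac:(by rc))).
apply: S11_ext (S11_and (nm_dom (es_nu (eprod E ebaire))) H) => a x.
split=> [[[[z b] [/= az bE]] nQ]|[[z b] [/= [az bE] bz]]].
  exists (z, b); split=> //=; apply: contrapT => /(QP z b)[u [Nu Qu]]; apply: nQ.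
  by exists u; rewrite pairNK /= bE; split=> //; apply/(nm_nbP u az).
split; first by exists (z, b).
move=> -[u]; rewrite pairNK /= bE => -[Nu Qu].
by have /(_ bz) : ~ F (z, b) by apply/(QP z b); exists u; split=> //; apply/(nm_nbP u az).
Qed.

(** F w consists of the points with a witness extending w. The last clause is the closedness of the
    matrix: if the sets along a real a have points in every neighbourhood of z, then a is a witness
    for z. *)
Lemma slices (E : espace) (S : set E) : Sg E S -> exists F : seq nat -> set E,
  [/\ forall z, F [::] z <-> S z, forall w, Sg E (F w),
      forall w z, F w z -> exists i, F (rcons w i) z,
      forall w w' z, prefix w w' -> F w' z -> F w z
    & forall a z, (forall n u, es_nb u z -> exists2 z', es_nb u z' & F (mkseq a n) z') -> S z].
Proof.
move=> [Fc /semiP sF FP].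
have sFc := Sg_semi sF; have [Q' [p cp pP] QP] := sF.
exists (fun w z => exists b : nat -> nat, Fc (z, b) /\ mkseq b (size w) = w); split.
- by move=> z; rewrite FP; split=> -[b]; [case|] => Fb; exists b.
- move=> w; apply: (@Sg_exp E ebaire); apply: Sg_and.
    by refine (@Sg_pre _ (eprod E ebaire) (fun p : eprod E ebaire => (p.1, p.2)) _ _ sFc); ef.
  have sw : Sg ebaire (fun b : ebaire => mkseq b (size w) = w).
    apply/SgP; set s := pairN (size w) (foldr pairN 0 w).
    have cs : comp (fun _ : nat => s) by rc.
    apply: S11_ext (S11_nb cs) => a x; rewrite /hat /= /s.
    split=> [H|[_ [<- aw]] i]; last first.
      by rewrite pairNK /= => il; rewrite -[RHS]/(get _ i) get_foldr -aw nth_mkseq // -aw size_mkseq.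
    exists a; split=> //; apply: (@eq_from_nth _ 0); rewrite size_mkseq // => i il.
    by rewrite nth_mkseq // H ?pairNK //= -/(get _ i) get_foldr.
  by refine (@Sg_pre _ ebaire (fun p : eprod E ebaire => p.2) _ _ sw); ef.
- move=> w z [b [Fb bw]]; exists (b (size w)), b; split=> //.
  by rewrite size_rcons mkseqS bw.
- move=> w w' z /prefixP[r ->] [b [Fb bw]]; exists b; split=> //.
  move: bw => /(congr1 (take (size w))); rewrite take_size_cat // size_cat /mkseq -map_take take_iota.
  by rewrite (minn_idPl (leq_addr _ _)).
- move=> a z H; apply/FP; exists a; apply: contrapT => /(QP z a)[u [Nu /pP[s [n [sa pn]]]]].
  have [z' Nz' [b [Fb bw]]] := H (phi0 s) u Nu.
  have /(_ Fb) // : ~ Fc (z', b); apply/(QP z' b); exists u; split=> //.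
  apply/pP; exists s, n; split=> // i il; rewrite -[RHS]/(get _ i) (get_nb sa il).
  by move: bw; rewrite size_mkseq => /(congr1 (fun l => nth 0 l i)); rewrite !nth_mkseq.
Qed.

(** * Density of closures and the label of a new edge *)

Section Chain.
Context (X Y : espace).
Local Notation Z := (eprod X Y).
Context (W : set enat) (C : set (eprod enat Z)).
Hypothesis WC : coding W C.
Variable xi : Ord.
Hypothesis hxi : below_omega1CK xi.
Local Notation cl zeta := (cl W C (oadd oone zeta)).

(** The complement gains only the strips over the complements of P and Q. These are rectangles,
    hence of level 0, which lies below every 1 + zeta. *)
Lemma lev_meet_rect zeta n (P : set X) (Q : set Y) : lev W C (oadd oone zeta) n ->
  Sg X P -> Pg X P -> Sg Y Q -> Pg Y Q ->
  exists n', lev W C (oadd oone zeta) n' /\ forall z, C (n', z) <-> [/\ C (n, z), P z.1 & Q z.2].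
Proof.
move=> ln sP pP sQ pQ; have Wn := lev_W ln; have [_ _ _ WD surj] := WC.
have [sCn pCn] := WD _ Wn.
have preX (S : set X) : Sg X S -> Sg Z (fun z => S z.1).
  by move=> sS; refine (@Sg_pre _ X (fun p : eprod X Y => p.1) _ _ sS); ef.
have preY (S : set Y) : Sg Y S -> Sg Z (fun z => S z.2).
  by move=> sS; refine (@Sg_pre _ Y (fun p : eprod X Y => p.2) _ _ sS); ef.
have [||n' [Wn' n'P]] := surj (fun z => C (n, z) /\ (P z.1 /\ Q z.2)).
- by apply: Sg_and => //; apply: Sg_and; [exact: preX|exact: preY].
- by apply: Pg_and => //; apply: Pg_and; [exact: (preX _ pP)|exact: (preY _ pQ)].
exists n'; split; last by move=> z; rewrite n'P; split=> [[? []]|[]].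
rewrite levS; last exact: one_add_gt0.
split=> // z; have [|nC] := pselect (C (n', z)); [by left|right].
have disj m : (forall z', C (n', z') -> W m /\ ~ C (m, z')) -> Cdisj W C m n'.
  by move=> H z'; have [/H|] := pselect (C (n', z')); [left|right].
have [Cn|nCn] := pselect (C (n, z)); last first.
  move: ln; rewrite levS; last exact: one_add_gt0.
  case=> _ /(_ z)[//|[m [bm [Cm dm]]]]; exists m; split=> //; split=> //.
  apply: disj => z' /n'P[Cn _]; by case: (dm z') => // -[].
have rect (S : set Z) : Sg Z S -> Pg Z S -> S z -> (forall z', S z' -> ~ (P z'.1 /\ Q z'.2)) ->
    (forall x y x' y', S (x, y') -> S (x', y) -> S (x, y)) ->
    exists m, levlt W C (oadd oone zeta) m /\ C (m, z) /\ Cdisj W C m n'.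
  move=> sS pS Sz SPQ Sr; have [m [Wm mP]] := surj S sS pS.
  exists m; split; last first.
    split; first exact/mP.
    by apply: disj => z' /n'P[_ pq]; split=> // /mP/SPQ; apply.
  exists ozero; first exact: one_add_gt0.
  by rewrite lev0; split=> // x y x' y' /mP h1 /mP h2; apply/mP; exact: Sr h1 h2.
have [Pz|nPz] := pselect (P z.1); last first.
  apply: (rect (fun z => ~ P z.1)) => //; first exact: (preX _ pP).
  - by rewrite /Pg; apply: Sg_ext (preX _ sP) => z'; rewrite /setC /=; split=> [s /(_ s)|/contrapT].
  - by move=> z' nP [].
have nQz : ~ Q z.2 by move=> Qz; apply: nC; apply/n'P.
apply: (rect (fun z => ~ Q z.2)) => //; first exact: (preY _ pQ).
- by rewrite /Pg; apply: Sg_ext (preY _ sQ) => z'; rewrite /setC /=; split=> [s /(_ s)|/contrapT].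
- by move=> z' nQ [].
Qed.

Variables (P : set X) (Q : set Y).
Hypotheses (sP : Sg X P) (sQ : Sg Y Q).
Definition rectPQ : set Z := fun z => P z.1 /\ Q z.2.

Lemma Sg_rectPQ : Sg Z rectPQ.
Proof.
apply: Sg_and; first by refine (@Sg_pre _ X (fun p : eprod X Y => p.1) _ _ sP); ef.
by refine (@Sg_pre _ Y (fun p : eprod X Y => p.2) _ _ sQ); ef.
Qed.

(** If A missed the rectangle, a Delta^1_1 rectangle around it would still miss A, and it is a
    level-0 neighbourhood of the points of V. *)
Lemma cl_meet0 eta (V A : set Z) : Sg Z A -> V !=set0 -> V `<=` rectPQ ->
  V `<=` cl eta A -> exists z, A z /\ rectPQ z.
Proof.
move=> sA [[vx vy] Vv] VPQ VA; apply: contrapT => ne.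
have [|P' [Q' [[sP' pP'] [sQ' pQ'] PP' QQ' nA]]] := Sg_rect_separation sP sQ sA.
  by move=> x y Px Qy Axy; apply: ne; exists (x, y).
have [_ _ _ _ surj] := WC.
have [||n [Wn nP]] := surj (fun z => P' z.1 /\ Q' z.2).
- apply: Sg_and; first by refine (@Sg_pre _ X (fun p : eprod X Y => p.1) _ _ sP'); ef.
  by refine (@Sg_pre _ Y (fun p : eprod X Y => p.2) _ _ sQ'); ef.
- apply: Pg_and; first by refine (@Pg_pre _ X (fun p : eprod X Y => p.1) _ _ pP'); ef.
  by refine (@Pg_pre _ Y (fun p : eprod X Y => p.2) _ _ pQ'); ef.
have [] := VA _ Vv n.
- exists ozero; first exact: one_add_gt0.
  by rewrite lev0; split=> // x y x' y' /nP[/= P'x _] /nP[/= _ Q'y]; apply/nP.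
- by have [/= Px Qy] := VPQ _ Vv; apply/nP; split=> /=; [apply: PP'|apply: QQ'].
by move=> [x y] [/nP[/= P'x Q'y]]; exact: nA.
Qed.

(** Otherwise a set of level 1 + zeta separates V from the part of A in some Delta^1_1 rectangle
    around P x Q. Intersected with that rectangle it is a neighbourhood of V missing A; its level
    must be below 1 + eta, hence zeta < eta. *)
Lemma cl_meet zeta eta (V A : set Z) : olt zeta eta -> ole eta xi -> Sg Z V -> Sg Z A ->
  V !=set0 -> V `<=` rectPQ -> V `<=` cl eta A ->
  exists z, [/\ A z, cl zeta V z & rectPQ z].
Proof.
move=> ze ex sV sA [v Vv] VPQ VA; apply: contrapT => ne.
have zx : ole zeta xi by apply: ole_trans ex; case: ze.
have sS := Sg_and sA (Sg_cl WC hxi zx sV).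
have [|P' [Q' [[sP' pP'] [sQ' pQ'] PP' QQ' nA]]] := Sg_rect_separation sP sQ sS.
  by move=> x y Px Qy [Axy Cxy]; apply: ne; exists (x, y).
have sA' : Sg Z (fun z => A z /\ (P' z.1 /\ Q' z.2)).
  apply: Sg_and => //; apply: Sg_and; first by refine (@Sg_pre _ X (fun p : eprod X Y => p.1) _ _ sP'); ef.
  by refine (@Sg_pre _ Y (fun p : eprod X Y => p.2) _ _ sQ'); ef.
have [|n [ln VC CA]] := lev_separation WC hxi zx sV sA'.
  by apply/seteqP; split=> -[x y] // [h1 [h2 [/= h3 h4]]]; exact: nA h3 h4 (conj h2 h1).
have [n' [ln' n'P]] := lev_meet_rect ln sP' pP' sQ' pQ'.
have [] := VA _ Vv n'; first by exists (oadd oone zeta) => //; exact: oadd_lt2.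
  by apply/n'P; have [/PP' ? /QQ' ?] := VPQ _ Vv; split=> //; exact: VC.
move=> z [/n'P[Cz Pz Qz] Az].
have : ((fun z => C (n, z)) `&` (fun z => A z /\ (P' z.1 /\ Q' z.2))) z by [].
by rewrite CA.
Qed.

Variables (rho : (nat -> bool) -> (nat -> bool)).
Variables (Rr : Ord -> seq bool -> seq bool -> Prop) (Pp : seq bool -> seq bool).
Hypothesis res : resolution xi rho Rr Pp.
Variables (A : set Z) (FA FB : seq nat -> set Z).
Hypotheses (sA : Sg Z A) (sFA : forall w, Sg Z (FA w)) (sFB : forall w, Sg Z (FB w)).
Hypotheses (FAn : forall z, FA [::] z <-> A z) (FAs : forall w z, FA w z -> exists i, FA (rcons w i) z).
Hypothesis FBs : forall w z, FB w z -> exists i, FB (rcons w i) z.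

(** The approximation of rho is still identically 0, so the branch still looks as if its point
    belonged to B. *)
Definition tyB (s : seq bool) : bool := ~~ has id (Pp s).

(* From the point of view of u, t is zeta-true and s is its last
   (zeta+1)-true initial segment. *)
Definition last_true zeta (s t : seq bool) : Prop := exists u,
  [/\ prefix t u, Rr zeta t u, Rr (osucc zeta) s u &
      forall s', prefix s s' -> s' <> s -> prefix s' t -> ~ Rr (osucc zeta) s' u].

(** A label is a Sigma^1_1 set with a finite part of a witness. A label of type B also stays in the
    xi-closure of A, because the type may still change from B to A. *)
Definition good (s : seq bool) (U : set Z) (w : seq nat) : Prop :=
  [/\ Sg Z U, tyB s -> U `<=` FB w /\ U `<=` cl xi A & ~~ tyB s -> U `<=` FA w].

Definition goodp (s t : seq bool) (l l' : set Z * seq nat) : Prop :=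
  (forall zeta, olt zeta xi -> last_true zeta s t -> l'.1 `<=` cl zeta l.1) /\
  (Rr xi s t -> tyB s = tyB t ->
     [/\ l'.1 `<=` l.1, prefix l.2 l'.2 & size l.2 < size l'.2]).

Section Extend.
Variables (tau : seq bool) (lab : nat -> set Z * seq nat) (V0 : set Z).
Local Notation n := (size tau).
Local Notation sg m := (take m tau).
Local Notation U m := (lab m).1.
Hypotheses (n0 : 0 < n) (glab : forall m, m < n -> good (sg m) (lab m).1 (lab m).2).
Hypothesis gplab : forall k m, k < m -> m < n -> goodp (sg k) (sg m) (lab k) (lab m).
Hypotheses (sV0 : Sg Z V0) (V0n : V0 !=set0) (V0PQ : V0 `<=` rectPQ) (V0U : V0 `<=` U n.-1).

Definition isr eta r : Prop := [/\ r < n, Rr eta (sg r) tau &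
  forall k, r < k -> k < n -> ~ Rr eta (sg k) tau].

Lemma pre_sg k m : k <= m -> prefix (sg k) (sg m).
Proof. by move=> km; rewrite -(take_takel tau km) prefix_take. Qed.

Lemma pre_tau k : prefix (sg k) tau. Proof. exact: prefix_take. Qed.

Lemma isr_ex eta : exists r, isr eta r.
Proof.
pose D r := (r < n) && `[<Rr eta (sg r) tau>].
have D0 : exists r, D r by exists 0; rewrite /D n0 take0; apply/asboolP; exact: (res_nil res).
have Db r : D r -> r <= n by move=> /andP[/ltnW].
have [r /andP[rn /asboolP rR] rmax] := ex_maxnP D0 Db.
exists r; split=> // k rk kn kR; have H := rmax k; rewrite /D kn in H.
by have := H (introT (asboolP _) kR); rewrite leqNgt rk.
Qed.

Lemma isr_le eta eta' r r' : ole eta eta' -> ole eta' xi -> isr eta r -> isr eta' r' -> r' <= r.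
Proof.
move=> ee ex [rn rR rmax] [rn' rR' _]; rewrite leqNgt; apply/negP => rr.
exact: rmax rr rn' (res_dec res ee ex rR').
Qed.

(** Only at such ranks can tau have a proper initial segment as its last (zeta+1)-true one, so only
    these ranks impose closure conditions on the new label. *)
Definition fail zeta : Prop := exists u, [/\ prefix tau u, Rr zeta tau u & ~ Rr (osucc zeta) tau u].

(** At a limit, uniformity yields th below it such that th-truth of tau implies truth at the limit;
    ranks above th then cannot fail. *)
Lemma fail_bound zeta : ole zeta xi -> zeta <> ozero ->
  exists2 z, olt z zeta & forall z', olt z' zeta -> fail z' -> ole z' z.
Proof.
move=> zx z0; case: (ord_cases zeta) => [//|[z zE]|zl].
  by subst zeta; exists z; [exact: osucc_gt|move=> z' /olt_succ].
have [th thz H] := res_unif res tau zl zx; exists th => // z' zz' [u [tu Ru nRu]].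
have [//|/oltNle/(fun h => h.1) tz] := pselect (ole z' th).
case: nRu; apply: (res_dec res (osucc_le zz') zx); apply: H.
by apply: (res_dec res tz _ Ru); exact: ole_trans zz'.1 zx.
Qed.

(** One rank bounds all failing ranks below zeta, so a single closure, and with it a Sigma^1_1 set,
    serves for all of them. *)
Lemma chain_step zeta V (A' : set Z) : ole zeta xi -> Sg Z V -> Sg Z A' -> V !=set0 ->
  V `<=` rectPQ -> V `<=` cl zeta A' -> exists V', [/\ Sg Z V', V' !=set0, V' `<=` A', V' `<=` rectPQ
    & forall z, olt z zeta -> fail z -> V' `<=` cl z V].
Proof.
move=> zx sV sA' Vn VPQ VA'; have [z0|z0] := pselect (zeta = ozero).
  exists (fun z => A' z /\ rectPQ z); split.
  - exact: Sg_and sA' Sg_rectPQ.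
  - exact: cl_meet0 Vn VPQ VA'.
  - by move=> z [].
  - by move=> z [].
  - by move=> z; rewrite z0 => /olt0.
have [z zz H] := fail_bound zx z0.
exists (fun p => A' p /\ (cl z V p /\ rectPQ p)); split.
- apply: Sg_and => //; apply: Sg_and; last exact: Sg_rectPQ.
  by apply: (Sg_cl WC hxi) => //; exact: ole_trans zz.1 zx.
- by have [p [? ? ?]] := cl_meet zz zx sV sA' Vn VPQ VA'; exists p.
- by move=> p [].
- by move=> p [_ []].
- by move=> z' zz' /(H _ zz') z'z p [_ [h _]]; apply: cl_le h; exact: oadd_le2.
Qed.

(** By the club condition sg k is (zeta+1)-true in tau as well, so it is an initial segment of the
    longest such sg r, and the labels of k and r are already related. *)
Lemma chain_last zeta k r u : olt zeta xi -> prefix tau u -> Rr zeta tau u -> Rr (osucc zeta) (sg k) u ->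
  (forall s', prefix (sg k) s' -> s' <> sg k -> prefix s' tau -> ~ Rr (osucc zeta) s' u) ->
  k < n -> isr (osucc zeta) r -> U r `<=` cl zeta (U k).
Proof.
move=> zx tu Rtu Rku nk kn [rn rR rmax].
have sx : ole (osucc zeta) xi := osucc_le zx.
have kR : Rr (osucc zeta) (sg k) tau by apply: (res_club res zx _ Rku Rtu); exact: pre_tau.
have kr : k <= r by rewrite leqNgt; apply/negP => rk; exact: rmax rk kn kR.
move: kr; rewrite leq_eqVlt => /orP[/eqP ->|kr]; first exact: cl_sub.
have [gp _] := gplab kr rn; apply: gp => //; exists u; split=> //.
- exact: prefix_trans (pre_tau _) tu.
- apply: (res_trans res) Rtu; exact: (res_dec res (osucc_gt zeta).1 sx rR).
- by move=> s' ks sk sr; apply: nk => //; exact: prefix_trans sr (pre_tau _).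
Qed.

(** A set in the label of the immediate predecessor is moved back to the labels of the longest
    eta-true segments for growing eta. These lengths decrease with eta, so at a limit they have
    become constant. *)
Lemma chain eta : ole eta xi -> forall r, isr eta r -> exists V, [/\ Sg Z V, V !=set0, V `<=` U r,
  V `<=` rectPQ & forall zeta q, olt zeta eta -> fail zeta -> isr (osucc zeta) q -> V `<=` cl zeta (U q)].
Proof.
elim/olt_ind: eta => eta IH ex r rr; case: (ord_cases eta) => [e0|[zeta eE]|el].
- exists V0; split=> //; last by move=> z q; rewrite e0 => /olt0.
  suff -> : r = n.-1 by [].
  case: rr => rn _ rmax; apply: contrapT => rN; apply: (rmax n.-1); rewrite ?e0; try by move: rN; lia.
  by apply/(res0 res); exact: pre_tau.
- subst eta; have zx : olt zeta xi := olt_le_trans (osucc_gt zeta) ex.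
  have [m mr] := isr_ex zeta; have [V [sV Vn VU VPQ Vc]] := IH _ (osucc_gt zeta) zx.1 _ mr.
  have rm : r <= m := isr_le (osucc_gt zeta).1 ex mr rr.
  move: rm; rewrite leq_eqVlt => /orP[/eqP rm|rm].
    exists V; split=> //; first by rewrite rm.
    move=> z q /olt_succ/ole_eqVlt[->|zz]; last exact: Vc.
    move=> _ qr; have -> : q = r.
      by apply/eqP; rewrite eqn_leq !(isr_le (ole_refl _) ex) //.
    by rewrite rm => p /VU; exact: cl_sub.
  have [rn rR rmax] := rr; have [mn mR mmax] := mr.
  (* Seen from tau, sg m is zeta-true and sg r is its last (zeta+1)-true segment, so [goodp] relates
     their labels. *)
  have VA' : V `<=` cl zeta (U r).
    move=> p /VU; have [gp _] := gplab rm mn; apply: gp => //; exists tau; split=> //.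
    - exact: pre_tau.
    - move=> s' rs sr sm sR; have sE : s' = sg (size s').
        by have := prefix_trans sm (pre_tau m); rewrite prefixE => /eqP.
      have := size_prefix rs; rewrite size_takel ?(ltnW rn) // leq_eqVlt => /orP[/eqP rE|rl].
        by apply: sr; rewrite rE -sE.
      have := size_prefix sm; rewrite size_takel ?(ltnW mn) // => sn.
      by apply: (rmax (size s')) => //; [exact: leq_ltn_trans sn mn|rewrite -sE].
  have [sU _ _] := glab rn.
  have [V' [sV' Vn' VU' VPQ' Vc']] := chain_step zx.1 sV sU Vn VPQ VA'.
  exists V'; split=> // z q /olt_succ/ole_eqVlt[->|zz] fz qr.
    have -> : q = r by apply/eqP; rewrite eqn_leq !(isr_le (ole_refl _) ex).
    by move=> p /VU'; exact: cl_sub.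
  move=> p /(Vc' _ zz fz) H; apply: cl_idem; apply: cl_mono H.
  exact: Vc zz fz qr.
have [th the H] := fail_bound ex el.1.
(* The least length r0 occurring at a rank between th and eta persists at all later ranks; ranks
   above th do not fail, so no further condition arises on the way to eta. *)
pose D r := `[<exists zeta, [/\ olt zeta eta, olt th zeta & isr zeta r]>].
have D0 : exists r, D r.
  have [q qr] := isr_ex (osucc th); exists q; apply/asboolP; exists (osucc th); split=> //; last exact: osucc_gt.
  by have [E|//] := ole_eqVlt (osucc_le the); case: el => _ /(_ th); rewrite E.
have [r0 /asboolP[z0 [z0e thz r0r]] r0min] := ex_minnP D0.
have [V [sV Vn VU VPQ Vc]] := IH _ z0e (ole_trans z0e.1 ex) _ r0r.
have [r0n r0R r0max] := r0r.
have Rall z : olt z eta -> Rr z (sg r0) tau.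
  move=> ze; have [zz|/oltNle zz] := pselect (ole z z0).
    exact: (res_dec res zz (ole_trans z0e.1 ex) r0R).
  have [q qr] := isr_ex z.
  have q1 : q <= r0 := isr_le zz.1 (ole_trans ze.1 ex) r0r qr.
  have q2 : r0 <= q by apply: r0min; apply/asboolP; exists z; split=> //; exact: olt_trans thz zz.
  have <- : q = r0 by lia.
  by case: qr.
have r0e := (res_lim res el ex Rall).
have rE : r = r0.
  have r1 : r <= r0 := isr_le z0e.1 ex r0r rr.
  apply/eqP; rewrite eqn_leq r1 /= leqNgt; apply/negP => rl.
  by case: rr => _ _ /(_ _ rl r0n).
exists V; split=> //; first by rewrite rE.
move=> zeta q ze fz qr; apply: Vc => //.
exact: ole_lt_trans (H _ ze fz) thz.
Qed.

Lemma tyB_mono s t : Rr xi s t -> ~~ tyB s -> ~~ tyB t.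
Proof.
move=> /(res_P res)/prefixP[p E]; rewrite /tyB !negbK E has_cat => ->.
by [].
Qed.

(** If the longest xi-true segment has the type of tau, one value is added to its witness. Otherwise
    the type changes from B to A, and V, which lies in the xi-closure of A, is moved into A with an
    empty witness. *)
Lemma extend : exists U w, [/\ good tau U w, forall k, k < n -> goodp (sg k) tau (lab k) (U, w)
  & exists z, U z /\ rectPQ z].
Proof.
have [r rr] := isr_ex xi; have [V [sV [v Vv] VU VPQ Vc]] := chain (ole_refl xi) rr.
have [rn rR rmax] := rr; have [sU gB gA] := glab rn.
have far U' k : (forall z, olt z xi -> fail z -> U' `<=` cl z V) -> k < n ->
    forall zeta, olt zeta xi -> last_true zeta (sg k) tau -> U' `<=` cl zeta (U k).
  move=> U'V kn zeta zx [u [tu Rtu Rku nk]].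
  have fz : fail zeta.
    exists u; split=> //; apply: nk; [exact: pre_tau| |exact: prefix_refl].
    by move=> /(congr1 size); rewrite size_takel ?(ltnW kn) // => E; rewrite E ltnn in kn.
  have [q qr] := isr_ex (osucc zeta).
  have Uq := chain_last zx tu Rtu Rku nk kn qr.
  move=> p /(U'V _ zx fz) H; apply: cl_idem; apply: cl_mono H.
  move=> p' /(Vc _ _ zx fz qr) H; apply: cl_idem; exact: cl_mono H.
have le_r k : k < n -> Rr xi (sg k) tau -> k <= r.
  by move=> kn kR; rewrite leqNgt; apply/negP => rk; exact: rmax rk kn kR.
have kr_R k : k <= r -> Rr xi (sg k) tau -> Rr xi (sg k) (sg r).
  by move=> kr kR; apply: (res_club' res (ole_refl _) _ kR rR); exact: pre_sg.
have [tE|tN] := eqVneq (tyB (sg r)) (tyB tau).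
  pose F := if tyB tau then FB else FA.
  have sF w : Sg Z (F w) by rewrite /F; case: ifP.
  have VF : V `<=` F (lab r).2.
    move=> z /VU Uz; rewrite /F; case: ifP => tt; first by have [H _] := gB (etrans tE tt); exact: H.
    by apply: gA => //; rewrite tE tt.
  have [i Fi] : exists i, F (rcons (lab r).2 i) v.
    by move: (VF _ Vv); rewrite /F; case: ifP => _; [exact: FBs|exact: FAs].
  exists (fun z => V z /\ F (rcons (lab r).2 i) z), (rcons (lab r).2 i); split.
  - split; first exact: Sg_and.
      move=> tt; split=> z [Vz]; first by rewrite /F tt.
      by have [_ H _] := gB (etrans tE tt); apply: H; exact: VU.
    by move=> tt z [_]; rewrite /F (negbTE tt).
  - move=> k kn; split.
      by apply: far => // z _ _ p [Vp _]; exact: cl_sub.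
    move=> kR tk; have kr := le_r _ kn kR; move: kr (kr_R _ kr kR); rewrite leq_eqVlt.
    move=> /orP[/eqP -> _|kr kRr] /=.
      by split; [move=> z [/VU]|exact: prefix_rcons|rewrite size_rcons].
    have [_ /(_ kRr (etrans tk (esym tE)))[h1 h2 h3]] := gplab kr rn.
    split; first by move=> z [/VU/h1].
      exact: prefix_trans h2 (prefix_rcons _ _).
    by rewrite size_rcons ltnW.
  - by exists v; split; [split|exact: VPQ].
have tB : tyB (sg r).
  by case: (boolP (tyB (sg r))) => // nB; move: tN; rewrite (negbTE nB) (negbTE (tyB_mono rR nB)) eqxx.
have tA : ~~ tyB tau by move: tN; rewrite tB; case: (tyB tau).
have VA : V `<=` cl xi A by move=> z /VU; have [_ H] := gB tB; exact: H.
have [V' [sV' [v' Vv'] VA' VPQ' Vc']] := chain_step (ole_refl _) sV sA (ex_intro _ v Vv) VPQ VA.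
exists V', [::]; split; last by exists v'; split=> //; exact: VPQ'.
  by split=> //; [rewrite (negbTE tA)|move=> _ z /VA'/FAn].
move=> k kn; split; first exact: far.
move=> kR tk; exfalso; have kr := le_r _ kn kR.
by have := tyB_mono (kr_R _ kr kR); rewrite tk tA tB => /(_ isT).
Qed.

End Extend.
End Chain.


(** * The forest of a test *)

Definition words n : seq (seq bool) := map (@tval n bool) (enum {: n.-tuple bool}).

Lemma mem_words n s : (s \in words n) = (size s == n).
Proof.
apply/mapP/eqP => [[x _ ->]|sn]; first exact: size_tuple.
by exists (tcast sn (in_tuple s)); rewrite ?mem_enum // val_tcast.
Qed.

Notation edge := (seq bool * seq bool)%type (only parsing).
Definition anc (e : edge) (k : nat) : edge := (take k e.1, take k e.2).
(** The first letter of the difference is dropped to match [cshift (symdiff a b)]: an edge of length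
    n + 1 carries a word of length n. *)
Definition str (e : edge) : seq bool := behead [seq p.1 (+) p.2 | p <- zip e.1 e.2].

Lemma str_anc e k : size e.1 = size e.2 -> str (anc e k.+1) = take k (str e).
Proof.
case: e => [[|x s] [|y t]] //= [st]; rewrite /str /=.
elim: k s t st => [|k IH] [|x' s] [|y' t] //= [st]; congr cons; exact: IH.
Qed.

Lemma size_str e : size e.1 = size e.2 -> size (str e) = (size e.1).-1.
Proof. by move=> se; rewrite size_behead size_map size_zip se minnn. Qed.

Section TestTree.
Variable E : set edge.
Hypothesis hE : is_test E.
Local Notation T := (tree E).

Lemma E_nil : E ([::], [::]).
Proof.
have [[s t] [[Es sz] _]] := test_uniq hE 0.
have := test_dom hE Es; move: sz => /= /size0nil sE; subst s => /= /esym/size0nil tE.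
by subst t.
Qed.

Lemma E_fun s t s' t' : E (s, t) -> E (s', t') -> size s = size s' -> (s, t) = (s', t').
Proof.
move=> e1 e2 ss; have [p [_ pu]] := test_uniq hE (size s).
by rewrite -(pu (s, t)) // -(pu (s', t')).
Qed.

Lemma E_T s t : E (s, t) -> T (s, t).
Proof.
move=> e; have [s0|s0] := posnP (size s); last first.
  by have [s' [t' [w [e' _ -> ->]]]] := test_prev hE e s0; right; exists s', t', w.
have := test_dom hE e; rewrite s0 => /esym/size0nil ->; rewrite (size0nil s0); by left.
Qed.

Lemma T_size s t : T (s, t) -> size s = size t.
Proof.
by case=> [[-> ->]//|[s' [t' [w [/(test_dom hE) H [-> ->]]]]]]; rewrite !size_cat H.
Qed.

Lemma T_take s t k : T (s, t) -> T (take k s, take k t).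
Proof.
have [n sn] := ubnP (size s); elim: n s t sn => // n IH s t sn.
case=> [[-> ->]|[s' [t' [w [e [sE tE]]]]]]; first by left.
have dd := test_dom hE e.
have ss : size s' < size s by rewrite sE size_cat /= addnS ltnS leq_addr.
have [ks|ks] := leqP k (size s').
  rewrite sE tE !takel_cat -?dd //; apply: IH; last exact: E_T.
  by apply: leq_trans ss _.
right; exists s', t', (take (k - size s').-1 w); split=> //.
rewrite sE tE !take_cat -dd ltnNge (ltnW ks) /=.
by rewrite -(prednK (n := k - size s')) ?subn_gt0.
Qed.

Lemma T_inv s t : T (s, t) -> 0 < size s ->
  (exists s' t', [/\ E (s', t'), s = rcons s' false & t = rcons t' true]) \/
  (exists s' t' b, [/\ T (s', t'), 0 < size s', s = rcons s' b & t = rcons t' b]).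
Proof.
case=> [[-> _]//|[s' [t' [w [e [-> ->]]]]]] _.
case: (lastP w) => [|w' b]; first by left; exists s', t'; rewrite !cats1.
right; exists (s' ++ false :: w'), (t' ++ true :: w'), b.
by rewrite !rcons_cat size_cat addnS; split=> //; right; exists s', t', w'.
Qed.

(* Removing the edge (s, t) from a level of T disconnects s from t, which allows
   the two sides of a solution to be changed independently. *)
Lemma T_bridge n s t : size s = n.+1 -> T (s, t) -> exists cX cY : seq bool -> bool,
  cX s <> cY t /\ forall s' t', T (s', t') -> size s' = n.+1 -> (s', t') <> (s, t) -> cX s' = cY t'.
Proof.
elim: n s t => [|n IH] s t sn st.
all: case: (T_inv st ltac:(by rewrite sn)) => [[s1 [t1 [e1 sE tE]]]|[s1 [t1 [b [T1 s10 sE tE]]]]].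
1,3: exists (last false), (last false); rewrite sE tE !last_rcons; split=> // s' t' st' sn' ne;
  case: (T_inv st' ltac:(by rewrite sn')) => [[s2 [t2 [e2 sE2 tE2]]]|[s2 [t2 [b [T2 s20 -> ->]]]]];
  [|by rewrite !last_rcons]; case: ne; move: sn sn'; rewrite sE sE2 tE2 !size_rcons => -[sn] [sn'];
  have [-> ->] := E_fun e1 e2 ltac:(by rewrite sn sn'); rewrite ?sE ?tE.
1,2: by [].
  by move: sn; rewrite sE size_rcons => -[s0]; rewrite s0 in s10.
have sn1 : size s1 = n.+1 by move: sn; rewrite sE size_rcons => -[].
have [cX [cY [cN cE]]] := IH _ _ sn1 T1.
have [[sn_ tn_] [[en sne] _]] := test_uniq hE n.+1; rewrite /= in sne.
have tne : size tn_ = n.+1 by rewrite -(test_dom hE en).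
have tn1 : size t1 = n.+1 by rewrite -(T_size T1).
(* The copy of the lower level with last letter b keeps its colours and the other copy is constant;
   the constant is chosen so that the one edge between the copies is monochromatic. *)
pose k := if b then cY tn_ else cX sn_.
exists (fun v => if last false v == b then cX (take n.+1 v) else k),
  (fun v => if last false v == b then cY (take n.+1 v) else k).
have tk v c : size v = n.+1 -> take n.+1 (rcons v c) = v by move=> vn; rewrite -cats1 take_size_cat.
rewrite sE tE !last_rcons eqxx !tk //; split=> // s' t' st' sn' ne.
case: (T_inv st' ltac:(by rewrite sn')) => [[s2 [t2 [e2 sE2 tE2]]]|[s2 [t2 [c [T2 s20 sE2 tE2]]]]].
  have [s2E t2E] : (sn_, tn_) = (s2, t2).
    by apply: E_fun => //; move: sn'; rewrite sE2 size_rcons => -[->].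
  by rewrite sE2 tE2 -s2E -t2E !last_rcons !tk // /k; case: (b).
have sn2 : size s2 = n.+1 by move: sn'; rewrite sE2 size_rcons => -[].
have tn2 : size t2 = n.+1 by rewrite -(T_size T2).
rewrite sE2 tE2 !last_rcons !tk //; case: eqP => // cb; apply: cE => //.
by move=> [s12 t12]; apply: ne; rewrite sE2 tE2 cb s12 t12.
Qed.

Definition edges n : seq edge := [seq e <- allpairs pair (words n) (words n) | `[<T e>]].

Lemma mem_edges n e : (e \in edges n) <-> T e /\ size e.1 = n.
Proof.
rewrite mem_filter; split=> [/andP[/asboolP Te /allpairsP[[s t] /= [s1 t1 eE]]]|[Te en]].
  by subst e; split=> //; move: s1; rewrite mem_words => /eqP.
apply/andP; split; first exact/asboolP.
apply/allpairsP; exists e; rewrite !mem_words en; case: e Te en => s t Te /= en.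
by rewrite -(T_size Te) en eqxx.
Qed.

End TestTree.

Lemma Sg_allin (E : espace) (I : eqType) (l : seq I) (F : I -> set E) :
  (forall i, Sg E (F i)) -> Sg E (fun x => forall i, i \in l -> F i x).
Proof.
move=> sF; elim: l => [|i l IH]; first by apply: Sg_ext (Sg_true E).
apply: Sg_ext (Sg_and (sF i) IH) => x; split=> [[Fi Fl] j|H].
  by rewrite inE => /orP[/eqP ->|/Fl].
by split=> [|j jl]; apply: H; rewrite inE ?eqxx ?jl ?orbT.
Qed.

Lemma Sg_nbset (E : espace) u : Sg E (fun z => es_nb u z).
Proof.
apply/SgP; have cu : comp (fun _ : nat => u) by rc.
apply: S11_ext (S11_and (nm_dom (es_nu E)) (S11_sig (sig_subst (nm_nb_sig (es_nu E)) cu))) => a x.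
split=> [[[z az] H]|[z [az H]]].
  by exists z; split=> //; apply/(nm_nbP u az).
by split; [exists z|apply/(nm_nbP u az)].
Qed.

(** * Assignments of points to the vertices of a level *)

Section Solutions.
Context (X Y : espace).
Local Notation Z := (eprod X Y).
Variables (x0 : X) (y0 : Y).
Variables (Es : seq edge) (VX VY : seq (seq bool)).
Variables (U : edge -> set Z) (PX : seq bool -> set X) (PY : seq bool -> set Y).
Hypotheses (sU : forall e, Sg Z (U e)) (sPX : forall v, Sg X (PX v)) (sPY : forall v, Sg Y (PY v)).

Definition sol (f : seq bool -> X) (g : seq bool -> Y) : Prop :=
  [/\ forall e, e \in Es -> U e (f e.1, g e.2), forall v, v \in VX -> PX v (f v)
    & forall v, v \in VY -> PY v (g v)].

Let ix (v : seq bool) := pairN 0 (pickle v).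
Let iy (v : seq bool) := pairN 1 (pickle v).

(** One real names the values at all vertices, row by row, so that quantifying over assignments is
    quantifying over reals. Rows of vertices without constraints may name nothing; [nsolP] fills
    them with x0 and y0. *)
Let nsol (a : ebaire) : Prop :=
  ((forall e, e \in Es -> exists z : Z, (nm (es_nu X) (row (ix e.1) a) z.1 /\ nm (es_nu Y) (row (iy e.2) a) z.2) /\ U e z) /\
   (forall v, v \in VX -> exists x, nm (es_nu X) (row (ix v) a) x /\ PX v x)) /\
   (forall v, v \in VY -> exists y, nm (es_nu Y) (row (iy v) a) y /\ PY v y).

Lemma eff_row (E : espace) k (f : E -> ebaire) : eff f -> @eff E ebaire (fun x => row k (f x)).
Proof.
by move=> [Phi oPhi fP]; exists (fun a x => row k (Phi a x)) => [|a x /fP /= ->//];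
  exact: (oper_comp (oper_row k)).
Qed.

Lemma Sg_nsol : Sg ebaire nsol.
Proof.
apply: Sg_and; first apply: Sg_and.
- apply: Sg_allin => e; apply: (@Sg_exp ebaire Z); apply: Sg_and; first apply: Sg_and.
  + refine (@Sg_pre _ (eprod X ebaire) (fun p : eprod ebaire Z => (p.2.1, row (ix e.1) p.1)) _ _ (Sg_nm X)).
    by apply: eff_pair; [ef|apply: eff_row; ef].
  + refine (@Sg_pre _ (eprod Y ebaire) (fun p : eprod ebaire Z => (p.2.2, row (iy e.2) p.1)) _ _ (Sg_nm Y)).
    by apply: eff_pair; [ef|apply: eff_row; ef].
  + by refine (@Sg_pre _ Z (fun p : eprod ebaire Z => p.2) _ _ (sU e)); ef.
- apply: Sg_allin => v; apply: (@Sg_exp ebaire X); apply: Sg_and.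
    refine (@Sg_pre _ (eprod X ebaire) (fun p : eprod ebaire X => (p.2, row (ix v) p.1)) _ _ (Sg_nm X)).
    by apply: eff_pair; [ef|apply: eff_row; ef].
  by refine (@Sg_pre _ X (fun p : eprod ebaire X => p.2) _ _ (sPX v)); ef.
- apply: Sg_allin => v; apply: (@Sg_exp ebaire Y); apply: Sg_and.
    refine (@Sg_pre _ (eprod Y ebaire) (fun p : eprod ebaire Y => (p.2, row (iy v) p.1)) _ _ (Sg_nm Y)).
    by apply: eff_pair; [ef|apply: eff_row; ef].
  by refine (@Sg_pre _ Y (fun p : eprod ebaire Y => p.2) _ _ (sPY v)); ef.
Qed.

Lemma nsolP (a : ebaire) : nsol a -> exists f g, sol f g /\
  (forall v x, nm (es_nu X) (row (ix v) a) x -> f v = x) /\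
  (forall v y, nm (es_nu Y) (row (iy v) a) y -> g v = y).
Proof.
move=> [[H1 H2] H3].
pose f v := if pselect (exists x, nm (es_nu X) (row (ix v) a) x) is left h then sval (cid h) else x0.
pose g v := if pselect (exists y, nm (es_nu Y) (row (iy v) a) y) is left h then sval (cid h) else y0.
have fE v x : nm (es_nu X) (row (ix v) a) x -> f v = x.
  move=> ax; rewrite /f; case: pselect => [h|[]]; last by exists x.
  exact: nm_inj (svalP (cid h)) ax.
have gE v y : nm (es_nu Y) (row (iy v) a) y -> g v = y.
  move=> ay; rewrite /g; case: pselect => [h|[]]; last by exists y.
  exact: nm_inj (svalP (cid h)) ay.
exists f, g; split=> //; split=> [e /H1[[x y] [[/= /fE -> /gE ->]]]//|v /H2[x [/fE ->]]//|v /H3[y [/gE ->]]//].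
Qed.

Lemma sol_name f g : exists a, (forall v, nm (es_nu X) (row (ix v) a) (f v)) /\
  forall v, nm (es_nu Y) (row (iy v) a) (g v).
Proof.
have /choice[F FP] : forall v, exists a, nm (es_nu X) a (f v) by move=> v; exact: nm_ex.
have /choice[G GP] : forall v, exists a, nm (es_nu Y) a (g v) by move=> v; exact: nm_ex.
exists (fun i => let k := phi0 i in let v := odflt [::] (unpickle (phi1 k)) in
  if phi0 k == 0 then F v (phi1 i) else G v (phi1 i)).
have E1 v : row (ix v) (fun i => let k := phi0 i in let v := odflt [::] (unpickle (phi1 k)) in
  if phi0 k == 0 then F v (phi1 i) else G v (phi1 i)) = F v.
  by apply/funext => i; rewrite /row /ix; lazy zeta; rewrite !pairNK; cbv [fst snd]; rewrite ?pairNK; cbv [fst snd]; rewrite pickleK.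
have E2 v : row (iy v) (fun i => let k := phi0 i in let v := odflt [::] (unpickle (phi1 k)) in
  if phi0 k == 0 then F v (phi1 i) else G v (phi1 i)) = G v.
  by apply/funext => i; rewrite /row /iy; lazy zeta; rewrite !pairNK; cbv [fst snd]; rewrite ?pairNK; cbv [fst snd]; rewrite pickleK.
by split=> v; rewrite ?E1 ?E2.
Qed.

Lemma sol_nsol f g a : sol f g -> (forall v, nm (es_nu X) (row (ix v) a) (f v)) ->
  (forall v, nm (es_nu Y) (row (iy v) a) (g v)) -> nsol a.
Proof.
move=> [H1 H2 H3] nf ng; split; first split.
- by move=> e /H1 Ue; exists (f e.1, g e.2).
- by move=> v /H2 Pv; exists (f v).
- by move=> v /H3 Pv; exists (g v).
Qed.

Lemma Sg_solX s : Sg X (fun x => exists f g, sol f g /\ f s = x).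
Proof.
have H : Sg X (fun x => exists a : ebaire, nm (es_nu X) (row (ix s) a) x /\ nsol a).
  apply: (@Sg_exp X ebaire); apply: Sg_and.
    refine (@Sg_pre _ (eprod X ebaire) (fun p : eprod X ebaire => (p.1, row (ix s) p.2)) _ _ (Sg_nm X)).
    by apply: eff_pair; [ef|apply: eff_row; ef].
  by refine (@Sg_pre _ ebaire (fun p : eprod X ebaire => p.2) _ _ Sg_nsol); ef.
apply: Sg_ext H => x; split=> [[a [ax /nsolP[f [g [fg [fE _]]]]]]|[f [g [fg <-]]]].
  by exists f, g; split=> //; exact: fE.
by have [a [af ag]] := sol_name f g; exists a; split=> //; exact: sol_nsol fg af ag.
Qed.

Lemma Sg_solY t : Sg Y (fun y => exists f g, sol f g /\ g t = y).
Proof.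
have H : Sg Y (fun y => exists a : ebaire, nm (es_nu Y) (row (iy t) a) y /\ nsol a).
  apply: (@Sg_exp Y ebaire); apply: Sg_and.
    refine (@Sg_pre _ (eprod Y ebaire) (fun p : eprod Y ebaire => (p.1, row (iy t) p.2)) _ _ (Sg_nm Y)).
    by apply: eff_pair; [ef|apply: eff_row; ef].
  by refine (@Sg_pre _ ebaire (fun p : eprod Y ebaire => p.2) _ _ Sg_nsol); ef.
apply: Sg_ext H => x; split=> [[a [ax /nsolP[f [g [fg [_ gE]]]]]]|[f [g [fg <-]]]].
  by exists f, g; split=> //; exact: gE.
by have [a [af ag]] := sol_name f g; exists a; split=> //; exact: sol_nsol fg af ag.
Qed.

End Solutions.

(** * Construction of one new level *)

Section Level.
Context (X Y : espace).
Local Notation Z := (eprod X Y).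
Variables (E : set edge) (hE : is_test E).
Context (W : set enat) (C : set (eprod enat Z)).
Hypothesis WC : coding W C.
Variable xi : Ord.
Hypothesis hxi : below_omega1CK xi.
Variables (rho : (nat -> bool) -> (nat -> bool)).
Variables (Rr : Ord -> seq bool -> seq bool -> Prop) (Pp : seq bool -> seq bool).
Hypothesis res : resolution xi rho Rr Pp.
Variables (A : set Z) (FA FB : seq nat -> set Z).
Hypotheses (sA : Sg Z A) (sFA : forall w, Sg Z (FA w)) (sFB : forall w, Sg Z (FB w)).
Hypotheses (FAn : forall z, FA [::] z <-> A z) (FAs : forall w z, FA w z -> exists i, FA (rcons w i) z).
Hypothesis FBs : forall w z, FB w z -> exists i, FB (rcons w i) z.
Local Notation goodl := (good W C xi Pp A FA FB).
Local Notation goodpl := (goodp W C xi Rr Pp).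

Implicit Type lab : edge -> set Z * seq nat.

Definition good_edge lab (e : edge) (l : set Z * seq nat) : Prop :=
  goodl (str e) l.1 l.2 /\
  forall k, k < size (str e) -> goodpl (str (anc e k.+1)) (str e) (lab (anc e k.+1)) l.

Definition good_lab n lab : Prop :=
  forall e, tree E e -> 0 < size e.1 -> size e.1 <= n -> good_edge lab e (lab e).

Lemma anc_anc e j k : j <= k -> anc (anc e k) j = anc e j.
Proof. by move=> jk; rewrite /anc /= !take_takel. Qed.

Lemma anc_T e k : tree E e -> tree E (anc e k).
Proof. by case: e => s t; exact: T_take. Qed.

Variables (x0 : X) (y0 : Y).

(** New edges are labelled one at a time. An edge not yet treated keeps the label of its parent, so
    copying the old points to both extensions of each vertex gives a first solution. *)
Lemma level_up n lab (PX : seq bool -> set X) (PY : seq bool -> set Y) f0 g0 :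
  0 < n -> good_lab n lab -> (forall v, Sg X (PX v)) -> (forall v, Sg Y (PY v)) ->
  sol (edges E n) (words n) (words n) (fun e => (lab e).1) PX PY f0 g0 ->
  exists lab' f g, (forall e, tree E e -> size e.1 = n.+1 -> good_edge lab e (lab' e)) /\
    sol (edges E n.+1) (words n.+1) (words n.+1) (fun e => (lab' e).1)
      (fun v => PX (take n v)) (fun v => PY (take n v)) f g.
Proof.
move=> n0 gl sPX sPY [H1 H2 H3].
pose Lab (done : seq edge) (lab1 : edge -> set Z * seq nat) e := if e \in done then lab1 e else lab (anc e n).
have par_edge e : e \in edges E n.+1 -> anc e n \in edges E n.
  by move=> /(mem_edges hE)[Te en]; apply/(mem_edges hE); split; [exact: anc_T|rewrite size_takel // en].
have main (done : seq edge) : {subset done <= edges E n.+1} -> uniq done ->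
    exists lab1 f g, (forall e, e \in done -> good_edge lab e (lab1 e)) /\
     sol (edges E n.+1) (words n.+1) (words n.+1) (fun e => (Lab done lab1 e).1)
      (fun v => PX (take n v)) (fun v => PY (take n v)) f g.
  elim: done => [_ _|e done IH] /=.
    exists lab, (fun v => f0 (take n v)), (fun v => g0 (take n v)); split=> //; split.
    - by move=> e /par_edge/H1.
    - by move=> v; rewrite mem_words => /eqP vn; apply: H2; rewrite mem_words size_takel // vn.
    - by move=> v; rewrite mem_words => /eqP vn; apply: H3; rewrite mem_words size_takel // vn.
  move=> sub /andP[edone udone].
  have [|//|lab1 [f [g [lab1P [S1 S2 S3]]]]] := IH.
    by move=> e' e'd; apply: sub; rewrite inE e'd orbT.
  have eE : e \in edges E n.+1 by apply: sub; rewrite mem_head.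
  have [Te en] := (mem_edges hE _ _).1 eE.
  have esz : size e.1 = size e.2 by case: e Te {sub edone eE en} => s t; exact: T_size.
  have strn : size (str e) = n by rewrite size_str // en.
  pose Es := [seq e' <- edges E n.+1 | e' != e].
  pose U e' := if e' \in edges E n.+1 then (Lab done lab1 e').1 else setT.
  have sU e' : Sg Z (U e').
    rewrite /U; case: ifP => [e'E|_]; last exact: Sg_true.
    rewrite /Lab; case: ifP => [/lab1P[[]//]|_].
    have [T1 n1] := (mem_edges hE _ _).1 (par_edge _ e'E).
    by have [[]] := gl _ T1 ltac:(by rewrite n1) ltac:(by rewrite n1).
  (* P and Q are the points that solutions of all the other constraints take at the two ends of e.
     The point found in the new label inside P x Q takes its coordinates from two different
     solutions. *)
  pose P : set X := fun x => exists f g, sol Es (words n.+1) (words n.+1) U (fun v => PX (take n v)) (fun v => PY (take n v)) f g /\ f e.1 = x.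
  pose Q : set Y := fun x => exists f g, sol Es (words n.+1) (words n.+1) U (fun v => PX (take n v)) (fun v => PY (take n v)) f g /\ g e.2 = x.
  have sP : Sg X P by apply: Sg_solX => // v.
  have sQ : Sg Y Q by apply: Sg_solY => // v.
  have solE : sol Es (words n.+1) (words n.+1) U (fun v => PX (take n v)) (fun v => PY (take n v)) f g.
    by split=> // e'; rewrite mem_filter /U => /andP[_ e'E]; rewrite e'E; exact: S1.
  have [Tp np] := (mem_edges hE _ _).1 (par_edge _ eE).
  have gp := gl _ Tp ltac:(by rewrite np) ltac:(by rewrite np).
  pose V0 : set Z := fun z => rectPQ P Q z /\ (lab (anc e n)).1 z.
  have sV0 : Sg Z V0 by apply: Sg_and; [exact: Sg_rectPQ|case: gp => -[]].
  have V0n : V0 !=set0.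
    exists (f e.1, g e.2); split; first by split; exists f, g.
    by have := S1 _ eE; rewrite /Lab (negbTE edone).
  have strk k : str (anc e k.+1) = take k (str e) by exact: str_anc.
  have glab m : m < size (str e) -> goodl (take m (str e)) (lab (anc e m.+1)).1 (lab (anc e m.+1)).2.
    rewrite strn => mn; rewrite -strk.
    have sz : size (anc e m.+1).1 = m.+1 by rewrite size_takel // en ltnW.
    by have [] := gl (anc e m.+1) (anc_T _ Te) ltac:(by rewrite sz) ltac:(by rewrite sz).
  have gplab k m : k < m -> m < size (str e) -> goodpl (take k (str e)) (take m (str e)) (lab (anc e k.+1)) (lab (anc e m.+1)).
    rewrite strn => km mn; rewrite -!strk.
    have sz : size (anc e m.+1).1 = m.+1 by rewrite size_takel // en ltnW.
    have [_] := gl (anc e m.+1) (anc_T _ Te) ltac:(by rewrite sz) ltac:(by rewrite sz).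
    move=> /(_ k); rewrite anc_anc; last exact: leqW.
    by apply; rewrite strk size_takel ?strn // ltnW.
  have [|||U' [w' [gU gpU [z [Uz [[f1 [g1 [[A1 A2 A3] fz]]] [f2 [g2 [[B1 B2 B3] gz]]]]]]]]] :=
      extend WC hxi sP sQ res sA sFA sFB FAn FAs FBs (tau := str e) (lab := fun m => lab (anc e m.+1)) (V0 := V0) _ glab gplab sV0 V0n _ _.
  - by rewrite strn.
  - by move=> z' [].
  - by move=> z' [_]; rewrite strn prednK.
  (* The first solution is used on the side of e.1 and the second on the side of e.2; every other
     edge lies on one side and sees a single solution. *)
  have [cX [cY [cN cE]]] := T_bridge hE en (t := e.2) ltac:(by case: (e) Te).
  exists (fun e' => if e' == e then (U', w') else lab1 e').
  exists (fun v => if cX v == cX e.1 then f1 v else f2 v).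
  exists (fun v => if cY v == cX e.1 then g1 v else g2 v).
  split.
    move=> e'; rewrite inE; case: eqP => [-> _|_ /= /lab1P//].
    by split=> //= k kn; rewrite strk; exact: gpU.
  split=> [e' e'E|v vn|v vn]; [|by case: ifP => _; [exact: A2|exact: B2]|by case: ifP => _; [exact: A3|exact: B3]].
  rewrite /Lab inE; case: eqP => [->|ne] /=.
    rewrite !eqxx /= ; case: eqP => [/esym//|_].
    by rewrite fz gz; case: (z) Uz.
  have e'Es : e' \in Es by rewrite mem_filter e'E andbT; apply/eqP.
  have [T' n'] := (mem_edges hE _ _).1 e'E.
  have -> : cX e'.1 = cY e'.2.
    by apply: cE => //; [case: (e') T'|move=> H; apply: ne; move: H; case: (e') => ? ?; case: (e)].
  have UE : U e' = (if e' \in done then lab1 e' else lab (anc e' n)).1 by rewrite /U e'E.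
  by rewrite -UE; case: ifP => _; [exact: A1|exact: B1].
have [|lab1 [f [g [l1 S]]]] := main (undup (edges E n.+1)) _ (undup_uniq _).
  by move=> e; rewrite mem_undup.
exists lab1, f, g; split.
  by move=> e Te en; apply: l1; rewrite mem_undup; apply/(mem_edges hE).
case: S => S1 S2 S3; split=> // e eE; have := S1 _ eE.
by rewrite /Lab mem_undup eE.
Qed.

End Level.


(** * The limit maps *)

Lemma mkseq_take (T : Type) (a : nat -> T) m n : m <= n -> take m (mkseq a n) = mkseq a m.
Proof. by move=> mn; rewrite /mkseq -map_take take_iota (minn_idPl mn). Qed.

Lemma nbhs_cylinder (a : cantor_space) n : nbhs a [set b : cantor_space | mkseq b n = mkseq a n].
Proof.
elim: n => [|n IH]; first by apply: filterS filterT.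
have H : nbhs a [set b : cantor_space | b n = a n].
  have /= := @proj_continuous nat (fun=> bool : topologicalType) n a [set a n].
  by apply; exact: discrete_set1.
by apply: filterS (filterI IH H) => b [/= e1 e2]; rewrite !mkseqS e1 e2.
Qed.

Section LimitMap.
Context (R : realType) (X : rpPolish R).
Local Notation d := (@mdist R X).
Variables (P : nat -> seq bool -> set X) (F : nat -> seq bool -> X).
Hypothesis PF : forall n v, size v = n.+1 -> P n v (F n v).
Hypothesis Psub : forall n v, size v = n.+2 -> P n.+1 v `<=` P n (take n.+1 v).
Hypothesis Pball : forall n v, size v = n.+2 -> exists i, forall x, P n.+1 v x -> (d (rp_seq X i) x < iv R n)%R.

Lemma P_anti (a : nat -> bool) m n : m <= n -> P n (mkseq a n.+1) `<=` P m (mkseq a m.+1).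
Proof.
move=> /subnK <-; elim: (n - m) => // k IH; apply: subset_trans IH.
have := @Psub (k + m) (mkseq a (k + m).+2); rewrite mkseq_take //; apply.
by rewrite size_mkseq.
Qed.

Lemma F_close n (a b : nat -> bool) k l : mkseq a n.+2 = mkseq b n.+2 -> n < k -> n < l ->
  (d (F k (mkseq a k.+1)) (F l (mkseq b l.+1)) < iv R n + iv R n)%R.
Proof.
move=> ab nk nl; have [|i iP] := @Pball n (mkseq a n.+2); first by rewrite size_mkseq.
have h1 : (d (rp_seq X i) (F k (mkseq a k.+1)) < iv R n)%R.
  by apply: iP; apply: (P_anti nk); apply: PF; rewrite size_mkseq.
have h2 : (d (rp_seq X i) (F l (mkseq b l.+1)) < iv R n)%R.
  by apply: iP; rewrite ab; apply: (P_anti nl); apply: PF; rewrite size_mkseq.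
have := rp_tri (F k (mkseq a k.+1)) (rp_seq X i) (F l (mkseq b l.+1)).
by move: h1; rewrite rp_sym; move: h2; glra.
Qed.

Lemma small_inv2 (e : R) : (0 < e)%R -> exists n : nat, (iv R n + iv R n < e)%R.
Proof.
move=> e0; have [|n nP] := @small_inv R (e / 2)%R; first by rewrite divr_gt0.
by exists n; move: nP; glra.
Qed.

Lemma limit_map : exists u : cantor_space -> X, continuous u /\
  forall a e, (0 < e)%R -> exists N, forall n, N <= n -> (d (F n (mkseq a n.+1)) (u a) < e)%R.
Proof.
have /choice[u uP] : forall a : cantor_space, exists l, forall e, (0 < e)%R -> exists N, forall n, N <= n ->
    (d (F n (mkseq a n.+1)) l < e)%R.
  move=> a; apply: (@rp_complete _ X) => e e0; have [n nP] := small_inv2 e0.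
  exists n.+1 => k l nk nl; apply: lt_trans nP; exact: F_close.
exists u; split=> // a; apply/cvg_ballP => e e0; have e4 : (0 < e / 4)%R by rewrite divr_gt0.
have [|n nP] := @small_inv2 (e / 2)%R; first by rewrite divr_gt0.
apply: filterS (nbhs_cylinder a n.+2) => b /= ba; rewrite ballEmdist /=.
have [Na aP] := uP a _ e4; have [Nb bP] := uP b _ e4.
pose k := Na + Nb + n.+1; have nk : n < k by rewrite /k addnS ltnS leq_addl.
have := aP k ltac:(by rewrite /k -addnA leq_addr); have := bP k ltac:(by rewrite /k addnAC leq_addl).
have := F_close ba nk nk; rewrite rp_sym.
have := rp_tri (u a) (F k (mkseq a k.+1)) (u b); rewrite (rp_sym (u a) (F _ _)).
have := rp_tri (F k (mkseq a k.+1)) (F k (mkseq b k.+1)) (u b).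
by move: nP; glra.
Qed.

End LimitMap.

Lemma mono_le (f : nat -> nat) : (forall m, f m <= f m.+1) -> {homo f : m n / m <= n}.
Proof. by move=> H m n /subnK <-; elim: (n - m) => // k IH; exact: leq_trans IH (H _). Qed.

Section Construction.
Context (R : realType) (X Y : rpPolish R).
Local Notation EX := (ESpace (rp_naming X)).
Local Notation EY := (ESpace (rp_naming Y)).
Local Notation Z := (eprod EX EY).
Variables (E : set edge) (hE : is_test E).
Context (W : set enat) (C : set (eprod enat Z)).
Hypothesis WC : coding W C.
Variable xi : Ord.
Hypothesis hxi : below_omega1CK xi.
Variables (rho : (nat -> bool) -> (nat -> bool)).
Variables (Rr : Ord -> seq bool -> seq bool -> Prop) (Pp : seq bool -> seq bool).
Hypothesis res : resolution xi rho Rr Pp.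

Section Slices.
Variables (A B : set Z) (FA FB : seq nat -> set Z).
Hypotheses (sA : Sg Z A) (sB : Sg Z B) (sFA : forall w, Sg Z (FA w)) (sFB : forall w, Sg Z (FB w)).
Hypotheses (FAn : forall z, FA [::] z <-> A z) (FBn : forall z, FB [::] z <-> B z).
Hypotheses (FAs : forall w z, FA w z -> exists i, FA (rcons w i) z)
  (FBs : forall w z, FB w z -> exists i, FB (rcons w i) z).
Variable z0 : Z.
Hypotheses (z0B : B z0) (z0A : cl W C (oadd oone xi) A z0).
Local Notation goode := (good_edge W C xi Rr Pp A FA FB).
Local Notation goodl := (good_lab E W C xi Rr Pp A FA FB).

Record stage := Stage {
  st_lab : edge -> set Z * seq nat; st_f : seq bool -> X; st_g : seq bool -> Y;
  st_P : seq bool -> set X; st_Q : seq bool -> set Y }.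

Definition stage_ok n st := [/\ goodl n (st_lab st), forall v, Sg EX (st_P st v),
  forall v, Sg EY (st_Q st v)
  & @sol EX EY (edges E n) (words n) (words n) (fun e => (st_lab st e).1) (st_P st) (st_Q st) (st_f st) (st_g st)].

Definition small (V : rpPolish R) n (P : set V) :=
  exists i, forall x, P x -> (mdist (rp_seq V i) x < iv R n)%R.

Definition stage_next n st st' := [/\ forall e : edge, size e.1 <= n.+1 -> st_lab st' e = st_lab st e,
  forall v, st_P st' v `<=` st_P st (take n.+1 v) /\ small n (st_P st' v)
  & forall v, st_Q st' v `<=` st_Q st (take n.+1 v) /\ small n (st_Q st' v)].

Lemma shrink (V : rpPolish R) n (P : seq bool -> set V) (f : seq bool -> V) :
  (forall v, Sg (ESpace (rp_naming V)) (P v)) ->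
  exists P', [/\ forall v, Sg (ESpace (rp_naming V)) (P' v),
    forall v, P' v `<=` P (take n.+1 v) /\ small n (P' v) & forall v, P (take n.+1 v) (f v) -> P' v (f v)].
Proof.
move=> sP; have /choice[c cP] : forall v, exists i, (mdist (rp_seq V i) (f v) < iv R n)%R.
  by move=> v; apply: rp_close; rewrite /iv invr_gt0.
have nbE i x : rp_nb V (pairN i (pairN 1 n)) x <-> (mdist (rp_seq V i) x < iv R n)%R.
  by rewrite /rp_nb !pairNK ballEmdist /= mul1r.
exists (fun v x => P (take n.+1 v) x /\ rp_nb V (pairN (c v) (pairN 1 n)) x); split.
- by move=> v; apply: Sg_and => //; exact: (@Sg_nbset (ESpace (rp_naming V))).
- by move=> v; split=> [x []//|]; exists (c v) => x [_ /nbE].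
- by move=> v Pv; split=> //; exact/nbE.
Qed.

Lemma stage_step n st : stage_ok n.+1 st -> exists st', stage_ok n.+2 st' /\ stage_next n st st'.
Proof.
move=> [gl sP sQ S].
have [//|lab' [f [g [gl' [S1 S2 S3]]]]] :=
  level_up hE WC hxi res sA sFA sFB FAn FAs FBs z0.1 z0.2 _ gl sP sQ S.
have [P' [sP' PP' Pf]] := @shrink X n (st_P st) f sP.
have [Q' [sQ' QQ' Qf]] := @shrink Y n (st_Q st) g sQ.
pose lab2 (e : edge) := if size e.1 == n.+2 then lab' e else st_lab st e.
exists (Stage lab2 f g P' Q'); split; last first.
  by split=> //= e en; rewrite /lab2 ltn_eqF.
have gl2 : goodl n.+2 lab2.
  move=> e Te e0; rewrite leq_eqVlt => /orP[/eqP en|en].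
    have [g1 g2] := gl' _ Te en; have -> : lab2 e = lab' e by rewrite /lab2 en eqxx.
    split=> // k kn.
    suff -> : lab2 (anc e k.+1) = st_lab st (anc e k.+1) by exact: g2.
      have sz : size e.1 = size e.2 by case: (e) Te => s t /(T_size hE).
      rewrite /lab2 size_take en; move: kn; rewrite size_str // en /=.
      by move=> kn; rewrite ltnS kn ltn_eqF.
  have [g1 g2] := gl _ Te e0 en; rewrite /lab2 (ltn_eqF en); split=> // k kn.
  suff -> : (size (anc e k.+1).1 == n.+2) = false by exact: g2.
  rewrite ltn_eqF //; apply: leq_ltn_trans en; rewrite /anc /= size_take.
  by case: ltnP => // /ltnW.
split=> //=; split=> [e eE|v vn|v vn]; [|by apply: Pf; exact: S2|by apply: Qf; exact: S3].
have [_ en] := (mem_edges hE _ _).1 eE.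
by rewrite /lab2 en eqxx; exact: S1.
Qed.

Lemma tyB_nil : tyB Pp [::].
Proof. by rewrite /tyB (res_Pnil res). Qed.

(** Edges of length 1 carry the empty word, which is of type B; so a point of B in the xi-closure of
    A starts the construction. *)
Lemma stage0 : exists st, stage_ok 1 st.
Proof.
pose U0 : set Z := fun z => B z /\ cl W C (oadd oone xi) A z.
exists (Stage (fun=> (U0, [::])) (fun=> z0.1) (fun=> z0.2) (fun=> setT) (fun=> setT)); split=> /=.
- move=> e Te e0 en; have se : size e.1 = 1 by lia.
  have strE : str e = [::].
    by apply/size0nil; rewrite size_str ?se //; case: (e) Te se => s t /T_size /= H; rewrite ?H.
  split=> [|k]; rewrite strE // ; split.
  + by apply: Sg_and => //; apply: (Sg_cl WC hxi) => //; exact: ole_refl.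
  + by move=> _; split=> z [Bz Az] //; exact: (FBn z).2.
  + by rewrite tyB_nil.
- by move=> v; exact: Sg_true.
- by move=> v; exact: Sg_true.
- by split=> // e _; case: (z0) z0B z0A.
Qed.

Lemma stages : exists s : nat -> stage, forall n, stage_ok n.+1 (s n) /\ stage_next n (s n) (s n.+1).
Proof.
have /choice[F FP] : forall p : nat * stage, exists st', stage_ok p.1.+1 p.2 ->
    stage_ok p.1.+2 st' /\ stage_next p.1 p.2 st'.
  move=> [n st] /=; have [h|h] := pselect (stage_ok n.+1 st); last by exists st.
  by have [st' ?] := stage_step h; exists st'.
have [st0 ok0] := stage0.
pose s := fix s n := if n is m.+1 then F (m, s m) else st0.
have ok n : stage_ok n.+1 (s n) by elim: n => // n IH; have [] := FP (n, s n) IH.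
by exists s => n; split=> //; have [] := FP (n, s n) (ok n).
Qed.

Section Limit.
Hypotheses (FAp : forall w w' z, prefix w w' -> FA w' z -> FA w z)
  (FBp : forall w w' z, prefix w w' -> FB w' z -> FB w z).
Hypotheses
  (FAc : forall a z, (forall n u, es_nb u z -> exists2 z', es_nb u z' & FA (mkseq a n) z') -> A z)
  (FBc : forall a z, (forall n u, es_nb u z -> exists2 z', es_nb u z' & FB (mkseq a n) z') -> B z).
Variable s : nat -> stage.
Hypothesis sP : forall n, stage_ok n.+1 (s n) /\ stage_next n (s n) (s n.+1).
(** Labels are never changed after their level is built ([LABE]), so each is read at the stage that
    creates it. *)
Definition LAB (e : edge) := st_lab (s (size e.1).-1) e.

Lemma LABE n (e : edge) : 0 < size e.1 -> size e.1 <= n.+1 -> st_lab (s n) e = LAB e.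
Proof.
move=> e0; elim: n => [|n IH] en; first by rewrite /LAB; have -> : (size e.1).-1 = 0 by lia.
move: en; rewrite leq_eqVlt => /orP[/eqP en|en]; first by rewrite /LAB en.
by have [_ [H _ _]] := sP n; rewrite H ?IH.
Qed.

Lemma LAB_good e : tree E e -> 0 < size e.1 -> goode LAB e (LAB e).
Proof.
move=> Te e0; have [[gl _ _ _] _] := sP (size e.1).-1.
have [g1 g2] := gl _ Te e0 ltac:(by rewrite prednK).
rewrite -/(LAB e) in g1 g2; split=> // k kn; have := g2 k kn.
suff -> : st_lab (s (size e.1).-1) (anc e k.+1) = LAB (anc e k.+1) by [].
have [s0 s1] : 0 < size (anc e k.+1).1 /\ size (anc e k.+1).1 <= size e.1.
  by rewrite /anc /= size_take; case: (ltnP k.+1 (size e.1)) => [/ltnW|].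
by apply: LABE => //; rewrite prednK.
Qed.

Lemma LAB_mem n (e : edge) : tree E e -> size e.1 = n.+1 -> (LAB e).1 (st_f (s n) e.1, st_g (s n) e.2).
Proof.
move=> Te en; have [[_ _ _ [S _ _]] _] := sP n.
by rewrite -(@LABE n) ?en //; apply: S; apply/(mem_edges hE).
Qed.

Section Branch.
Variables (a b : nat -> bool).
Hypothesis ab : branches (tree E) (a, b).
Local Notation eps := (cshift (symdiff a b)).
Let e_ n : edge := (mkseq a n.+1, mkseq b n.+1).
Let U n := (LAB (e_ n)).1.
Let w n := (LAB (e_ n)).2.

Lemma str_mkseq n : str (e_ n) = mkseq eps n.
Proof.
have sz : size (str (e_ n)) = n.
  by rewrite size_str /e_; cbv [fst snd]; rewrite !size_mkseq.
apply: (@eq_from_nth _ false); rewrite sz ?size_mkseq // => i il.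
rewrite /str nth_behead (nth_map (false, false)) ?size_zip ?size_mkseq ?minnn //.
by rewrite nth_zip ?size_mkseq // !nth_mkseq.
Qed.

Lemma anc_mkseq n k : k <= n -> anc (e_ n) k.+1 = e_ k.
Proof. by move=> kn; rewrite /anc /e_; cbv [fst snd]; rewrite !mkseq_take. Qed.

Lemma branch_good k n : k <= n -> Rr xi (mkseq eps k) (mkseq eps n) ->
  tyB Pp (mkseq eps k) = tyB Pp (mkseq eps n) ->
  [/\ U n `<=` U k, prefix (w k) (w n) & k < n -> size (w k) < size (w n)].
Proof.
rewrite leq_eqVlt => /orP[/eqP -> _ _|kn]; first by split=> //; [exact: prefix_refl|rewrite ltnn].
have [_ /(_ k)] := LAB_good (ab n.+1) ltac:(by rewrite size_mkseq).
rewrite -[(mkseq _ _, _)]/(e_ n) str_mkseq size_mkseq anc_mkseq; last exact: ltnW.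
by rewrite str_mkseq => /(_ kn)[_ H] kR /(H kR)[].
Qed.

Lemma branch_type n : (tyB Pp (mkseq eps n) -> U n `<=` FB (w n)) /\ (~~ tyB Pp (mkseq eps n) -> U n `<=` FA (w n)).
Proof.
have [[_ h1 h2] _] := LAB_good (ab n.+1) ltac:(by rewrite size_mkseq).
by move: h1 h2; rewrite -[(mkseq _ _, _)]/(e_ n) str_mkseq => h1 h2; split=> // /h1[].
Qed.

(** Along xi-true segments of constant type the sets decrease and the finite witnesses are initial
    segments of one real c; by the closedness clause of [slices], c witnesses the limit point. *)
Lemma branch_limit (F : seq nat -> set Z) (S : set Z) n M z :
  (forall w w' z, prefix w w' -> F w' z -> F w z) ->
  (forall a z, (forall n u, es_nb u z -> exists2 z', es_nb u z' & F (mkseq a n) z') -> S z) ->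
  is_path (Rr xi) Pp eps (rho eps) n ->
  (forall m, M <= m -> tyB Pp (mkseq eps (n m)) = tyB Pp (mkseq eps (n M))) ->
  (forall m, M <= m -> U (n m) `<=` F (w (n m))) ->
  (forall u : nat, es_nb u z -> exists N, forall k, N <= k -> es_nb u ((st_f (s k) (mkseq a k.+1), st_g (s k) (mkseq b k.+1)) : Z)) ->
  S z.
Proof.
move=> Fp Fc np ty UF zlim.
have nS m : n m <= n m.+1.
  have [_ /(res_prefix res (ole_refl _))/size_prefix] := np m; by rewrite !size_mkseq.
have nm m : m <= n m.
  by have [H _] := np m; have := res_size res (mkseq eps (n m)); rewrite H !size_mkseq.
have Rmm m m' : m <= m' -> Rr xi (mkseq eps (n m)) (mkseq eps (n m')) by move=> mm; exact: (path_mono res np).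
have bg m m' : M <= m -> m <= m' -> [/\ U (n m') `<=` U (n m), prefix (w (n m)) (w (n m')) & n m < n m' -> size (w (n m)) < size (w (n m'))].
  move=> Mm mm; apply: branch_good; [exact: mono_le|exact: Rmm|].
  by rewrite (ty m) // (ty m') //; exact: leq_trans mm.
have big L : exists2 m, M <= m & L <= size (w (n m)).
  elim: L => [|L [m Mm Lm]]; first by exists M.
  exists (n m).+1; first by apply: leq_trans Mm _; apply: leqW.
  have mm : m <= (n m).+1 by apply: leqW.
  by have [_ _ H] := bg _ _ Mm mm; apply: leq_ltn_trans Lm (H _); exact: nm.
have /choice[k kP] : forall i, exists m, M <= m /\ i < size (w (n m)).
  by move=> i; have [m ? ?] := big i.+1; exists m.
pose c i := nth 0 (w (n (k i))) i.
have cE m i : M <= m -> i < size (w (n m)) -> nth 0 (w (n m)) i = c i.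
  move=> Mm im; have [Mk ik] := kP i; rewrite /c.
  have [mk|/ltnW mk] := leqP m (k i).
    by have [_ /prefixP[r ->] _] := bg _ _ Mm mk; rewrite nth_cat im.
  by have [_ /prefixP[r ->] _] := bg _ _ Mk mk; rewrite nth_cat ik.
apply: (Fc c) => L u /zlim[N NP]; have [m Mm Lm] := big L.
pose m' := maxn m N; have mm' : m <= m' by exact: leq_maxl.
have Mm' : M <= m' := leq_trans Mm mm'.
exists (st_f (s (n m')) (mkseq a (n m').+1), st_g (s (n m')) (mkseq b (n m').+1)).
  by apply: NP; apply: leq_trans (nm m'); exact: leq_maxr.
have [_ pw _] := bg _ _ Mm mm'.
apply: (Fp _ (w (n m'))); last first.
  apply: UF => //; apply: (LAB_mem (ab (n m').+1)); by rewrite size_mkseq.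
apply: prefix_trans pw; rewrite prefixE size_mkseq; apply/eqP.
apply: (@eq_from_nth _ 0); rewrite ?size_mkseq size_takel // => i il.
by rewrite nth_take // nth_mkseq // cE //; exact: leq_trans Lm.
Qed.

Lemma branch_AB z :
  (forall u : nat, es_nb u z -> exists N, forall k, N <= k -> es_nb u ((st_f (s k) (mkseq a k.+1), st_g (s k) (mkseq b k.+1)) : Z)) ->
  (rho eps = (fun=> false) -> B z) /\ (rho eps <> (fun=> false) -> A z).
Proof.
move=> zlim; have [n np] := res_path res eps.
have tyE m : tyB Pp (mkseq eps (n m)) = ~~ has id (mkseq (rho eps) m).
  by have [H _] := np m; rewrite /tyB H.
split=> re.
  have tt m : tyB Pp (mkseq eps (n m)).
    by rewrite tyE re; apply/hasPn => x /mapP[i _ ->].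
  apply: (@branch_limit FB B n 0 z) => //; first by move=> m _; rewrite !tt.
  by move=> m _; exact: (branch_type _).1.
have [m0 m0P] : exists m, rho eps m.
  apply: contrapT => H; apply: re; apply/funext => i.
  by apply/negbTE/negP => ri; apply: H; exists i.
have tt m : m0.+1 <= m -> ~~ tyB Pp (mkseq eps (n m)).
  move=> mm; rewrite tyE negbK; apply/hasP; exists true => //.
  by apply/mapP; exists m0; rewrite ?mem_iota ?add0n.
apply: (@branch_limit FA A n m0.+1 z) => //.
  by move=> m mm; rewrite (negbTE (tt _ mm)) (negbTE (tt _ (leqnn _))).
by move=> m /tt; exact: (branch_type _).2.
Qed.

End Branch.

Lemma rp_nb_lim (V : rpPolish R) (x : nat -> V) l u :
  (forall e, (0 < e)%R -> exists N, forall n, N <= n -> (mdist (x n) l < e)%R) ->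
  rp_nb V u l -> exists N, forall n, N <= n -> rp_nb V u (x n).
Proof.
move=> xl; rewrite /rp_nb ballEmdist /= => lu.
have [|N NP] := xl (fr R (phi0 (phi1 u)) (phi1 (phi1 u)) - mdist (rp_seq V (phi0 u)) l)%R.
  by rewrite subr_gt0.
exists N => n /NP; rewrite -/(fr R _ _).
have := rp_tri (rp_seq V (phi0 u)) l (x n); rewrite (rp_sym l).
by glra.
Qed.

Lemma limit_maps : exists (u : cantor_space -> X) (v : cantor_space -> Y), [/\ continuous u, continuous v &
  forall a b, branches (tree E) (a, b) -> 
    (rho (cshift (symdiff a b)) = (fun=> false) -> B (u a, v b)) /\
    (rho (cshift (symdiff a b)) <> (fun=> false) -> A (u a, v b))].
Proof.
have [|||u [cu ul]] := @limit_map R X (fun n => st_P (s n)) (fun n => st_f (s n)).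
- by move=> n v vn; have [[_ _ _ [_ H _]] _] := sP n; apply: H; rewrite mem_words vn.
- by move=> n v vn; have [_ [_ H _]] := sP n; have [] := H v.
- by move=> n v vn; have [_ [_ H _]] := sP n; have [] := H v.
have [|||v [cv vl]] := @limit_map R Y (fun n => st_Q (s n)) (fun n => st_g (s n)).
- by move=> n v vn; have [[_ _ _ [_ _ H]] _] := sP n; apply: H; rewrite mem_words vn.
- by move=> n v vn; have [_ [_ _ H]] := sP n; have [] := H v.
- by move=> n v vn; have [_ [_ _ H]] := sP n; have [] := H v.
exists u, v; split=> // a b ab; apply: branch_AB => // c [/= uc vc].
have [N1 P1] := rp_nb_lim (ul a) uc; have [N2 P2] := rp_nb_lim (vl b) vc.
exists (maxn N1 N2) => k; rewrite geq_max => /andP[k1 k2].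
by split; [exact: P1|exact: P2].
Qed.

End Limit.
End Slices.

Lemma reduction (A B : set Z) : Sg Z A -> Sg Z B -> cl W C (oadd oone xi) A `&` B !=set0 ->
  exists (u : cantor_space -> X) (v : cantor_space -> Y), [/\ continuous u, continuous v &
  forall a b, branches (tree E) (a, b) ->
    (rho (cshift (symdiff a b)) = (fun=> false) -> B (u a, v b)) /\
    (rho (cshift (symdiff a b)) <> (fun=> false) -> A (u a, v b))].
Proof.
move=> sA sB [z0 [z0A z0B]].
have [FA [A1 A2 A3 A4 A5]] := slices sA; have [FB [B1 B2 B3 B4 B5]] := slices sB.
have [s sP] := stages sA sB A2 B2 A1 B1 A3 B3 z0B z0A.
have H := limit_maps A4 B4 A5 B5 sP; exact: H.
Qed.

End Construction.


(** * Hardness of H *)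

Section Hardness_of_H.

Implicit Types (a b c : nat -> bool).

Definition agr n a b : Prop := forall i, i < n -> a i = b i.

Lemma agr_le m n a b : m <= n -> agr n a b -> agr m a b.
Proof. by move=> mn ab i im; apply: ab; exact: leq_trans mn. Qed.

Lemma agr_mkseq n a b : agr n a b <-> mkseq b n = mkseq a n.
Proof.
split=> [ab|ab i il].
  by apply: (@eq_from_nth _ false); rewrite !size_mkseq // => i il; rewrite !nth_mkseq ?ab.
by have := congr1 (fun s => nth false s i) ab; rewrite /= !nth_mkseq.
Qed.

Definition copen : set (set cantor) := fun U => forall a, U a -> exists n, forall b, agr n a b -> U b.

Definition ccont (f : cantor -> cantor) : Prop :=
  forall j a, exists n, forall b, agr n a b -> f a j = f b j.

Lemma ccont_agr f k a : ccont f -> exists n, forall b, agr n a b -> agr k (f a) (f b).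
Proof.
move=> cf; elim: k => [|k [n IH]]; first by exists 0.
have [m mP] := cf k a; exists (maxn n m) => b ab i; rewrite ltnS leq_eqVlt => /orP[/eqP ->|ik].
  by apply: mP; apply: agr_le ab; exact: leq_maxr.
by apply: IH => //; apply: agr_le ab; exact: leq_maxl.
Qed.

Lemma ccont_open f U : ccont f -> copen U -> copen (f @^-1` U).
Proof.
move=> cf oU a /oU[k kP]; have [n nP] := ccont_agr k a cf.
by exists n => b /nP; exact: kP.
Qed.

Lemma copen_bigcup (F : nat -> set cantor) : (forall n, copen (F n)) -> copen (fun x => exists n, F n x).
Proof. by move=> oF a [n /oF[k kP]]; exists k => b /kP; exists n. Qed.

Lemma copenI U V : copen U -> copen V -> copen (fun x => U x /\ V x).
Proof.
move=> oU oV a [/oU[m mP] /oV[n nP]]; exists (maxn m n) => b ab; split; [apply: mP|apply: nP];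
  apply: agr_le ab; [exact: leq_maxl|exact: leq_maxr].
Qed.

Definition cyl (s : seq bool) : set cantor := fun x => mkseq x (size s) = s.

Lemma cyl_open s : copen (cyl s).
Proof. by move=> a <-; exists (size s) => b /agr_mkseq; rewrite /cyl size_mkseq. Qed.

Lemma cyl_closed s : copen (~` cyl s).
Proof. by move=> a na; exists (size s) => b /agr_mkseq ab; rewrite /setC /cyl /= ab. Qed.

Lemma mem_cyl x n : cyl (mkseq x n) x. Proof. by rewrite /cyl size_mkseq. Qed.

Definition nth_cyl (U : set cantor) (j : nat) : set cantor := fun x =>
  exists2 s, unpickle j = Some s & cyl s `<=` U /\ cyl s x.

Lemma nth_cyl_open U j : copen (nth_cyl U j).
Proof. by move=> a [s js [sU /cyl_open[n nP]]]; exists n => b /nP sb; exists s. Qed.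

Lemma nth_cyl_closed U j : copen (~` nth_cyl U j).
Proof.
move=> a; rewrite /setC /nth_cyl /=; case E : (unpickle j) => [s|] na; last by exists 0 => b _ [].
have [sU|nU] := pselect (cyl s `<=` U); last by exists 0 => b _ [_ [<-] []].
have /cyl_closed[n nP] : (~` cyl s) a by move=> sa; apply: na; exists s.
by exists n => b /nP nb [_ [<-] []].
Qed.

Lemma nth_cylP U : copen U -> forall x, U x <-> exists j, nth_cyl U j x.
Proof.
move=> oU x; split=> [/oU[n nP]|[j [s _ [sU sx]]]]; last exact: sU.
exists (pickle (mkseq x n)), (mkseq x n); first by rewrite pickleK.
by split=> [b|]; [rewrite /cyl size_mkseq => /agr_mkseq/nP|exact: mem_cyl].
Qed.

Lemma Sigma0_ext (T : Type) (tau : set (set T)) eta (S S' : set T) :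
  (forall t : T, S t <-> S' t) -> Sigma0 tau eta S -> Sigma0 tau eta S'.
Proof. by move=> SS; suff -> : S = S' by []; apply/seteqP; split=> t /SS. Qed.

Lemma Sigma0_ge1 (T : Type) (tau : set (set T)) eta S : Sigma0 tau eta S -> ole oone eta.
Proof. by case=> [U _|e zeta F [] //]; exact: ole_refl. Qed.

Lemma Sigma0_one (T : Type) (tau : set (set T)) S : Sigma0 tau oone S -> tau S.
Proof.
move E : oone => e H; case: H E => [U //|e' zeta F + _ E].
by rewrite -E => -[].
Qed.

Lemma Sigma0_big (T : Type) (tau : set (set T)) eta S : olt oone eta -> Sigma0 tau eta S ->
  exists (zeta : nat -> Ord) (F : nat -> set T), [/\ forall n, olt (zeta n) eta,
    forall n, Sigma0 tau (zeta n) (~` F n) & S = \bigcup_n F n].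
Proof.
move=> e1 H; case: H e1 => [U _ []//|e zeta F _ zF _].
by exists zeta, F; split=> // n; have [] := zF n.
Qed.

Lemma Sigma0_pre (T : Type) (tau : set (set T)) (U : Type) (tau' : set (set U)) (h : U -> T) :
  (forall V, tau V -> tau' (h @^-1` V)) ->
  forall eta S, Sigma0 tau eta S -> Sigma0 tau' eta (h @^-1` S).
Proof.
move=> hh; elim/olt_ind => eta IH S sS.
case: (ole_eqVlt (Sigma0_ge1 sS)) => [E|e1]; first by subst eta; apply: Sigma0_open; apply: hh; exact: Sigma0_one.
have [zeta [F [ze sF ->]]] := Sigma0_big e1 sS.
rewrite preimage_bigcup; apply: (Sigma0_bigcup (zeta := zeta)) => // n; split=> //.
by apply: (IH _ (ze n) (~` F n)).
Qed.

Lemma Sigma0_le (T : Type) (tau : set (set T)) eta eta' (S : set T) :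
  (forall U, tau U -> exists2 F : nat -> set T, U = \bigcup_n F n & forall n, tau (~` F n)) ->
  ole eta eta' -> Sigma0 tau eta S -> Sigma0 tau eta' S.
Proof.
move=> tauF /ole_eqVlt[<- //|ee] sS; have e1 := ole_lt_trans (Sigma0_ge1 sS) ee.
case: (ole_eqVlt (Sigma0_ge1 sS)) => [E|e2].
  subst eta; have [F -> oF] := tauF _ (Sigma0_one sS).
  by apply: (Sigma0_bigcup (zeta := fun=> oone)) => // n; split=> //; exact: Sigma0_open.
have [zeta [F [ze sF ->]]] := Sigma0_big e2 sS.
by apply: (Sigma0_bigcup (zeta := zeta)) => // n; split=> //; exact: olt_trans (ze n) ee.
Qed.

Lemma Sigma0_mono eta eta' (S : set cantor) : ole eta eta' -> Sigma0 copen eta S -> Sigma0 copen eta' S.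
Proof.
apply: Sigma0_le => U oU; exists (nth_cyl U); last exact: nth_cyl_closed.
by apply/seteqP; split=> x; rewrite (nth_cylP oU); [move=> [j]; exists j|move=> [j _]; exists j].
Qed.

Lemma Sigma0_setU (T : Type) (tau : set (set T)) eta (S S' : set T) :
  (forall U V, tau U -> tau V -> tau (U `|` V)) ->
  Sigma0 tau eta S -> Sigma0 tau eta S' -> Sigma0 tau eta (S `|` S').
Proof.
move=> tauU sS sS'; case: (ole_eqVlt (Sigma0_ge1 sS)) => [E|e1].
  by subst eta; apply: Sigma0_open; apply: tauU; exact: Sigma0_one.
have [z [F [ze sF ->]]] := Sigma0_big e1 sS; have [z' [F' [ze' sF' ->]]] := Sigma0_big e1 sS'.
apply: (@Sigma0_ext _ _ _ (\bigcup_n (if odd n then F n./2 else F' n./2))).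
  move=> t; split=> [[n _]|[[n _ Fn]|[n _ Fn]]].
  - by case: ifP => _ ?; [left|right]; exists n./2.
  - by exists n.*2.+1 => //; rewrite /= odd_double uphalf_double.
  - by exists n.*2 => //; rewrite odd_double doubleK.
by apply: (Sigma0_bigcup (zeta := fun n => if odd n then z n./2 else z' n./2)) => // n; case: ifP.
Qed.

Lemma copen_const (P : Prop) : copen (fun=> P).
Proof. by move=> a Pa; exists 0. Qed.

Definition brow (k : nat) c : nat -> bool := fun j => c (pairN k j).

Lemma ccont_id : ccont id. Proof. by move=> j a; exists j.+1 => b; apply. Qed.
Lemma ccont_brow k f : ccont f -> ccont (fun z => brow k (f z)).
Proof. by move=> cf j a; have [n nP] := cf (pairN k j) a; exists n. Qed.

(** The rows of c code the members of a union. Each row is tagged with a rank from an enumeration of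
    all ranks between 1 and eta, so one relation handles unions in which the ranks vary. *)
Lemma universal eta : ole oone eta -> exists U : cantor -> cantor -> Prop,
  (forall f g, ccont f -> ccont g -> Sigma0 copen eta (fun z => U (f z) (g z))) /\
  (forall S, Sigma0 copen eta S -> exists c, forall z, S z <-> U c z).
Proof.
elim/olt_ind: eta => eta IH /ole_eqVlt[<-|e1].
  exists (fun c z => exists j, c j /\ cyl (odflt [::] (unpickle j)) z); split.
    move=> f g cf cg; apply/Sigma0_open/copen_bigcup => j; apply: copenI.
      by move=> a fa; have [n nP] := cf j a; exists n => b /nP <-.
    exact: (ccont_open cg (@cyl_open _)).
  move=> S /Sigma0_one oS; exists (fun j => `[<cyl (odflt [::] (unpickle j)) `<=` S>]) => z.
  split=> [/oS[n nP]|[j [/asboolP H]]]; last exact: H.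
  exists (pickle (mkseq z n)); rewrite pickleK; split; last exact: mem_cyl.
  by apply/asboolP => b; rewrite /= /cyl size_mkseq => /agr_mkseq/nP.
pose D := [set th | ole oone th /\ olt th eta].
have [th [thD thS]] : exists th : nat -> Ord, (forall k, D (th k)) /\ forall y, D y -> exists k, th k = y.
  have /countable_injP[f finj] : countable D.
    by apply: sub_countable (countable_ole eta); apply: subset_card_le => x [_ []].
  exists (fun k => if pselect (exists x, D x /\ f x = k) is left h then sval (cid h) else oone); split.
    move=> k; case: pselect => [h|_]; first by have [] := svalP (cid h).
    by split=> //; exact: ole_refl.
  move=> x Dx; exists (f x); case: pselect => [h|[]]; last by exists x.
  by have [Dy fy] := svalP (cid h); apply: finj; rewrite ?inE.
have /choice[U UP] : forall k, exists U : cantor -> cantor -> Prop,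
    (forall f g, ccont f -> ccont g -> Sigma0 copen (th k) (fun z => U (f z) (g z))) /\
    (forall S, Sigma0 copen (th k) S -> exists c, forall z, S z <-> U c z).
  by move=> k; have [? ?] := thD k; exact: IH.
exists (fun c z => exists p, ~ U (phi0 p) (brow p c) z); split.
  move=> f g cf cg.
  apply: (@Sigma0_ext _ _ _ (\bigcup_p [set z | ~ U (phi0 p) (brow p (f z)) (g z)])).
    by move=> t; split=> [[p _ pt]|[p pt]]; exists p.
  apply: (Sigma0_bigcup (zeta := fun p => th (phi0 p))) => // p; split; first by have [] := thD (phi0 p).
  apply: (@Sigma0_ext _ _ _ (fun z => U (phi0 p) (brow p (f z)) (g z))).
    by move=> t; rewrite /setC /=; split=> [h /(_ h)|/contrapT].
  by have [h _] := UP (phi0 p); apply: h => //; exact: ccont_brow.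
move=> S /(Sigma0_big e1)[zeta [F [ze sF ->]]].
have /choice[k kP] : forall n, exists k, th k = zeta n.
  by move=> n; apply: thS; split=> //; exact: Sigma0_ge1 (sF n).
have /choice[c cP] : forall p, exists c, forall z, U (phi0 p) c z <-> (k (phi1 p) = phi0 p -> ~ F (phi1 p) z).
  move=> p; have [_ h] := UP (phi0 p); have [E|nE] := pselect (k (phi1 p) = phi0 p).
    have [|c cP] := h (~` F (phi1 p)); first by rewrite -E kP.
    by exists c => z; rewrite -cP; split=> // /(_ E).
  (* A row whose tag does not match codes the whole space, whose complement adds nothing to the
     union. *)
  have [|c cP] := h setT.
    by apply: Sigma0_mono (thD _).1 _; apply: Sigma0_open; exact: copen_const.
  by exists c => z; rewrite -cP; split=> // _ /nE.
exists (fun j => c (phi0 j) (phi1 j)) => z.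
have cE p : brow p (fun j => c (phi0 j) (phi1 j)) = c p by apply/funext => j; rewrite /brow pairNK.
split=> [[n _ Fn]|[p]].
  by exists (pairN (k n) n); rewrite cE cP pairNK /= => /(_ erefl).
rewrite cE cP => H; exists (phi1 p) => //; apply: contrapT => nF.
by apply: H.
Qed.

Lemma Sigma0_not_Pi0 eta : ole oone eta -> exists S, Sigma0 copen eta S /\ ~ Sigma0 copen eta (~` S).
Proof.
move=> /universal[U [U1 U2]]; exists (fun z => U z z); split; first exact: U1 ccont_id ccont_id.
by move=> /U2[c /(_ c)]; rewrite /setC /=; tauto.
Qed.

(** * Realizing sets at single output coordinates *)

Section Realize.
Implicit Types (r : cantor -> cantor) (J : nat -> set nat).

(* Only the input coordinates in J i are controlled, so that realizations at
   different coordinates can be combined when the sets J i are disjoint. *)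
Definition Real r J i (D : set cantor) : Prop := exists2 f, ccont f &
  forall e x, (forall j, J i j -> e j = f x j) -> (r e i <-> D x).

(** S is a union of sets recognized by output coordinates of r. These are prescribed by an arbitrary
    injection, so that they can all be placed in one column for [rho0] to read. *)
Definition Base theta r J : Prop := forall S (k : nat -> nat), Sigma0 copen (oadd oone theta) S -> injective k ->
  exists D : nat -> set cantor, (forall x, S x <-> exists j, D j x) /\ forall j, Real r J (k j) (D j).

Definition Jdisj J : Prop := forall i i' j, J i j -> J i' j -> i = i'.

Lemma Real_all r J (k : nat -> nat) (D : nat -> set cantor) : Jdisj J -> injective k ->
  (forall j, Real r J (k j) (D j)) -> exists2 f, ccont f &
    forall e x, (forall j l, J (k j) l -> e l = f x l) -> forall j, r e (k j) <-> D j x.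
Proof.
move=> dJ ik H.
have /choice[f fP] : forall j, exists f, ccont f /\ forall e x, (forall l, J (k j) l -> e l = f x l) -> (r e (k j) <-> D j x).
  by move=> j; have [f ? ?] := H j; exists f.
pose w l := if pselect (exists j, J (k j) l) is left h then Some (sval (cid h)) else None.
have wE j l : J (k j) l -> w l = Some j.
  move=> jl; rewrite /w; case: pselect => [h|[]]; last by exists j.
  by congr Some; apply: ik; apply: dJ (svalP (cid h)) jl.
exists (fun x l => if w l is Some j then f j x l else false).
  move=> l a; case E : (w l) => [j|]; last by exists 0.
  by have [n nP] := (fP j).1 l a; exists n.
by move=> e x ex j; apply: (fP j).2 => l jl; rewrite (ex _ _ jl) (wE _ _ jl).
Qed.

Lemma Base_id : Base ozero id (fun i => [set i]).
Proof.
move=> S k; rewrite oadd0 => /Sigma0_one oS ik.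
exists (nth_cyl S); split; first exact: nth_cylP.
move=> j; exists (fun x _ => `[<nth_cyl S j x>]).
  move=> l a; have [/[dup] na /nth_cyl_open[n nP]|na] := pselect (nth_cyl S j a).
    by exists n => b /nP nb; rewrite !asboolT.
  by have [n nP] := nth_cyl_closed na; exists n => b /nP nb; rewrite !asboolF.
move=> e x /= ->//; split=> [/asboolP//|h]; exact/asboolP.
Qed.

(** The complement of S is spread over column i, and [rho0] asks that the whole column be empty. *)
Lemma rho0P r J theta i S : Jdisj J -> Base theta r J -> Sigma0 copen (oadd oone theta) (~` S) ->
  Real (rho0 \o r) (fun i j => exists l, J (pairN i l) j) i S.
Proof.
move=> dJ bJ sS; have [|D [SD rD]] := bJ _ (pairN i) sS.
  by move=> l l' /(congr1 phi); rewrite !pairNK => -[].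
have [|f cf fP] := Real_all dJ _ rD.
  by move=> l l' /(congr1 phi); rewrite !pairNK => -[].
exists f => // e x ex; have H := fP e x (fun j l Jl => ex l (ex_intro _ j Jl)).
rewrite /rho0 /=; split=> [/asboolP h|Sx].
  by apply: contrapT => /SD[j /H]; rewrite h.
by apply/asboolP => j; apply/negbTE/negP => /H Dj; have /(_ Sx) : (~` S) x by apply/SD; exists j.
Qed.

End Realize.

Lemma oadd_cofinal x (s : nat -> Ord) z : s 0 = ozero -> olt z (oadd x (osup s)) ->
  exists k, olt z (oadd x (s k)).
Proof.
move=> s0 zl; apply: contrapT => H.
have sz k : ole (oadd x (s k)) z.
  by have [//|/oltNle h] := pselect (ole (oadd x (s k)) z); case: H; exists k.
have [_ _ least] := oaddP x (osup s); have /oltNle := zl; apply; apply: least.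
  by have := sz 0; rewrite s0 oadd0.
move=> y yl; have [k yk] : exists k, olt y (s k).
  apply: contrapT => Hy; have /oltNle := yl; apply; apply: osup_least => k.
  by have [//|/oltNle h] := pselect (ole (s k) y); case: Hy; exists k.
exact: olt_le_trans (oadd_lt2 x yk) (sz k).
Qed.

Section Hardness.
Variables (fs : Ord -> nat -> Ord) (hfs : limit_choice fs).
Local Notation rho := (rho fs).

(** The last clause serves at limits, where output coordinate k is coordinate 0 of a map of nonzero
    rank applied after k stages. *)
Definition lifts eta theta (r : cantor -> cantor) (J J' : nat -> set nat) : Prop :=
  [/\ Jdisj J', forall i j, J' i j -> exists i', J i' j,
    Base (oadd theta eta) (rho eta \o r) J' &
    eta <> ozero -> forall i S, Sigma0 copen (oadd oone theta) (~` S) -> Real (rho eta \o r) J' i S].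

Section Limit.
Variables (l theta : Ord) (r : cantor -> cantor) (J : nat -> set nat).
Hypotheses (ll : olimit l) (dJ : Jdisj J) (bJ : Base theta r J).
Hypothesis IH : forall k theta r J, Jdisj J -> Base theta r J -> exists J', lifts (fs l k) theta r J J'.
Local Notation s := (opsum (fs l)).

(** The coordinates from k on after the first k stages; applying the next map and reading coordinate
    0 gives coordinate k of the limit. *)
Fixpoint tail_map k : cantor -> cantor :=
  if k is m.+1 then fun e i => rho (fs l m) (tail_map m e) i.+1 else r.

Lemma rho_limE e k : rho l (r e) k = rho (fs l k) (tail_map k e) 0.
Proof.
rewrite (rho_lim hfs ll) /rho_limit.
have H m : forall i, rho_upto (fun k => rho (fs l k)) m (r e) (i + m) = tail_map m e i.
  elim: m => [|m IHm] i; first by rewrite addn0.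
  rewrite /= /rho_step ifF; last by rewrite addnS ltnNge ltnW // ltnS leq_addl.
  rewrite addnS -addSn addnK; congr (rho _ _ _).
  by apply/funext => j; exact: IHm.
rewrite /= /rho_step ltnn subnn; congr (rho _ _ _).
by apply/funext => j; exact: H.
Qed.

Lemma Base_limit : exists J', lifts l theta r J J'.
Proof.
have /choice[F FP] : forall p : nat * (nat -> set nat), exists J', Jdisj p.2 ->
    Base (oadd theta (s p.1)) (tail_map p.1) p.2 ->
    lifts (fs l p.1) (oadd theta (s p.1)) (tail_map p.1) p.2 J'.
  move=> [k J1] /=; have [[d b]|n] := pselect (Jdisj J1 /\ Base (oadd theta (s k)) (tail_map k) J1).
    by have [J' ?] := IH k d b; exists J'.
  by exists J1 => d b; case: n.
(* [JG k] controls the input of stage k: its part at coordinate 0 is spent on output k, and the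
   parts at positive coordinates are passed on, shifted by one, to stage k + 1. *)
pose JT := fix JT k := if k is m.+1 then fun i => F (m, JT m) i.+1 else J.
pose JG k := F (k, JT k).
have inv k : Jdisj (JT k) /\ Base (oadd theta (s k)) (tail_map k) (JT k).
  elim: k => [|k [d b]]; first by rewrite oadd0.
  have [h1 h2 h3 h4] := FP (k, JT k) d b; split=> /=.
    by move=> i i' j a1 a2; have [] := h1 _ _ _ a1 a2.
  move=> S q sS iq; have [||D [SD rD]] := h3 S (succn \o q).
  - by rewrite -oaddA.
  - by move=> ? ? [/iq].
  by exists D; split=> // j; have [f cf fP] := rD j; exists f.
have spec k := FP (k, JT k) (inv k).1 (inv k).2.
have JTsub k i j : JT k i j -> exists i', J i' j.
  elim: k i => [|k IHk] i /=; first by exists i.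
  by have [_ h _ _] := spec k => /h[i' /IHk].
have JTlt k m i j : JT (m + k.+1) i j -> exists i', JG k i'.+1 j.
  elim: m i => [|m IHm] i /=; first by exists i.
  by have [_ h _ _] := spec (m + k.+1) => /h[i' /IHm].
have JGlt k k' j : k < k' -> JG k 0 j -> ~ JG k' 0 j.
  move=> kk a1 a2; have [_ h _ _] := spec k'; have [i' a3] := h _ _ a2.
  have [i a4] := @JTlt k (k' - k.+1) i' j ltac:(by rewrite subnK).
  by have [hd _ _ _] := spec k; have := hd _ _ _ a1 a4.
have realE k S : Real (rho (fs l k) \o tail_map k) (JG k) 0 S -> Real (rho l \o r) (fun k => JG k 0) k S.
  by move=> [f cf fP]; exists f => // e x /fP; rewrite /= rho_limE.
have full k S : Sigma0 copen (oadd oone (oadd theta (s k))) (~` S) -> Real (rho l \o r) (fun k => JG k 0) k S.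
  move=> sS; apply: realE; have [_ _ _ h] := spec k; apply: h => // E.
  by have [/(_ k)[[_]]] := hfs ll; rewrite E.
have full0 k S : Sigma0 copen (oadd oone theta) (~` S) -> Real (rho l \o r) (fun k => JG k 0) k S.
  by move=> sS; apply: full; apply: Sigma0_mono sS; apply: oadd_le2; exact: ole_addl.
exists (fun k => JG k 0); split=> //.
- move=> k k' j a1 a2; case: (ltngtP k k') => // kk; exfalso.
    exact: JGlt kk a1 a2.
  exact: JGlt kk a2 a1.
- by move=> k j; have [_ h _ _] := spec k => /h[i' /JTsub].
move=> S q sS iq; have l1 : olt oone (oadd oone (oadd theta l)).
  rewrite -[X in olt X _]oadd0; apply: oadd_lt2.
  exact: olt_le_trans (ozero_lt ll.1) (ole_addr _ _).
have [zeta [F' [ze sF ->]]] := Sigma0_big l1 sS.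
(* Index j offers the set [F' (phi0 j)] to coordinate q j. It is accepted if the stage has reached
   the rank of that set, and replaced by the empty set otherwise. *)
pose ok j := ole (zeta (phi0 j)) (oadd oone (oadd theta (s (q j)))).
exists (fun j => if pselect (ok j) then F' (phi0 j) else set0); split.
  move=> x; split=> [[n _ Fn]|[j]]; last first.
    by case: (pselect (ok j)) => [? Fx|? []]; exists (phi0 j).
  have [k kP] : exists k, olt (zeta n) (oadd (oadd oone theta) (s k)).
    apply: oadd_cofinal => //; have [_] := hfs ll; rewrite /osum => ->.
    by rewrite -oaddA.
  (* Infinitely many indices offer F' n and q is injective, so one of them is sent to a coordinate
     at or beyond k. *)
  have [j [jn kj]] : exists j, phi0 j = n /\ k <= q j.
    apply: contrapT => H.
    have small i : q (pairN n i) < k.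
      by rewrite ltnNge; apply/negP => ki; apply: H; exists (pairN n i); rewrite pairNK.
    have inj : injective (fun i : 'I_k.+1 => Ordinal (small i)).
      by move=> i i' [/iq/(congr1 phi)]; rewrite !pairNK => -[/val_inj].
    by have := leq_card _ inj; rewrite !card_ord ltnn.
  exists j; case: (pselect (ok j)) => [?|[]]; first by rewrite jn.
  rewrite /ok jn oaddA; apply: ole_trans kP.1 _; apply: oadd_le2.
  have /subnK <- := kj; elim: (q j - k) => [|m IHm]; first exact: ole_refl.
  by rewrite addSn; apply: ole_trans IHm _; exact: ole_addl.
move=> j; case: (pselect (ok j)) => [okj|?].
  by apply: full; apply: Sigma0_mono okj _.
apply: full0; rewrite setC0; apply: Sigma0_mono (ole_addl _ _) _.
by apply: Sigma0_open; exact: copen_const.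
Qed.

End Limit.

Lemma Base_rho eta : forall theta r J, Jdisj J -> Base theta r J -> exists J', lifts eta theta r J J'.
Proof.
elim/olt_ind: eta => eta IH theta r J dJ bJ; case: (ord_cases eta) => [->|[zeta eE]|el].
- by exists J; rewrite /lifts oadd0 rho_zero; split=> // i j; exists i.
- subst eta; have [J1 [d1 s1 b1 _]] := IH _ (osucc_gt zeta) _ _ _ dJ bJ.
  have R i S : Sigma0 copen (oadd oone (oadd theta zeta)) (~` S) ->
      Real (rho (osucc zeta) \o r) (fun i j => exists l, J1 (pairN i l) j) i S.
    by rewrite rho_succ => sS; exact: rho0P d1 b1 sS.
  exists (fun i j => exists l, J1 (pairN i l) j); split.
  + by move=> i i' j [k a1] [k' a2]; have := d1 _ _ _ a1 a2 => /(congr1 phi); rewrite !pairNK => -[].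
  + by move=> i j [k /s1].
  + move=> S q; rewrite !oaddS => sS iq.
    have [|zeta' [F [ze sF ->]]] := Sigma0_big _ sS; first by apply/olt_succ; exact: ole_addl.
    exists F; split=> [x|j]; first by split=> [[n _]|[n]]; exists n.
    by apply: R; apply: Sigma0_mono (sF j); apply/olt_succ.
  + move=> _ i S sS; apply: R; apply: Sigma0_mono sS; apply: oadd_le2; exact: ole_addl.
- by apply: Base_limit => // k th r' J'; apply: IH; have [/(_ k)[]] := hfs el.
Qed.

(** Pulling H back along the realizing map f would make the complement of an arbitrary
    Sigma^0_(1+xi) set again Sigma^0_(1+xi). *)
Lemma setH_hard xi : ~ Sigma0 copen (oadd oone xi) (setH fs xi).
Proof.
move=> sH; have [|S [sS nS]] := @Sigma0_not_Pi0 (oadd oone xi); first exact: ole_addl.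
have dI : Jdisj (fun i => [set i]) by move=> i i' j /= -> ->.
have [J [dJ _ bJ _]] := Base_rho xi dI Base_id.
have [||D [SD rD]] := bJ S id.
- by rewrite oadd0l.
- by [].
have [|f cf fP] := Real_all dJ _ rD; first by [].
apply: nS; apply: Sigma0_ext (Sigma0_pre (h := f) _ sH); last by move=> V; exact: ccont_open.
move=> x; have H := fP (f x) x (fun _ _ _ => erefl); rewrite /setH /preimage /setC /=; split.
  by move=> E /SD[j /H]; rewrite /= E.
by move=> nx; apply/funext => j; apply/negbTE/negP => /H Dj; apply: nx; apply/SD; exists j.
Qed.

End Hardness.

End Hardness_of_H.


(** * Lusin separation and the Baire property *)

Lemma open_copen (U : set cantor_space) : open U -> copen U.
Proof.
move=> oU a Ua.
pose F : set_system cantor_space := [set S | exists n, forall b, agr n a b -> S b].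
have FF : Filter F.
  split; first by exists 0.
    move=> P Q [m mP] [n nQ]; exists (maxn m n) => b ab; split; [apply: mP|apply: nQ];
      apply: agr_le ab; [exact: leq_maxl|exact: leq_maxr].
  by move=> P Q PQ [n nP]; exists n => b /nP/PQ.
have cF : F --> (a : cantor_space).
  apply/cvg_sup => i V [V'] [[W] oW <-] Wa WV.
  by exists i.+1 => b ab; apply: WV; rewrite /= -ab.
have /cF[n nP] : nbhs (a : cantor_space) U by exact: open_nbhs_nbhs.
by exists n.
Qed.

(** * Lusin separation over a sigma-algebra *)

Section Separation.
Context {T : Type} (M : set (set T)).
Hypothesis hM : sigma_algebra setT M.

Lemma sigma0 : M set0. Proof. by case: hM. Qed.
Lemma sigmaC S : M S -> M (~` S). Proof. by case: hM => _ h _ /h; rewrite setTD. Qed.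
Lemma sigmaU (F : nat -> set T) : (forall n, M (F n)) -> M (\bigcup_n F n).
Proof. by case: hM => _ _ h; exact: h. Qed.
Lemma sigmaI (F : nat -> set T) : (forall n, M (F n)) -> M (\bigcap_n F n).
Proof.
move=> MF; rewrite -[\bigcap_n _]setCK setC_bigcap; apply: sigmaC; apply: sigmaU => n.
exact: sigmaC.
Qed.
Lemma sigmaT : M setT. Proof. by rewrite -setC0; apply: sigmaC; exact: sigma0. Qed.

Definition msep (A B : set T) : Prop := exists2 C, M C & A `<=` C /\ C `<=` ~` B.

Lemma msep_split (P Q : seq nat -> set T) s t :
  P s `<=` \bigcup_i P (rcons s i) -> Q t `<=` \bigcup_i Q (rcons t i) ->
  (forall i j, msep (P (rcons s i)) (Q (rcons t j))) -> msep (P s) (Q t).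
Proof.
move=> Ps Qt H; have /choice[C CP] : forall p : nat * nat, exists C, [/\ M C, P (rcons s p.1) `<=` C & C `<=` ~` Q (rcons t p.2)].
  by move=> p; have [C ? [? ?]] := H p.1 p.2; exists C.
exists (\bigcup_i \bigcap_j C (i, j)).
  by apply: sigmaU => i; apply: sigmaI => j; have [] := CP (i, j).
split=> x; first by move=> /Ps[i _ Pi]; exists i => // j _; have [_ h _] := CP (i, j); exact: h.
by move=> [i _ Ci] /Qt[j _ Qj]; have [_ _ h] := CP (i, j); exact: h (Ci j I) Qj.
Qed.

(** If all pieces could be separated, so could the whole sets by a countable union of countable
    intersections; hence inseparability descends along two branches. *)
Lemma lusin (P Q : seq nat -> set T) : (forall s, P s `<=` \bigcup_i P (rcons s i)) ->
  (forall t, Q t `<=` \bigcup_i Q (rcons t i)) -> ~ msep (P [::]) (Q [::]) ->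
  exists a b, forall n, ~ msep (P (mkseq a n)) (Q (mkseq b n)).
Proof.
move=> Ps Qs nPQ.
have /choice[F FP] : forall st : seq nat * seq nat, exists p : nat * nat, ~ msep (P st.1) (Q st.2) ->
    ~ msep (P (rcons st.1 p.1)) (Q (rcons st.2 p.2)).
  move=> [s t] /=; have [h|h] := pselect (msep (P s) (Q t)); first by exists (0, 0).
  suff [[i j] ij] : exists p : nat * nat, ~ msep (P (rcons s p.1)) (Q (rcons t p.2)) by exists (i, j).
  apply: contrapT => nh; apply: h; apply: msep_split => // i j.
  by apply: contrapT => ij; apply: nh; exists (i, j).
pose st := fix st n := if n is m.+1 then (rcons (st m).1 (F (st m)).1, rcons (st m).2 (F (st m)).2) else ([::], [::]).
exists (fun n => (F (st n)).1), (fun n => (F (st n)).2) => n.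
have [-> ->] : mkseq (fun n => (F (st n)).1) n = (st n).1 /\ mkseq (fun n => (F (st n)).2) n = (st n).2.
  by elim: n => // n [h1 h2]; rewrite !mkseqS h1 h2.
by elim: n => // n /FP.
Qed.

(** An analytic presentation of A: along a branch of nonempty pieces the pieces converge to a point
    of A in the coarse topology [op], the only one in which separation is needed. *)
Definition shrinking (op : set (set T)) (P : seq nat -> set T) (A : set T) : Prop :=
  (forall s, P s `<=` \bigcup_i P (rcons s i)) /\
  forall a, (forall n, P (mkseq a n) !=set0) -> exists2 x, A x &
    forall O, op O -> O x -> exists N, forall n, N <= n -> P (mkseq a n) `<=` O.

Lemma shrinking_sep (op : set (set T)) (P Q : seq nat -> set T) (A B : set T) :
  op `<=` M -> (forall x y : T, x <> y -> exists O O', [/\ op O, op O', O x, O' y & O `&` O' = set0]) ->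
  shrinking op P A -> shrinking op Q B -> A `&` B = set0 -> msep (P [::]) (Q [::]).
Proof.
move=> opM haus [Ps Pa] [Qs Qb] AB; apply: contrapT => /lusin[//|//|a [b nab]].
have [|x Ax Px] := Pa a.
  move=> n; apply/set0P/eqP => E; apply: (nab n); exists set0; first exact: sigma0.
  by rewrite E; split=> // x [].
have [|y By Qy] := Qb b.
  move=> n; apply/set0P/eqP => E; apply: (nab n); exists setT; first exact: sigmaT.
  by rewrite E; split=> // z _ [].
have [|O [ O' [oO oO' Ox O'y OO]]] := haus x y.
  by move=> xy; subst y; have : (A `&` B) x by []; rewrite AB.
have [N1 h1] := Px _ oO Ox; have [N2 h2] := Qy _ oO' O'y.
apply: (nab (maxn N1 N2)); exists O; first exact: opM.
split; first by apply: h1; exact: leq_maxl.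
move=> z Oz /h2 O'z; have : (O `&` O') z by split=> //; apply: O'z; exact: leq_maxr.
by rewrite OO.
Qed.

End Separation.

Section MetricPieces.
Context (R : realType) (T : Type) (d : T -> T -> R) (r : nat -> T).
Hypotheses (dm : is_metric d) (dc : metric_complete d).
Hypothesis rd : forall x (e : R), (0 < e)%R -> exists i, (d x (r i) < e)%R.
Variables (op : set (set T)) (G : seq nat -> set T) (A : set T).
Hypothesis fine_op : forall O x, op O -> O x -> exists2 e, (0 < e)%R & forall y, (d x y < e)%R -> O y.
Hypotheses (Gs : forall s, G s `<=` \bigcup_i G (rcons s i)) (Gp : forall s t, prefix s t -> G t `<=` G s).
Hypothesis Gc : forall a x, (forall n (e : R), (0 < e)%R -> exists2 y, G (mkseq a n) y & (d x y < e)%R) -> A x.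

(** Each entry of s pairs a choice in the scheme G with a point of the dense sequence within 1 / (k
    + 1) of x; the second part makes the diameters vanish. *)
Definition pieces s : set T := fun x => G (map (fun k => phi0 k) s) x /\
  forall k, k < size s -> (d x (r (phi1 (nth 0 s k))) < iv R k)%R.

Lemma iv_gt0 n : (0 < iv R n)%R. Proof. by rewrite /iv invr_gt0. Qed.

Lemma pieces_shrinking : shrinking op pieces A.
Proof.
have [d0 dsym dtri] := dm; split=> [s x [/Gs[i _ Gi] H]|a ne].
  have [j jP] := @rd x _ (iv_gt0 (size s)); exists (pairN i j) => //; split.
    by rewrite map_rcons pairNK.
  move=> k; rewrite size_rcons ltnS leq_eqVlt nth_rcons => /orP[/eqP ->|ks].
    by rewrite ltnn eqxx pairNK.
  by rewrite ks; exact: H.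
have /choice[x xP] : forall n, exists x, pieces (mkseq a n) x by move=> n; exact: ne.
have near k n y : k < n -> pieces (mkseq a n) y -> (d y (r (phi1 (a k))) < iv R k)%R.
  by move=> kn [_ /(_ k)]; rewrite size_mkseq nth_mkseq //; apply.
have near2 k m n y z : k < m -> k < n -> pieces (mkseq a m) y -> pieces (mkseq a n) z -> (d y z < iv R k + iv R k)%R.
  move=> km kn /(near _ _ _ km) h1 /(near _ _ _ kn); rewrite dsym => h2.
  have := dtri y (r (phi1 (a k))) z; move: h1 h2; move: (iv R k) (d y z) => ? ?; lra.
have [|l lP] := dc (x := x).
  move=> e /small_inv2[k kP]; exists k.+1 => m n km kn; apply: lt_trans kP.
  by apply: near2 (xP m) (xP n).
exists l.
  apply: (@Gc (fun k => phi0 (a k))) => n e e0; have [N NP] := lP e e0.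
  exists (x (maxn n N)); last by rewrite dsym; apply: NP; exact: leq_maxr.
  have [Gx _] := xP (maxn n N); apply: Gp Gx.
  have -> : map (fun k => phi0 k) (mkseq a (maxn n N)) = mkseq (fun k => phi0 (a k)) (maxn n N) by rewrite /mkseq -map_comp.
  by rewrite prefixE size_mkseq mkseq_take // leq_maxl.
move=> O oO Ol; have [e e0 eO] := fine_op oO Ol.
have [|k kP] := @small_inv2 R (e / 2)%R; first by rewrite divr_gt0.
have [|N NP] := lP (e / 2)%R; first by rewrite divr_gt0.
exists k.+1 => n kn y yP; apply: eO.
have h1 := NP (maxn k.+1 N) (leq_maxr _ _).
have h2 := near2 k _ _ _ _ (leq_maxl k.+1 N) kn (xP _) yP.
have := dtri l (x (maxn k.+1 N)) y; rewrite (dsym l (x _)).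
by move: h1 h2 kP; move: (iv R k) (d (x _) _) (d (x _) _) (d l y) => ? ? ? ?; lra.
Qed.

End MetricPieces.

Section BorelFiner.
Context (R : realType) (X : metricType R).

Lemma open_metric (O : set X) x : open O -> O x -> exists2 e, (0 < e)%R & forall y, (mdist x y < e)%R -> O y.
Proof.
move=> oO Ox; have /nbhs_ballP[e /= e0 eO] : nbhs x O by exact: open_nbhs_nbhs.
by exists e => // y xy; apply: eO; rewrite ballEmdist.
Qed.

Lemma metric_sep (x y : X) : x <> y -> exists O O', [/\ open O, open O', O x, O' y & O `&` O' = set0].
Proof.
move=> /eqP xy; have := @metric_hausdorff R X; rewrite open_hausdorff => /(_ _ _ xy).
by move=> [[U V] /= [/set_mem Ux /set_mem Vy] [oU oV /eqP UV]]; exists U, V.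
Qed.

Variables (M : set (set X)).
Hypotheses (hM : sigma_algebra setT M) (openM : @open X `<=` M).

Lemma separable_seq (T : Type) (d : T -> T -> R) (t : T) : metric_separable d ->
  exists r : nat -> T, forall x (e : R), (0 < e)%R -> exists i, (d x (r i) < e)%R.
Proof.
move=> [D /countable_injP[f fi] dD].
exists (fun n => if pselect (exists x, D x /\ f x = n) is left h then sval (cid h) else t).
move=> x e /(dD x)[y Dy xy]; exists (f y); case: pselect => [h|[]]; last by exists y.
have [Dz fz] := svalP (cid h).
by have -> : sval (cid h) = y by apply: fi; rewrite ?inE.
Qed.

(** A sigma-open V is the union of the sigma-closed sets of points at distance at least 1 / (n + 1)
    from its complement. Each is separated from the complement within M: branches converge in the
    complete metric of sigma, and their limits are separated by original open sets. *)
Lemma finer_sub (sigma : set (set X)) : @open X `<=` sigma -> polish R sigma -> sigma `<=` M.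
Proof.
move=> os [d [dm dc ds sE]] V sV; have [d0 dsym dtri] := dm.
have [[t _]|nX] := pselect (exists t : X, True); last first.
  have -> : V = set0 by apply/seteqP; split=> // x _; case: nX; exists x.
  exact: sigma0.
have [r rd] := separable_seq t ds.
have fine_op (O : set X) x : open O -> O x -> exists2 e, (0 < e)%R & forall y, (d x y < e)%R -> O y.
  by move=> /os; rewrite sE => h /h.
have sep (F K : set X) : (forall x, (forall e : R, (0 < e)%R -> exists2 y, F y & (d x y < e)%R) -> F x) ->
    (forall x, (forall e : R, (0 < e)%R -> exists2 y, K y & (d x y < e)%R) -> K x) ->
    F `&` K = set0 -> exists2 C, M C & F `<=` C /\ C `<=` ~` K.
  have sh (F' : set X) : (forall x, (forall e : R, (0 < e)%R -> exists2 y, F' y & (d x y < e)%R) -> F' x) ->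
      shrinking open (pieces d r (fun=> F')) F'.
    move=> cF; apply: pieces_shrinking => //.
    - by move=> s x Fx; exists 0.
    - by move=> s t' _ x.
    - by move=> a x /(_ 0); exact: cF.
  move=> /sh sF /sh sK FK; have [C MC [h1 h2]] := shrinking_sep hM openM metric_sep sF sK FK.
  by exists C => //; split=> [x Fx|x /h2 nK Kx]; [apply: h1; split|apply: nK; split].
have /choice[C CP] : forall n, exists C, [/\ M C, (fun x => forall y, ~ V y -> (iv R n <= d x y)%R) `<=` C & C `<=` V].
  move=> n; have [|||C MC [h1 h2]] := sep (fun x => forall y, ~ V y -> (iv R n <= d x y)%R) (~` V).
  - move=> x H y nV; rewrite leNgt; apply/negP => xy.
    have [|z Fz xz] := H (iv R n - d x y)%R; first by rewrite subr_gt0.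
    have := Fz _ nV; have := dtri z x y; rewrite (dsym z x); move: xz; move: (iv R n) (d x z) (d z y) (d x y) => ? ? ? ?; lra.
  - move=> x H Vx; move: sV; rewrite sE => /(_ x Vx)[e e0 eV].
    by have [y nV /eV] := H e e0.
  - apply/seteqP; split=> // x [/(_ x) h /h]; have -> : (d x x = 0)%R by apply/d0.
    by rewrite leNgt iv_gt0.
  by exists C; split=> // x /h2; apply: contrapT.
have -> : V = \bigcup_n C n.
  apply/seteqP; split=> [x Vx|x [n _]]; last by have [_ _] := CP n; exact.
  have [e e0 eV] : exists2 e, (0 < e)%R & forall y, (d x y < e)%R -> V y by move: sV; rewrite sE; exact.
  have [n nP] := small_inv e0; exists n => //; have [_ h _] := CP n; apply: h => y nV.
  rewrite leNgt; apply/negP => xy; apply: nV; apply: eV; exact: lt_trans nP.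
by apply: (sigmaU hM) => n; have [] := CP n.
Qed.

End BorelFiner.

Section DeltaBorel.
Context (R : realType) (X : rpPolish R).
Local Notation EX := (ESpace (rp_naming X)).
Variables (M : set (set X)).
Hypotheses (hM : sigma_algebra setT M) (openM : @open X `<=` M).

(** Suslin's theorem: A and its complement both have shrinking schemes, so the separating member of
    M is A itself. *)
Lemma Delta_sub (A : set X) : Sg EX A -> Pg EX A -> M A.
Proof.
have sh (S : set X) : Sg EX S -> exists2 P, shrinking open P S & forall x, S x -> P [::] x.
  move=> /slices[F [Fn _ Fs Fp Fc]].
  exists (pieces (@mdist R X) (rp_seq X) F); last by move=> x Sx; split=> //; apply/Fn.
  apply: pieces_shrinking.
  - by split; [move=> x y; split=> [/mdist_positivity|->]; rewrite ?mdistxx|exact: rp_sym|exact: rp_tri].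
  - exact: rp_complete.
  - by move=> x e /(@rp_close R X x)[i]; rewrite rp_sym; exists i.
  - exact: open_metric.
  - by move=> s x /Fs[i]; exists i.
  - by move=> s t /Fp h x; exact: h.
  move=> a x H; apply: (Fc a) => n u; rewrite /= /rp_nb !ballEmdist /= => ux.
  have [|y Fy xy] := H n (fr R (phi0 (phi1 u)) (phi1 (phi1 u)) - mdist (rp_seq X (phi0 u)) x)%R.
    by rewrite subr_gt0.
  exists y => //=; have := rp_tri (rp_seq X (phi0 u)) x y; move: xy; rewrite -/(fr R _ _); glra.
move=> /sh[P sP Pn] /sh[Q sQ Qn].
have [|C MC [h1 h2]] := shrinking_sep hM openM (@metric_sep R X) sP sQ; first exact: setICr.
suff -> : A = C by [].
apply/seteqP; split=> x; first by move=> /Pn/h1.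
by move=> /h2 nQ; apply: contrapT => /Qn.
Qed.

End DeltaBorel.

(** * Baire category in the Cantor space *)

Definition cdense (D : set cantor) : Prop := forall a n, exists b, agr n a b /\ D b.

(** The Baire property, with the exceptional meager set given through dense open sets that avoid
    it. *)
Definition BP (S : set cantor) : Prop := exists O D, [/\ copen O,
  forall n, copen (D n) /\ cdense (D n) & forall a, (forall n : nat, D n a) -> (S a <-> O a)].

Lemma BP_sigma : sigma_algebra setT BP.
Proof.
split.
- exists set0, (fun=> setT); split=> //.
  by move=> n; split=> [a _|a n']; [exists 0|exists a].
- move=> S [ O [D [oO hD SO]]]; rewrite setTD.
  pose O' : set cantor := fun a => exists n, forall b, agr n a b -> ~ O b.
  have oO' : copen O'.
    move=> a [n nP]; exists n => b ab; exists n => c bc; apply: nP => i il.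
    by rewrite ab // bc.
  exists O', (fun n => if n is m.+1 then D m else fun a => O a \/ O' a); split=> //.
    move=> [|n]; last exact: hD.
    split=> [a [/oO[n nP]|/oO'[n nP]]|a n]; first by exists n => b /nP; left.
      by exists n => b /nP; right.
    have [[b [ab Ob]]|nb] := pselect (exists b, agr n a b /\ O b); first by exists b; split=> //; left.
    exists a; split=> //; right; exists n => b ab Ob; apply: nb; by exists b.
  move=> a Da; have SOa := SO a (fun n => Da n.+1); split=> [nS|[n nP] /SOa].
    by case: (Da 0) => // /SOa /nS.
  exact: nP.
- move=> F BF; have /choice[ O OP] : forall n, exists O, exists D, [/\ copen O,
    forall n, copen (D n) /\ cdense (D n) & forall a, (forall n : nat, D n a) -> (F n a <-> O a)] by [].
  have /choice[D DP] := OP.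
  exists (fun x => exists n, O n x), (fun p => D (phi0 p) (phi1 p)); split.
  + by apply: copen_bigcup => n; have [] := DP n.
  + by move=> p; have [_ h _] := DP (phi0 p); exact: h.
  move=> a Da; have H n : F n a <-> O n a.
    by have [_ _ h] := DP n; apply: h => k; have := Da (pairN n k); rewrite pairNK.
  by split=> [[n _ /H]|[n /H]]; exists n.
Qed.

Section Comeager.
Context (R : realType) (X : metricType R) (u : cantor_space -> X).
Hypothesis cu : continuous u.
Variable (sigma : set (set X)).
Hypotheses (os : @open X `<=` sigma) (ps : polish R sigma).

(** By [finer_sub] preimages of sigma-open sets have the Baire property. Intersecting the comeager
    sets for countably many sigma-balls leaves one on which u is continuous into sigma. *)
Lemma comeager_continuous : exists D : nat -> set cantor, (forall n, copen (D n) /\ cdense (D n)) /\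
  forall V a, sigma V -> (forall n, D n a) -> V (u a) ->
    exists N, forall b, (forall n, D n b) -> agr N a b -> V (u b).
Proof.
pose M : set (set X) := fun V => BP (u @^-1` V).
have hM : sigma_algebra setT M.
  have [h1 h2 h3] := BP_sigma; split.
  - by rewrite /M preimage_set0.
  - by move=> S /h2; rewrite /M !setTD preimage_setC.
  - by move=> F MF; rewrite /M preimage_bigcup; exact: h3.
have openM : @open X `<=` M.
  move=> V oV; exists (u @^-1` V), (fun=> setT); split=> //.
    by apply: open_copen; apply: open_comp oV => a _; exact: cu.
  by move=> n; split=> [a _|a n']; [exists 0|exists a].
have sM := finer_sub hM openM os ps; have [d [dm dc ds sE]] := ps.
have [d0 dsym dtri] := dm.
have [r rd] := separable_seq (u (fun=> false)) ds.
pose V i n : set X := fun x => (d (r i) x < iv R n)%R.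
have sV i n : sigma (V i n).
  rewrite sE => x Vx; exists (iv R n - d (r i) x)%R; first by rewrite subr_gt0.
  move=> y xy; rewrite /V; have := dtri (r i) x y; move: xy; move: (iv R n) (d _ _) (d _ _) (d _ _) => ? ? ? ?; lra.
have /choice[ O OP] : forall p : nat * nat, exists O, exists D, [/\ copen O,
    forall n, copen (D n) /\ cdense (D n) & forall a, (forall n : nat, D n a) -> ((u @^-1` V p.1 p.2) a <-> O a)].
  by move=> [i n]; exact: sM (sV i n).
have /choice[D DP] := OP.
exists (fun q => D (phi (phi0 q)) (phi1 q)); split.
  by move=> q; have [_ h _] := DP (phi (phi0 q)); exact: h.
have DV a i n : (forall q, D (phi (phi0 q)) (phi1 q) a) -> (V i n (u a) <-> O (i, n) a).
  move=> Da; have [_ _ h] := DP (i, n); apply: h => k.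
  by have := Da (pairN (pairN i n) k); rewrite !pairNK.
move=> W a sW Da Wa; move: sW; rewrite sE => /(_ _ Wa)[e e0 eW].
have [n nP] := small_inv2 e0; have [i ri] := rd (u a) _ (iv_gt0 R n).
have /(DV _ _ _ Da) : V i n (u a) by rewrite /V dsym.
have [oO _ _] := DP (i, n) => /oO[N NP]; exists N => b Db /NP /(DV _ _ _ Db) Vb.
apply: eW; apply: lt_trans nP; have := dtri (u a) (r i) (u b).
by move: ri Vb; rewrite /V; move: (iv R n) (d _ _) (d _ _) (d _ _) => ? ? ? ?; lra.
Qed.

End Comeager.


(** * Reducing H to the body of the tree *)

Section BranchMap.
Variables (E : set edge) (hE : is_test E).
Variables (D1 D2 : nat -> set cantor).
Hypotheses (D1P : forall n, copen (D1 n) /\ cdense (D1 n)) (D2P : forall n, copen (D2 n) /\ cdense (D2 n)).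

Implicit Type st : edge * seq bool.
(** A state is an element (s_q, t_q) of the test with a word w, and stands for the pair (s_q 0 w,
    t_q 1 w) of the tree. *)
Definition word1 st := st.1.1 ++ false :: st.2.
Definition word2 st := st.1.2 ++ true :: st.2.

Lemma enter (D : set cantor) s : copen D -> cdense D -> exists w, cyl (s ++ w) `<=` D.
Proof.
move=> oD dD; have [b [ab Db]] := dD (nth false s) (size s); have [n nP] := oD _ Db.
exists (drop (size s) (mkseq b (maxn n (size s)))) => c; rewrite /cyl.
have -> : s ++ drop (size s) (mkseq b (maxn n (size s))) = mkseq b (maxn n (size s)).
  rewrite -[RHS](cat_take_drop (size s)); congr (_ ++ _).
  apply: (@eq_from_nth _ false); rewrite ?size_takel ?size_mkseq ?leq_maxr // => i il.
  by rewrite nth_take // nth_mkseq ?ab //; apply: leq_trans il (leq_maxr _ _).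
rewrite size_mkseq => /agr_mkseq bc; apply: nP; apply: agr_le bc; exact: leq_maxl.
Qed.

Lemma word_size st : E st.1 -> size (word1 st) = size (word2 st).
Proof.
by case: st => [[s t] w] /= /(test_dom hE) H; rewrite /word1 /word2 !size_cat /= H.
Qed.

(** A bit 1 is written by the extension clause of the test, which places the next difference in
    column [phi0 n]; a bit 0 appends equal letters. Common letters then lead both words into the
    n-th dense open sets. *)
Lemma state_step n b st : E st.1 -> exists st', E st'.1 /\ exists v x1 x2 w,
  [/\ word1 st' = (word1 st ++ v) ++ x1 :: w, word2 st' = (word2 st ++ v) ++ x2 :: w,
      x1 (+) x2 = b, b -> phi0 (size (word1 st ++ v)).-1 = phi0 n &
      cyl (word1 st') `<=` D1 n /\ cyl (word2 st') `<=` D2 n].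
Proof.
move=> Est; have [st1 [E1 [v [x1 [x2 [h1 h2 h3 h4]]]]]] : exists st1, E st1.1 /\ exists v x1 x2,
    [/\ word1 st1 = (word1 st ++ v) ++ [:: x1], word2 st1 = (word2 st ++ v) ++ [:: x2],
      x1 (+) x2 = b & b -> phi0 (size (word1 st ++ v)).-1 = phi0 n].
  case: b; last first.
    exists (st.1, rcons st.2 false); split=> //; exists [::], false, false.
    by rewrite /word1 /word2 !cats0 -!catA /= cats1.
  case: st Est => [[s t] w] /= Est; have [v [Ev vn]] := test_ext hE (phi0 n) w Est.
  exists ((s ++ false :: w ++ v, t ++ true :: w ++ v), [::]); split=> //.
  exists v, false, true; rewrite /word1 /word2 /= -!catA /=; split=> [| | |_] //; rewrite -?catA //.
  by rewrite -vn !size_cat /= (test_dom hE Est).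
have [oD1 dD1] := D1P n; have [oD2 dD2] := D2P n.
have [w1 w1P] := enter (word1 st1) oD1 dD1; have [w2 w2P] := enter (word2 st1 ++ w1) oD2 dD2.
exists (st1.1, st1.2 ++ w1 ++ w2); split=> //; exists v, x1, x2, (w1 ++ w2).
have e1 : word1 (st1.1, st1.2 ++ w1 ++ w2) = word1 st1 ++ w1 ++ w2 by rewrite /word1 /= -catA.
have e2 : word2 (st1.1, st1.2 ++ w1 ++ w2) = word2 st1 ++ w1 ++ w2 by rewrite /word2 /= -catA.
rewrite e1 e2; split=> //; [by rewrite h1 -catA|by rewrite h2 -catA|split].
  move=> c; rewrite catA /cyl => H; apply: w1P; rewrite /cyl.
  have := congr1 (take (size (word1 st1 ++ w1))) H.
  by rewrite mkseq_take ?take_size_cat //; rewrite [leqRHS]size_cat leq_addr.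
by rewrite catA.
Qed.

Lemma states : exists F : nat -> bool -> edge * seq bool -> edge * seq bool, forall n b st, E st.1 ->
  E (F n b st).1 /\ exists v x1 x2 w,
  [/\ word1 (F n b st) = (word1 st ++ v) ++ x1 :: w, word2 (F n b st) = (word2 st ++ v) ++ x2 :: w,
      x1 (+) x2 = b, b -> phi0 (size (word1 st ++ v)).-1 = phi0 n &
      cyl (word1 (F n b st)) `<=` D1 n /\ cyl (word2 (F n b st)) `<=` D2 n].
Proof.
have /choice[F FP] : forall p : nat * bool * (edge * seq bool), exists st', E p.2.1 -> E st'.1 /\ exists v x1 x2 w,
  [/\ word1 st' = (word1 p.2 ++ v) ++ x1 :: w, word2 st' = (word2 p.2 ++ v) ++ x2 :: w,
      x1 (+) x2 = p.1.2, p.1.2 -> phi0 (size (word1 p.2 ++ v)).-1 = phi0 p.1.1 &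
      cyl (word1 st') `<=` D1 p.1.1 /\ cyl (word2 st') `<=` D2 p.1.1].
  move=> [[n b] st] /=; have [Es|nE] := pselect (E st.1); last by exists st.
  by have [st' H] := state_step n b Es; exists st'.
by exists (fun n b st => F (n, b, st)) => n b st; exact: (FP (n, b, st)).
Qed.

(** What survives of e in the difference of the two branches: hits may move within their columns,
    but empty columns remain empty and nonempty ones nonempty. [rho0] reads no more than this. *)
Definition same_columns (e e' : cantor) : Prop :=
  forall m, (exists2 n, phi0 n = m & e n) <-> (exists2 n, phi0 n = m & e' n).

Lemma branch_map : exists g1 g2 : cantor -> cantor, [/\
  forall e, branches (tree E) (g1 e, g2 e),
  forall e, same_columns e (cshift (symdiff (g1 e) (g2 e))),
  forall e n, D1 n (g1 e) /\ D2 n (g2 e) &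
  forall e e' n, agr n e e' -> agr n (g1 e) (g1 e') /\ agr n (g2 e) (g2 e')].
Proof.
have [F FP] := states.
pose s e := fix s n := if n is m.+1 then F m (e m) (s m) else (([::], [::]), [::]) : edge * seq bool.
have Es e n : E (s e n).1 by elim: n => [|n IH]; [exact: E_nil|exact: (FP n (e n) _ IH).1].
have step e n := (FP n (e n) _ (Es e n)).2.
have sz e n : n < size (word1 (s e n)).
  elim: n => // n IH; have [v [x1 [x2 [w [-> _ _ _ _]]]]] := step e n.
  by rewrite size_cat /= size_cat; move: IH; lia.
have pre1 e m n : m <= n -> prefix (word1 (s e m)) (word1 (s e n)).
  move=> /subnK <-; elim: (n - m) => [|k IH]; first exact: prefix_refl.
  apply: (prefix_trans IH); have [v [x1 [x2 [w [-> _ _ _ _]]]]] := step e (k + m).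
  by rewrite -catA prefix_prefix.
have pre2 e m n : m <= n -> prefix (word2 (s e m)) (word2 (s e n)).
  move=> /subnK <-; elim: (n - m) => [|k IH]; first exact: prefix_refl.
  apply: (prefix_trans IH); have [v [x1 [x2 [w [_ -> _ _ _]]]]] := step e (k + m).
  by rewrite -catA prefix_prefix.
pose g1 e : cantor := fun i => nth false (word1 (s e i)) i.
pose g2 e : cantor := fun i => nth false (word2 (s e i)) i.
have g1E e n i : i < size (word1 (s e n)) -> g1 e i = nth false (word1 (s e n)) i.
  move=> il; have [ni|/ltnW ni] := leqP n i; first by rewrite (prefix_nth (pre1 e _ _ ni)).
  by rewrite /g1 (prefix_nth (pre1 e _ _ ni)).
have g2E e n i : i < size (word1 (s e n)) -> g2 e i = nth false (word2 (s e n)) i.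
  move=> il; have [ni|/ltnW ni] := leqP n i; first by rewrite (prefix_nth (pre2 e _ _ ni)) -?word_size.
  by rewrite /g2 (prefix_nth (pre2 e _ _ ni)) -?word_size.
have mk1 e n : mkseq (g1 e) (size (word1 (s e n))) = word1 (s e n).
  by apply: (@eq_from_nth _ false); rewrite size_mkseq // => i il; rewrite nth_mkseq // (g1E _ n).
have mk2 e n : mkseq (g2 e) (size (word2 (s e n))) = word2 (s e n).
  apply: (@eq_from_nth _ false); rewrite size_mkseq // => i il.
  by rewrite nth_mkseq // (g2E _ n) ?word_size.
exists g1, g2; split.
- move=> e n /=; have H : tree E (word1 (s e n), word2 (s e n)).
    by right; exists (s e n).1.1, (s e n).1.2, (s e n).2; split=> //; case: ((s e n).1) (Es e n).
  have := T_take hE n H; rewrite -mk1 -mk2 !mkseq_take //; last exact: ltnW.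
  by rewrite -word_size //; exact: ltnW.
- move=> e m; split=> [[n nm en]|[i im]].
    have [v [x1 [x2 [w [h1 h2 h3 h4 _]]]]] := step e n.
    pose l := size (word1 (s e n) ++ v).
    have l0 : 0 < l by rewrite /l size_cat; have := sz e n; lia.
    have ll : l < size (word1 (s e n.+1)) by rewrite h1 size_cat /= -/l addnS ltnS leq_addr.
    exists l.-1; first by rewrite h4.
    rewrite /cshift /symdiff prednK // (g1E _ n.+1) // (g2E _ n.+1) // h1 h2.
    have l2 : size (word2 (s e n) ++ v) = l by rewrite /l [LHS]size_cat [RHS]size_cat word_size.
    by rewrite -[l in nth _ _ l]/(size _) nth_cat ltnn subnn /= -l2 nth_cat ltnn subnn /= h3.
  rewrite /cshift /symdiff => di.
  (* At the first stage n + 1 whose words cover position i + 1, a difference there can only be the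
     letter written for bit n, since all other new letters agree. *)
  have ex : exists n, i.+1 < size (word1 (s e n)) by exists i.+1.
  have [n nP nmin] := ex_minnP ex; case: n nP nmin => [//|n] nP nmin.
  have ni : size (word1 (s e n)) <= i.+1 by rewrite leqNgt; apply/negP => /nmin; rewrite ltnn.
  have [v [x1 [x2 [w [h1 h2 h3 h4 _]]]]] := step e n.
  have l2 : size (word2 (s e n) ++ v) = size (word1 (s e n) ++ v) by rewrite [LHS]size_cat [RHS]size_cat word_size.
  move: di; rewrite (g1E _ n.+1) // (g2E _ n.+1) // h1 h2.
  rewrite (nth_cat _ (word1 (s e n) ++ v)) (nth_cat _ (word2 (s e n) ++ v)) l2.
  case: (ltngtP i.+1 (size (word1 (s e n) ++ v))) => [_|il|il].
  + by rewrite !nth_cat -word_size // ltnNge ni /= addbb.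
  + by rewrite -(subnSK il) /= addbb.
  by rewrite il subnn /= h3 => en; exists n => //; rewrite -h4 // -il.
- move=> e n; have [v [x1 [x2 [w [_ _ _ _ [c1 c2]]]]]] := step e n.
  by split; [apply: c1; exact: (mk1 e n.+1)|apply: c2; exact: (mk2 e n.+1)].
- move=> e e' n ee; have sE m : m <= n -> s e m = s e' m.
    elim: m => // m IH mn; rewrite /= -/(s e m) -/(s e' m) ee // IH //; exact: ltnW.
  by split=> i il; rewrite /g1 /g2 sE // ltnW.
Qed.

End BranchMap.

Lemma same_columns_rho0 e e' : same_columns e e' -> rho0 e = rho0 e'.
Proof.
move=> H; apply/funext => m; rewrite /rho0.
have aux (a a' : cantor) : same_columns a a' -> (forall j, a (pairN m j) = false) -> forall j, a' (pairN m j) = false.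
  move=> sc h j; apply/negbTE/negP => aj; have [n nm an] : exists2 n, phi0 n = m & a n.
    by apply/sc; exists (pairN m j); rewrite ?pairNK.
  by have := h (phi1 n); rewrite -nm phiK an.
have sym : same_columns e' e by move=> k; split=> /H.
by congr asbool; apply/propext; split; exact: aux.
Qed.

Lemma same_columns_rho fs xi e e' : limit_choice fs -> xi <> ozero -> same_columns e e' ->
  rho fs xi e = rho fs xi e'.
Proof.
move=> hfs + /same_columns_rho0 H; elim/olt_ind: xi => xi IH x0.
case: (ord_cases xi) => [//|[z zE]|lx].
  subst xi; rewrite rho_succ /=; have [->|z0] := pselect (z = ozero); first by rewrite rho_zero.
  by rewrite (IH z (osucc_gt z) z0).
(* The first stage of a limit has nonzero rank, so it already identifies e and e'; all later stages
   act on equal inputs. *)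
have [fx _] := hfs _ lx; have [f0 f1] := fx 0.
have E0 : rho fs (fs xi 0) e = rho fs (fs xi 0) e' by apply: IH => // fE; move: f0; rewrite fE => /olt_irr.
rewrite (rho_lim hfs lx); apply/funext => k; rewrite /rho_limit; congr (_ _).
elim: k => [|k IHk].
  apply/funext => i; rewrite /= /rho_step /= subn0.
  have shift0 (a : cantor) : (fun j => a (j + 0)) = a by apply/funext => j; rewrite addn0.
  by rewrite !shift0 E0.
by rewrite [LHS]/(rho_step _ _ (rho_upto _ k.+1 e)) [rho_upto]lock /= -lock IHk.
Qed.

(** For xi = 0 the map is the identity and does not identify e and e'; but the zero sequence is
    determined by having only empty columns. *)
Lemma setH_same_columns fs xi e e' : limit_choice fs -> same_columns e e' -> setH fs xi e -> setH fs xi e'.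
Proof.
move=> hfs H; rewrite /setH /=; have [->|x0] := pselect (xi = ozero); last first.
  by rewrite (same_columns_rho hfs x0 H).
rewrite rho_zero /= => e0; apply/funext => n; apply/negbTE/negP => en.
have [k _] : exists2 k, phi0 k = phi0 n & e k by apply/(H (phi0 n)); exists n.
by rewrite e0.
Qed.

Section Hard.
Context (R : realType) (X Y : rpPolish R) (fs : Ord -> nat -> Ord) (hfs : limit_choice fs).
Variables (E : set edge) (hE : is_test E) (xi : Ord) (A B : set (X * Y)).
Variables (u : cantor_space -> X) (v : cantor_space -> Y).
Hypotheses (cu : continuous u) (cv : continuous v).
Hypothesis uvA : setA E fs xi `<=` (fun p => (u p.1, v p.2)) @^-1` A.
Hypothesis uvB : branches (tree E) `\` setA E fs xi `<=` (fun p => (u p.1, v p.2)) @^-1` B.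

Lemma reduction_not_pot : ~ exists C, pot_Pi0 X Y (oadd oone xi) C /\ separates C A B.
Proof.
move=> [C [+ [AC CB]]]; rewrite /pot_Pi0 /= asboolF; last first.
  by move=> E0; have := one_add_gt0 xi; rewrite E0 => /olt_irr.
move=> [_ [sg [tu [os ps ot pt PC]]]].
have [D1 [D1P D1c]] := comeager_continuous cu os ps.
have [D2 [D2P D2c]] := comeager_continuous cv ot pt.
have [g1 [g2 [gT gS gD gC]]] := branch_map hE D1P D2P.
pose h e := (u (g1 e), v (g2 e)).
have hc V : prod_top sg tu V -> copen (h @^-1` V).
  move=> oV e /oV[P [Q [sP tQ Pu Qv PQV]]].
  have [N1 N1P] := D1c _ _ sP (fun n => (gD e n).1) Pu.
  have [N2 N2P] := D2c _ _ tQ (fun n => (gD e n).2) Qv.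
  exists (maxn N1 N2) => e' /gC[a1 a2]; apply: PQV; split=> /=.
    by apply: N1P => [n|]; [exact: (gD e' n).1|apply: agr_le a1; exact: leq_maxl].
  by apply: N2P => [n|]; [exact: (gD e' n).2|apply: agr_le a2; exact: leq_maxr].
apply: (@setH_hard fs hfs xi); apply: Sigma0_ext (Sigma0_pre hc PC) => e.
have scsym : same_columns (cshift (symdiff (g1 e) (g2 e))) e by move=> m; split=> /(gS e m).
rewrite /preimage /setC /=; split=> [nC|He Ch].
  apply: contrapT => nH; apply: nC; apply: AC; apply: (uvA (t := (g1 e, g2 e))); split=> //=.
  by move=> Hd; apply: nH; exact: setH_same_columns hfs scsym Hd.
have : B (h e).
  apply: (uvB (t := (g1 e, g2 e))); split=> // -[_]; apply => /=.
  exact: setH_same_columns hfs (gS e) He.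
by move=> Bh; have : (C `&` B) (h e) by []; rewrite CB.
Qed.

End Hard.


(** * Refining Polish topologies *)

Import numFieldNormedType.Exports.

Ltac nlra := repeat match goal with
  | |- context [@Num.norm ?a ?b ?c] => generalize (@Num.norm a b c)
  | |- context [iv ?A ?n] => generalize (iv A n)
  | |- context [@mdist ?a ?b ?c ?d] => generalize (@mdist a b c d) end; intros; lra.

Section Tends.
Context (R : realType).
Local Open Scope ring_scope.

Definition tends (T : Type) (d : T -> T -> R) (x : nat -> T) (l : T) : Prop :=
  forall e, 0 < e -> exists N, forall k, (N <= k)%N -> d (x k) l < e.
Definition rdist (a b : R) : R := `|a - b|.

Lemma rdist_lt a b e : (rdist a b < e) = (a - b < e) && (b - a < e).
Proof. by rewrite /rdist ltr_norml ltrNl opprB andbC. Qed.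

Lemma tends_all (T : Type) (P : nat -> nat -> Prop) m :
  (forall n, (n < m)%N -> exists N, forall k, (N <= k)%N -> P n k) ->
  exists N, forall k, (N <= k)%N -> forall n, (n < m)%N -> P n k.
Proof.
elim: m => [|m IH] H; first by exists 0%N.
have [|N1 h1] := IH; first by move=> n nm; apply: H; exact: ltnW.
have [N2 h2] := H m (leqnn _); exists (maxn N1 N2) => k; rewrite geq_max => /andP[k1 k2] n.
by rewrite ltnS leq_eqVlt => /orP[/eqP ->|nm]; [exact: h2|exact: h1].
Qed.

Lemma rdist_complete : @metric_complete R R rdist.
Proof.
move=> x xc; have cx : cvg (x @ \oo).
  apply/cauchy_cvgP/cauchy_ballP => e e0; have [N NP] := xc e e0.
  exists (fun a => exists2 k, (N <= k)%N & x k = a, fun a => exists2 k, (N <= k)%N & x k = a) => /=.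
    by split; exists N => // k /= Nk; exists k.
  by move=> [a b] /= [[k Nk <-] [l Nl <-]]; exact: NP.
exists (lim (x @ \oo)) => e e0; have /cvgrPdist_lt/(_ e e0) := cx.
by move=> [N _ NP]; exists N => n /NP; rewrite /= distrC.
Qed.

End Tends.

Section Refinement.
Context (R : realType) (X : rpPolish R).
Local Open Scope ring_scope.
Local Notation d := (@mdist R X).

Definition closed_graph (phi : X -> nat -> R) : Prop := forall (x : nat -> X) l y,
  tends d x l -> (forall n, tends (@rdist R) (fun k => phi (x k) n) (y n)) -> phi l =1 y.

Definition ind (A : set X) (x : X) : R := if pselect (A x) then 1 else 0.

(* A is clopen for the Polish topology pulled back along x |-> (x, phi x). *)
Definition good_set (A : set X) : Prop := exists phi, closed_graph phi /\ forall x, phi x 0%N = ind A x.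

Lemma tends_uniq (a : nat -> R) (b c : R) : tends (@rdist R) a b -> tends (@rdist R) a c -> b = c.
Proof.
have H b' c' : tends (@rdist R) a b' -> tends (@rdist R) a c' -> b' <= c'.
  move=> ab ac; rewrite leNgt; apply/negP => cb.
  have e0 : 0 < (b' - c') / 2 by rewrite divr_gt0 // subr_gt0.
  have [N NP] := ab _ e0; have [M MP] := ac _ e0.
  have := NP _ (leq_maxl N M); have := MP _ (leq_maxr N M); rewrite !rdist_lt.
  by move=> /andP[? ?] /andP[? ?]; lra.
by move=> ab ac; apply/eqP; rewrite eq_le !H.
Qed.

Lemma tends_evconst (a : nat -> R) b c N : (forall k, (N <= k)%N -> a k = c) -> tends (@rdist R) a b -> b = c.
Proof.
move=> ac ab; apply: (tends_uniq ab) => e e0; exists N => k /ac ->.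
by rewrite /rdist subrr normr0.
Qed.

Lemma ind_ev (A : set X) x l : tends (@rdist R) (fun k => ind A (x k)) (ind A l) ->
  exists N, forall k, (N <= k)%N -> (A (x k) <-> A l).
Proof.
move=> /(_ 1 ltr01)[N NP]; exists N => k /NP; rewrite /rdist /ind.
by do 2 case: pselect => ? //; rewrite ?subr0 ?sub0r ?normrN normr1 ltxx.
Qed.

Lemma good_compl A : good_set A -> good_set (~` A).
Proof.
move=> [phi [cg p0]]; exists (fun x n => if n is m.+1 then phi x m else 1 - phi x 0%N); split.
  move=> x l y xl xy; have H := cg x l (fun n => y n.+1) xl (fun n => xy n.+1).
  move=> [|n]; last exact: H.
  apply: tends_uniq (xy 0%N) => e e0; have [N NP] := xy 1%N e e0; exists N => k /NP /=.
  have E : phi l 0%N = y 1%N := H 0%N.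
  by rewrite !rdist_lt /= E => /andP[? ?]; apply/andP; split; lra.
move=> x; rewrite p0 /ind; case: (pselect (A x)) => h; case: (pselect ((~` A) x)) => h' //.
- by rewrite subrr.
- by rewrite subr0.
Qed.

(** Besides coordinates for all F n, the least index of a set containing x is recorded. If points of
    the union tend to a point outside it, convergence of this index bounds it, and finitely many F
    n, each eventually decided by its own coordinates, rule this out. *)
Lemma good_bigcup (F : nat -> set X) : (forall n, good_set (F n)) -> good_set (\bigcup_n F n).
Proof.
move=> /choice[phi phiP].
pose m x : R := if pselect (exists n, `[<F n x>]) is left h then (ex_minn h)%:R else 0.
exists (fun x n => if n is k.+1 then (if k is j.+1 then phi (phi0 j) x (phi1 j) else m x) else ind (\bigcup_n F n) x).
split=> // x l y xl xy.
have H n : phi n l =1 (fun j => y (pairN n j).+2).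
  by have [cg _] := phiP n; apply: (cg x) => // j; have := xy (pairN n j).+2; rewrite /= pairNK.
have ev n : exists N, forall k, (N <= k)%N -> (F n (x k) <-> F n l).
  have [_ p0] := phiP n; apply: ind_ev; rewrite -p0 H.
  by move=> e e0; have [N NP] := xy (pairN n 0).+2 e e0; exists N => k /NP /=; rewrite pairNK /= p0.
have [[n0 _ Fn]|nF] := pselect ((\bigcup_n F n) l).
  have ex : exists n, `[<F n l>] by exists n0; exact/asboolP.
  have [n /asboolP nF nmin] := ex_minnP ex.
  have [N NP] := @tends_all nat (fun n k => F n (x k) <-> F n l) n.+1 (fun n _ => ev n).
  have mE z : (forall i, (i < n.+1)%N -> (F i z <-> F i l)) -> m z = n%:R /\ ind (\bigcup_n F n) z = 1.
    move=> zl; have Fz : F n z by apply/zl.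
    split; last by rewrite /ind; case: pselect => // -[]; exists n.
    rewrite /m; case: pselect => [h|[]]; last by exists n; exact/asboolP.
    case: ex_minnP => i /asboolP iz imin; congr (_%:R); apply/eqP; rewrite eqn_leq imin; last exact/asboolP.
    rewrite leqNgt; apply/negP => ni; have Fi : F i l by apply/zl => //; exact: ltnW.
    by have := nmin i (asboolT Fi); rewrite leqNgt ni.
  have [mlE ilE] := mE l (fun _ _ => iff_refl _).
  move=> [|[|j]]; last by rewrite H phiK.
    by rewrite ilE; apply/esym; apply: (tends_evconst (N := N)) (xy 0%N) => k /NP /mE[].
  by rewrite mlE; apply/esym; apply: (tends_evconst (N := N)) (xy 1%N) => k /NP /mE[].
have out : exists N, forall k, (N <= k)%N -> ~ (\bigcup_n F n) (x k).
  have [N1 h1] := xy 1%N 1 ltr01; pose b := (Num.truncn (`|y 1%N| + 1)).+1.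
  have [N2 h2] := @tends_all nat (fun n k => F n (x k) <-> F n l) b (fun n _ => ev n).
  exists (maxn N1 N2) => k; rewrite geq_max => /andP[/h1 k1 /h2 k2] [n _ Fn].
  move: k1; rewrite rdist_lt /= /m; case: pselect => [h|[]]; last by exists n; exact/asboolP.
  case: ex_minnP => i /asboolP iz _ /andP[hi _].
  have : (i < b)%N.
    rewrite -(ltr_nat R) /b; apply: lt_trans (truncnS_gt _).
    have : y 1%N <= `|y 1%N| := ler_norm _; move: hi.
    by move: (i%:R) (`|y 1%N|) => ? ?; lra.
  by move=> /k2[/(_ iz) Fl _]; apply: nF; exists i.
have [N NP] := out.
have mE z : ~ (\bigcup_n F n) z -> m z = 0 /\ ind (\bigcup_n F n) z = 0.
  move=> nz; rewrite /m /ind; case: pselect => [h|_]; last by case: pselect.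
  by exfalso; case: h => n /asboolP; apply: contra_not nz => ?; exists n.
have [mlE ilE] := mE l nF.
move=> [|[|j]]; last by rewrite H phiK.
  by rewrite ilE; apply/esym; apply: (tends_evconst (N := N)) (xy 0%N) => k /NP /mE[].
by rewrite mlE; apply/esym; apply: (tends_evconst (N := N)) (xy 1%N) => k /NP /mE[].
Qed.

Lemma good_empty : good_set set0.
Proof.
exists (fun _ _ => 0); split; last by move=> x; rewrite /ind; case: pselect.
by move=> x l y _ xy n; apply/esym; apply: (tends_evconst (N := 0%N)) (xy n).
Qed.

Lemma tends_dist (x : nat -> X) l p : tends d x l -> tends (@rdist R) (fun k => d p (x k)) (d p l).
Proof.
move=> xl e e0; have [N NP] := xl e e0; exists N => k /NP; apply: le_lt_trans.
rewrite /rdist ler_norml; have := rp_tri p (x k) l; have := rp_tri p l (x k); rewrite (rp_sym l).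
by move: (d _ _) (d _ _) (d _ _) => ? ? ? ? ?; apply/andP; split; lra.
Qed.

(** The coordinate 1 / (q - d p x) blows up at the boundary, so no sequence in the ball converges in
    the graph to a point outside it; outside the value is 0. *)
Lemma good_ball p q : good_set [set x | d p x < q].
Proof.
pose f x := if d p x < q then (q - d p x)^-1 else 0.
exists (fun x n => if n is 0%N then ind [set x | d p x < q] x else f x); split=> // x l y xl xy.
have dl := tends_dist p xl.
have [lq|lq] := boolP (d p l < q).
  have [|N NP] := dl (q - d p l); first by rewrite subr_gt0.
  have inb k : (N <= k)%N -> d p (x k) < q.
    by move=> /NP; rewrite rdist_lt => /andP[+ _]; nlra.
  have iE z : d p z < q -> ind [set x | d p x < q] z = 1 by move=> zq; rewrite /ind; case: pselect.
  move=> [|n]; first by rewrite iE //; apply/esym; apply: (tends_evconst (N := N)) (xy 0%N) => k /inb/iE.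
  apply: tends_uniq (xy n.+1); have cv : (fun k => f (x k)) @ \oo --> f l.
    rewrite {2}/f lq; apply: cvg_trans (_ : (fun k => (q - d p (x k))^-1) @ \oo --> _).
      apply: near_eq_cvg; exists N => // k /= /inb kq; by rewrite /f kq.
    apply: cvgV; first by rewrite subr_eq0 gt_eqF.
    apply: cvgB; first exact: cvg_cst.
    by apply/cvgrPdist_lt => e e0; have [N' N'P] := dl e e0; exists N' => // k /= /N'P; rewrite /rdist distrC.
  by move=> e e0; have /cvgrPdist_lt/(_ e e0)[N' _ N'P] := cv; exists N' => k /N'P /=; rewrite /rdist distrC.
have ql : q <= d p l by rewrite leNgt.
have [N1 h1] := xy 1%N 1 ltr01.
have bpos : 0 < (`|y 1%N| + 1)^-1 by rewrite invr_gt0 ltr_pwDr.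
have [N2 h2] := dl _ bpos.
have out k : (maxn N1 N2 <= k)%N -> (d p (x k) < q) = false.
  rewrite geq_max => /andP[/h1 k1 /h2 k2]; apply/negbTE/negP => kq; move: k1 k2; rewrite !rdist_lt /f kq => /andP[k1 _].
  have a0 : 0 < q - d p (x k) by rewrite subr_gt0.
  have k1' : (q - d p (x k))^-1 < `|y 1%N| + 1.
    have : y 1%N <= `|y 1%N| := ler_norm _; move: k1.
    by move: (`|y 1%N|) ((q - d p (x k))^-1) => ? ?; lra.
  have k2 : (`|y 1%N| + 1)^-1 < q - d p (x k).
    by rewrite -[ltRHS]invrK ltf_pV2 ?posrE ?invr_gt0 // ltr_pwDr.
  move=> /andP[_]; move: k2 ql.
  by move: ((`|y 1%N| + 1)^-1) => ?; nlra.
have iE z : (d p z < q) = false -> ind [set x | d p x < q] z = 0.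
  by move=> zq; rewrite /ind; case: pselect => //=; rewrite zq.
move=> [|n].
  by rewrite iE ?(negbTE lq) //; apply/esym; apply: (tends_evconst (N := maxn N1 N2)) (xy 0%N) => k /out/iE.
rewrite {1}/f (negbTE lq); apply/esym; apply: (tends_evconst (N := maxn N1 N2)) (xy n.+1) => k /out kq.
by rewrite /f kq.
Qed.

Lemma good_sigma : sigma_algebra setT good_set.
Proof.
split; [exact: good_empty|by move=> S; rewrite setTD; exact: good_compl|exact: good_bigcup].
Qed.

Lemma good_open : @open X `<=` good_set.
Proof.
move=> U oU; pose F s := if pselect (rp_nb X s `<=` U) then rp_nb X s else set0.
have -> : U = \bigcup_s F s.
  apply/seteqP; split=> [x Ux|x [s _]]; last by rewrite /F; case: pselect => // h; exact: h.
  have [e e0 eU] := open_metric oU Ux; have [n nP] := small_inv2 e0.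
  have [i ri] := rp_close x (iv_gt0 R n); exists (pairN i (pairN 1 n)) => //.
  have nbE y : rp_nb X (pairN i (pairN 1 n)) y <-> d (rp_seq X i) y < iv R n.
    by rewrite /rp_nb !pairNK ballEmdist /= mul1r.
  rewrite /F; case: pselect => [?|[]]; first exact/nbE.
  move=> y /nbE iy; apply: eU; have := rp_tri x (rp_seq X i) y; rewrite (rp_sym x (rp_seq X i)).
  by move: ri iy nP; glra.
apply: good_bigcup => s; rewrite /F; case: pselect => ?; last exact: good_empty.
by rewrite /= /rp_nb ballEmdist; exact: good_ball.
Qed.

Section Metric.
Variable Phi : X -> nat -> R.
Hypothesis cPhi : closed_graph Phi.

(** The cap 1 / (n + 1) bounds the supremum and makes all but finitely many terms small. *)
Definition term x y n : R := Num.min (iv R n) `|Phi x n - Phi y n|.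
Definition supd x y : R := sup (range (term x y)).
Definition refd x y : R := d x y + supd x y.

Lemma iv_le m n : (m <= n)%N -> iv R n <= iv R m.
Proof. by move=> mn; rewrite /iv lef_pV2 ?posrE // ler_nat ltnS. Qed.

Lemma term_ge0 x y n : 0 <= term x y n.
Proof. by rewrite /term le_min normr_ge0 ltW ?iv_gt0. Qed.

Lemma term_le x y n : term x y n <= supd x y.
Proof.
apply: ub_le_sup; last by exists n.
exists (iv R 0) => _ [m _ <-]; apply: le_trans (iv_le (leq0n m)); by rewrite /term ge_min lexx.
Qed.

Lemma supd_le x y c : (forall n, term x y n <= c) -> supd x y <= c.
Proof. by move=> H; apply: ge_sup; [exists (term x y 0); exists 0%N|move=> _ [n _ <-]]. Qed.

Lemma supd_ge0 x y : 0 <= supd x y.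
Proof. exact: le_trans (term_ge0 x y 0) (term_le _ _ _). Qed.

Lemma refd_metric : is_metric refd.
Proof.
split.
- move=> x y; split=> [E|->].
    by apply: mdist_positivity; have := supd_ge0 x y; have := rp_ge0 x y; move: E; rewrite /refd; lra.
  rewrite /refd mdistxx add0r; apply/eqP; rewrite eq_le supd_ge0 andbT; apply: supd_le => n.
  by rewrite /term subrr normr0 ge_min lexx orbT.
- move=> x y; rewrite /refd /supd rp_sym.
  by have -> : term x y = term y x by apply/funext => n; rewrite /term distrC.
- move=> x y z; rewrite /refd; have : supd x z <= supd x y + supd y z.
    apply: supd_le => n; have := term_le x y n; have := term_le y z n; rewrite /term.
    have := ler_normD (Phi x n - Phi y n) (Phi y n - Phi z n); rewrite subrKA.
    have := normr_ge0 (Phi x n - Phi y n); have := normr_ge0 (Phi y n - Phi z n).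
    have := iv_gt0 R n; rewrite !minEle.
    move: (iv R n) (`|Phi x n - Phi y n|) (`|Phi y n - Phi z n|) (`|Phi x n - Phi z n|) => a b c e.
    by case: ifP; case: ifP; case: ifP; lra.
  have := rp_tri x y z; move: (supd _ _) (supd _ _) (supd _ _) (d _ _) (d _ _) (d _ _) => ? ? ? ? ? ?; lra.
Qed.

Lemma refd_small x y m c : (forall n, (n < m)%N -> `|Phi x n - Phi y n| <= c) -> iv R m <= c -> supd x y <= c.
Proof.
move=> H mc; apply: supd_le => n; rewrite /term ge_min; have [nm|mn] := ltnP n m.
  by rewrite H ?orbT.
by rewrite (le_trans (iv_le mn) mc).
Qed.

Lemma refd_complete : metric_complete refd.
Proof.
move=> x xc.
have [|l xl] := @rp_complete _ X x.
  move=> e /xc[N NP]; exists N => m n Nm Nn; apply: le_lt_trans (NP m n Nm Nn).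
  by rewrite /refd lerDl supd_ge0.
have /choice[y yP] : forall n, exists y, tends (@rdist R) (fun k => Phi (x k) n) y.
  move=> n; apply: rdist_complete => e e0.
  have [|N NP] := xc (Num.min e (iv R n)); first by rewrite lt_min e0 iv_gt0.
  exists N => a b Na Nb; have := NP a b Na Nb; rewrite lt_min => /andP[h1 h2].
  have := term_le (x a) (x b) n; have := rp_ge0 (x a) (x b).
  move: h1 h2; rewrite /refd /rdist /term minEle; case: ifP => _.
    by move: (iv R n) (d _ _) (supd _ _) => ? ? ?; lra.
  by move: (`|_|) (d _ _) (supd _ _) => ? ? ?; lra.
have yE := cPhi xl yP; exists l => e e0.
have [n nP] := small_inv (divr_gt0 e0 (ltr0n _ 2%N)).
have [N1 h1] := xl (e / 2) (divr_gt0 e0 (ltr0n _ 2%N)).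
have [N3 h3] := @tends_all nat (fun i k => rdist (Phi (x k) i) (Phi l i) < iv R n) n
  ltac:(by move=> i _ /=; rewrite yE; apply: yP; exact: iv_gt0).
exists (maxn N1 N3) => k; rewrite geq_max => /andP[/h1 k1 /h3 k3].
have := @refd_small (x k) l n (iv R n) (fun i im => ltW (k3 i im)) (lexx _).
by move: k1 nP; rewrite /refd; move: (iv R n) (d _ _) (supd _ _) => ? ? ?; lra.
Qed.

(** One point is chosen from each nonempty set described by a ball around the dense sequence and
    finitely many rational approximations of coordinates. *)
Lemma refd_separable : metric_separable refd.
Proof.
pose near (c : nat * nat * seq rat) x := d (rp_seq X c.1.1) x < iv R c.1.2 /\
  forall n, (n < c.1.2)%N -> `|Phi x n - ratr (nth 0 c.2 n)| < iv R c.1.2.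
pose D := [set x | exists c, exists h : (exists x, near c x), x = sval (cid h)].
exists D.
  have cD : countable (range (fun c => if pselect (exists x, near c x) is left h then Some (sval (cid h)) else None)).
    exact: (sub_countable (card_image_le _ _) (countableP _)).
  have /countable_injP[f finj] := cD.
  apply/countable_injP; exists (fun x => f (Some x)) => x y; rewrite !inE => -[c [h ->]] [c' [h' ->]] E.
  have : Some (sval (cid h)) = Some (sval (cid h')).
    apply: finj E; rewrite inE /=; [exists c|exists c'] => //; case: pselect => // h0; [by rewrite (Prop_irrelevance h0 h)|by rewrite (Prop_irrelevance h0 h')].
  by case.
move=> x e e0; have [m mP] := small_inv (divr_gt0 e0 (ltr0n _ 4%N)).
have [i ri] := rp_close x (iv_gt0 R m).
have /choice[q qP] : forall n, exists q : rat, `|Phi x n - ratr q| < iv R m.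
  move=> n; have [|q] := @rat_in_itvoo R (Phi x n - iv R m) (Phi x n); first by rewrite ltrBlDr ltrDl iv_gt0.
  rewrite in_itv /= => /andP[q1 q2]; exists q; rewrite ger0_norm ?subr_ge0 ?ltW //.
  by move: q1; rewrite ltrBlDr -ltrBlDl.
pose c := (i, m, mkseq q m); have h : exists x, near c x.
  by exists x; split=> // n nm; rewrite nth_mkseq.
exists (sval (cid h)); first by exists c, h.
have [h1 h2] := svalP (cid h); move: (sval (cid h)) h1 h2 => y /= h1 h2.
have := rp_tri x (rp_seq X i) y; rewrite (rp_sym x (rp_seq X i)).
have : supd x y <= iv R m + iv R m.
  apply: (refd_small (m := m)) => [n nm|]; last by rewrite lerDl ltW ?iv_gt0.
  have a1 : rdist (Phi x n) (ratr (q n)) < iv R m := qP n.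
  have := h2 n nm; rewrite nth_mkseq // -/(rdist _ _) => a2; apply: ltW.
  rewrite -/(rdist _ _); move: a1 a2; rewrite !rdist_lt; move: (ratr _) (iv R m) => ? ?.
  by move=> /andP[? ?] /andP[? ?]; apply/andP; split; lra.
by move: h1 ri mP; rewrite /refd; move: (iv R m) (d _ _) (d _ _) (d _ _) (supd _ _) => ? ? ? ? ?; lra.
Qed.

Lemma refd_polish : polish R (metric_top refd).
Proof. by exists refd; split; [exact: refd_metric|exact: refd_complete|exact: refd_separable|]. Qed.

Lemma refd_finer : @open X `<=` metric_top refd.
Proof.
move=> U oU x Ux; have [e e0 eU] := open_metric oU Ux; exists e => // y xy; apply: eU.
by apply: le_lt_trans xy; rewrite /refd lerDl supd_ge0.
Qed.

Lemma refd_ind (A : set X) n : (forall x, Phi x n = ind A x) -> metric_top refd A.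
Proof.
move=> PA x Ax; exists (iv R n); first exact: iv_gt0.
move=> y xy; have : term x y n < iv R n.
  by apply: le_lt_trans (term_le _ _ _) (le_lt_trans _ xy); rewrite /refd lerDr rp_ge0.
rewrite /term gt_min ltxx /= !PA /ind; case: pselect => [?|//]; case: pselect => [//|?].
rewrite subr0 normr1 => /lt_le_trans/(_ (iv_le (leq0n n))).
by rewrite /iv invr1 ltxx.
Qed.

End Metric.

Lemma polish_refinement (F : nat -> set X) : (forall n, good_set (F n)) ->
  exists sigma, [/\ @open X `<=` sigma, polish R sigma, is_topology sigma & forall n, sigma (F n)].
Proof.
move=> /choice[phi phiP]; pose Phi x n := phi (phi0 n) x (phi1 n).
have cP : closed_graph Phi.
  move=> x l y xl xy n; have [cg _] := phiP (phi0 n).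
  have := cg x l (fun j => y (pairN (phi0 n) j)) xl; rewrite /Phi => ->; rewrite ?phiK // => j.
  by have := xy (pairN (phi0 n) j); rewrite /Phi pairNK.
exists (metric_top (refd Phi)); split.
- exact: refd_finer.
- exact: refd_polish.
- split=> [x _|U V oU oV x [/oU[e e0 eU] /oV[e' e0' eV]]|G oG x [U GU Ux]].
  + by exists 1.
  + exists (Num.min e e'); first by rewrite lt_min e0.
    by move=> y; rewrite lt_min => /andP[/eU ? /eV ?].
  + by have [e e0 eU] := oG _ GU _ Ux; exists e => // y /eU; exists U.
- move=> n; have H := @refd_ind Phi (F n) (pairN n 0); apply: H => x; rewrite /Phi pairNK /=.
  by have [_ ->] := phiP n.
Qed.

End Refinement.


(** * Equivalence of the conditions *)

Lemma Pg_true (E : espace) : Pg E setT.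
Proof.
have ct : comp (fun _ : nat => true) by rc.
have := @Pg_dec E (fun=> true) (fun=> 0) ct (eff_const E 0).
by apply: Sg_ext => x; rewrite /setC /=; split=> // h; exfalso; apply: h.
Qed.

(** Membership in the initial segment of D below the index of zeta is decided by the recursive order
    itself. *)
Lemma below_le xi zeta : ole zeta xi -> below_omega1CK xi -> below_omega1CK zeta.
Proof.
move=> /ole_eqVlt[-> //|zx] [D [L [f [rD rL fD fs fL]]]].
have [k Dk fk] := fs _ zx.
exists [set v | D v /\ L [tuple thead v; k]], L, f; split=> //.
- have cD := comp_D rD; have ck : comp (fun _ : nat => k) by rc.
  have ci : comp (fun n : nat => n) by rc.
  have cL := comp_tuple2 rL ci ck.
  have := comp_and cD cL; congr recursive; apply/funext => v /=.
  congr nat_of_bool; rewrite /edecode /=.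
  have -> : [tuple thead v] = v by apply/eq_from_tnth => i; rewrite ord1 [LHS](tnth_nth 0) /= /thead.
  by apply/andP/asboolP => [[/asboolP ? /asboolP]|[? ?]] //; split; exact/asboolP.
- by move=> n [Dn]; rewrite /thead (tnth_nth 0) /= => /(fL n k Dn Dk).1; rewrite fk.
- move=> eta ez; have [n Dn fn] := fs _ (olt_trans ez zx); exists n => //.
  by split=> //; rewrite /thead (tnth_nth 0) /=; apply/(fL n k Dn Dk).1; rewrite fk fn.
- by move=> m n [Dm _] [Dn _]; exact: fL.
Qed.

Section OneSpace.
Context (R : realType) (X : rpPolish R).
Local Notation EX := (ESpace (rp_naming X)).
Local Notation Dl := (Delta11 (rp_nb X)).

Lemma Dl_setI (P Q : set X) : Dl P -> Dl Q -> Dl (P `&` Q).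
Proof. by move=> [sP pP] [sQ pQ]; split; [exact: (@Sg_and EX)|exact: (@Pg_and EX)]. Qed.

Lemma Dl_setT : Dl setT.
Proof. by split; [exact: (Sg_true EX)|exact: (Pg_true EX)]. Qed.

Lemma Dl_setC (P : set X) : Dl P -> Dl (~` P).
Proof. by move=> [sP pP]; split=> //; rewrite /Pi11 /= setCK. Qed.

Lemma Dl_enum : exists F : nat -> set X, (forall n, Dl (F n)) /\ forall D, Dl D -> exists n, F n = D.
Proof.
have [W [C [_ _ _ WD surj]]] := coding_ex EX.
exists (fun n => if pselect (W n) then [set x | C (n, x)] else setT); split.
  by move=> n; case: pselect => [/[dup] Wn Wn'|?]; [have [? ?] := WD _ Wn; split|exact: Dl_setT].
move=> D [sD pD]; have [n [Wn nD]] := surj D sD pD; exists n.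
by case: pselect => // ?; apply/seteqP; split=> x /nD.
Qed.

Lemma Dl_base U x : gen_top Dl U -> U x -> exists P, [/\ Dl P, P x & P `<=` U].
Proof.
move=> gU; move: x; suff H : [set V : set X | forall x, V x -> exists P, [/\ Dl P, P x & P `<=` V]] U by exact: H.
apply: gU; last by move=> D dD x Dx; exists D; split=> // y.
split=> [x _|V V' hV hV' x [/hV[P [dP Px PV]] /hV'[P' [dP' Px' PV']]]|G hG x [V GV Vx]].
- by exists setT; split=> //; exact: Dl_setT.
- exists (P `&` P'); split=> //; first exact: Dl_setI.
  by move=> y [/PV ? /PV'].
- by have [P [dP Px PV]] := hG V GV x Vx; exists P; split=> // y /PV; exists V.
Qed.

Lemma Dl_gen D : Dl D -> gen_top Dl D.
Proof. by move=> dD tau _; apply. Qed.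

Lemma Dl_Borel D : Dl D -> Borel D.
Proof.
move=> [sD pD]; apply: (Delta_sub _ _ sD pD); first exact: smallest_sigma_algebra.
exact: sub_sigma_algebra.
Qed.

(** There are only countably many Delta^1_1 sets and all are good by [Delta_sub], so one Polish
    refinement makes them all open. *)
Lemma Dl_polish : exists sigma, [/\ @open X `<=` sigma, polish R sigma & gen_top Dl `<=` sigma].
Proof.
have [F [dF surj]] := Dl_enum.
have [n|sigma [os ps ts sF]] := @polish_refinement R X F.
  by have [sn pn] := dF n; apply: (Delta_sub _ _ sn pn); [exact: good_sigma|exact: good_open].
exists sigma; split=> // U; apply; first exact: ts.
by move=> D /surj[n <-].
Qed.

End OneSpace.

(** * Coded levels, closures and potential classes *)

Section TwoSpaces.
Context (R : realType) (X Y : rpPolish R).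
Local Notation EX := (ESpace (rp_naming X)).
Local Notation EY := (ESpace (rp_naming Y)).
Local Notation Z := (eprod EX EY).
Local Notation DX := (Delta11 (rp_nb X)).
Local Notation DY := (Delta11 (rp_nb Y)).
Local Notation tau1 := (tau_one X Y).

Lemma tau1_rect (P : set X) (Q : set Y) : DX P -> DY Q -> tau1 (P `*` Q).
Proof. by move=> dP dQ z [Pz Qz]; exists P, Q; split=> //; exact: Dl_gen. Qed.

Lemma tau1_base V z : tau1 V -> V z -> exists P Q, [/\ DX P, DY Q, P z.1, Q z.2 & P `*` Q `<=` V].
Proof.
move=> oV /oV[P [Q [gP gQ Pz Qz PQ]]].
have [P' [dP' P'z PP]] := Dl_base gP Pz; have [Q' [dQ' Q'z QQ]] := Dl_base gQ Qz.
by exists P', Q'; split=> // t [/PP ? /QQ ?]; apply: PQ.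
Qed.

Lemma tau1_bigcup (I : Type) (F : I -> set (X * Y)) : (forall i, tau1 (F i)) -> tau1 (fun z => exists i, F i z).
Proof.
by move=> oF z [i /oF[P [Q [gP gQ Pz Qz PQ]]]]; exists P, Q; split=> // t /PQ ?; exists i.
Qed.

Lemma tau1U U V : tau1 U -> tau1 V -> tau1 (U `|` V).
Proof.
by move=> oU oV z [/oU|/oV] [P [Q [gP gQ Pz Qz PQ]]]; exists P, Q; split=> // t /PQ; [left|right].
Qed.

Lemma tau1_rectC (P : set X) (Q : set Y) : DX P -> DY Q -> tau1 (~` (P `*` Q)).
Proof.
move=> dP dQ; have -> : ~` (P `*` Q) = ((~` P) `*` setT) `|` (setT `*` (~` Q)).
  apply/seteqP; split=> z; rewrite /setC /= => h.
    by have [Pz|nPz] := pselect (P z.1); [right|left]; split=> // Qz; apply: h.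
  by move=> [Pz Qz]; case: h => -[].
by apply: tau1U; apply: tau1_rect; [exact: Dl_setC|exact: Dl_setT|exact: Dl_setT|exact: Dl_setC].
Qed.

Lemma tau1_sigma V : tau1 V -> exists F : nat -> set (X * Y), V = \bigcup_n F n /\
  forall n, exists P Q, [/\ DX P, DY Q & F n = P `*` Q].
Proof.
move=> oV; have [F [dF surjF]] := Dl_enum X; have [G [dG surjG]] := Dl_enum Y.
exists (fun n => if pselect (F (phi0 n) `*` G (phi1 n) `<=` V) then F (phi0 n) `*` G (phi1 n) else set0 `*` setT).
split; last first.
  move=> n; case: pselect => ?; first by exists (F (phi0 n)), (G (phi1 n)).
  exists set0, setT; split=> //; last exact: Dl_setT.
  by rewrite -setCT; apply: Dl_setC; exact: Dl_setT.
apply/seteqP; split=> [z Vz|z [n _]]; last by case: pselect => [h|? []//]; exact: h.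
have [P [Q [/surjF[i <-] /surjG[j <-] Pz Qz PQ]]] := tau1_base oV Vz.
by exists (pairN i j) => //; rewrite pairNK /=; case: pselect.
Qed.

Lemma tau1_closed U : tau1 U -> exists2 F : nat -> set (X * Y), U = \bigcup_n F n & forall n, tau1 (~` F n).
Proof.
move=> /tau1_sigma[F [UF FP]]; exists F => // n.
by have [P [Q [dP dQ ->]]] := FP n; exact: tau1_rectC.
Qed.

Lemma Borel_rect (P : set X) (Q : set Y) : Borel P -> Borel Q -> Borel (P `*` Q : set (X * Y)).
Proof.
have sg : sigma_algebra setT (@Borel (X * Y)%type) by exact: smallest_sigma_algebra.
have pre (T : topologicalType) (f : X * Y -> T) : continuous f -> forall S, Borel S -> Borel (f @^-1` S).
  move=> cf; apply: smallest_sub.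
    case: sg => h1 h2 h3; split.
    - by rewrite /= preimage_set0.
    - by move=> S /= /h2; rewrite !setTD preimage_setC.
    - by move=> F /= hF; rewrite preimage_bigcup; exact: h3.
  move=> O oO; apply: sub_sigma_algebra; apply: open_comp oO => z _; exact: cf.
move=> bP bQ; have -> : P `*` Q = ~` ((fst @^-1` (~` P)) `|` (snd @^-1` (~` Q))) :> set (X * Y).
  apply/seteqP; split=> z /=; first by move=> [Pz Qz] [].
  by move=> h; split; apply: contrapT => n; apply: h; [left|right].
apply: (sigmaC sg); rewrite -bigcup2E; apply: (sigmaU sg) => -[|[|n]]; last exact: (sigma0 sg).
- by apply: pre; [move=> z; exact: cvg_fst|apply: (sigmaC (smallest_sigma_algebra _ _))].
- by apply: pre; [move=> z; exact: cvg_snd|apply: (sigmaC (smallest_sigma_algebra _ _))].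
Qed.

Lemma tau1_Borel eta S : Sigma0 tau1 eta S -> Borel (S : set (X * Y)).
Proof.
have sg : sigma_algebra setT (@Borel (X * Y)%type) by exact: smallest_sigma_algebra.
elim/olt_ind: eta S => eta IH S sS; case: (ole_eqVlt (Sigma0_ge1 sS)) => [E|e1].
  subst eta; have [F [-> FP]] := tau1_sigma (Sigma0_one sS); apply: (sigmaU sg) => n.
  by have [P [Q [dP dQ ->]]] := FP n; apply: Borel_rect; exact: Dl_Borel.
have [z [F [ze sF ->]]] := Sigma0_big e1 sS; apply: (sigmaU sg) => n.
by rewrite -[F n]setCK; apply: (sigmaC sg); exact: IH (ze n) _ (sF n).
Qed.

Lemma Pi0_pot eta C : olt ozero eta -> Pi0 tau1 eta C -> pot_Pi0 X Y eta C.
Proof.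
move=> e0 PC; rewrite /pot_Pi0 /= asboolF; last by move=> E; move: e0; rewrite E => /olt_irr.
have sg : sigma_algebra setT (@Borel (X * Y)%type) by exact: smallest_sigma_algebra.
split; first by rewrite -[C]setCK; apply: (sigmaC sg); exact: tau1_Borel PC.
have [sX [oX pX gX]] := Dl_polish X; have [sY [oY pY gY]] := Dl_polish Y.
exists sX, sY; split=> //; apply: (Sigma0_pre (h := id)) PC => V oV z /oV[P [Q [/gX sP /gY sQ Pz Qz PQ]]].
by exists P, Q.
Qed.

Lemma coding_of W C : Delta11_coding W C -> @coding Z W C.
Proof.
move=> [pW pC DE pWC]; split=> //.
- move=> n Wn; have : Delta11 (xy_nb X Y) [set z | C (n, z)] by rewrite DE; exists n.
  by move=> [].
- move=> D sD pD; have : Delta11 (xy_nb X Y) D by split.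
  by rewrite DE => -[n Wn <-]; exists n.
Qed.

Lemma of_coding W C : @coding Z W C -> forall n, W n -> Delta11 (xy_nb X Y) [set z | C (n, z)].
Proof. by move=> [_ _ _ WD _] n /WD[s p]; split. Qed.

Section Codes.
Context (W : set enat) (C : set (eprod enat Z)).
Hypothesis WC : coding W C.
Local Notation Ci n := ([set z : X * Y | C (n, z)]).

(** The sides are projections, a priori only Sigma^1_1. In a nonempty rectangle x belongs to P
    exactly if (x, y) lies in it for all y in Q, which is Pi^1_1. *)
Lemma rect_codeP n : rect_code W C n -> exists P Q, [/\ DX P, DY Q & Ci n = P `*` Q].
Proof.
move=> [Wn rect]; have [_ _ _ WD _] := WC; have [sC pC] := WD _ Wn.
have [[[x0 y0] C0]|ne] := pselect (exists z, C (n, z)); last first.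
  exists set0, setT; split; last first.
  - by apply/seteqP; split=> z; [move=> Cz; case: ne; exists z|move=> []].
  - exact: Dl_setT.
  - by rewrite -setCT; apply: Dl_setC; exact: Dl_setT.
pose P : set X := fun x => exists y, C (n, (x, y)); pose Q : set Y := fun y => exists x, C (n, (x, y)).
have sP : Sg EX P.
  apply: (@Sg_exp EX EY); by refine (@Sg_pre _ Z (fun p : eprod EX EY => (p.1, p.2)) _ _ sC); ef.
have sQ : Sg EY Q.
  apply: (@Sg_exp EY EX); by refine (@Sg_pre _ Z (fun p : eprod EY EX => (p.2, p.1)) _ _ sC); ef.
have CPQ x y : C (n, (x, y)) <-> P x /\ Q y.
  split=> [h|[[y' h1] [x' h2]]]; first by split; [exists y|exists x].
  exact: rect h1 h2.
exists P, Q; split; last by apply/seteqP; split=> -[x y] /=; rewrite CPQ.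
- split=> //; have H : Pg EX (fun x => forall y : EY, ~ Q y \/ C (n, (x, y))).
    apply: Pg_all; apply: Pg_or.
      have nQ : Pg EY (~` Q) by rewrite /Pg setCK.
      by refine (@Pg_pre _ EY (fun p : eprod EX EY => p.2) _ _ nQ); ef.
    by refine (@Pg_pre _ Z (fun p : eprod EX EY => (p.1, p.2)) _ _ pC); ef.
  apply: Sg_ext H => x; rewrite /setC /=; split=> h Px; apply: h.
    by move=> y; have [Qy|nQ] := pselect (Q y); [right; apply/CPQ|left].
  have [|/CPQ[]//] := Px y0; by case; exists x0.
- split=> //; have H : Pg EY (fun y => forall x : EX, ~ P x \/ C (n, (x, y))).
    apply: Pg_all; apply: Pg_or.
      have nP : Pg EX (~` P) by rewrite /Pg setCK.
      by refine (@Pg_pre _ EX (fun p : eprod EY EX => p.2) _ _ nP); ef.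
    by refine (@Pg_pre _ Z (fun p : eprod EY EX => (p.2, p.1)) _ _ pC); ef.
  apply: Sg_ext H => y; rewrite /setC /=; split=> h Qy; apply: h.
    by move=> x; have [Px|nP] := pselect (P x); [right; apply/CPQ|left].
  have [|/CPQ[]//] := Qy x0; by case; exists y0.
Qed.

Lemma lev_open n : lev W C ozero n -> tau1 (Ci n) /\ tau1 (~` Ci n).
Proof.
rewrite lev0 => /rect_codeP[P [Q [dP dQ ->]]].
by split; [exact: tau1_rect|exact: tau1_rectC].
Qed.

Lemma lev_Pi0 eta n : olt ozero eta -> lev W C eta n -> Pi0 tau1 eta (Ci n).
Proof.
elim/olt_ind: eta n => eta IH n e0; rewrite levS // => -[Wn cov].
pose S m := levlt W C eta m /\ Cdisj W C m n.
have CE z : (~` Ci n) z <-> exists m, S m /\ C (m, z).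
  split=> [nz|[m [[_ dm] Cm]] Cn]; last by case: (dm z) => -[].
  by case: (cov z) => [//|[m [lm [Cm dm]]]]; exists m.
case: (ole_eqVlt (ole1 e0)) => [E|e1].
  subst eta; rewrite /Pi0 /=; apply: (@Sigma0_ext _ _ _ (fun z => exists m : {m | S m}, C (sval m, z))).
    by move=> z; rewrite CE; split=> [[[m Sm] Cm]|[m [Sm Cm]]]; [exists m|exists (exist _ m Sm)].
  apply: Sigma0_open; apply: tau1_bigcup => -[m [[zeta z1 lm] _]] /=.
  have zE : zeta = ozero by apply: ole_anti (ozero_le _); apply/olt_succ.
  by move: lm; rewrite zE => /lev_open[].
rewrite /Pi0 /=; apply: (@Sigma0_ext _ _ _ (\bigcup_m (if pselect (S m) then Ci m else set0))).
  move=> z; rewrite CE; split=> [[m _]|[m [Sm Cm]]].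
    by case: pselect => [Sm Cm|? []//]; exists m.
  by exists m => //; case: pselect.
have /choice[zt ztP] : forall m, exists zeta, olt zeta eta /\ Sigma0 tau1 zeta (~` (if pselect (S m) then Ci m else set0)).
  move=> m; case: pselect => [[[zeta ze lm] ?]|?]; last first.
    by exists oone; split=> //; rewrite setC0; apply: Sigma0_open => z _; exists setT, setT; split=> //; apply: Dl_gen; exact: Dl_setT.
  have [z0|z0] := pselect (zeta = ozero).
    have lm0 : lev W C ozero m by rewrite -z0.
    by exists oone; split=> //; apply: Sigma0_open; have [] := lev_open lm0.
  by exists zeta; split=> //; apply: IH => //; exact: ozero_lt.
by apply: (Sigma0_bigcup (zeta := zt)).
Qed.

Lemma lev_ext eta n n' : W n' -> (forall z, C (n, z) <-> C (n', z)) -> lev W C eta n -> lev W C eta n'.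
Proof.
move=> Wn' nn; rewrite !levE; case: asboolP => _.
  by move=> [Wn r]; split=> // x y x' y' /nn h1 /nn h2; apply/nn; exact: r h1 h2.
move=> [Wn cov]; split=> // z; case: (cov z) => [/nn|[m [lm [Cm dm]]]]; [by left|right].
exists m; split=> //; split=> // z'; case: (dm z') => [|[_ nC]]; [by left|right].
by split=> // /nn.
Qed.

Section Level.
Context (fs : Ord -> nat -> Ord) (hfs : limit_choice fs) (E : set edge) (hE : is_test E).
Variables (xi : Ord).
Hypothesis hxi : below_omega1CK xi.

Lemma cl_reduction (A B : set (X * Y)) : Sg Z A -> Sg Z B -> cl W C (oadd oone xi) A `&` B !=set0 ->
  exists (u : cantor_space -> X) (v : cantor_space -> Y), [/\ continuous u, continuous v,
    setA E fs xi `<=` (fun p => (u p.1, v p.2)) @^-1` A &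
    branches (tree E) `\` setA E fs xi `<=` (fun p => (u p.1, v p.2)) @^-1` B].
Proof.
move=> sA sB AB; have [Rr [Pp res]] := resolution_ex hfs xi.
have [u [v [cu cv uv]]] := reduction hE WC hxi res sA sB AB.
exists u, v; split=> // -[a b] /= []; first by move=> ab nH; apply: (uv a b ab).2.
move=> ab nA; apply: (uv a b ab).1; apply: contrapT => nH.
by apply: nA; split.
Qed.

(** If the closure met B, the maps of [cl_reduction] would contradict [reduction_not_pot]. *)
Lemma pot_cl (A B : set (X * Y)) : Sg Z A -> Sg Z B ->
  (exists S, pot_Pi0 X Y (oadd oone xi) S /\ separates S A B) -> cl W C (oadd oone xi) A `&` B = set0.
Proof.
move=> sA sB sep; apply/eqP; apply: contraT => /set0P /(cl_reduction sA sB)[u [v [cu cv uA uB]]].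
by case: (reduction_not_pot hfs hE cu cv uA uB sep).
Qed.

(** A potentially Pi^0_(1+xi) set separates itself from its complement, and any separator of the two
    equals it; so the separator of level 1 + xi is another code of the same set. *)
Lemma pot_lev n : W n -> pot_Pi0 X Y (oadd oone xi) (Ci n) <-> lev W C (oadd oone xi) n.
Proof.
move=> Wn; have [_ _ _ WD _] := WC; have [sC pC] := WD _ Wn.
split=> [pot|ln]; last by apply: Pi0_pot; [exact: one_add_gt0|exact: lev_Pi0 (one_add_gt0 _) ln].
have cl0 : cl W C (oadd oone xi) (Ci n) `&` (~` Ci n) = set0.
  by apply: pot_cl => //; exists (Ci n); split=> //; split=> //; exact: setICr.
have [m [lm CC Cm]] := lev_separation WC hxi (ole_refl _) sC pC cl0.
apply: (lev_ext Wn _ lm) => z; split=> [mz|/CC//].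
apply: contrapT => nz; have : ([set z | C (m, z)] `&` (~` Ci n)) z by [].
by rewrite Cm.
Qed.

End Level.

Lemma pot0_lev n : W n -> pot_Pi0 X Y ozero (Ci n) <-> lev W C ozero n.
Proof.
move=> Wn; rewrite lev0 /pot_Pi0 /= asboolT //; split=> [[P [Q [bP bQ CE]]]|/rect_codeP[P [Q [dP dQ CE]]]].
  have CP x y : C (n, (x, y)) <-> P x /\ Q y.
    by have /seteqP[h1 h2] := CE; split=> [/(h1 (x, y))|/(h2 (x, y))].
  by split=> // x y x' y' /CP[Px _] /CP[_ Qy]; apply/CP.
by exists P, Q; split=> //; exact: Dl_Borel.
Qed.

End Codes.

Lemma gen_Sg_setI eta (S S' : set (X * Y)) :
  (Sg Z `&` Pi0_lt tau1 eta) S -> (Sg Z `&` Pi0_lt tau1 eta) S' -> (Sg Z `&` Pi0_lt tau1 eta) (S `&` S').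
Proof.
move=> [sS [z ze pS]] [sS' [z' ze' pS']]; split; first exact: Sg_and.
suff [z2 [z2e h1 h2]] : exists z2, [/\ olt z2 eta, Sigma0 tau1 z2 (~` S) & Sigma0 tau1 z2 (~` S')].
  by exists z2 => //; rewrite /Pi0 /= setCI; apply: Sigma0_setU => //; exact: tau1U.
case: (ole_total z z') => zz; [exists z'|exists z]; split=> //.
  exact: (Sigma0_le tau1_closed) zz pS.
exact: (Sigma0_le tau1_closed) zz pS'.
Qed.

(** For eta > 1 the basic neighbourhoods are Sigma^1_1 and hence sections of one universal set; the
    complement of the closure is a countable union of sets of lower class. *)
Lemma closure_Pi0 eta (A : set (X * Y)) : olt ozero eta -> Pi0 tau1 eta (top_closure (tau_ X Y eta) A).
Proof.
move=> e0; rewrite /Pi0 /= /tau_; case: asboolP => [->|n1].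
  apply: Sigma0_open => z nz.
  have [U [oU Uz UA]] : exists U, [/\ tau1 U, U z & A `&` U = set0].
    apply: contrapT => H; apply: nz => U oU Uz; apply/set0P/eqP => UA; apply: H; by exists U.
  have [P [Q [gP gQ Pz Qz PQ]]] := oU z Uz; exists P, Q; split=> // t /PQ Ut /(_ U oU Ut)[s As].
  by have : (A `&` U) s by []; rewrite UA.
have e1 : olt oone eta by case: (ole_eqVlt (ole1 e0)) => // E; case: n1.
set G := Sigma11 _ `&` _; have topG : gen_top G `<=` [set V | forall z, V z -> exists S, [/\ G S, S z & S `<=` V]].
  move=> V; apply; last by move=> S GS z Sz; exists S; split=> // y.
  split=> [z _|U V' hU hV z [/hU[S [GS Sz SU]] /hV[S' [GS' Sz' SV]]]|F hF z [U FU Uz]].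
  - exists setT; split=> //; split; first exact: (Sg_true Z).
    exists oone => //; rewrite /Pi0 /= setCT; apply: Sigma0_open => t [].
  - exists (S `&` S'); split=> //; first exact: gen_Sg_setI.
    by move=> t [/SU ? /SV].
  - by have [S [GS Sz SU]] := hF U FU z Uz; exists S; split=> // t /SU; exists U.
pose F e : set (X * Y) := fun z => [/\ G [set t | Usg (E := Z) (e, t)], A `&` [set t | Usg (E := Z) (e, t)] = set0 & Usg (E := Z) (e, z)].
apply: (@Sigma0_ext _ _ _ (\bigcup_e F e)).
  move=> z; split=> [[e _ [Ge Ae ez]] /(_ [set t | Usg (E := Z) (e, t)])|nz].
    case=> //; first by move=> tau _; apply.
    by move=> t [At et]; have : (A `&` [set t | Usg (E := Z) (e, t)]) t by []; rewrite Ae.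
  have [U [oU Uz UA]] : exists U, [/\ gen_top G U, U z & A `&` U = set0].
    apply: contrapT => H; apply: nz => U oU Uz; apply/set0P/eqP => UA; apply: H; by exists U.
  have [S [GS Sz SU]] := topG U oU z Uz; have [e eP] := UsgP (E := Z) GS.1.
  have SE : S = [set t | Usg (E := Z) (e, t)] by apply/seteqP; split=> t /eP.
  exists e => //; split; rewrite -?SE //; last exact/eP.
  apply/seteqP; split=> // t [At /SU Ut]; have : (A `&` U) t by []; by rewrite UA.
have /choice[zt ztP] : forall e, exists zeta, olt zeta eta /\ Sigma0 tau1 zeta (~` F e).
  move=> e; have [[Ge Ae]|nG] := pselect (G [set t | Usg (E := Z) (e, t)] /\ A `&` [set t | Usg (E := Z) (e, t)] = set0).
    have [_ [zeta ze pz]] := Ge; exists zeta; split=> //; apply: Sigma0_ext pz => t.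
    by rewrite /setC /F /=; split=> [nt [_ _ //]|nt ht]; apply: nt.
  exists oone; split=> //; apply: Sigma0_open; have -> : ~` F e = setT.
    by apply/seteqP; split=> // t _ [h1 h2 _]; apply: nG.
  by move=> t _; exists setT, setT; split=> //; apply: Dl_gen; exact: Dl_setT.
by apply: (Sigma0_bigcup (zeta := zt)).
Qed.

Lemma closure_cl W C eta (A : set (X * Y)) : @coding Z W C -> olt ozero eta ->
  top_closure (tau_ X Y eta) A `<=` cl W C eta A.
Proof.
move=> WC e0 z zA m [zeta ze lm] Cz; suff oC : tau_ X Y eta [set t | C (m, t)] by have [t [At Ct]] := zA _ oC Cz; exists t.
have [_ _ _ WD _] := WC; have [sC _] := WD _ (lev_W lm).
rewrite /tau_; case: asboolP => [E|n1].
  have z0 : zeta = ozero by apply: ole_anti (ozero_le _); apply/olt_succ; move: ze; rewrite E.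
  by move: lm; rewrite z0 => /(lev_open WC)[].
have e1 : olt oone eta by case: (ole_eqVlt (ole1 e0)) => // E; case: n1.
move=> tau _; apply; split=> //; have [z0|z0] := pselect (zeta = ozero).
  by exists oone => //; apply: Sigma0_open; move: lm; rewrite z0 => /(lev_open WC)[].
by exists zeta => //; apply: (lev_Pi0 WC) => //; exact: ozero_lt.
Qed.

End TwoSpaces.

Theorem theorem17 (R : realType)
    (fs : Ord -> nat -> Ord) (hfs : limit_choice fs)
    (E : set (seq bool * seq bool)) (hE : is_test E)
    (xi : Ord) (hxi : below_omega1CK xi)
    (X Y : rpPolish R) :
  (forall A B : set (X * Y),
     Sigma11 (xy_nb X Y) A -> Sigma11 (xy_nb X Y) B -> A `&` B = set0 ->
     [<-> ~ (exists C, pot_Pi0 X Y (oadd oone xi) C /\ separates C A B);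
          ~ (exists C, [/\ Delta11 (xy_nb X Y) C, pot_Pi0 X Y (oadd oone xi) C
                         & separates C A B]);
          ~ (exists C, Pi0 (tau_one X Y) (oadd oone xi) C /\
                       separates C A B);
          top_closure (tau_ X Y (oadd oone xi)) A `&` B !=set0;
          exists (u : cantor_space -> X) (v : cantor_space -> Y),
            [/\ continuous u, continuous v,
                setA E fs xi `<=` (fun p => (u p.1, v p.2)) @^-1` A
              & branches (tree E) `\` setA E fs xi `<=`
                  (fun p => (u p.1, v p.2)) @^-1` B]])
  /\
  (forall (W : set nat) (C : set (nat * (X * Y))),
     Delta11_coding W C ->
     Pi11 nat_nb (W_ W C (oadd oone xi)) /\
     Pi11 nat_nb (W_lt W C (oadd oone xi))).
Proof.
have e0 := one_add_gt0 xi; split.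
- move=> A B sA sB _.
  have [W [C WC]] := coding_ex (eprod (ESpace (rp_naming X)) (ESpace (rp_naming Y))).
  tfae.
  + by move=> na [S [_ pS sS]]; apply: na; exists S.
  + move=> nb [S [pS sS]]; apply: nb.
    have [n [ln AC CB]] := lev_separation WC hxi (ole_refl _) sA sB
      (pot_cl WC hfs hE hxi sA sB (ex_intro _ S (conj (Pi0_pot e0 pS) sS))).
    exists [set z | C (n, z)]; split; first exact: (of_coding WC (lev_W ln)).
      by apply: Pi0_pot => //; exact: (lev_Pi0 WC).
    by [].
  (* If the closure of A misses B, it is itself a separating set of the required class. *)
  + move=> nc; apply/set0P/eqP => AB; apply: nc; exists (top_closure (tau_ X Y (oadd oone xi)) A).
    split; first exact: closure_Pi0.
    by split=> // z Az U _ Uz; exists z.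
  + move=> [z [Az Bz]]; apply: (cl_reduction WC hfs hE hxi sA sB).
    by exists z; split=> //; exact: (closure_cl WC e0).
  + by move=> [u [v [cu cv uA uB]]]; exact: reduction_not_pot uA uB.
- move=> W C /coding_of WC; split.
    apply: Sg_ext (Pg_lev WC hxi (ole_refl _)) => n; rewrite /setC /W_ /=; split=> h h'; apply: h.
      by case: h' => Wn /(pot_lev WC hfs hE hxi Wn).
    by split; [exact: lev_W h'|apply/(pot_lev WC hfs hE hxi (lev_W h'))].
  apply: Sg_ext (Pg_levlt WC hxi (ole_refl _)) => n; rewrite /setC /W_lt /W_ /=.
  (* A rank below 1 + xi is 0 or of the form 1 + y with y < xi, and y is again below omega_1^CK. *)
  have HH zeta : olt zeta (oadd oone xi) -> W n -> pot_Pi0 X Y zeta [set z | C (n, z)] <-> @lev (ESpace (rp_naming X)) (ESpace (rp_naming Y)) W C zeta n.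
    move=> ze Wn; have [->|z0] := pselect (zeta = ozero); first exact: pot0_lev.
    have [y yE] := one_addP (ozero_lt z0); move: ze; rewrite yE => /oadd_lt2E[yx _].
    exact: (pot_lev WC hfs hE (below_le yx hxi) Wn).
  split=> h h'; apply: h; first by case: h' => zeta ze [Wn /(HH _ ze Wn)]; exists zeta.
  case: h' => zeta ze ln; exists zeta => //; split; first exact: lev_W ln.
  by apply/HH => //; exact: lev_W ln.
Qed.
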